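(* Let $\Omega\subset\mathbb R^3$ be a bounded Lipschitz domain with connected complement, $\Gamma$ an open subset of $\partial\Omega$, $k\in\mathbb R_+$, and let $v,w\in H^1(\Omega)$ be a pair of conductive transmission eigenfunctions associated with $k$, i.e. a nontrivial pair satisfying $$\Delta w+k^2 q w=0\ \text{ in }\Omega,\qquad \Delta v+k^2 v=0\ \text{ in }\Omega,\qquad w=v,\ \ \partial_\nu w=\partial_\nu v+\eta v\ \text{ on }\Gamma .$$ Assume $\mathbf 0\in\Gamma$ and $\Omega\cap B_h=\mathcal C\cap B_h=\mathcal C^h$, where $\mathcal C$ is a strictly convex conic cone with apex $\mathbf 0$ and opening angle $2\theta_0$, $\theta_0\in(0,\pi/2)$, and $h\in\mathbb R_+$ is sufficiently small such that $q\in H^2(\overline{\mathcal C^h})$ and $\eta\in C^{\alpha_1}(\overline{\Gamma_h})$ with $\alpha_1\in(0,1)$. Assume: (a) for given positive constants $\beta,\gamma$ with $$\gamma<\tfrac{10}{11}\alpha\beta,\qquad \alpha=\min\{\alpha_1,1/2\},$$ $v$ can be approximated in $H^1(\mathcal C^h)$ by Herglotz wave functions $v_j(\mathbf x)=\int_{\mathbb S^2}e^{\mathrm i k\xi\cdot\mathbf x}g_j(\xi)\,\mathrm d\xi$, $j=1,2,\dots$, with kernels $g_j\in L^2(\mathbb S^2)$ satisfying $\|v-v_j\|_{H^1(\mathcal C^h)}\le j^{-\beta}$ and $\|g_j\|_{L^2(\mathbb S^2)}\le j^\gamma$; (b) $\eta(\mathbf 0)\ne0$, where $\mathbf 0$ is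 the apex of $\mathcal C^h$. Then $$\lim_{\lambda\to+0}\frac{1}{m(B(\mathbf 0,\lambda)\cap\Omega)}\int_{B(\mathbf 0,\lambda)\cap\Omega}|v(\mathbf x)|\,\mathrm d\mathbf x=0,$$ where $m(B(\mathbf 0,\lambda)\cap\Omega)$ is the volume of $B(\mathbf 0,\lambda)\cap\Omega$.
   Context: $q=1+V$ with $V\in L^\infty(\Omega)$ complex-valued; $\eta\in L^\infty(\partial\Omega)$ is complex-valued; $\nu$ is the exterior unit normal to $\partial\Omega$. $B_h$ (resp. $B(\mathbf 0,\lambda)$) is the open ball of radius $h$ (resp. $\lambda$) centered at the origin. The conic cone with apex $\mathbf 0$, axis $\mathbf v_0=(0,0,1)^\top$ and half-opening $\theta_0$ is $\mathcal C=\{\mathbf y\in\mathbb R^3\setminus\{\mathbf 0\}: 0\le\angle(\mathbf y,\mathbf v_0)<\theta_0\}$; $\mathcal C^h=\mathcal C\cap B_h$ and $\Gamma_h=\partial\mathcal C\cap B_h$. *)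

(* Defs.v *)
From HB Require Import structures.
From mathcomp Require Import all_boot all_order all_algebra.
From mathcomp Require Import complex.
From mathcomp Require Import all_classical all_reals all_analysis.
Set Implicit Arguments.
Unset Strict Implicit.
Unset Printing Implicit Defensive.
Import Order.TTheory GRing.Theory Num.Theory.
Import numFieldNormedType.Exports.
Local Open Scope classical_set_scope.
Local Open Scope ring_scope.

Section Defs.
Context {R : realType}.

(** ** Euclidean space

    The norm and the balls that the libraries put on [R * R * R] are those of
    the maximum norm: they give the right topology, but Euclidean lengths and
    balls have to be defined. *)

Local Notation R3 := (R * R * R)%type.

(* [R^2] and [R^3] as the measurable spaces that carry the products of
   [lebesgue_measure] *)
Local Notation mR := (measurableTypeR R).
Local Notation mR2 := (mR * mR)%type.
Local Notation mR3 := (mR * mR * mR)%type.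

Definition dot (x y : R3) : R := x.1.1 * y.1.1 + x.1.2 * y.1.2 + x.2 * y.2.
Definition enorm (x : R3) : R := Num.sqrt (dot x x).
Definition eball (r : R) : set R3 := [set x | enorm x < r].
Definition angle (x y : R3) : R := acos (dot x y / (enorm x * enorm y)).
Definition bnd (A : set R3) : set R3 := closure A `\` A°.

Definition evec (i : 'I_3) : R3 :=
  ((i == 0%N :> nat)%:R, (i == 1%N :> nat)%:R, (i == 2%N :> nat)%:R).

Definition leb2 : {measure set mR2 -> \bar R} :=
  (@lebesgue_measure R \x @lebesgue_measure R)%E.
Definition leb3 : {measure set mR3 -> \bar R} :=
  (@lebesgue_measure R \x @lebesgue_measure R \x @lebesgue_measure R)%E.

(** ** Complex-valued functions *)

Definition cmeasurable d (T : measurableType d) (D : set T) (f : T -> R[i]) :=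
  measurable_fun D (fun x => complex.Re (f x)) /\
  measurable_fun D (fun x => complex.Im (f x)).

Definition cint d (T : measurableType d) (mu : {measure set T -> \bar R})
    (D : set T) (f : T -> R[i]) : R[i] :=
  Complex (\int[mu]_(x in D) complex.Re (f x))
          (\int[mu]_(x in D) complex.Im (f x)).

Definition L2norm d (T : measurableType d) (mu : {measure set T -> \bar R})
    (D : set T) (f : T -> R[i]) : \bar R :=
  sqrte (\int[mu]_(x in D) (Normc.normc (f x) ^+ 2)%:E)%E.

Definition in_L2 d (T : measurableType d) (mu : {measure set T -> \bar R})
    (D : set T) (f : T -> R[i]) :=
  cmeasurable D f /\ (L2norm mu D f < +oo)%E.

Definition in_Linfty d (T : measurableType d) (mu : {measure set T -> \bar R})
    (D : set T) (f : T -> R[i]) :=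
  cmeasurable D f /\
  exists M : R, {ae mu, forall x, D x -> Normc.normc (f x) <= M}.

Definition holder (a : R) (D : set R3) (f : R3 -> R[i]) :=
  exists M : R, forall x y, D x -> D y ->
    Normc.normc (f x - f y) <= M * enorm (x - y) `^ a.

(** ** Smooth functions and test functions *)

Fixpoint Cn (n : nat) (f : R3 -> R) : Prop :=
  if n is m.+1 then
    continuous f /\ forall i, (forall x, derivable f x (evec i)) /\
                              Cn m ('D_(evec i) f)
  else continuous f.

Definition smooth (f : R3 -> R) := forall n, Cn n f.

Definition csmooth (f : R3 -> R[i]) :=
  smooth (fun x => complex.Re (f x)) /\ smooth (fun x => complex.Im (f x)).

Definition supported_in (K : set R3) (phi : R3 -> R) :=
  forall x, ~ K x -> phi x = 0.

Definition test_function (D : set R3) (phi : R3 -> R) :=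
  smooth phi /\ exists K, [/\ compact K, K `<=` D & supported_in K phi].

(** ** Sobolev spaces on an open set [D] *)

Definition is_weak_partial (D : set R3) (i : 'I_3) (u g : R3 -> R[i]) :=
  forall phi, test_function D phi ->
    cint leb3 D (fun x => u x * ('D_(evec i) phi x)%:C%C) =
    - cint leb3 D (fun x => g x * (phi x)%:C%C).

(* A representative of the weak partial derivative, chosen among those which
   are square integrable; 0 if there is none. *)
Definition wpartial (D : set R3) (i : 'I_3) (u : R3 -> R[i]) : R3 -> R[i] :=
  xget (fun=> 0) [set g | in_L2 leb3 D g /\ is_weak_partial D i u g].

Definition in_H1 (D : set R3) (u : R3 -> R[i]) :=
  in_L2 leb3 D u /\
  forall i, exists g, in_L2 leb3 D g /\ is_weak_partial D i u g.

(* Meaningful for [u] in H^1(D) only, because of the default in [wpartial]. *)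
Definition H1norm (D : set R3) (u : R3 -> R[i]) : \bar R :=
  sqrte (L2norm leb3 D u ^+ 2 +
         \sum_(i < 3) L2norm leb3 D (wpartial D i u) ^+ 2)%E.

Definition in_H2 (D : set R3) (u : R3 -> R[i]) :=
  in_H1 D u /\ forall i, in_H1 D (wpartial D i u).

(* [f] is the distributional Laplacian of [u] in [D] *)
Definition is_laplacian (D : set R3) (u f : R3 -> R[i]) :=
  forall phi, test_function D phi ->
    cint leb3 D (fun x =>
      u x * (\sum_(i < 3) 'D_(evec i) ('D_(evec i) phi) x)%:C%C) =
    cint leb3 D (fun x => f x * (phi x)%:C%C).

(** ** Lipschitz domains and their surface measure *)

(* In the open set [U], and in the orthonormal frame [a], [b], [c], the set
   [Om] is the part lying strictly above the graph of the Lipschitz function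
   [z]. *)
Definition graph_chart (Om U : set R3) (a b c : R3) (z : R * R -> R) :=
  [/\ open U,
      [/\ dot a a = 1, dot b b = 1 & dot c c = 1],
      [/\ dot a b = 0, dot b c = 0 & dot a c = 0],
      exists L : R, forall y y' : R * R, `|z y - z y'| <= L * `|y - y'| &
      Om `&` U = [set x | z (dot x a, dot x b) < dot x c] `&` U].

Definition lipschitz_boundary (Om : set R3) :=
  forall x, bnd Om x -> exists U a b c z, graph_chart Om U a b c z /\ U x.

Definition bounded_lipschitz_domain (Om : set R3) :=
  [/\ open Om, connected Om, bounded_set Om & lipschitz_boundary Om].

Definition graph_point (a b c : R3) (z : R * R -> R) (y : R * R) : R3 :=
  y.1 *: a + y.2 *: b + z y *: c.

(* sqrt (1 + |grad z|^2), defined almost everywhere since z is Lipschitz *)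
Definition area_element (z : R * R -> R) (y : R * R) : R :=
  Num.sqrt (1 + ('D_((1, 0) : R * R) z y) ^+ 2
              + ('D_((0, 1) : R * R) z y) ^+ 2).

(* These conditions determine [sigma]: the boundary of a bounded Lipschitz
   domain is compact, hence covered by finitely many charts. *)
Definition is_surface_measure (Om : set R3)
    (sigma : {measure set mR3 -> \bar R}) :=
  sigma (~` bnd Om) = 0%E /\
  forall U a b c z, graph_chart Om U a b c z ->
  forall A : set mR3, measurable A -> A `<=` bnd Om `&` U ->
    sigma A = (\int[leb2]_(y in graph_point a b c z @^-1` A)
                 (area_element z y)%:E)%E.

(** ** Boundary values *)

(* The trace operator is the continuous extension to H^1(Om), with values in
   L^2 of the boundary, of the restriction of smooth functions. *)
Definition is_trace (Om : set R3) (sigma : {measure set mR3 -> \bar R})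
    (u tu : R3 -> R[i]) :=
  in_L2 sigma (bnd Om) tu /\
  exists un : nat -> R3 -> R[i],
    [/\ forall n, csmooth (un n),
        H1norm Om (fun x => un n x - u x) @[n --> \oo] --> 0%E &
        L2norm sigma (bnd Om) (fun x => un n x - tu x) @[n --> \oo] --> 0%E].

(* The pairing of phi with the exterior normal derivative of u, an element of
   H^{-1/2} of the boundary, where f is the Laplacian of u: by definition
   (Green's formula) it is the integral of grad u . grad phi + f phi. *)
Definition normal_derivative (Om : set R3) (u f : R3 -> R[i])
    (phi : R3 -> R) : R[i] :=
  cint leb3 Om (fun x =>
    \sum_(i < 3) wpartial Om i u x * ('D_(evec i) phi x)%:C%C
    + f x * (phi x)%:C%C).

(* smooth functions on R^3 whose support meets the boundary of Om inside Gam *)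
Definition boundary_test (Om Gam : set R3) (phi : R3 -> R) :=
  smooth phi /\
  exists K, [/\ compact K, K `&` bnd Om `<=` Gam & supported_in K phi].

(** ** Conductive transmission eigenfunctions *)

Definition conductive_eigenpair (Om Gam : set R3)
    (sigma : {measure set mR3 -> \bar R}) (k : R)
    (q eta v w : R3 -> R[i]) :=
  let lapw x := - ((k ^+ 2)%:C%C * q x * w x) in
  let lapv x := - ((k ^+ 2)%:C%C * v x) in
  [/\ in_H1 Om v /\ in_H1 Om w,
      ~ {ae leb3, forall x, Om x -> v x = 0 /\ w x = 0},
      is_laplacian Om w lapw,
      is_laplacian Om v lapv &
      exists tv tw : R3 -> R[i],
        [/\ is_trace Om sigma v tv, is_trace Om sigma w tw,
            {ae sigma, forall x, Gam x -> tw x = tv x} &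
            forall phi, boundary_test Om Gam phi ->
              normal_derivative Om w lapw phi =
              normal_derivative Om v lapv phi +
              cint sigma Gam (fun x => eta x * tv x * (phi x)%:C%C)]].

(** ** The cone *)

Definition cone (theta0 : R) : set R3 :=
  [set y | y != 0 /\ 0 <= angle y (0, 0, 1) < theta0].

Definition cone_h (theta0 h : R) : set R3 := cone theta0 `&` eball h.

Definition Gamma_h (theta0 h : R) : set R3 := bnd (cone theta0) `&` eball h.

(** ** Herglotz wave functions, in spherical coordinates *)

Definition sphere : set R3 := [set xi | enorm xi = 1].

Definition sph (t : R * R) : R3 :=
  (sin t.1 * cos t.2, sin t.1 * sin t.2, cos t.1).

Definition sph_dom : set (R * R) := `[0, pi] `*` `[0, 2 * pi].

Definition sphere_cint (F : R3 -> R[i]) : R[i] :=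
  cint leb2 sph_dom (fun t => F (sph t) * (sin t.1)%:C%C).

Definition sphere_L2norm (g : R3 -> R[i]) : \bar R :=
  sqrte (\int[leb2]_(t in sph_dom)
           (Normc.normc (g (sph t)) ^+ 2 * sin t.1)%:E)%E.

Definition in_L2_sphere (g : R3 -> R[i]) :=
  cmeasurable (sphere : set mR3) g /\ (sphere_L2norm g < +oo)%E.

Definition herglotz (k : R) (g : R3 -> R[i]) (x : R3) : R[i] :=
  sphere_cint (fun xi => Complex (cos (k * dot xi x)) (sin (k * dot xi x)) * g xi).

End Defs.

Notation R3 R := (R * R * R)%type.
Notation mR3 R :=
  (measurableTypeR R * measurableTypeR R * measurableTypeR R)%type.

(* Main.v *)
(* Near the apex, u = w - v has zero trace on the boundary of the cone and its
   normal derivative jumps by eta v. Green's formula with the harmonic kernel of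
   a quadrupole placed at depth e below the apex, cut off away from the apex,
   shows that the integral of eta v against this kernel over the lateral surface
   tends to 0 with e: the gradient term is O(e) since the kernel is harmonic and
   u vanishes on the boundary, and the lower order terms tend to 0 by a weighted
   Hardy inequality. On the lateral surface the kernel is homogeneous with an
   integral bounded below by c > 0, so comparing v with v_j and v_j with v_j(0) gives
     |eta(0) v_j(0)| <= C (o(1) + j^-beta / e + j^gamma e^alpha1),
   and e = j^-s with gamma / alpha1 < s < beta yields v_j(0) -> 0. Finally the
   average of |v| over the ball of radius lam is at most
     |v_j(0)| + C j^gamma lam + C j^-beta lam^(-3/2),
   which tends to 0 for j of the order lam^-p with 3 / (2 beta) < p < 1 / gamma. *)
Require Import Defs.
From HB Require Import structures.
From mathcomp Require Import all_boot all_order all_algebra.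
From mathcomp Require Import complex.
From mathcomp Require Import all_classical all_reals all_analysis.
From mathcomp Require Import measurable_realfun.
From mathcomp Require Import ring lra.
Set Implicit Arguments.
Unset Strict Implicit.
Unset Printing Implicit Defensive.
Import Order.TTheory GRing.Theory Num.Theory.
Import numFieldNormedType.Exports.
Local Open Scope classical_set_scope.
Local Open Scope ring_scope.

(** * Differential calculus of smooth functions *)

Section Calc.
Context {R : realType}.
Implicit Types (f g : R3 R -> R) (n : nat) (x : R3 R).

(** Scaling dictates the kernel. On a surface, [e] times a harmonic function of degree -3 has mass
    of order one at distance [e] from the apex and is O([e]) at fixed distance; a monopole or a
    dipole is not concentrated enough. But [kern] changes sign on wide cones, so its mass on the
    lateral surface is bounded below through a divergence identity and not pointwise. The second
    constraint is that [v] and [w] are only H^1. The L^2 norm of the kernel in the cone grows like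
    [e]^(-1/2), so plain Cauchy-Schwarz fails; the weight [wt2] is placed so that the kernel factor
    stays bounded while the factor with [v] or [w] tends to 0. The inequalities involved use the
    vertical derivative alone: they are proved on vertical segments for C^1 functions, integrated by
    Tonelli, and carried over to Sobolev functions with traces at the cost of a factor 4. Finally
    the kernel does not vanish on the lateral surface, so its harmonicity helps only after an
    integration by parts up to that surface. Zero trace makes the integral of [|w - v|] over a strip
    of width [T] of order [T]^(3/2), which beats the gradient 1 / [T] of a cutoff. *)

Lemma CnW n f : Cn n.+1 f -> Cn n f.
Proof.
elim: n f => [|n ih] f; first by case.
case=> fc H; split=> // i; have [d c] := H i; split=> //.
exact: ih.
Qed.

Lemma Cn_continuous n f : Cn n f -> continuous f.
Proof. by case: n => [//|n] []. Qed.

Lemma Cn_cst n (c : R) : Cn n (fun _ => c).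
Proof.
elim: n c => [|n ih] c; first exact: cst_continuous.
split; first exact: cst_continuous.
move=> i; split=> [x|]; first exact: derivable_cst.
have -> : 'D_(evec i) (fun _ : R3 R => c) = (fun _ => 0).
  by apply/funext => x; exact: derive_cst.
exact: ih.
Qed.

Lemma CnD n f g : Cn n f -> Cn n g -> Cn n (fun x => f x + g x).
Proof.
elim: n f g => [|n ih] f g.
  by move=> fc gc x; apply: cvgD; [exact: fc|exact: gc].
move=> [fc fH] [gc gH]; split.
  by move=> x; apply: cvgD; [exact: fc|exact: gc].
move=> i; have [fd fC] := fH i; have [gd gC] := gH i; split.
  by move=> x; apply: derivableD.
have -> : 'D_(evec i) (fun x => f x + g x) =
    (fun x => 'D_(evec i) f x + 'D_(evec i) g x).
  by apply/funext => x; rewrite -deriveD.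
exact: ih.
Qed.

Lemma CnM n f g : Cn n f -> Cn n g -> Cn n (fun x => f x * g x).
Proof.
elim: n f g => [|n ih] f g.
  by move=> fc gc x; apply: cvgM; [exact: fc|exact: gc].
move=> fC gC; have [fc fH] := fC; have [gc gH] := gC; split.
  by move=> x; apply: cvgM; [exact: fc|exact: gc].
move=> i; have [fd fC'] := fH i; have [gd gC'] := gH i; split.
  by move=> x; apply: derivableM.
have -> : 'D_(evec i) (fun x => f x * g x) =
    (fun x => f x * 'D_(evec i) g x + g x * 'D_(evec i) f x).
  by apply/funext => x; rewrite -[LHS]/('D_(evec i) (f * g) x) deriveM.
apply: CnD; apply: ih => //; exact: CnW.
Qed.

Lemma CnN n f : Cn n f -> Cn n (fun x => - f x).
Proof.
move=> fC; have -> : (fun x => - f x) = (fun x => -1 * f x).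
  by apply/funext => x; rewrite mulN1r.
by apply: CnM => //; exact: Cn_cst.
Qed.

Lemma CnB n f g : Cn n f -> Cn n g -> Cn n (fun x => f x - g x).
Proof. by move=> fC gC; apply: CnD => //; exact: CnN. Qed.

Lemma is_derive_val (V : normedModType R) (f : V -> R) (x v : V) (d d' : R) :
  is_derive x v f d -> d = d' -> is_derive x v f d'.
Proof. by move=> h <-. Qed.

(** The difference quotients along [v] at [t *: v + x] and those of the restriction to the line are
    the same function of the increment. Through this equivalence the chain rule and the fundamental
    theorem in one variable serve functions on R^3. *)
Lemma is_derive_line (V : normedModType R) (f : V -> R) (x v : V) (t df : R) :
  is_derive (t *: v + x) v f df <->
  is_derive t 1 (fun h : R => f (h *: v + x)) df.
Proof.
have E : (fun h : R => h^-1 *: ((f \o shift (t *: v + x)) (h *: v) - f (t *: v + x)))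
  = (fun h : R => h^-1 *: (((fun h : R => f (h *: v + x)) \o shift t) (h *: 1) -
        f (t *: v + x))).
  by apply/funext => h /=; rewrite [_%:A]mulr1 scalerDl addrA.
split=> -[d <-]; apply: DeriveDef.
- by move: d; rewrite /derivable E.
- by rewrite /derive E.
- by move: d; rewrite /derivable E.
- by rewrite /derive E.
Qed.

Lemma is_derive_line0 (V : normedModType R) (f : V -> R) (x v : V) (df : R) :
  is_derive x v f df <-> is_derive (0 : R) 1 (fun h : R => f (h *: v + x)) df.
Proof. by rewrite -is_derive_line scale0r add0r. Qed.

Lemma is_derive_comp1 (F : R -> R) f x (v : R3 R) (df dF : R) :
  is_derive (f x) 1 F dF -> is_derive x v f df ->
  is_derive x v (fun y => F (f y)) (dF * df).
Proof.
move=> hF /is_derive_line0 hf; apply/is_derive_line0.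
by apply: (@is_derive1_comp R F); rewrite ?scale0r ?add0r.
Qed.

Lemma is_derive_affine (a b t : R) : is_derive t 1 (fun h : R => h * a + b) a.
Proof.
have -> : (fun h : R => h * a + b) = a *: id + cst b.
  by apply/funext => h; rewrite /= mulrC.
by apply: is_derive_eq; rewrite addr0 [_%:A]mulr1.
Qed.

Lemma is_derive_c1 x (v : R3 R) : is_derive x v (fun y : R3 R => y.1.1) v.1.1.
Proof.
apply/is_derive_line0 => /=.
exact: is_derive_affine.
Qed.

Lemma is_derive_c2 x (v : R3 R) : is_derive x v (fun y : R3 R => y.1.2) v.1.2.
Proof.
apply/is_derive_line0 => /=.
exact: is_derive_affine.
Qed.

Lemma is_derive_c3 x (v : R3 R) : is_derive x v (fun y : R3 R => y.2) v.2.
Proof.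
apply/is_derive_line0 => /=.
exact: is_derive_affine.
Qed.

Lemma c1_continuous : continuous (fun y : R3 R => y.1.1).
Proof. by move=> x; apply: (@cvg_comp _ _ _ fst fst _ (nbhs x.1)); exact: cvg_fst. Qed.

Lemma c2_continuous : continuous (fun y : R3 R => y.1.2).
Proof. by move=> x; apply: (@cvg_comp _ _ _ fst snd _ (nbhs x.1)); [exact: cvg_fst|exact: cvg_snd]. Qed.

Lemma c3_continuous : continuous (fun y : R3 R => y.2).
Proof. by move=> x; exact: cvg_snd. Qed.

Lemma Cn_of_derive n f (df : 'I_3 -> R3 R -> R) : continuous f ->
  (forall i x, is_derive x (evec i) f (df i x)) -> (forall i, Cn n (df i)) ->
  Cn n.+1 f.
Proof.
move=> fc fd dfC; split=> // i; split=> [x|]; first by case: (fd i x).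
suff -> : 'D_(evec i) f = df i by [].
by apply/funext => x; apply: derive_val.
Qed.

Lemma Cn_c1 n : Cn n (fun y : R3 R => y.1.1).
Proof.
case: n => [|n]; first exact: c1_continuous.
apply: (@Cn_of_derive _ _ (fun i _ => (evec i).1.1)) => [|i x|i].
- exact: c1_continuous.
- exact: is_derive_c1.
- exact: Cn_cst.
Qed.

Lemma Cn_c2 n : Cn n (fun y : R3 R => y.1.2).
Proof.
case: n => [|n]; first exact: c2_continuous.
apply: (@Cn_of_derive _ _ (fun i _ => (evec i).1.2)) => [|i x|i].
- exact: c2_continuous.
- exact: is_derive_c2.
- exact: Cn_cst.
Qed.

Lemma Cn_c3 n : Cn n (fun y : R3 R => y.2).
Proof.
case: n => [|n]; first exact: c3_continuous.
apply: (@Cn_of_derive _ _ (fun i _ => (evec i).2)) => [|i x|i].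
- exact: c3_continuous.
- exact: is_derive_c3.
- exact: Cn_cst.
Qed.

Lemma CnS_derive n f : Cn n.+1 f ->
  forall i x, is_derive x (evec i) f ('D_(evec i) f x).
Proof. by case=> _ H i x; have [d _] := H i; apply: derivableP. Qed.

Lemma Cn_derive n f i : Cn n.+1 f -> Cn n ('D_(evec i) f).
Proof. by case=> _ H; have [_] := H i. Qed.

Lemma is_derive1_inv (t : R) : t != 0 -> is_derive t 1 (@GRing.inv R) (- t^-1 * t^-1).
Proof.
move=> t0; have h := @is_deriveV R id t 1 1 t0 (is_derive_id _ _).
by apply: is_derive_eq; rewrite /= [_%:A]mulr1 -exprVn expr2 mulNr.
Qed.

(** The derivative of 1 / f is a product of two factors 1 / f and one derivative of f, so the
    induction on the order feeds on itself; [Cn_sqrt] closes in the same way. *)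
Lemma CnV n f : (forall x, f x != 0) -> Cn n f -> Cn n (fun x => (f x)^-1).
Proof.
move=> f0; elim: n => [|n ih] fC; first by move=> x; apply: cvgV => //; exact: fC.
apply: (@Cn_of_derive _ _ (fun i x => - (f x)^-1 * (f x)^-1 * 'D_(evec i) f x)).
- by move=> x; apply: cvgV => //; exact: (Cn_continuous fC).
- move=> i x; have h := @is_derive1_inv (f x) (f0 x).
  exact: (is_derive_comp1 h (CnS_derive fC i x)).
- move=> i; apply: CnM; last exact: Cn_derive.
  by apply: CnM; [apply: CnN|]; apply: ih; exact: CnW.
Qed.

Lemma Cn_sqrt n f : (forall x, 0 < f x) -> Cn n f -> Cn n (fun x => Num.sqrt (f x)).
Proof.
move=> f0; elim: n => [|n ih] fC.
  by move=> x; apply: (@cvg_comp _ _ _ f) ; [exact: fC|exact: sqrt_continuous].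
have fc := Cn_continuous fC.
apply: (@Cn_of_derive _ _ (fun i x => (2 * Num.sqrt (f x))^-1 * 'D_(evec i) f x)).
- by move=> x; apply: (@cvg_comp _ _ _ f) ; [exact: fc|exact: sqrt_continuous].
- move=> i x; apply: is_derive_comp1; last exact: CnS_derive fC _ _.
  by have := is_derive1_sqrt (f0 x).
- move=> i; apply: CnM; last exact: Cn_derive.
  apply: CnV => [x|]; first by rewrite mulf_neq0 ?pnatr_eq0 // gt_eqF // sqrtr_gt0.
  by apply: CnM; [exact: Cn_cst|apply: ih; exact: CnW].
Qed.

End Calc.

(** * Smooth transition functions built from exp(-1/t) *)

Section Flat.
Context {R : realType}.
Implicit Types (t : R) (k : nat).

(** The exponent [k] is a parameter because differentiation sends this family into its own span,
    which makes smoothness an induction on the order with [k] free. *)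
Definition flat k t : R := if 0 < t then (t^-1) ^+ k * expR (- t^-1) else 0.

Lemma flat_ge0 k t : 0 <= flat k t.
Proof.
rewrite /flat; case: ifPn => // t0.
by rewrite mulr_ge0 ?expR_ge0 // exprn_ge0 // invr_ge0 ltW.
Qed.

Lemma flat_gt0 k t : 0 < t -> 0 < flat k t.
Proof. by move=> t0; rewrite /flat t0 mulr_gt0 ?expR_gt0 // exprn_gt0 // invr_gt0. Qed.

Lemma flat_le0 k t : t <= 0 -> flat k t = 0.
Proof. by move=> t0; rewrite /flat ltNge t0. Qed.

(** Exponential growth against powers: exp(u) is at least (u / (k + 2))^(k + 2), by 1 + x <= exp(x)
    at x = u / (k + 2). The two spare powers leave t^2, which gives derivative 0 at the origin. *)
Lemma flat_bound k : exists2 C, 0 < C & forall t, flat k t <= C * t ^+ 2.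
Proof.
exists (k.+2%:R ^+ k.+2); first by rewrite exprn_gt0.
move=> t; rewrite /flat; case: ifPn => t0; last first.
  by rewrite mulr_ge0 ?sqr_ge0 // exprn_ge0.
rewrite expRN ler_pdivrMr ?expR_gt0 //.
have h : (t^-1 / k.+2%:R) ^+ k.+2 <= expR (t^-1).
  rewrite (_ : expR (t^-1) = expR (t^-1 / k.+2%:R) ^+ k.+2); last first.
    by rewrite -expRM_natl mulrC divfK.
  have u0 : 0 <= t^-1 / k.+2%:R by rewrite divr_ge0 ?invr_ge0 // ltW.
  apply: lerXn2r; rewrite ?nnegrE ?expR_ge0 //.
    apply: (@le_trans _ _ (1 + t^-1 / k.+2%:R)); first by rewrite lerDr.
  exact: expR_ge1Dx.
apply: le_trans (_ : k.+2%:R ^+ k.+2 * t ^+ 2 * (t^-1 / k.+2%:R) ^+ k.+2 <= _); last first.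
  by rewrite ler_wpM2l // mulr_ge0 ?sqr_ge0 // exprn_ge0.
rewrite expr_div_n le_eqVlt; apply/orP; left; apply/eqP.
have -> : t^-1 ^+ k.+2 = t^-1 ^+ k * (t^-1 * t^-1) by rewrite !exprSr mulrA.
have : k.+2%:R ^+ k.+2 != 0 :> R by rewrite expf_neq0 // pnatr_eq0.
move: (k.+2%:R ^+ k.+2) (t^-1 ^+ k) => K T K0.
by field; rewrite K0 gt_eqF.
Qed.

Lemma is_derive_near (f g : R -> R) t d : (\near t, f t = g t) ->
  is_derive t 1 f d -> is_derive t 1 g d.
Proof. exact: near_eq_is_derive. Qed.

(** The slope [f z / z], extended by 0, is at most [C] times |z| and hence continuous at 0. Used for
    the flat functions at the origin and for the Taylor remainder of an integral depending on a
    parameter. *)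
Lemma is_derive_quadratic (f : R -> R) (C : R) : f 0 = 0 ->
  (forall t, `|f t| <= C * t ^+ 2) -> is_derive (0 : R) 1 f 0.
Proof.
move=> f00 fC; apply/is_derive1_caratheodory.
exists (fun z => if z == 0 then 0 else f z / z); split; last by rewrite eqxx.
- move=> z; rewrite f00 !subr0; case: eqP => [->|/eqP z0]; first by rewrite f00 mul0r.
  by rewrite divfK.
- have C0 : 0 <= C by have := le_trans (normr_ge0 _) (fC 1); rewrite expr1n mulr1.
  apply/cvgrPdist_le => /= e e0.
  have eC : 0 < e / (C + 1) by rewrite divr_gt0 // ltr_wpDl.
  near=> z; rewrite eqxx sub0r normrN; case: eqP => [_|/eqP z0]; first by rewrite normr0 ltW.
  rewrite normrM normfV ler_pdivrMr ?normr_gt0 //.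
  apply: le_trans (fC z) _; rewrite -real_normK ?num_real // expr2 mulrA.
  apply: ler_wpM2r => //.
  have : `|z| <= e / (C + 1).
    by near: z; exact: (@nbhs0_le _ R^o _ eC).
  rewrite ler_pdivlMr ?ltr_wpDl // => h; apply: le_trans h.
  by rewrite mulrC ler_wpM2l // lerDl.
Unshelve. all: by end_near. Qed.

(** To the left of 0 the function is locally 0, to the right it is u^k exp(-u) composed with
    inversion, and at 0 the quadratic bound applies. *)
Lemma is_derive_flat k t :
  is_derive t 1 (flat k) (flat k.+2 t - k%:R * flat k.+1 t).
Proof.
have [t0|t0|->] := ltgtP t 0.
- rewrite !flat_le0 ?ltW // mulr0 subr0.
  apply: (@is_derive_near (fun h => h * 0 + 0)); last exact: is_derive_affine.
  by near=> s; rewrite flat_le0 ?mulr0 ?addr0 //; near: s; exact: lt_le_nbhsl.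
- apply: (@is_derive_near (fun s => (s^-1) ^+ k * expR (- s^-1))).
    near=> s; rewrite /flat ifT //; near: s; exact: lt_nbhsr.
  rewrite /flat t0.
  have hF : is_derive (t^-1) 1 (fun u : R => u ^+ k * expR (- u))
      (k%:R * t^-1 ^+ k.-1 * expR (- t^-1) - t^-1 ^+ k * expR (- t^-1)).
    have h1 : is_derive (t^-1) 1 (fun u : R => u ^+ k) (k%:R * t^-1 ^+ k.-1).
      have d : derivable (@GRing.exp R ^~ k) (t^-1) 1 by exact: exprn_derivable.
      by apply: (DeriveDef d); rewrite exp_derive /GRing.scale /= mulr1.
    have h2 : is_derive (t^-1) 1 (fun u : R => expR (- u)) (- expR (- t^-1)).
      have h3 := @is_deriveNid R R (t^-1) 1.
      have := @is_derive1_comp R expR -%R (t^-1) _ _ (is_derive_expR _) h3.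
      by rewrite mulrN1.
    apply: (is_derive_val (@is_deriveM R R (fun u : R => u ^+ k) (fun u => expR (- u)) (t^-1) 1 _ _ h1 h2)).
    by rewrite /GRing.scale /=; ring.
  have h1 := is_derive1_inv (lt0r_neq0 t0).
  apply: (is_derive_val (@is_derive1_comp R _ GRing.inv t _ _ hF h1)); case: k {hF} => [|k] /=; first by rewrite !exprS expr0; ring.
  by rewrite !exprS; ring.
- rewrite !flat_le0 // mulr0 subr0.
  have [C C0 hC] := flat_bound k.
  apply: (@is_derive_quadratic _ C); first by rewrite flat_le0.
  by move=> s; rewrite ger0_norm ?flat_ge0.
Unshelve. all: by end_near. Qed.

Lemma flat_derive_continuous k : continuous (flat k).
Proof.
move=> t; apply: differentiable_continuous; apply/derivable1_diffP.
by case: (is_derive_flat k t).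
Qed.

Definition sden t : R := flat 0 t + flat 0 (1 - t).

Lemma sden_gt0 t : 0 < sden t.
Proof.
rewrite /sden; have [t0|t0] := ltP 0 t; first by rewrite ltr_pwDl ?flat_gt0 ?flat_ge0.
by rewrite ltr_wpDl ?flat_ge0 // flat_gt0 // subr_gt0 (le_lt_trans t0).
Qed.

Definition step t : R := flat 0 t / sden t.

(** The quotient rule for [step] after cancellation of the common product; what remains is a sum of
    nonnegative terms. This sign later makes the integral of the kernel over the lateral surface
    positive. *)
Definition dstep t : R :=
  (flat 2 t * flat 0 (1 - t) + flat 0 t * flat 2 (1 - t)) / sden t ^+ 2.

Lemma step_ge0 t : 0 <= step t.
Proof. by rewrite divr_ge0 ?flat_ge0 // ltW // sden_gt0. Qed.

Lemma step_le1 t : step t <= 1.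
Proof. by rewrite ler_pdivrMr ?sden_gt0 // mul1r lerDl flat_ge0. Qed.

Lemma step0 t : t <= 0 -> step t = 0.
Proof. by move=> t0; rewrite /step flat_le0 // mul0r. Qed.

Lemma step1 t : 1 <= t -> step t = 1.
Proof.
move=> t1; have := sden_gt0 t; rewrite /step /sden [flat 0 (1 - t)]flat_le0 ?subr_le0 //.
by rewrite addr0 => h; rewrite divff // gt_eqF.
Qed.

Lemma dstep_ge0 t : 0 <= dstep t.
Proof. by rewrite divr_ge0 ?sqr_ge0 // addr_ge0 // mulr_ge0 // flat_ge0. Qed.

Lemma dstep0 t : t <= 0 -> dstep t = 0.
Proof. by move=> t0; rewrite /dstep ![flat _ t]flat_le0 // !mul0r addr0 mul0r. Qed.

Lemma dstep1 t : 1 <= t -> dstep t = 0.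
Proof.
by move=> t1; rewrite /dstep ![flat _ (1 - t)]flat_le0 ?subr_le0 // !mulr0 addr0 mul0r.
Qed.

Lemma is_derive_step t : is_derive t 1 step (dstep t).
Proof.
have h0 : is_derive t 1 (flat 0) (flat 2 t).
  by have := is_derive_flat 0 t; rewrite mul0r subr0.
have hc : is_derive t 1 (fun s => flat 0 (1 - s)) (- flat 2 (1 - t)).
  have h1 : is_derive (1 - t) 1 (flat 0) (flat 2 (1 - t)).
    by have := is_derive_flat 0 (1 - t); rewrite mul0r subr0.
  have h2 : is_derive t 1 (fun s : R => 1 - s) (- 1).
    have -> : (fun s : R => 1 - s) = (fun h => h * -1 + 1).
      by apply/funext => h; rewrite mulrN1 addrC.
    exact: is_derive_affine.
  have := @is_derive1_comp R _ (fun s : R => 1 - s) t _ _ h1 h2.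
  by rewrite mulrN1.
have hs : is_derive t 1 sden (flat 2 t - flat 2 (1 - t)) := is_deriveD h0 hc.
have s0 := sden_gt0 t; have s0' : sden t != 0 by rewrite gt_eqF.
have hi := @is_deriveV R _ t _ 1 s0' hs.
apply: (is_derive_val (is_deriveM h0 hi)); rewrite /GRing.scale /= /dstep.
have E : sden t = flat 0 t + flat 0 (1 - t) by [].
by field: E.
Qed.

Lemma step_continuous : continuous step.
Proof.
move=> t; apply: differentiable_continuous; apply/derivable1_diffP.
by case: (is_derive_step t).
Qed.

Lemma dstep_continuous : continuous dstep.
Proof.
have cf k : continuous (fun t : R => flat k (1 - t)).
  move=> t; apply: (@cvg_comp _ _ _ (fun t : R => 1 - t)); last exact: flat_derive_continuous.
  by apply: cvgB; [exact: cvg_cst|exact: cvg_id].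
move=> t; apply: cvgM.
  by apply: cvgD; apply: cvgM; (exact: flat_derive_continuous || exact: cf).
apply: cvgV; first by rewrite expf_neq0 // gt_eqF // sden_gt0.
rewrite expr2; under eq_fun do rewrite expr2.
by apply: cvgM; (apply: cvgD; [exact: flat_derive_continuous|exact: cf]).
Qed.

Lemma dstep_bound : exists2 C, 0 < C & forall t, dstep t <= C.
Proof.
have [c _ hc] := @EVT_max R dstep 0 1 ler01 (@continuous_subspaceT _ _ _ _ dstep_continuous).
exists (dstep c + 1); first by rewrite ltr_wpDl ?dstep_ge0.
move=> t; have [t0|t0] := leP t 0; first by rewrite dstep0 // addr_ge0 ?dstep_ge0.
have [t1|t1] := leP 1 t; first by rewrite dstep1 // addr_ge0 ?dstep_ge0.
by apply: le_trans (hc t _) _; rewrite ?lerDl // in_itv /= !ltW.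
Qed.

Lemma Cn_flat n k (f : R3 R -> R) : Cn n f -> Cn n (fun x => flat k (f x)).
Proof.
elim: n k => [|n ih] k fC.
  by move=> x; apply: (@cvg_comp _ _ _ f); [exact: fC|exact: flat_derive_continuous].
apply: (@Cn_of_derive _ _ _
  (fun i x => (flat k.+2 (f x) - k%:R * flat k.+1 (f x)) * 'D_(evec i) f x)).
- move=> x; apply: (@cvg_comp _ _ _ f); last exact: flat_derive_continuous.
  exact: (Cn_continuous fC).
- move=> i x; apply: is_derive_comp1; first exact: is_derive_flat.
  exact: CnS_derive fC _ _.
- move=> i; apply: CnM; last exact: Cn_derive.
  apply: CnB; first by apply: ih; exact: CnW.
  by apply: CnM; [exact: Cn_cst|apply: ih; exact: CnW].
Qed.

Lemma Cn_step n (f : R3 R -> R) : Cn n f -> Cn n (fun x => step (f x)).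
Proof.
move=> fC; have f1 : Cn n (fun x => 1 - f x) by apply: CnB => //; exact: Cn_cst.
apply: CnM; first exact: Cn_flat.
apply: CnV; first by move=> x; rewrite gt_eqF // sden_gt0.
by apply: CnD; [exact: Cn_flat|exact: (@Cn_flat _ 0 _ f1)].
Qed.

End Flat.

Lemma continuous_pair (T U V : topologicalType) (f : T -> U) (g : T -> V) :
  continuous f -> continuous g -> continuous (fun x => (f x, g x)).
Proof.
move=> fc gc x.
exact: (@cvg_pair _ _ _ _ (nbhs (f x)) (nbhs (g x)) _ _ _ f g (fc x) (gc x)).
Qed.

(** * Integration on slabs above a graph *)

Section MeasR3.
Context {R : realType}.
Notation mu := (@lebesgue_measure R).
Notation mR := (measurableTypeR R).

(** Balls of the maximum norm are products of intervals, which ties the topology to the product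
    sigma-algebra. *)
Lemma measurable_box (c : R3 R) e : measurable (ball c e : set (mR3 R)).
Proof.
have -> : (ball c e : set (mR3 R)) = (ball c.1.1 e `*` ball c.1.2 e) `*` ball c.2 e.
  by apply/seteqP; split => x; [case=> -[]|case=> -[]].
by apply: measurableX; [apply: measurableX|]; apply: open_measurable; apply: ball_open.
Qed.

(** Second countability by hand: balls with rational centre and radius 1 / (k + 1), enumerated
    through [unpickle]. Codes that decode to nothing, or to a ball not contained in the set, get
    radius 0, that is the empty ball. *)
Lemma open_bigcup_balls (U : set (R3 R)) : open U ->
  exists (c : nat -> R3 R) (e : nat -> R), U = \bigcup_n ball (c n) (e n).
Proof.
move=> oU.
pose pt (q : rat * rat * rat) : R3 R := (ratr q.1.1, ratr q.1.2, ratr q.2).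
pose F (n : nat) : R3 R * R :=
  if @unpickle (rat * rat * rat * nat)%type n is Some qk then
    if `[< ball (pt qk.1) (qk.2.+1%:R^-1) `<=` U >] then (pt qk.1, qk.2.+1%:R^-1)
    else (0, 0) else (0, 0).
have ball0 (c : R3 R) : ball c 0 = set0.
  by rewrite -subset0 => x [] [] /=; rewrite /ball /= ltNge normr_ge0.
exists (fun n => (F n).1), (fun n => (F n).2).
apply/seteqP; split => [x Ux|x [n _]].
  have /nbhs_ballP[d /= d0 dU] : nbhs x U by exact: open_nbhs_nbhs.
  have [k kd] : exists k : nat, k.+1%:R^-1 < d / 2.
    have [k] := ltr_add_invr (divr_gt0 d0 (ltr0Sn R 1)).
    by rewrite add0r => kd; exists k.
  pose e : R := k.+1%:R^-1.
  have e0 : 0 < e by rewrite invr_gt0.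
  have ex (t : R) : exists q : rat, `|ratr q - t| < e.
    have te : t - e < t + e by rewrite ltrD2l gt0_cp.
    by have [q /itvP hq] := rat_in_itvoo te; exists q; rewrite ltr_distl !hq.
  have [q1 h1] := ex x.1.1; have [q2 h2] := ex x.1.2; have [q3 h3] := ex x.2.
  have xB : ball (pt (q1, q2, q3)) e x by [].
  have := pickleK (q1, q2, q3, k); move: (pickle _) => n En.
  exists n => //; rewrite /F En.
  case: asboolP => //; case => y yB; apply: dU.
  by rewrite [d]splitr; apply: ball_triangle (le_ball (ltW kd) (ball_sym xB)) (le_ball (ltW kd) yB).
rewrite /F; case: unpickle => [qk|]; last by rewrite ball0.
by case: asboolP => [h /= /h //|_]; rewrite ball0.
Qed.

Lemma open_measurable_R3 (U : set (R3 R)) : open U -> measurable (U : set (mR3 R)).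
Proof.
move=> /open_bigcup_balls[c [e ->]].
by apply: bigcup_measurable => n _; exact: measurable_box.
Qed.

Lemma measurable_of_preimage_open d (T : measurableType d) (D : set T) (f : T -> R) :
  (forall U : set R, open U -> measurable (D `&` f @^-1` U)) -> measurable_fun D f.
Proof.
move=> H; apply: (measurability _ (RGenOpens.measurableE R)).
by move=> _ -[_ [a [b ->]] <-]; apply: H; exact: interval_open.
Qed.

Lemma continuous_measurable_R3 (f : R3 R -> R) (D : set (mR3 R)) :
  continuous f -> measurable_fun D (f : mR3 R -> R).
Proof.
move=> fc; apply: (@measurable_funS _ _ _ _ setT) => //.
apply: measurable_of_preimage_open => U oU; rewrite setTI.
by apply: open_measurable_R3; apply: open_comp => // x _; exact: fc.
Qed.

(** The plane as a slice of space, so that planar measurability is inherited from the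
    three-dimensional statements. *)
Let in3 (y : R * R) : R3 R := (y, 0).

Lemma measurable_in3 : measurable_fun setT
  (in3 : measurableTypeR R * measurableTypeR R -> mR3 R).
Proof. by apply: measurable_fun_pair => //; exact: measurable_cst. Qed.

Lemma continuous_measurable_R2 (f : R * R -> R)
    (D : set (measurableTypeR R * measurableTypeR R)) :
  continuous f -> measurable_fun D (f : measurableTypeR R * measurableTypeR R -> R).
Proof.
move=> fc; apply: (@measurable_funS _ _ _ _ setT) => //.
have -> : f = (fun x : R3 R => f x.1) \o in3 by [].
apply: measurableT_comp measurable_in3; apply: continuous_measurable_R3.
by move=> x; apply: (@cvg_comp _ _ _ fst f _ (nbhs x.1)); [exact: cvg_fst|exact: fc].
Qed.

Lemma open_measurable_R2 (U : set (R * R)) : open U ->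
  measurable (U : set (measurableTypeR R * measurableTypeR R)).
Proof.
move=> oU; have -> : U = in3 @^-1` (fst @^-1` U) by [].
rewrite -[X in measurable X]setTI; apply: measurable_in3 => //.
by apply: open_measurable_R3; apply: open_comp => // x _; exact: cvg_fst.
Qed.

Let mu2_sigma_finite : sigma_finite setT ((mu \x mu)%E : set (mR * mR)%type -> \bar R).
Proof.
have /sigma_finiteP[F [TF ndF Foo]] := sigma_finiteT mu.
exists (fun n => F n `*` F n).
 rewrite -setXTT TF predeqE => -[x y]; split.
    move=> [/= [n _ Fnx] [k _ Gky]]; exists (maxn n k) => //; split.
    - by move: x Fnx; exact/subsetPset/ndF/leq_maxl.
    - by move: y Gky; exact/subsetPset/ndF/leq_maxr.
  by move=> [n _ []/= ? ?]; split; exists n.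
move=> k; have [? ?] := Foo k.
split; first exact: measurableX.
by rewrite product_measure1E// lte_mul_pinfty// ge0_fin_numE.
Qed.
(** The same product as [leb2], under a name that carries a sigma-finite instance, so that [leb3]
    can be treated by Fubini as the product of [mu2] with the measure of the line. *)
Definition mu2 : set (mR * mR)%type -> \bar R := (mu \x mu)%E.
HB.instance Definition _ := Measure.on mu2.
HB.instance Definition _ := @Measure_isSigmaFinite.Build _ (mR * mR)%type R mu2 mu2_sigma_finite.

Lemma tonelli2 (f : measurableTypeR R * measurableTypeR R -> \bar R) :
  (forall x, 0 <= f x)%E -> measurable_fun setT f ->
  (\int[leb2]_x f x = \int[mu]_s \int[mu]_t f (s, t))%E.
Proof. by move=> f0 mf; exact: (@fubini_tonelli1 _ _ _ _ _ mu mu f mf f0). Qed.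

Lemma tonelli3 (f : mR3 R -> \bar R) : (forall x, 0 <= f x)%E -> measurable_fun setT f ->
  (\int[leb3]_x f x = \int[leb2]_y \int[mu]_t f (y, t))%E.
Proof. by move=> f0 mf; exact: (@fubini_tonelli1 _ _ (mR * mR)%type mR R mu2 mu f mf f0). Qed.

Lemma measurable_tonelli3 (f : mR3 R -> \bar R) :
  (forall x, 0 <= f x)%E -> measurable_fun setT f ->
  measurable_fun setT (fun y => \int[mu]_t f (y, t))%E.
Proof. by move=> f0 mf; exact: (@measurable_fun_fubini_tonelli_F _ _ (mR * mR)%type mR R mu f mf f0). Qed.

Lemma fubini3_12 (f : mR3 R -> R) : leb3.-integrable setT (EFin \o f) ->
  (\int[leb3]_x (f x)%:E = \int[leb2]_y \int[mu]_t (f (y, t))%:E)%E.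
Proof.
move=> fi; apply/esym.
exact: (@integral12_prod_meas1 _ _ (mR * mR)%type mR R mu2 mu (EFin \o f) fi).
Qed.

Lemma fubini3_21 (f : mR3 R -> R) : leb3.-integrable setT (EFin \o f) ->
  (\int[leb3]_x (f x)%:E = \int[mu]_t \int[leb2]_y (f (y, t))%:E)%E.
Proof.
move=> fi; apply/esym.
exact: (@integral21_prod_meas1 _ _ (mR * mR)%type mR R mu2 mu (EFin \o f) fi).
Qed.

Lemma fubini2_12 (f : measurableTypeR R * measurableTypeR R -> R) :
  leb2.-integrable setT (EFin \o f) ->
  (\int[leb2]_x (f x)%:E = \int[mu]_s \int[mu]_t (f (s, t))%:E)%E.
Proof.
move=> fi; apply/esym.
exact: (@integral12_prod_meas1 _ _ _ _ _ mu mu (EFin \o f) fi).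
Qed.

Lemma fubini2_21 (f : measurableTypeR R * measurableTypeR R -> R) :
  leb2.-integrable setT (EFin \o f) ->
  (\int[leb2]_x (f x)%:E = \int[mu]_t \int[mu]_s (f (s, t))%:E)%E.
Proof.
move=> fi; apply/esym.
exact: (@integral21_prod_meas1 _ _ _ _ _ mu mu (EFin \o f) fi).
Qed.

(** Every vertical fibre has the same length [T], so an inequality on intervals [[a, a + T]] with a
    constant depending on [T] alone integrates over the base. *)
Definition slab (D : set (R * R)) (z : R * R -> R) (T : R) : set (R3 R) :=
  [set x | D x.1 /\ z x.1 < x.2 < z x.1 + T].

Lemma slab_integral (D : set (mR * mR)) (z : R * R -> R) (T : R) (f : mR3 R -> \bar R) :
  measurable (slab D z T : set (mR3 R)) -> measurable D ->
  measurable_fun (slab D z T : set (mR3 R)) f -> (forall x, 0 <= f x)%E ->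
  (\int[leb3]_(x in slab D z T) f x =
   \int[leb2]_(y in D) \int[mu]_(t in `]z y, (z y + T)%R[) f (y, t))%E.
Proof.
move=> ms mD mf f0; rewrite integral_mkcond tonelli3; last 2 first.
- by move=> x; rewrite patchE; case: ifP.
- by apply/(measurable_restrictT _ _).1.
rewrite [RHS]integral_mkcond; apply: eq_integral => y _.
rewrite !patchE; case: ifPn => yD.
  rewrite [RHS]integral_mkcond; apply: eq_integral => t _.
  rewrite !patchE /=; congr (if _ then _ else _).
  apply/idP/idP; rewrite !inE /= in_itv /slab /=; first by case.
  by move=> ?; split => //; rewrite inE in yD.
apply: integral0_eq => t _; rewrite patchE ifF //; apply/negbTE.
by move: yD; apply: contra; rewrite !inE => -[].
Qed.

Lemma measurable_slab_F (D : set (mR * mR)) (z : R * R -> R) (T : R) (f : mR3 R -> \bar R) :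
  measurable (slab D z T : set (mR3 R)) -> measurable D ->
  measurable_fun (slab D z T : set (mR3 R)) f -> (forall x, 0 <= f x)%E ->
  measurable_fun D (fun y => \int[mu]_(t in `]z y, (z y + T)%R[) f (y, t))%E.
Proof.
move=> ms mD mf f0.
have H : measurable_fun setT (fun y => \int[mu]_t (f \_ (slab D z T)) (y, t))%E.
  apply: measurable_tonelli3; last by apply/(measurable_restrictT _ _).1.
  by move=> x; rewrite patchE; case: ifP.
apply: eq_measurable_fun (measurable_funS _ _ H) => // y /[!inE] yD.
rewrite [RHS]integral_mkcond; apply: eq_integral => t _.
rewrite !patchE /=; congr (if _ then _ else _).
apply/idP/idP; rewrite !inE /= in_itv /slab /=; first by case.
by move=> ?; split.
Qed.

(** Tonelli in the vertical direction; [b] collects the contribution of the foot of each fibre,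
    where traces will enter. *)
Lemma slab_le (D : set (mR * mR)) (z : R * R -> R) (T : R) (g1 g2 : R3 R -> R)
    (b : R * R -> R) :
  measurable (slab D z T : set (mR3 R)) -> measurable D ->
  measurable_fun (slab D z T : set (mR3 R)) g1 ->
  measurable_fun (slab D z T : set (mR3 R)) g2 ->
  measurable_fun (D : set (mR * mR)) b ->
  (forall x, 0 <= g1 x) -> (forall x, 0 <= g2 x) -> (forall x, 0 <= b x) ->
  (forall y, D y -> \int[mu]_(t in `]z y, (z y + T)%R[) (g1 (y, t))%:E <=
    (b y)%:E + \int[mu]_(t in `]z y, (z y + T)%R[) (g2 (y, t))%:E)%E ->
  (\int[leb3]_(x in slab D z T) (g1 x)%:E <=
    \int[leb2]_(y in D) (b y)%:E + \int[leb3]_(x in slab D z T) (g2 x)%:E)%E.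
Proof.
move=> ms mD m1 m2 mb p1 p2 pb H.
rewrite !slab_integral //; [|exact/measurable_EFinP|exact/measurable_EFinP].
rewrite -ge0_integralD //; last 3 first.
- exact/measurable_EFinP.
- by move=> y _; apply: integral_ge0 => t _; rewrite lee_fin.
- by apply: (@measurable_slab_F _ _ _ (EFin \o g2) ms mD) => //; exact/measurable_EFinP.
apply: ge0_le_integral => //.
- by move=> y _; apply: integral_ge0 => t _; rewrite lee_fin.
- by apply: (@measurable_slab_F _ _ _ (EFin \o g1) ms mD) => //; exact/measurable_EFinP.
- apply: emeasurable_funD; first exact/measurable_EFinP.
  by apply: (@measurable_slab_F _ _ _ (EFin \o g2) ms mD) => //; exact/measurable_EFinP.
- by move=> y _; rewrite lee_fin.
Qed.

End MeasR3.

(** * Strip, trace and Hardy inequalities on an interval *)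

Section OneD.
Context {R : realType}.
Notation mu := (@lebesgue_measure R).

Lemma C1_oo_LR (F : R -> R) (a b : R) : continuous F -> (forall x : R, derivable F x 1) ->
  derivable_oo_LRcontinuous F a b.
Proof.
move=> Fc Fd; split=> //.
- exact: (cvg_at_right_filter (Fc a)).
- exact: (cvg_at_left_filter (Fc b)).
Qed.

(** Form in which a pointwise completion of squares is integrated: a total derivative on the right
    contributes its end point values only. *)
Lemma FTC_le (F dF g1 g2 : R -> R) (a b : R) : a < b ->
  (forall x : R, x \in `[a, b] -> is_derive x 1 F (dF x)) ->
  {within `[a, b], continuous dF} ->
  {within `[a, b], continuous g1} -> {within `[a, b], continuous g2} ->
  {in `[a, b], forall x, g1 x <= dF x + g2 x} ->
  (\int[mu]_(x in `[a, b]) (g1 x)%:E <=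
     (F b - F a)%:E + \int[mu]_(x in `[a, b]) (g2 x)%:E)%E.
Proof.
move=> ab dFP cF c1 c2 h.
have int (f : R -> R) : {within `[a, b], continuous f} ->
    mu.-integrable `[a, b] (EFin \o f).
  by move=> cf; apply: continuous_compact_integrable => //; exact: segment_compact.
have FE : (\int[mu]_(x in `[a, b]) (dF x)%:E = (F b - F a)%:E)%E.
  rewrite EFinB; apply: continuous_FTC2 => //.
  - have Fc x : x \in `[a, b] -> {for x, continuous F}.
      move=> /dFP xd; apply: differentiable_continuous; apply/derivable1_diffP.
      by case: xd.
    split.
    + by move=> x xab; have [] := dFP x (subset_itv_oo_cc xab).
    + by apply: cvg_at_right_filter; apply: Fc; rewrite in_itv /= lexx ltW.
    + by apply: cvg_at_left_filter; apply: Fc; rewrite in_itv /= lexx ltW.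
  - by move=> x /subset_itv_oo_cc /dFP xd; rewrite derive1E derive_val.
rewrite -FE -integralD_EFin //; [|exact: int|exact: int].
apply: le_integral => //; first exact: int.
- have := integrableD _ (int _ cF) (int _ c2); apply => //.
- by move=> x; rewrite inE /= lee_fin => /h.
Qed.

(* All three integrate (W f^2)' = W' f^2 + 2 W f f' for a suitable weight W. *)
Section ineq.
Variables (f df : R -> R).
Hypothesis fd : forall x : R, is_derive x 1 f (df x).
Hypothesis dfc : continuous df.

Let fc : continuous f.
Proof.
move=> x; apply: differentiable_continuous; apply/derivable1_diffP.
by case: (fd x).
Qed.

Let der (W : R -> R) (w x : R) : is_derive x 1 W w ->
  is_derive x 1 (fun t => W t * f t ^+ 2) (w * f x ^+ 2 + 2 * W x * f x * df x).
Proof.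
move=> hW; have h2 := @is_deriveM R R f f x 1 _ _ (fd x) (fd x).
have := @is_deriveM R R W (f * f) x 1 _ _ hW h2.
have -> : W * (f * f) = (fun t => W t * f t ^+ 2).
  by apply/funext => t /=; rewrite expr2.
by move=> h; apply: (is_derive_val h); rewrite /GRing.scale fctE /=; ring.
Qed.

Let cw (g : R -> R) a b : continuous g -> {within `[a, b], continuous g}.
Proof. exact: continuous_subspaceT. Qed.

Let csq (g : R -> R) : continuous g -> continuous (fun x => g x ^+ 2).
Proof. by move=> gc x; under eq_fun do rewrite expr2; apply: cvgM; exact: gc. Qed.

Let cZ (g : R -> R) (c : R) : continuous g -> continuous (fun x => c * g x).
Proof. by move=> gc x; apply: cvgMr; exact: gc. Qed.

Let cD (g1 g2 : R -> R) : continuous g1 -> continuous g2 -> continuous (fun x => g1 x + g2 x).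
Proof. by move=> g1c g2c x; apply: cvgD; [exact: g1c|exact: g2c]. Qed.

Let cM (g1 g2 : R -> R) : continuous g1 -> continuous g2 -> continuous (fun x => g1 x * g2 x).
Proof. by move=> g1c g2c x; apply: cvgM; [exact: g1c|exact: g2c]. Qed.

Let c0 (c : R) : continuous (fun _ : R => c).
Proof. exact: cst_continuous. Qed.

Let cid : continuous (fun x : R => x).
Proof. by move=> x; exact: cvg_id. Qed.

Lemma strip_1D (a T : R) : 0 < T ->
  (\int[mu]_(x in `[a, (a + T)%R]) (f x ^+ 2)%:E <= (2 * T * f a ^+ 2)%:E +
    \int[mu]_(x in `[a, (a + T)%R]) (4 * T ^+ 2 * df x ^+ 2)%:E)%E.
Proof.
move=> T0; have ab : a < a + T by rewrite ltrDl.
(* The weight vanishes at the top end, so only the value at [a] survives; the pointwise inequality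
   is (f + 2 (x - a - T) f')^2 >= 0. *)
have hW (x : R) : is_derive x 1 (fun t => 2 * (t - (a + T))) 2.
  have -> : (fun t => 2 * (t - (a + T))) = (fun t => t * 2 + (- 2 * (a + T))).
    by apply/funext => t; ring.
  exact: is_derive_affine.
have := @FTC_le _ _ (fun x => f x ^+ 2) (fun x => 4 * T ^+ 2 * df x ^+ 2)
  a (a + T) ab (fun x _ => der (hW x)) .
rewrite subrr mulr0 mul0r sub0r.
have -> : - (2 * (a - (a + T)) * f a ^+ 2) = 2 * T * f a ^+ 2 by ring.
apply.
- apply: cw; apply: cD; first by apply: cZ; exact: csq.
  apply: cM => //; apply: cM => //; apply: cZ; apply: cZ.
  exact: cD.
- by apply: cw; exact: csq.
- by apply: cw; apply: cZ; exact: csq.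
- move=> x; rewrite in_itv /= => /andP[ax xb].
  have h : (x - (a + T)) ^+ 2 <= T ^+ 2.
    by rewrite -sqrrN ler_sqr ?nnegrE; lra.
  have h2 : (x - (a + T)) ^+ 2 * df x ^+ 2 <= T ^+ 2 * df x ^+ 2.
    by rewrite ler_wpM2r // sqr_ge0.
  have := sqr_ge0 (f x + 2 * (x - (a + T)) * df x); nra.
Qed.

Lemma trace_1D (a T : R) : 0 < T ->
  ((f a ^+ 2)%:E <=
    \int[mu]_(x in `[a, (a + T)%R]) ((T^-1 + 1) * f x ^+ 2 + df x ^+ 2)%:E)%E.
Proof.
move=> T0; have ab : a < a + T by rewrite ltrDl.
(* This weight falls linearly from 1 at [a] to 0 at [a + T], which isolates [f a ^+ 2]. *)
have hW (x : R) : is_derive x 1 (fun t => T^-1 * (a + T - t)) (- T^-1).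
  have -> : (fun t => T^-1 * (a + T - t)) = (fun t => t * - T^-1 + (T^-1 * (a + T))).
    by apply/funext => t; ring.
  exact: is_derive_affine.
have := @FTC_le _ _ (fun x => 0) (fun x => (T^-1 + 1) * f x ^+ 2 + df x ^+ 2)
  a (a + T) ab (fun x _ => der (hW x)) .
rewrite subrr mulr0 mul0r sub0r integral0.
have -> : - (T^-1 * (a + T - a) * f a ^+ 2) = - f a ^+ 2.
  by field; rewrite gt_eqF.
rewrite EFinN addeC sube_ge0 ?fin_numE //; apply.
- apply: cw; apply: cD; first by apply: cZ; exact: csq.
  apply: cM => //; apply: cM => //; apply: cZ; apply: cZ.
  apply: cD => //; by move=> x; apply: cvgN; exact: cid.
- by apply: cw; exact: c0.
- by apply: cw; apply: cD; [apply: cZ; exact: csq|exact: csq].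
- move=> x; rewrite in_itv /= => /andP[ax xb].
  set w := T^-1 * (a + T - x).
  have Ti : 0 < T^-1 by rewrite invr_gt0.
  have w0 : 0 <= w by apply: mulr_ge0; [exact: ltW|lra].
  have w1 : w <= 1 by rewrite /w mulrC ler_pdivrMr // mul1r; lra.
  have hw : w ^+ 2 <= 1 by rewrite expr_le1.
  have h2 : w ^+ 2 * df x ^+ 2 <= 1 * df x ^+ 2 by rewrite ler_wpM2r // sqr_ge0.
  have := sqr_ge0 (f x + w * df x); nra.
Qed.

Lemma hardy_1D (a T e : R) : 0 < T -> 0 <= a -> 0 < e ->
  (\int[mu]_(x in `[a, (a + T)%R]) (e / (x + e) ^+ 2 * f x ^+ 2)%:E <=
    (e / (a + e) * f a ^+ 2)%:E +
    \int[mu]_(x in `[a, (a + T)%R]) (e / (x + e) * f x ^+ 2 + e / (x + e) * df x ^+ 2)%:E)%E.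
Proof.
move=> T0 a0 e0; have ab : a < a + T by rewrite ltrDl.
have pos x : x \in `[a, a + T] -> 0 < x + e.
  by rewrite in_itv /= => /andP[ax _]; rewrite ltr_wpDl // (le_trans a0).
have ci : {within `[a, a + T], continuous (fun x => (x + e)^-1)}.
  apply: continuous_in_subspaceT => x /[!inE] xab.
  by apply: cvgV; [rewrite gt_eqF // pos|apply: cD].
have cwD (g1 g2 : R -> R) : {within `[a, a + T], continuous g1} ->
    {within `[a, a + T], continuous g2} -> {within `[a, a + T], continuous (fun x => g1 x + g2 x)}.
  by move=> h1 h2 x; apply: (@cvgD _ R^o); [exact: h1|exact: h2].
have cwM (g1 g2 : R -> R) : {within `[a, a + T], continuous g1} ->
    {within `[a, a + T], continuous g2} -> {within `[a, a + T], continuous (fun x => g1 x * g2 x)}.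
  by move=> h1 h2 x; apply: (@cvgM R); [exact: h1|exact: h2].
(* The weight -e / (t + e) has derivative e / (t + e)^2, the density to be bounded; its contribution
   at the top end has a favourable sign and is dropped. What is left pointwise is e / (x + e) (f -
   f')^2 >= 0. *)
have hW (x : R) : x \in `[a, a + T] -> is_derive x 1 (fun t => - e / (t + e)) (e / (x + e) ^+ 2).
  move=> xab; have x0 : x + e != 0 by rewrite gt_eqF // pos.
  have h1 : is_derive x 1 (fun t => t + e) 1.
    have -> : (fun t => t + e) = (fun t => t * 1 + e).
      by apply/funext => t; rewrite mulr1.
    exact: is_derive_affine.
  have h2 := @is_deriveV R _ x _ 1 x0 h1.
  have := @is_deriveZ R _ _ (fun t => (t + e)^-1) (- e) x 1 _ h2.
  by move=> h; apply: (is_derive_val h); rewrite /GRing.scale /=; field.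
have := @FTC_le _ _ (fun x => e / (x + e) ^+ 2 * f x ^+ 2)
  (fun x => e / (x + e) * f x ^+ 2 + e / (x + e) * df x ^+ 2)
  a (a + T) ab (fun x xab => der (hW x xab)).
have cw0 (c : R) : {within `[a, a + T], continuous (fun _ => c)}.
  by move=> x; exact: cvg_cst.
have cinv2 : {within `[a, a + T], continuous (fun x => e / (x + e) ^+ 2)}.
  have -> : (fun x => e / (x + e) ^+ 2) = (fun x => e * ((x + e)^-1 * (x + e)^-1)).
    by apply/funext => x; rewrite -expr2 exprVn.
  exact: (cwM _ _ (cw0 e) (cwM _ _ ci ci)).
have cinv1 (c : R) : {within `[a, a + T], continuous (fun x => c / (x + e))}.
  exact: (cwM _ _ (cw0 c) ci).
have cf : {within `[a, a + T], continuous f} by exact: cw.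
have cdf : {within `[a, a + T], continuous df} by exact: cw.
have cf2 : {within `[a, a + T], continuous (fun x => f x ^+ 2)} by apply: cw; exact: csq.
have cdf2 : {within `[a, a + T], continuous (fun x => df x ^+ 2)} by apply: cw; exact: csq.
move=> H; apply: le_trans (H _ _ _ _) _.
- exact: (cwD _ _ (cwM _ _ cinv2 cf2) (cwM _ _ (cwM _ _ (cwM _ _ (cw0 2) (cinv1 (- e))) cf) cdf)).
- exact: (cwM _ _ cinv2 cf2).
- exact: (cwD _ _ (cwM _ _ (cinv1 e) cf2) (cwM _ _ (cinv1 e) cdf2)).
- move=> x xab; have x0 := pos x xab.
  have w0 : 0 <= e / (x + e) by rewrite divr_ge0 ?ltW.
  have := mulr_ge0 w0 (sqr_ge0 (f x - df x)).
  rewrite mulNr; set w := e / (x + e); nra.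
- rewrite leeD2r // lee_fin.
  have : 0 <= e / (a + T + e) * f (a + T) ^+ 2.
    by rewrite mulr_ge0 ?sqr_ge0 // divr_ge0 ?ltW //; lra.
  by rewrite !mulNr; lra.
Qed.

End ineq.
End OneD.

(** * Cauchy-Schwarz, weighted comparison and dominated convergence *)

Section L2.
Context d (T : measurableType d) (R : realType) (mu : {measure set T -> \bar R}).
Variables (D : set T) (mD : measurable D).
Implicit Types (f g h w : T -> R).

Lemma measurable_sqr f : measurable_fun D f -> measurable_fun D (fun x => f x ^+ 2).
Proof. by move=> mf; under eq_fun do rewrite expr2; exact: measurable_funM. Qed.

Lemma int_le f g : measurable_fun D f -> measurable_fun D g ->
  (forall x, D x -> 0 <= f x) -> (forall x, D x -> f x <= g x) ->
  (\int[mu]_(x in D) (f x)%:E <= \int[mu]_(x in D) (g x)%:E)%E.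
Proof.
move=> mf mg f0 fg; apply: ge0_le_integral => //.
- exact/measurable_EFinP.
- exact/measurable_EFinP.
Qed.

Lemma int_addZ f g a b : measurable_fun D f -> measurable_fun D g ->
  (forall x, D x -> 0 <= f x) -> (forall x, D x -> 0 <= g x) -> 0 <= a -> 0 <= b ->
  (\int[mu]_(x in D) (a * f x + b * g x)%:E =
   a%:E * \int[mu]_(x in D) (f x)%:E + b%:E * \int[mu]_(x in D) (g x)%:E)%E.
Proof.
move=> mf mg f0 g0 a0 b0.
under eq_integral do rewrite EFinD !EFinM.
rewrite ge0_integralD //.
- rewrite !ge0_integralZl_EFin //; by [exact/measurable_EFinP|move=> x Dx; rewrite lee_fin; auto].
- by move=> x Dx; rewrite -EFinM lee_fin mulr_ge0 //; exact: f0.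
- by under eq_fun do rewrite -EFinM; apply/measurable_EFinP; exact: measurable_funM.
- by move=> x Dx; rewrite -EFinM lee_fin mulr_ge0 //; exact: g0.
- by under eq_fun do rewrite -EFinM; apply/measurable_EFinP; exact: measurable_funM.
Qed.

Lemma int_Zl f a : measurable_fun D f -> (forall x, D x -> 0 <= f x) -> 0 <= a ->
  (\int[mu]_(x in D) (a * f x)%:E = a%:E * \int[mu]_(x in D) (f x)%:E)%E.
Proof.
move=> mf f0 a0; under eq_integral do rewrite EFinM.
rewrite ge0_integralZl_EFin //; first exact/measurable_EFinP.
Qed.

(** Weighted arithmetic-geometric mean with weight [b / a]. The bounds are first enlarged by some
    [e > 0] so that this quotient makes sense when [A] or [B] vanishes, and [e] is then sent to
    0. *)
Lemma cauchy_schwarz_int f g (A B : R) : measurable_fun D f -> measurable_fun D g ->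
  0 <= A -> 0 <= B ->
  (\int[mu]_(x in D) (f x ^+ 2)%:E <= (A ^+ 2)%:E)%E ->
  (\int[mu]_(x in D) (g x ^+ 2)%:E <= (B ^+ 2)%:E)%E ->
  (\int[mu]_(x in D) `|f x * g x|%:E <= (A * B)%:E)%E.
Proof.
move=> mf mg A0 B0 hA hB.
have key e : 0 < e -> (\int[mu]_(x in D) `|f x * g x|%:E <= ((A + e) * (B + e))%:E)%E.
  move=> e0; set a := A + e; set b := B + e.
  have a0 : 0 < a by rewrite ltr_wpDl. have b0 : 0 < b by rewrite ltr_wpDl.
  pose c := b / a; have c0 : 0 < c by rewrite divr_gt0.
  apply: (@le_trans _ _ (\int[mu]_(x in D) ((c / 2) * f x ^+ 2 + (c^-1 / 2) * g x ^+ 2)%:E)%E).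
    apply: int_le => //.
    - by apply: measurableT_comp => //; exact: measurable_funM.
    - apply: measurable_funD; apply: measurable_funM => //; exact: measurable_sqr.
    - move=> x _; rewrite normrM.
      have h : 0 <= c^-1 * (c * `|f x| - `|g x|) ^+ 2.
        by rewrite mulr_ge0 ?sqr_ge0 // invr_ge0 ltW.
      rewrite -(real_normK (num_real (f x))) -(real_normK (num_real (g x))).
      have E : c^-1 * (c * `|f x| - `|g x|) ^+ 2 =
          c * `|f x| ^+ 2 - 2 * (`|f x| * `|g x|) + c^-1 * `|g x| ^+ 2.
        by field; rewrite gt_eqF.
      rewrite E in h; lra.
  rewrite int_addZ //; first last.
  - by rewrite divr_ge0 // invr_ge0 ltW.
  - by rewrite divr_ge0 // ltW.
  - by move=> x _; exact: sqr_ge0.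
  - by move=> x _; exact: sqr_ge0.
  - exact: measurable_sqr.
  - exact: measurable_sqr.
  apply: (@le_trans _ _ ((c / 2)%:E * (a ^+ 2)%:E + (c^-1 / 2)%:E * (b ^+ 2)%:E)%E).
    apply: leeD; apply: lee_wpmul2l.
    - by rewrite lee_fin divr_ge0 // ltW.
    - by apply: le_trans hA _; rewrite lee_fin ler_sqr ?nnegrE ?(ltW a0) // /a; lra.
    - by rewrite lee_fin divr_ge0 // invr_ge0 ltW.
    - by apply: le_trans hB _; rewrite lee_fin ler_sqr ?nnegrE ?(ltW b0) // /b; lra.
  rewrite -!EFinM -EFinD lee_fin /c le_eqVlt; apply/orP; left; apply/eqP.
  by field; rewrite !gt_eqF.
apply/lee_addgt0Pr => e e0.
(* With [e' <= 1] the product exceeds [A * B] by at most [e' * (A + B + 1)]. *)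
pose e' := Num.min 1 (e / (A + B + 1)).
have p : 0 < A + B + 1 by lra.
have e'0 : 0 < e' by rewrite lt_min ltr01 divr_gt0.
apply: le_trans (key _ e'0) _; rewrite -EFinD lee_fin.
have h1 : e' <= 1 by rewrite ge_min lexx.
have h2 : e' * (A + B + 1) <= e by rewrite -ler_pdivlMr // ge_min lexx orbT.
nra.
Qed.

Lemma Rint_bound f C : measurable_fun D f ->
  (\int[mu]_(x in D) `|f x|%:E <= C%:E)%E ->
  mu.-integrable D (EFin \o f) /\ `|\int[mu]_(x in D) f x| <= C.
Proof.
move=> mf hC; have fi : mu.-integrable D (EFin \o f).
  by apply/integrableP; split; [exact/measurable_EFinP|exact: le_lt_trans hC (ltry _)].
split=> //; apply: le_trans (le_normr_Rintegral mD fi) _.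
rewrite -lee_fin; apply: le_trans (hC); rewrite /Rintegral fineK //.
rewrite ge0_fin_numE; last by apply: integral_ge0 => x _; rewrite lee_fin.
exact: le_lt_trans hC (ltry _).
Qed.

End L2.

Section L2b.
Context d (T : measurableType d) (R : realType) (mu : {measure set T -> \bar R}).

(** The gap 2 w h^2 + 2 w (h - g)^2 - w g^2 equals w (2 h - g)^2. In the error term the weight is
    replaced by its bound [M], after which the integral may be taken over the larger set. *)
Lemma weighted_sq_tri (S S0 : set T) (g h w : T -> R) (M : R) :
  measurable S -> measurable S0 -> S `<=` S0 ->
  measurable_fun S0 g -> measurable_fun S0 h -> measurable_fun S w ->
  (forall x, S x -> 0 <= w x <= M) -> 0 <= M ->
  (\int[mu]_(x in S) (w x * g x ^+ 2)%:E <=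
    2%:E * \int[mu]_(x in S) (w x * h x ^+ 2)%:E +
    (2 * M)%:E * \int[mu]_(x in S0) ((h x - g x) ^+ 2)%:E)%E.
Proof.
move=> mS mS0 SS0 mg mh mw w0 M0.
have mg' := measurable_funS mS0 SS0 mg; have mh' := measurable_funS mS0 SS0 mh.
have ms : measurable_fun S0 (fun x => (h x - g x) ^+ 2).
  by apply: measurable_sqr => //; exact: measurable_funB.
apply: (@le_trans _ _ (2%:E * \int[mu]_(x in S) (w x * h x ^+ 2)%:E +
    (2 * M)%:E * \int[mu]_(x in S) ((h x - g x) ^+ 2)%:E)%E); last first.
  apply: leeD => //; apply: lee_wpmul2l; first by rewrite lee_fin mulr_ge0.
  apply: ge0_subset_integral => //; first exact/measurable_EFinP.
  by move=> x _; rewrite lee_fin sqr_ge0.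
rewrite -int_addZ //; first last.
- by rewrite mulr_ge0.
- by move=> x _; exact: sqr_ge0.
- by move=> x Sx; rewrite mulr_ge0 ?sqr_ge0 //; case/andP: (w0 _ Sx).
- exact: measurable_funS ms.
- by apply: measurable_funM => //; exact: measurable_sqr.
apply: int_le => //.
- by apply: measurable_funM => //; exact: measurable_sqr.
- apply: measurable_funD; apply: measurable_funM => //.
    by apply: measurable_funM => //; exact: measurable_sqr.
  exact: measurable_funS ms.
- by move=> x Sx; rewrite mulr_ge0 ?sqr_ge0 //; case/andP: (w0 _ Sx).
- move=> x Sx; have /andP[w0' wM] := w0 _ Sx.
  have h1 : (h x - g x) ^+ 2 * w x <= (h x - g x) ^+ 2 * M.
    by rewrite ler_wpM2l // sqr_ge0.
  have h2 : 0 <= w x * (2 * h x - g x) ^+ 2 by rewrite mulr_ge0 // sqr_ge0.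
  nra.
Qed.

Lemma dct (D : set T) (f_ : nat -> T -> R) (f g : T -> R) : measurable D ->
  (forall n, measurable_fun D (f_ n)) -> measurable_fun D f ->
  (forall x, D x -> f_ n x @[n --> \oo] --> f x) ->
  (forall n x, D x -> `|f_ n x| <= g x) -> mu.-integrable D (EFin \o g) ->
  (\int[mu]_(x in D) (f_ n x)%:E @[n --> \oo] --> \int[mu]_(x in D) (f x)%:E)%E.
Proof.
move=> mD mf_ mf hcvg hb gi.
have mfn n : measurable_fun D (fun x => (f_ n x)%:E) by exact/measurable_EFinP.
have mfe : measurable_fun D (EFin \o f) by exact/measurable_EFinP.
have h1 : {ae mu, forall x, D x -> (f_ n x)%:E @[n --> \oo] --> (EFin \o f) x}.
  by apply: aeW => x Dx; apply: cvg_EFin; [exact: nearW|exact: hcvg].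
have h2 : {ae mu, forall x n, D x -> (`|(f_ n x)%:E| <= (EFin \o g) x)%E}.
  by apply: aeW => x n Dx; rewrite /= lee_fin hb.
by have [_ _] := dominated_convergence mD mfn mfe h1 gi h2.
Qed.

Lemma Rdct (D : set T) (f_ : nat -> T -> R) (f g : T -> R) : measurable D ->
  (forall n, measurable_fun D (f_ n)) -> measurable_fun D f ->
  (forall x, D x -> f_ n x @[n --> \oo] --> f x) ->
  (forall n x, D x -> `|f_ n x| <= g x) -> mu.-integrable D (EFin \o g) ->
  \int[mu]_(x in D) f_ n x @[n --> \oo] --> \int[mu]_(x in D) f x.
Proof.
move=> mD mf_ mf hcvg hb gi; apply: fine_cvg.
have fi : mu.-integrable D (EFin \o f).
  apply: le_integrable gi => //; first exact/measurable_EFinP.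
  move=> x Dx; rewrite lee_fin.
  apply: (@le_trans _ _ (g x)); last exact: ler_norm.
  have hn : `|f_ n x| @[n --> \oo] --> `|f x| by apply: cvg_norm; exact: hcvg.
  rewrite -(cvg_lim _ hn) //; apply: limr_le; first exact: (cvgP _ hn).
  by apply: nearW => n; exact: hb.
rewrite fineK; first exact: (dct mD mf_ mf hcvg hb gi).
exact: integrable_fin_num.
Qed.

Lemma integrable_mul_bounded (D : set T) (g h : T -> R) (B : R) : measurable D ->
  mu.-integrable D (EFin \o g) -> measurable_fun D h ->
  (forall x, D x -> `|h x| <= B) -> mu.-integrable D (EFin \o (fun x => g x * h x)).
Proof.
move=> mD gi mh hB.
have gi' := integrableZl mD B gi.
apply: le_integrable gi' => //.
  apply/measurable_EFinP; apply: measurable_funM => //.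
  by apply/measurable_EFinP; case/integrableP: gi.
move=> x Dx; rewrite /= lee_fin !normrM mulrC ler_wpM2r //.
exact: le_trans (hB _ Dx) (ler_norm _).
Qed.

End L2b.

(** * The cone as an epigraph, and the vertical weights *)

Section Geometry.
Context {R : realType}.
Notation mR := (measurableTypeR R).
Implicit Types (m r T h : R) (y : R * R) (x : R3 R).

Definition sqn y : R := y.1 ^+ 2 + y.2 ^+ 2.
(** The lateral surface as a graph; [m] will be the cotangent of the half-opening. *)
Definition zc m y : R := m * Num.sqrt (sqn y).
Definition disc r : set (R * R) := [set y | sqn y < r ^+ 2].

Lemma sqn_ge0 y : 0 <= sqn y.
Proof. by rewrite addr_ge0 ?sqr_ge0. Qed.

Lemma zc_ge0 m y : 0 <= m -> 0 <= zc m y.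
Proof. by move=> m0; rewrite mulr_ge0 ?sqrtr_ge0. Qed.

Lemma fst_continuous2 : continuous (@fst R R).
Proof. by move=> y; exact: cvg_fst. Qed.

Lemma snd_continuous2 : continuous (@snd R R).
Proof. by move=> y; exact: cvg_snd. Qed.

Lemma sqn_continuous : continuous sqn.
Proof.
by move=> y; apply: cvgD; under eq_fun do rewrite expr2; apply: cvgM;
  (exact: fst_continuous2 || exact: snd_continuous2).
Qed.

Lemma zc_continuous m : continuous (zc m).
Proof.
move=> y; apply: cvgMr; apply: (@cvg_comp _ _ _ sqn); first exact: sqn_continuous.
exact: sqrt_continuous.
Qed.

Lemma disc_open r : open (disc r).
Proof.
have -> : disc r = sqn @^-1` `]-oo, r ^+ 2[.
  by apply/seteqP; split => y; rewrite /disc /= in_itv.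
by apply: open_comp => [y _|]; [exact: sqn_continuous|exact: interval_open].
Qed.

Lemma disc_measurable r : measurable (disc r : set (mR * mR)).
Proof. by apply: open_measurable_R2; exact: disc_open. Qed.

Lemma R3fst_continuous : continuous (fun x => x.1).
Proof. by move=> x; exact: cvg_fst. Qed.

Lemma height_continuous m : continuous (fun x => x.2 - zc m x.1).
Proof.
move=> x; apply: cvgB; first exact: c3_continuous.
by apply: (@cvg_comp _ _ _ fst (zc m) _ (nbhs x.1)); [exact: R3fst_continuous|exact: zc_continuous].
Qed.

Lemma slab_open m r T : open (slab (disc r) (zc m) T).
Proof.
have -> : slab (disc r) (zc m) T =
    (fst @^-1` disc r) `&` ((fun x => x.2 - zc m x.1) @^-1` `]0, T[).
  apply/seteqP; split => x; rewrite /slab /= in_itv /= subr_gt0 ltrBlDl.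
    by case.
  by case.
apply: openI.
  by apply: open_comp => [x _|]; [exact: R3fst_continuous|exact: disc_open].
by apply: open_comp => [x _|]; [exact: height_continuous|exact: interval_open].
Qed.

Lemma slab_measurable m r T : measurable (slab (disc r) (zc m) T : set (mR3 R)).
Proof. by apply: open_measurable_R3; exact: slab_open. Qed.

Lemma dot_continuous : continuous (fun x : R3 R => dot x x).
Proof.
move=> x; apply: cvgD; last by apply: cvgM; exact: c3_continuous.
by apply: cvgD; apply: cvgM; (exact: c1_continuous || exact: c2_continuous).
Qed.

Lemma dot_ge0 x : 0 <= dot x x.
Proof. by rewrite /dot -!expr2 !addr_ge0 ?sqr_ge0. Qed.

Lemma enorm_continuous : continuous (@enorm R).
Proof.
move=> x; apply: (@cvg_comp _ _ _ (fun x => dot x x)); first exact: dot_continuous.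
exact: sqrt_continuous.
Qed.

Lemma enorm_ge0 x : 0 <= enorm x.
Proof. exact: sqrtr_ge0. Qed.

Lemma sqr_enorm x : enorm x ^+ 2 = sqn x.1 + x.2 ^+ 2.
Proof. by rewrite /enorm sqr_sqrtr ?dot_ge0 // /dot /sqn !expr2. Qed.

Lemma eball_open h : open (@eball R h).
Proof.
have -> : eball h = enorm @^-1` `]-oo, h[.
  by apply/seteqP; split => x; rewrite /eball /= in_itv.
by apply: open_comp => [x _|]; [exact: enorm_continuous|exact: interval_open].
Qed.

Lemma eballE h x : 0 <= h -> eball h x <-> sqn x.1 + x.2 ^+ 2 < h ^+ 2.
Proof.
by move=> h0; rewrite /eball /= -sqr_enorm ltr_sqr ?nnegrE ?enorm_ge0.
Qed.

Lemma slab_sub_eball m r T h : 0 <= m -> 0 <= r -> 0 <= T -> (m + 1) * r + T <= h ->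
  slab (disc r) (zc m) T `<=` eball h.
Proof.
move=> m0 r0 T0 hh x [xd /andP[x1 x2]].
have h0 : 0 <= h by apply: le_trans hh; rewrite addr_ge0 // mulr_ge0 // addr_ge0.
apply/eballE => //; rewrite /disc /= in xd.
have s0 := sqrtr_ge0 (sqn x.1).
have sE : Num.sqrt (sqn x.1) ^+ 2 = sqn x.1 by rewrite sqr_sqrtr // sqn_ge0.
have sr : Num.sqrt (sqn x.1) < r by rewrite -ltr_sqr ?nnegrE // sE.
have z0 := zc_ge0 x.1 m0.
have zr : zc m x.1 <= m * r by rewrite /zc ler_wpM2l // ltW.
have xb : x.2 <= m * r + T by apply: le_trans (ltW x2) _; rewrite lerD2r.
have x20 : 0 <= x.2 by apply: le_trans z0 (ltW x1).
have : x.2 ^+ 2 <= (m * r + T) ^+ 2 by rewrite ler_sqr ?nnegrE //; apply: le_trans xb.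
have : ((m + 1) * r + T) ^+ 2 <= h ^+ 2 by rewrite ler_sqr ?nnegrE // addr_ge0 // mulr_ge0 // addr_ge0.
have : 0 <= r * (m * r + T) by rewrite mulr_ge0 // addr_ge0 // mulr_ge0.
nra.
Qed.

(** As [acos] is decreasing, the angle condition reads cos(th) |x| < x3; both sides are nonnegative
    because th < pi/2, and squaring with cos^2 + sin^2 = 1 turns it into cot(th) |x'| < x3, where x'
    is the horizontal part. The apex is excluded on both sides, the right-hand one reading 0 < 0
    there. *)
Lemma coneE (th : R) : 0 < th < pi / 2 ->
  cone th = [set x | zc (cos th / sin th) x.1 < x.2].
Proof.
move=> /andP[t0 tpi].
have c0 : 0 < cos th by apply: cos_gt0_pihalf; rewrite tpi andbT (lt_trans _ t0) // oppr_lt0 divr_gt0 // pi_gt0.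
have tp : th < pi by apply: lt_trans tpi _; have := pi_gt0 R; lra.
have s0 : 0 < sin th by apply: sin_gt0_pi; rewrite t0.
have cs := cos2Dsin2 th.
have e3 : enorm ((0, 0, 1) : R3 R) = 1.
  by rewrite /enorm /dot /= !mul0r !add0r mulr1 sqrtr1.
apply/seteqP; split => x; rewrite /cone /= /angle e3 mulr1.
  move=> [x0 /andP[_ hlt]].
  have d3 : dot x (0, 0, 1) = x.2 by rewrite /dot /= !mulr0 !add0r mulr1.
  rewrite d3 in hlt.
  have n2 := sqr_enorm x.
  have np : 0 < enorm x.
    rewrite lt_neqAle enorm_ge0 andbT eq_sym; apply: contraNneq x0 => n0.
    move: n2; rewrite n0 expr0n /= => /esym /eqP.
    rewrite paddr_eq0 ?sqn_ge0 ?sqr_ge0 // /sqn paddr_eq0 ?sqr_ge0 // !sqrf_eq0.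
    by case: x {hlt d3 n0} => [[? ?] ?] /= /andP[/andP[/eqP-> /eqP->] /eqP->].
  have u1 : -1 <= x.2 / enorm x <= 1.
    rewrite -ler_norml normrM normfV [`|enorm x|]gtr0_norm // ler_pdivrMr // mul1r.
    by rewrite -ler_sqr ?nnegrE ?enorm_ge0 // real_normK ?num_real // n2 lerDr sqn_ge0.
  have hc : cos th < x.2 / enorm x.
    rewrite -(acosK u1) ltr_cos // in_itv /=.
    - by rewrite acos_ge0 ?acos_lepi.
    - by rewrite (ltW t0) (ltW tp).
  rewrite ltr_pdivlMr // in hc.
  have x20 : 0 < x.2 by apply: le_lt_trans hc; rewrite mulr_ge0 ?ltW.
  rewrite /zc mulrAC ltr_pdivrMr //.
  rewrite -ltr_sqr ?nnegrE; last 2 first.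
  - by rewrite mulr_ge0 ?sqrtr_ge0 // ltW.
  - by rewrite mulr_ge0 // ltW.
  rewrite !exprMn sqr_sqrtr ?sqn_ge0 //.
  have : (cos th * enorm x) ^+ 2 < x.2 ^+ 2 by rewrite ltr_sqr ?nnegrE ?mulr_ge0 ?ltW.
  rewrite exprMn n2; nra.
move=> hx.
have z0 : 0 <= zc (cos th / sin th) x.1 by apply: zc_ge0; rewrite divr_ge0 ?ltW.
have x20 : 0 < x.2 := le_lt_trans z0 hx.
have d3 : dot x (0, 0, 1) = x.2 by rewrite /dot /= !mulr0 !add0r mulr1.
have n2 := sqr_enorm x.
have np : 0 < enorm x.
  rewrite lt_neqAle enorm_ge0 andbT eq_sym; apply/eqP => n0.
  move: n2; rewrite n0 expr0n /=; have := sqn_ge0 x.1.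
  have : 0 < x.2 ^+ 2 by rewrite exprn_gt0.
  lra.
split; first by apply: contraTneq x20 => ->; rewrite ltxx.
rewrite d3.
have u1 : -1 <= x.2 / enorm x <= 1.
  rewrite -ler_norml normrM normfV [`|enorm x|]gtr0_norm // ler_pdivrMr // mul1r.
  by rewrite -ler_sqr ?nnegrE ?enorm_ge0 // real_normK ?num_real // n2 lerDr sqn_ge0.
rewrite acos_ge0 //= -ltr_cos ?in_itv /=.
- rewrite (acosK u1) ltr_pdivlMr //.
  rewrite -ltr_sqr ?nnegrE ?mulr_ge0 ?(ltW x20) ?(ltW c0) ?(ltW np) // exprMn n2.
  have hx' : cos th * Num.sqrt (sqn x.1) < x.2 * sin th.
    by move: hx; rewrite /zc mulrAC ltr_pdivrMr.
  have : (cos th * Num.sqrt (sqn x.1)) ^+ 2 < (x.2 * sin th) ^+ 2.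
    by rewrite ltr_sqr ?nnegrE ?mulr_ge0 ?sqrtr_ge0 ?(ltW x20) ?(ltW c0) ?(ltW s0).
  by rewrite !exprMn sqr_sqrtr ?sqn_ge0 //; nra.
- by rewrite acos_ge0 ?acos_lepi.
- by rewrite (ltW t0) (ltW tp).
Qed.

(** For s > 0, [wt2] is minus the derivative of [wt1], the pairing behind the Hardy inequality. The
    absolute value makes both weights continuous and bounded on the whole line, although they are
    evaluated at nonnegative heights. *)
Definition wt1 (e s : R) : R := e / (`|s| + e).
Definition wt2 (e s : R) : R := e / (`|s| + e) ^+ 2.

Lemma wt_den_gt0 (e s : R) : 0 < e -> 0 < `|s| + e.
Proof. by move=> e0; rewrite ltr_wpDl. Qed.

Lemma wt1_ge0 (e s : R) : 0 < e -> 0 <= wt1 e s.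
Proof. by move=> e0; rewrite divr_ge0 ?ltW // ?wt_den_gt0. Qed.

Lemma wt1_le1 (e s : R) : 0 < e -> wt1 e s <= 1.
Proof. by move=> e0; rewrite ler_pdivrMr ?wt_den_gt0 // mul1r lerDr. Qed.

Lemma wt2_ge0 (e s : R) : 0 < e -> 0 <= wt2 e s.
Proof. by move=> e0; rewrite divr_ge0 ?sqr_ge0 // ltW. Qed.

Lemma wt2_gt0 (e s : R) : 0 < e -> 0 < wt2 e s.
Proof. by move=> e0; rewrite divr_gt0 // exprn_gt0 // wt_den_gt0. Qed.

Lemma wt2_le (e s : R) : 0 < e -> wt2 e s <= e^-1.
Proof.
move=> e0; rewrite ler_pdivrMr ?exprn_gt0 ?wt_den_gt0 //.
rewrite -ler_pdivrMl ?invr_gt0 // invrK -expr2 ler_sqr ?nnegrE ?(ltW e0) //.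
  by rewrite lerDr.
by rewrite ltW // wt_den_gt0.
Qed.

Lemma normD_continuous (e : R) : continuous (fun s : R => `|s| + e).
Proof. by move=> s; apply: cvgD; [exact: norm_continuous|exact: cvg_cst]. Qed.

Lemma wt1_continuous (e : R) : 0 < e -> continuous (wt1 e).
Proof.
move=> e0 s; apply: cvgMr; apply: cvgV; last exact: normD_continuous.
by rewrite gt_eqF // wt_den_gt0.
Qed.

Lemma wt2_continuous (e : R) : 0 < e -> continuous (wt2 e).
Proof.
move=> e0 s; apply: cvgMr; apply: cvgV; first by rewrite gt_eqF // exprn_gt0 // wt_den_gt0.
by rewrite expr2; under eq_fun do rewrite expr2; apply: cvgM; exact: normD_continuous.
Qed.

End Geometry.

(** * Slab inequalities and their passage to Sobolev functions with traces *)

Section Slab.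
Context {R : realType}.
Notation mR := (measurableTypeR R).
Notation mu := (@lebesgue_measure R).

Definition i1 : 'I_3 := @Ordinal 3 0 isT.
Definition i2 : 'I_3 := @Ordinal 3 1 isT.
Definition i3 : 'I_3 := @Ordinal 3 2 isT.

Lemma is_derive_vertical (f : R3 R -> R) (y : R * R) (t : R) : Cn 1 f ->
  is_derive t 1 (fun t => f (y, t)) ('D_(evec i3) f (y, t)).
Proof.
move=> fC.
have E s : s *: evec i3 + (y, 0) = (y, s) :> R3 R.
  by case: y => y1 y2; rewrite /evec /=; congr ((_, _), _); rewrite /= ?[_ *: _]mulr0 ?[_ *: _]mulr1 ?add0r ?addr0.
have := (is_derive_line f (y, 0) (evec i3) t ('D_(evec i3) f (y, t))).1.
rewrite E => /(_ (CnS_derive fC i3 _)).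
by under eq_fun do rewrite E.
Qed.

Section fixed.
Variables (m r : R) (f : R3 R -> R).
Hypothesis fC : Cn 1 f.
Notation df := ('D_(evec i3) f).
Notation S T := (slab (disc r) (zc m) T).

Let pairc (y : R * R) : continuous (fun t : R => (y, t) : R3 R).
Proof. by apply: continuous_pair => t; [exact: cvg_cst|exact: cvg_id]. Qed.

Let dfc (y : R * R) : continuous (fun t => df (y, t)).
Proof.
move=> t; apply: (@cvg_comp _ _ _ (fun t : R => (y, t) : R3 R)); first exact: pairc.
exact: (Cn_continuous (Cn_derive i3 fC)).
Qed.

Let fc : continuous f. Proof. exact: (Cn_continuous fC). Qed.

Let fyc (y : R * R) : continuous (fun t => f (y, t)).
Proof.
by move=> t; apply: (@cvg_comp _ _ _ (fun t : R => (y, t) : R3 R)); [exact: pairc|exact: fc].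
Qed.

Let md1 (g : R -> R) D : continuous g -> measurable_fun (D : set mR) g.
Proof. by move=> gc; apply: measurable_funTS; exact: continuous_measurable_fun. Qed.

Lemma measurable_df (D : set (mR3 R)) : measurable_fun D (df : mR3 R -> R).
Proof. apply: continuous_measurable_R3; exact: (Cn_continuous (Cn_derive i3 fC)). Qed.

Lemma measurable_f (D : set (mR3 R)) : measurable_fun D (f : mR3 R -> R).
Proof. exact: continuous_measurable_R3. Qed.

Lemma measurable_bd (D : set (mR * mR)) :
  measurable_fun D (fun y => f (y, zc m y)).
Proof.
apply: continuous_measurable_R2 => y.
apply: (@cvg_comp _ _ _ (fun y => (y, zc m y) : R3 R)); last exact: fc.
by apply: (@continuous_pair _ _ _ id (zc m)) => u; [exact: cvg_id|exact: zc_continuous].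
Qed.

Let oc (a b : R) (g : R -> R) : measurable_fun setT g ->
  (\int[mu]_(t in `]a, b[) (g t)%:E = \int[mu]_(t in `[a, b]) (g t)%:E)%E.
Proof.
move=> mg; apply/esym; apply: integral_itv_bndoo.
by apply/measurable_EFinP; exact: measurable_funTS.
Qed.

Let mcsq (g : R -> R) : continuous g -> measurable_fun setT (fun t => g t ^+ 2).
Proof. by move=> gc; apply: measurable_sqr => //; exact: md1. Qed.

(** Poincare inequality in the vertical direction: the factor [T ^+ 2] on the derivative is what a
    vanishing trace turns into a decay rate in thin strips. *)
Lemma slab_strip T : 0 < T ->
  (\int[leb3]_(x in S T) (f x ^+ 2)%:E <=
   \int[leb2]_(y in disc r) (2 * T * f (y, zc m y) ^+ 2)%:E +
   \int[leb3]_(x in S T) (4 * T ^+ 2 * df x ^+ 2)%:E)%E.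
Proof.
move=> T0; apply: slab_le.
- exact: slab_measurable.
- exact: disc_measurable.
- by apply: measurable_sqr; exact: measurable_f.
- apply: measurable_funM => //; apply: measurable_sqr.
  exact: measurable_df.
- apply: measurable_funM => //; apply: measurable_sqr.
  exact: measurable_bd.
- by move=> x; exact: sqr_ge0.
- by move=> x; rewrite mulr_ge0 ?sqr_ge0 // mulr_ge0 ?sqr_ge0.
- by move=> x; rewrite mulr_ge0 ?sqr_ge0 // mulr_ge0 // ltW.
- move=> y _; have := strip_1D (fun t => is_derive_vertical y t fC) (@dfc y) (zc m y) T0.
  rewrite oc; last exact: (mcsq (@fyc y)).
  by rewrite oc // ; apply: measurable_funM => //; exact: (mcsq (@dfc y)).
Qed.

Lemma slab_trace T : 0 < T ->
  (\int[leb2]_(y in disc r) (f (y, zc m y) ^+ 2)%:E <=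
   \int[leb3]_(x in S T) ((T^-1 + 1) * f x ^+ 2 + df x ^+ 2)%:E)%E.
Proof.
move=> T0; rewrite slab_integral //; first last.
- move=> x; rewrite lee_fin addr_ge0 ?sqr_ge0 // mulr_ge0 ?sqr_ge0 //.
  by rewrite addr_ge0 // invr_ge0 ltW.
- apply/measurable_EFinP; apply: measurable_funD.
    apply: measurable_funM => //; apply: measurable_sqr.
    exact: measurable_f.
  by apply: measurable_sqr; exact: measurable_df.
- exact: disc_measurable.
- exact: slab_measurable.
apply: ge0_le_integral => //.
- exact: disc_measurable.
- by move=> y _; rewrite lee_fin sqr_ge0.
- apply/measurable_EFinP; apply: measurable_sqr.
  exact: measurable_bd.
- apply: (@measurable_slab_F _ _ _ _
    (fun x => ((T^-1 + 1) * f x ^+ 2 + df x ^+ 2)%:E)).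
  + exact: slab_measurable.
  + exact: disc_measurable.
  + apply/measurable_EFinP; apply: measurable_funD.
      apply: measurable_funM => //; apply: measurable_sqr.
      exact: measurable_f.
    by apply: measurable_sqr; exact: measurable_df.
  + move=> x; rewrite lee_fin addr_ge0 ?sqr_ge0 // mulr_ge0 ?sqr_ge0 //.
    by rewrite addr_ge0 // invr_ge0 ltW.
- move=> y _; have := trace_1D (fun t => is_derive_vertical y t fC) (@dfc y) (zc m y) T0.
  rewrite oc //; apply: measurable_funD; last exact: (mcsq (@dfc y)).
  by apply: measurable_funM => //; exact: (mcsq (@fyc y)).
Qed.

Lemma measurable_wt (w : R -> R) (D : set (mR3 R)) : continuous w ->
  measurable_fun D (fun x : mR3 R => w x.2).
Proof.
move=> wc; apply: continuous_measurable_R3 => x.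
by apply: (@cvg_comp _ _ _ (fun x : R3 R => x.2) w); [exact: c3_continuous|exact: wc].
Qed.

Lemma measurable_wt_zc (w : R -> R) (D : set (mR * mR)) : continuous w ->
  measurable_fun D (fun y : mR * mR => w (zc m y)).
Proof.
move=> wc; apply: continuous_measurable_R2 => x.
by apply: (@cvg_comp _ _ _ (zc m) w); [exact: zc_continuous|exact: wc].
Qed.

(** The foot term stands in place of a boundary condition; it carries the weight [wt1], which tends
    to 0 with [e] at every positive height. *)
Lemma slab_hardy T e : 0 <= m -> 0 < T -> 0 < e ->
  (\int[leb3]_(x in S T) (wt2 e x.2 * f x ^+ 2)%:E <=
   \int[leb2]_(y in disc r) (wt1 e (zc m y) * f (y, zc m y) ^+ 2)%:E +
   \int[leb3]_(x in S T) (wt1 e x.2 * f x ^+ 2 + wt1 e x.2 * df x ^+ 2)%:E)%E.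
Proof.
move=> m0 T0 e0; apply: slab_le.
- exact: slab_measurable.
- exact: disc_measurable.
- apply: measurable_funM; first by apply: measurable_wt; exact: wt2_continuous.
  by apply: measurable_sqr; exact: measurable_f.
- apply: measurable_funD; apply: measurable_funM;
    try by apply: measurable_wt; exact: wt1_continuous.
  + by apply: measurable_sqr; exact: measurable_f.
  + by apply: measurable_sqr; exact: measurable_df.
- apply: measurable_funM; first by apply: measurable_wt_zc; exact: wt1_continuous.
  by apply: measurable_sqr; exact: measurable_bd.
- by move=> x; rewrite mulr_ge0 ?sqr_ge0 // wt2_ge0.
- by move=> x; rewrite addr_ge0 // mulr_ge0 ?sqr_ge0 // wt1_ge0.
- by move=> x; rewrite mulr_ge0 ?sqr_ge0 // wt1_ge0.
- move=> y _; have z0 := zc_ge0 y m0.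
  have := hardy_1D (fun t => is_derive_vertical y t fC) (@dfc y) T0 z0 e0.
  rewrite /wt1 /wt2 (ger0_norm z0) => H.
  (* Heights on the fibre are nonnegative, so the absolute values in the weights disappear. *)
  have E (g h : R -> R) : (forall t, 0 <= t -> g t = h t) -> measurable_fun setT g ->
      (\int[mu]_(t in `]zc m y, (zc m y + T)%R[) (g t)%:E =
       \int[mu]_(t in `[zc m y, (zc m y + T)%R]) (h t)%:E)%E.
    move=> gh mg; rewrite oc //; apply: eq_integral => t.
    by rewrite inE /= in_itv /= => /andP[zt _]; rewrite gh // (le_trans z0).
  rewrite (E (fun t => e / (`|t| + e) ^+ 2 * f (y, t) ^+ 2)
             (fun t => e / (t + e) ^+ 2 * f (y, t) ^+ 2)); first last.
  - apply: measurable_funM; last exact: (mcsq (@fyc y)).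
    by apply: md1; exact: wt2_continuous.
  - by move=> t t0; rewrite (ger0_norm t0).
  rewrite (E (fun t => e / (`|t| + e) * f (y, t) ^+ 2 + e / (`|t| + e) * df (y, t) ^+ 2)
             (fun t => e / (t + e) * f (y, t) ^+ 2 + e / (t + e) * df (y, t) ^+ 2)); first last.
  - apply: measurable_funD; apply: measurable_funM;
      try by apply: md1; exact: wt1_continuous.
    + exact: (mcsq (@fyc y)).
    + exact: (mcsq (@dfc y)).
  - by move=> t t0; rewrite (ger0_norm t0).
  exact: H.
Qed.

End fixed.

(** Two comparisons with a factor 2 cost a factor 4, and the errors add up to 2 k + 2 (3 k) = 8
    k. *)
Lemma ereal_arith (X1 X2 X3 X4 X5 Y1 Y2 Y3 Y4 Y5 : \bar R) (k e : R) :
  (0 <= X3 -> 0 <= X4 -> 0 <= X5 ->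
   0 <= Y1 -> 0 <= Y2 -> 0 <= Y3 -> 0 <= Y4 -> 0 <= Y5 ->
   X1 <= 2%:E * Y1 + k%:E -> X2 <= 2%:E * Y2 + k%:E ->
   Y3 <= 2%:E * X3 + k%:E -> Y4 <= 2%:E * X4 + k%:E -> Y5 <= 2%:E * X5 + k%:E ->
   Y1 + Y2 <= Y3 + (Y4 + Y5) -> (0 <= k)%R -> (8 * k <= e)%R ->
   X1 + X2 <= 4%:E * (X3 + (X4 + X5)) + e%:E)%E.
Proof.
move=> x3 x4 x5 y1 y2 y3 y4 y5 h1 h2 h3 h4 h5 H k0 ke.
apply: le_trans (leeD h1 h2) _.
rewrite addeACA -EFinD -ge0_muleDr //.
have t0 : (0 <= 2%:E :> \bar R)%E by rewrite lee_fin.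
apply: le_trans (leeD (lee_wpmul2l t0 H) (lexx _)) _.
apply: le_trans (leeD (lee_wpmul2l t0 (leeD h3 (leeD h4 h5))) (lexx _)) _.
rewrite (addeACA (2%:E * X4)%E) (addeACA (2%:E * X3)%E) -!EFinD -!ge0_muleDr ?adde_ge0 //.
have : (0 <= X3 + (X4 + X5))%E by rewrite !adde_ge0.
move: (X3 + (X4 + X5))%E => S S0.
rewrite ge0_muleDr ?mule_ge0 ?lee_fin ?addr_ge0 // muleA -!EFinM -addeA -EFinD.
have -> : (2 * 2 = 4 :> R)%R by rewrite -natrM.
by rewrite leeD2l // lee_fin; lra.
Qed.

Section limit.
Variables (m r T : R).
Notation S0 := (slab (disc r) (zc m) T : set (mR3 R)).
Notation Dr := (disc r : set (mR * mR)).

(* [u], its weak vertical derivative [p] and its trace [t] on the graph are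
   limits of the corresponding data of smooth functions. *)
Definition smooth_approx (u p : R3 R -> R) (t : R * R -> R) :=
  [/\ measurable_fun S0 u, measurable_fun S0 p, measurable_fun Dr t &
  forall de, 0 < de -> exists f : R3 R -> R, [/\ Cn 1 f,
    (\int[leb3]_(x in S0) ((f x - u x) ^+ 2)%:E <= de%:E)%E,
    (\int[leb3]_(x in S0) (('D_(evec i3) f x - p x) ^+ 2)%:E <= de%:E)%E &
    (\int[leb2]_(y in Dr) ((f (y, zc m y) - t y) ^+ 2)%:E <= de%:E)%E]].

(** No limit is taken in the integrals: each one is compared with that of a single close smooth
    function through [weighted_sq_tri], from Sobolev to smooth on the left and back on the right.
    This works for every bounded weight, and the constant 4 replaces 1. *)
Lemma trace_limit (S : set (mR3 R)) (a c d : R3 R -> R) (al b : R * R -> R) (M : R)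
    (u p : R3 R -> R) (t : R * R -> R) :
  measurable S -> S `<=` S0 -> smooth_approx u p t -> 0 <= M ->
  [/\ measurable_fun S (a : mR3 R -> R), measurable_fun S (c : mR3 R -> R) &
      measurable_fun S (d : mR3 R -> R)] ->
  measurable_fun Dr al -> measurable_fun Dr b ->
  (forall x, S x -> [/\ 0 <= a x <= M, 0 <= c x <= M & 0 <= d x <= M]) ->
  (forall y, Dr y -> 0 <= al y <= M /\ 0 <= b y <= M) ->
  (forall f : R3 R -> R, Cn 1 f ->
    (\int[leb3]_(x in S) (a x * f x ^+ 2)%:E +
     \int[leb2]_(y in Dr) (al y * f (y, zc m y) ^+ 2)%:E <=
     \int[leb2]_(y in Dr) (b y * f (y, zc m y) ^+ 2)%:E +
     (\int[leb3]_(x in S) (c x * f x ^+ 2)%:E +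
      \int[leb3]_(x in S) (d x * 'D_(evec i3) f x ^+ 2)%:E))%E) ->
  (\int[leb3]_(x in S) (a x * u x ^+ 2)%:E +
     \int[leb2]_(y in Dr) (al y * t y ^+ 2)%:E <=
   4%:E * (\int[leb2]_(y in Dr) (b y * t y ^+ 2)%:E +
     (\int[leb3]_(x in S) (c x * u x ^+ 2)%:E +
      \int[leb3]_(x in S) (d x * p x ^+ 2)%:E)))%E.
Proof.
move=> mS SS [mu_ mp mt happ] M0 [ma mc md] mal mb hw hw2 H.
have mS0 : measurable S0 by exact: slab_measurable.
have mDr : measurable Dr by exact: disc_measurable.
have i0 (d' : measure_display) (X : measurableType d') (nu : {measure set X -> \bar R}) (D : set X)
    (w g : X -> R) : (forall x, D x -> 0 <= w x) ->
    (0 <= \int[nu]_(x in D) (w x * g x ^+ 2)%:E)%E.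
  by move=> w0; apply: integral_ge0 => x Dx; rewrite lee_fin mulr_ge0 ?sqr_ge0 ?w0.
apply/lee_addgt0Pr => e e0.
(* Each comparison has error [2 * M * de], and eight times this must stay below [e]. *)
pose de := e / (16 * M + 1).
have den : 0 < 16 * M + 1 by lra.
have de0 : 0 < de by rewrite divr_gt0.
have [f [fC h1 h2 h3]] := happ _ de0.
have mf : measurable_fun S0 f by exact: measurable_f.
have mdf : measurable_fun S0 ('D_(evec i3) f) by exact: measurable_df.
have mbd : measurable_fun Dr (fun y => f (y, zc m y)) by exact: measurable_bd.
have B0 : 0 <= 2 * M by rewrite mulr_ge0.
have h1' : (\int[leb3]_(x in S0) ((u x - f x) ^+ 2)%:E <= de%:E)%E.
  by under eq_integral do rewrite -sqrrN opprB.
have h2' : (\int[leb3]_(x in S0) ((p x - 'D_(evec i3) f x) ^+ 2)%:E <= de%:E)%E.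
  by under eq_integral do rewrite -sqrrN opprB.
have h3' : (\int[leb2]_(y in Dr) ((t y - f (y, zc m y)) ^+ 2)%:E <= de%:E)%E.
  by under eq_integral do rewrite -sqrrN opprB.
have add (X Y Z : \bar R) : (X <= 2%:E * Y + (2 * M)%:E * Z -> Z <= de%:E ->
    X <= 2%:E * Y + (2 * M * de)%:E)%E.
  move=> h hz; apply: le_trans h _; rewrite leeD2l // (EFinM (2 * M) de).
  by apply: lee_wpmul2l => //; rewrite lee_fin.
have wa x : S x -> 0 <= a x <= M by case/hw.
have wc x : S x -> 0 <= c x <= M by case/hw.
have wd x : S x -> 0 <= d x <= M by case/hw.
have wal y : Dr y -> 0 <= al y <= M by case/hw2.
have wb y : Dr y -> 0 <= b y <= M by case/hw2.
have q1 := add _ _ _ (weighted_sq_tri leb3 mS mS0 SS mu_ mf ma wa M0) h1.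
have q2 := add _ _ _ (weighted_sq_tri leb2 mDr mDr (@subset_refl _ _) mt mbd mal wal M0) h3.
have q3 := add _ _ _ (weighted_sq_tri leb2 mDr mDr (@subset_refl _ _) mbd mt mb wb M0) h3'.
have q4 := add _ _ _ (weighted_sq_tri leb3 mS mS0 SS mf mu_ mc wc M0) h1'.
have q5 := add _ _ _ (weighted_sq_tri leb3 mS mS0 SS mdf mp md wd M0) h2'.
have := H f fC.
set X1 := (\int[leb3]_(x in S) (a x * u x ^+ 2)%:E)%E in q1 *.
set X2 := (\int[leb2]_(y in Dr) (al y * t y ^+ 2)%:E)%E in q2 *.
set X3 := (\int[leb2]_(y in Dr) (b y * t y ^+ 2)%:E)%E in q3 *.
set X4 := (\int[leb3]_(x in S) (c x * u x ^+ 2)%:E)%E in q4 *.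
set X5 := (\int[leb3]_(x in S) (d x * p x ^+ 2)%:E)%E in q5 *.
set Y1 := (\int[leb3]_(x in S) (a x * f x ^+ 2)%:E)%E in q1 *.
set Y2 := (\int[leb2]_(y in Dr) (al y * f (y, zc m y) ^+ 2)%:E)%E in q2 *.
set Y3 := (\int[leb2]_(y in Dr) (b y * f (y, zc m y) ^+ 2)%:E)%E in q3 *.
set Y4 := (\int[leb3]_(x in S) (c x * f x ^+ 2)%:E)%E in q4 *.
set Y5 := (\int[leb3]_(x in S) (d x * 'D_(evec i3) f x ^+ 2)%:E)%E in q5 *.
have X30 : (0 <= X3)%E by apply: i0 => x /wb /andP[].
have X40 : (0 <= X4)%E by apply: i0 => x /wc /andP[].
have X50 : (0 <= X5)%E by apply: i0 => x /wd /andP[].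
have Y10 : (0 <= Y1)%E by apply: i0 => x /wa /andP[].
have Y20 : (0 <= Y2)%E by apply: i0 => x /wal /andP[].
have Y30 : (0 <= Y3)%E by apply: i0 => x /wb /andP[].
have Y40 : (0 <= Y4)%E by apply: i0 => x /wc /andP[].
have Y50 : (0 <= Y5)%E by apply: i0 => x /wd /andP[].
move=> hY; apply: (ereal_arith X30 X40 X50 Y10 Y20 Y30 Y40 Y50 q1 q2 q3 q4 q5 hY).
  by apply: mulr_ge0 => //; exact: ltW.
have -> : 8 * (2 * M * de) = 16 * M * de by ring.
rewrite /de mulrA ler_pdivrMr // mulrDr mulr1 [leLHS]mulrC lerDl.
exact: ltW.
Qed.

End limit.
End Slab.

(** * Weak derivatives *)

Section CompactSupport.
Context {R : realType}.
Notation mR := (measurableTypeR R).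
Notation mu := (@lebesgue_measure R).

Definition cube (M : R) : set (R3 R) :=
  (`[- M, M] `*` `[- M, M]) `*` `[- M, M].

Lemma cube_compact M : compact (cube M).
Proof. by do ?apply: compact_setX; exact: segment_compact. Qed.

Lemma cube_measurable M : measurable (cube M : set (mR3 R)).
Proof. by do ?apply: measurableX; exact: measurable_itv. Qed.

Lemma cube_closed M : closed (cube M).
Proof. by apply: compact_closed; [exact: norm_hausdorff|exact: cube_compact]. Qed.

Lemma cubeP M (x : R3 R) : cube M x <-> [/\ `|x.1.1| <= M, `|x.1.2| <= M & `|x.2| <= M].
Proof.
rewrite /cube /= !in_itv /= -!ler_norml; split; first by case=> -[].
by case=> -> -> ->.
Qed.

Lemma bounded_sub_cube (K : set (R3 R)) : bounded_set K ->
  exists2 M, 0 < M & K `<=` cube M.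
Proof.
move=> [M0 [_ HM]]; exists (`|M0| + 1); first by rewrite ltr_wpDl.
move=> x Kx; apply/cubeP.
have h : `|x| <= `|M0| + 1.
  by apply: (HM (`|M0| + 1)) => //; rewrite (le_lt_trans (ler_norm _)) // ltrDl.
have : `|x.1| <= `|x| by rewrite [leRHS]prod_normE le_max lexx.
have : `|x.2| <= `|x| by rewrite [leRHS]prod_normE le_max lexx orbT.
have : `|x.1.1| <= `|x.1| by rewrite [leRHS]prod_normE le_max lexx.
have : `|x.1.2| <= `|x.1| by rewrite [leRHS]prod_normE le_max lexx orbT.
by move=> a b c d; split; lra.
Qed.

Lemma compact_sub_cube (K : set (R3 R)) : compact K -> exists2 M, 0 < M & K `<=` cube M.
Proof. by move=> /compact_bounded; exact: bounded_sub_cube. Qed.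

Lemma continuous_bounded_cube (f : R3 R -> R) M : continuous f ->
  exists2 B, 0 <= B & forall x, cube M x -> `|f x| <= B.
Proof.
move=> fc.
have : compact ((fun x => f x) @` cube M).
  apply: continuous_compact; last exact: cube_compact.
  exact: continuous_subspaceT.
move=> /compact_bounded [B0 [_ HB]]; exists (`|B0| + 1); first by rewrite addr_ge0.
move=> x Mx; apply: (HB (`|B0| + 1)); last by exists x.
by rewrite (le_lt_trans (ler_norm _)) // ltrDl.
Qed.

Lemma leb3_cube M : (leb3 (cube M : set (mR3 R)) < +oo)%E.
Proof.
rewrite /cube.
pose I : set mR := [set` `[- M, M]].
have h : (mu I < +oo)%E.
  by rewrite lebesgue_measure_itv /=; case: ifP => _; rewrite ?ltry // -EFinD ltry.
have m1 : measurable I by exact: measurable_itv.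
have E2 : (mu2 (I `*` I) = mu I * mu I)%E.
  exact: (@product_measure1E _ _ mR mR R mu mu).
have E3 := @product_measure1E _ _ (mR * mR)%type mR R mu2 mu
  (I `*` I) I (measurableX m1 m1) m1.
have -> : (leb3 ((I `*` I) `*` I : set (mR3 R)) = mu I * mu I * mu I)%E.
  by rewrite -E2 -E3.
have a : (mu I * mu I < +oo)%E by rewrite lte_mul_pinfty ?ge0_fin_numE.
have a0 : (0 <= mu I * mu I)%E by exact: mule_ge0.
by rewrite lte_mul_pinfty // ge0_fin_numE.
Qed.

Definition square (M : R) : set (mR * mR) := `[- M, M] `*` `[- M, M].

Lemma leb2_square M : (leb2 (square M) < +oo)%E.
Proof.
pose I : set mR := [set` `[- M, M]].
have h : (mu I < +oo)%E.
  by rewrite lebesgue_measure_itv /=; case: ifP => _; rewrite ?ltry // -EFinD ltry.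
have m1 : measurable I by exact: measurable_itv.
have E2 : (mu2 (I `*` I) = mu I * mu I)%E.
  exact: (@product_measure1E _ _ mR mR R mu mu).
have -> : (leb2 (square M) = mu I * mu I)%E by rewrite -E2.
by rewrite !lte_mul_pinfty ?ge0_fin_numE.
Qed.

Lemma continuous_cs_integrable (f : R3 R -> R) M : continuous f ->
  (forall x, ~ cube M x -> f x = 0) -> leb3.-integrable setT (EFin \o f).
Proof.
move=> fc f0; have [B B0 hB] := continuous_bounded_cube M fc.
have E : (EFin \o f) = (EFin \o f) \_ (cube M).
  apply/funext => x; rewrite patchE; case: ifPn => // /negP xM /=.
  by rewrite f0 // => xM'; apply: xM; rewrite inE.
rewrite E -integrable_mkcond; last exact: cube_measurable.
apply: measurable_bounded_integrable.
- exact: cube_measurable.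
- exact: leb3_cube.
- exact: continuous_measurable_R3.
- exists B; split; first exact: num_real.
  by move=> y By x xM /=; apply: le_trans (hB _ xM) _; exact: ltW.
Qed.

Lemma continuous_cs_integrable2 (f : R * R -> R) M : continuous f ->
  (forall y, M < `|y.1| \/ M < `|y.2| -> f y = 0) -> leb2.-integrable setT (EFin \o f).
Proof.
move=> fc f0.
have fc3 : continuous (fun x : R3 R => f x.1).
  by move=> x; apply: (@cvg_comp _ _ _ fst f _ (nbhs x.1)); [exact: cvg_fst|exact: fc].
have [B B0 hB] := continuous_bounded_cube `|M| fc3.
pose I : set mR := [set` `[- M, M]].
have E : (EFin \o f) = (EFin \o f) \_ (I `*` I).
  apply/funext => x; rewrite patchE; case: ifPn => // /negP xM /=.
  rewrite f0 //; apply/orP; apply: contra_notT xM; rewrite negb_or -!leNgt => /andP[h1 h2].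
  by rewrite inE /I /=; split; rewrite /= in_itv /= -ler_norml.
have mI : measurable (I `*` I : set (mR * mR)).
  by apply: measurableX; exact: measurable_itv.
rewrite E -integrable_mkcond //.
apply: measurable_bounded_integrable => //.
- exact: leb2_square.
- exact: continuous_measurable_R2.
- exists B; split; first exact: num_real.
  move=> y By [x1 x2] [xM yM] /=; apply: le_trans (ltW By).
  apply: (hB (x1, x2, 0)); apply/cubeP => /=.
  move: xM yM; rewrite /I /= !in_itv /= -!ler_norml => xM yM.
  by rewrite normr0; split => //; apply: le_trans (ler_norm M).
Qed.

Lemma int_derive0_1D (F dF : R -> R) (M : R) : 0 < M ->
  (forall x : R, is_derive x 1 F (dF x)) -> continuous dF ->
  F (- M) = 0 -> F M = 0 -> (forall x, ~~ (x \in `[- M, M]) -> dF x = 0) ->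
  (\int[mu]_x (dF x)%:E = 0)%E.
Proof.
move=> M0 Fd dFc F1 F2 h.
have -> : (\int[mu]_x (dF x)%:E = \int[mu]_(x in [set` `[(- M)%R, M]]) (dF x)%:E)%E.
  rewrite [RHS]integral_mkcond; apply: eq_integral => x _.
  rewrite patchE; case: ifPn => //; rewrite notin_setE /= => /negP xM.
  by rewrite h.
have MM : - M < M by lra.
rewrite (continuous_FTC2 (F := F) MM).
- by rewrite F1 F2 sube0.
- exact: continuous_subspaceT.
- apply: C1_oo_LR; last by move=> x; case: (Fd x).
  move=> x; apply: differentiable_continuous; apply/derivable1_diffP.
  by case: (Fd x).
- by move=> x _; have xd := Fd x; rewrite derive1E derive_val.
Qed.

Lemma is_derive_h1 (f : R3 R -> R) (y2 t s : R) : Cn 1 f ->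
  is_derive s 1 (fun s => f ((s, y2), t)) ('D_(evec i1) f ((s, y2), t)).
Proof.
move=> fC.
have E s' : s' *: evec i1 + (0, y2, t) = (s', y2, t) :> R3 R.
  by rewrite /evec /=; congr ((_, _), _); rewrite /= ?[_ *: _]mulr0 ?[_ *: _]mulr1 ?add0r ?addr0.
have := (is_derive_line f (0, y2, t) (evec i1) s ('D_(evec i1) f (s, y2, t))).1.
rewrite E => /(_ (CnS_derive fC i1 _)).
by under eq_fun do rewrite E.
Qed.

Lemma is_derive_h2 (f : R3 R -> R) (y1 t s : R) : Cn 1 f ->
  is_derive s 1 (fun s => f ((y1, s), t)) ('D_(evec i2) f ((y1, s), t)).
Proof.
move=> fC.
have E s' : s' *: evec i2 + (y1, 0, t) = (y1, s', t) :> R3 R.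
  by rewrite /evec /=; congr ((_, _), _); rewrite /= ?[_ *: _]mulr0 ?[_ *: _]mulr1 ?add0r ?addr0.
have := (is_derive_line f (y1, 0, t) (evec i2) s ('D_(evec i2) f (y1, s, t))).1.
rewrite E => /(_ (CnS_derive fC i2 _)).
by under eq_fun do rewrite E.
Qed.

Lemma ord3P (i : 'I_3) : [\/ i = i1, i = i2 | i = i3].
Proof.
by case: i => -[|[|[|//]]] h; [apply: Or31|apply: Or32|apply: Or33]; exact: val_inj.
Qed.

Lemma derive_supp (f : R3 R -> R) (K : set (R3 R)) (v : R3 R) : closed K ->
  (forall x, ~ K x -> f x = 0) -> forall x, ~ K x -> 'D_v f x = 0.
Proof.
move=> cK f0 x Kx.
rewrite -(@derive_cst R (R3 R) R 0 x v); apply: near_eq_derive.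
have : open_nbhs x (~` K) by split => //; exact: closed_openC.
move=> /open_nbhs_nbhs; apply: filterS => z Kz /=; exact: f0.
Qed.

Lemma continuous_slice (T U : topologicalType) (g : R3 R -> U) (f : T -> R3 R) :
  continuous f -> continuous g -> continuous (fun x => g (f x)).
Proof. by move=> fc gc x; apply: (@cvg_comp _ _ _ f g); [exact: fc|exact: gc]. Qed.

(** Fubini is applied in the order that puts the direction of differentiation innermost, where the
    fundamental theorem gives 0. *)
Lemma int_derive0 (f : R3 R -> R) (M : R) (i : 'I_3) : Cn 1 f ->
  (forall x, ~ cube M x -> f x = 0) -> (\int[leb3]_x ('D_(evec i) f x)%:E = 0)%E.
Proof.
move=> fC f0.
wlog M0 : M f0 / 0 < M.
  move=> h; apply: (h (`|M| + 1)); last by rewrite ltr_wpDl.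
  move=> x xM; apply: f0 => /cubeP[a b c]; apply: xM; apply/cubeP.
  by have := ler_norm M; split; lra.
(* Strictly beyond the support, so that [f] vanishes at both end points of each segment. *)
pose N := M + 1.
have f0N : forall x, ~ cube M x -> 'D_(evec i) f x = 0.
  by apply: derive_supp => //; exact: cube_closed.
have di := continuous_cs_integrable (Cn_continuous (Cn_derive i fC)) f0N.
have dc : continuous ('D_(evec i) f) := Cn_continuous (Cn_derive i fC).
have N0 : 0 < N by rewrite addr_gt0.
have big (s : R) : ~~ (s \in `[- N, N]) -> M < `|s|.
  by rewrite in_itv /= -ler_norml -ltNge; rewrite /N; lra.
have bigN : M < `|N| by rewrite gtr0_norm // ltrDl.
have bigNN : M < `|- N| by rewrite normrN.
have c1 (a : R) : continuous (fun _ : R => a) by exact: cst_continuous.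
have cid : continuous (fun s : R => s) by move=> s; exact: cvg_id.
case: (ord3P i) => ei; rewrite ei in f0N dc di *.
- rewrite fubini3_21 //; apply: integral0_eq => t _.
  rewrite fubini2_21; last first.
    apply: (@continuous_cs_integrable2 (fun y => 'D_(evec i1) f (y, t)) M).
      apply: continuous_slice dc; apply: continuous_pair; first by move=> y; exact: cvg_id.
      exact: cst_continuous.
    by move=> y hy; apply: f0N => /cubeP[/= a b _]; case: hy; rewrite ltNge ?a ?b.
  apply: integral0_eq => y2 _.
  apply: (@int_derive0_1D (fun s => f ((s, y2), t)) _ N) => //.
  + by move=> s; exact: is_derive_h1.
  + apply: continuous_slice dc; apply: continuous_pair => //; apply: continuous_pair => //.
  + by apply: f0 => /cubeP[/= + _ _]; rewrite leNgt bigNN.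
  + by apply: f0 => /cubeP[/= + _ _]; rewrite leNgt bigN.
  + by move=> s /big hs; apply: f0N => /cubeP[/= + _ _]; rewrite leNgt hs.
- rewrite fubini3_21 //; apply: integral0_eq => t _.
  rewrite fubini2_12; last first.
    apply: (@continuous_cs_integrable2 (fun y => 'D_(evec i2) f (y, t)) M).
      apply: continuous_slice dc; apply: continuous_pair; first by move=> y; exact: cvg_id.
      exact: cst_continuous.
    by move=> y hy; apply: f0N => /cubeP[/= a b _]; case: hy; rewrite ltNge ?a ?b.
  apply: integral0_eq => y1 _.
  apply: (@int_derive0_1D (fun s => f ((y1, s), t)) _ N) => //.
  + by move=> s; exact: is_derive_h2.
  + apply: continuous_slice dc; apply: continuous_pair => //; apply: continuous_pair => //.
  + by apply: f0 => /cubeP[/= _ + _]; rewrite leNgt bigNN.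
  + by apply: f0 => /cubeP[/= _ + _]; rewrite leNgt bigN.
  + by move=> s /big hs; apply: f0N => /cubeP[/= _ + _]; rewrite leNgt hs.
- rewrite fubini3_12 //; apply: integral0_eq => y _.
  apply: (@int_derive0_1D (fun s => f (y, s)) _ N) => //.
  + by move=> s; exact: is_derive_vertical.
  + apply: continuous_slice dc; apply: continuous_pair => //; exact: cst_continuous.
  + by apply: f0 => /cubeP[/= _ _ +]; rewrite leNgt bigNN.
  + by apply: f0 => /cubeP[/= _ _ +]; rewrite leNgt bigN.
  + by move=> s /big hs; apply: f0N => /cubeP[/= _ _ +]; rewrite leNgt hs.
Qed.

(** Real counterpart of [is_weak_partial], which splits into two copies of it, one for each part;
    the analysis is done on real functions. *)
Definition wpd (D : set (R3 R)) (i : 'I_3) (u g : R3 R -> R) :=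
  forall phi, test_function D phi ->
    \int[leb3]_(x in (D : set (mR3 R))) (u x * 'D_(evec i) phi x) =
    - \int[leb3]_(x in (D : set (mR3 R))) (g x * phi x).

Lemma Rint_supp (D : set (mR3 R)) (f : R3 R -> R) : (forall x, ~ D x -> f x = 0) ->
  \int[leb3]_(x in D) f x = \int[leb3]_x f x.
Proof.
move=> f0; rewrite Rintegral_mkcond; congr Rintegral; apply/funext => x.
by rewrite patchE; case: ifPn => // /negP h; rewrite f0 // => h'; apply: h; rewrite inE.
Qed.

(** The product with a test function has compact support, so its derivative integrates to 0. *)
Lemma smooth_wpd (D : set (R3 R)) i (f : R3 R -> R) : Cn 1 f -> wpd D i f ('D_(evec i) f).
Proof.
move=> fC phi [phis [K [cK KD Kphi]]].
have [M M0 KM] := compact_sub_cube cK.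
have kcl : closed K by apply: compact_closed => //; exact: norm_hausdorff.
have phiC := phis 1%N.
have Kphi' : forall x, ~ K x -> phi x = 0 := Kphi.
have p0 x : ~ cube M x -> phi x = 0 by move=> h; apply: Kphi => /KM.
have dp0 x : ~ cube M x -> 'D_(evec i) phi x = 0.
  by move=> h; apply: (@derive_supp phi K (evec i) kcl Kphi' x) => /KM.
have d0 x : ~ D x -> 'D_(evec i) phi x = 0.
  by move=> h; apply: (@derive_supp phi K (evec i) kcl Kphi' x) => /KD.
rewrite (@Rint_supp D (fun x => f x * 'D_(evec i) phi x)); last first.
  by move=> x h; rewrite d0 ?mulr0.
rewrite (@Rint_supp D (fun x => 'D_(evec i) f x * phi x)); last first.
  by move=> x h; rewrite Kphi ?mulr0 // => /KD.
have fc := Cn_continuous fC; have pc := Cn_continuous phiC.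
have dfc := Cn_continuous (Cn_derive i fC); have dpc := Cn_continuous (Cn_derive i phiC).
have cM (g1 g2 : R3 R -> R) : continuous g1 -> continuous g2 -> continuous (fun x => g1 x * g2 x).
  by move=> a b x; apply: cvgM; [exact: a|exact: b].
have I1 : leb3.-integrable setT (EFin \o (fun x => f x * 'D_(evec i) phi x)).
  by apply: (@continuous_cs_integrable _ M); [exact: cM|move=> x /dp0 ->; rewrite mulr0].
have I2 : leb3.-integrable setT (EFin \o (fun x => 'D_(evec i) f x * phi x)).
  by apply: (@continuous_cs_integrable _ M); [exact: cM|move=> x /p0 ->; rewrite mulr0].
apply/eqP; rewrite -addr_eq0 -RintegralD //; apply/eqP.
have E : (fun x => f x * 'D_(evec i) phi x + 'D_(evec i) f x * phi x) =
    'D_(evec i) (fun x => f x * phi x).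
  apply/funext => x; rewrite -[RHS]/('D_(evec i) (f * phi) x) deriveM.
  - by rewrite /GRing.scale /= [_ * phi x]mulrC.
  - by case: (CnS_derive fC i x).
  - by case: (CnS_derive phiC i x).
rewrite E /Rintegral (@int_derive0 _ M) //; first exact: CnM.
by move=> x /p0 ->; rewrite mulr0.
Qed.

End CompactSupport.

(** * Fundamental lemma of the calculus of variations; uniqueness of weak derivatives *)

Section FL.
Context {R : realType}.
Notation mR := (measurableTypeR R).
Notation mu := (@lebesgue_measure R).

Lemma Cn_affine n (f : R3 R -> R) (a b : R) : Cn n f -> Cn n (fun x => a * f x + b).
Proof. by move=> fC; apply: CnD; [apply: CnM => //|]; exact: Cn_cst. Qed.

(** Zero outside [[a + 1/n, b - 1/n]] and 1 on [[a + 2/n, b - 2/n]]; the margin keeps the support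
    compact inside the open interval. For [n = 0] it is identically 0. *)
Definition bump (a b : R) (n : nat) (t : R) : R :=
  step (n%:R * (t - a) - 1) * step (n%:R * (b - t) - 1).

Lemma bump_ge0 a b n t : 0 <= bump a b n t.
Proof. by rewrite mulr_ge0 ?step_ge0. Qed.

Lemma bump_le1 a b n t : bump a b n t <= 1.
Proof. by rewrite mulr_ile1 ?step_ge0 ?step_le1. Qed.

Lemma Cn_bump k a b n (f : R3 R -> R) : Cn k f -> Cn k (fun x => bump a b n (f x)).
Proof.
move=> fC; apply: CnM; apply: Cn_step.
  have -> : (fun x => n%:R * (f x - a) - 1) = (fun x => n%:R * f x + (- (n%:R * a) - 1)).
    by apply/funext => x; ring.
  exact: Cn_affine.
have -> : (fun x => n%:R * (b - f x) - 1) = (fun x => - n%:R * f x + (n%:R * b - 1)).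
  by apply/funext => x; ring.
exact: Cn_affine.
Qed.

Lemma bump_supp a b n t : bump a b n t != 0 -> (0 < n)%N /\ a + n%:R^-1 <= t <= b - n%:R^-1.
Proof.
case: n => [|n]; first by rewrite /bump !mul0r sub0r step0 ?mul0r ?eqxx // oppr_le0.
have n0 : 0 < n.+1%:R :> R by [].
move=> h; split => //; apply/andP; split.
- rewrite leNgt; apply: contra h => h; rewrite /bump step0 ?mul0r //.
  rewrite subr_le0 -(@ler_pM2l _ n.+1%:R^-1) ?invr_gt0 // mulrA mulVf ?gt_eqF // mul1r mulr1.
  by rewrite lerBlDl ltW.
- rewrite leNgt; apply: contra h => h; rewrite /bump [X in _ * X]step0 ?mulr0 //.
  rewrite subr_le0 -(@ler_pM2l _ n.+1%:R^-1) ?invr_gt0 // mulrA mulVf ?gt_eqF // mul1r mulr1.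
  by rewrite lerBlDr -lerBlDl ltW.
Qed.

Lemma bump_out a b n t : ~~ (a < t < b) -> bump a b n t = 0.
Proof.
move=> h; apply/eqP/negPn/negP => /bump_supp[n0 /andP[h1 h2]].
have ni : 0 < n%:R^-1 :> R by rewrite invr_gt0 ltr0n.
by move/negP: h; apply; apply/andP; split; lra.
Qed.

Lemma bump_cvg a b t : a < t < b -> \forall n \near \oo, bump a b n t = 1.
Proof.
move=> /andP[at' tb].
have h (e : R) : 0 < e -> \forall n \near \oo, 1 <= n%:R * e - 1.
  move=> e0; near=> n; rewrite lerBrDr -ler_pdivrMr //.
  near: n; exact: nbhs_infty_ger.
near=> n; rewrite /bump !step1 ?mulr1 //; near: n; apply: h; rewrite subr_gt0 //.
Unshelve. all: by end_near. Qed.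

Definition obox (a b : R3 R) : set (R3 R) :=
  (`]a.1.1, b.1.1[ `*` `]a.1.2, b.1.2[) `*` `]a.2, b.2[.

Definition bump3 (a b : R3 R) n (x : R3 R) : R :=
  bump a.1.1 b.1.1 n x.1.1 * bump a.1.2 b.1.2 n x.1.2 * bump a.2 b.2 n x.2.

Lemma bump3_ge0 a b n x : 0 <= bump3 a b n x.
Proof. by apply: mulr_ge0; [apply: mulr_ge0|]; exact: bump_ge0. Qed.

Lemma bump3_le1 a b n x : bump3 a b n x <= 1.
Proof.
apply: mulr_ile1; [apply: mulr_ge0; exact: bump_ge0|exact: bump_ge0| |exact: bump_le1].
by apply: mulr_ile1; [exact: bump_ge0|exact: bump_ge0|exact: bump_le1|exact: bump_le1].
Qed.

Lemma bump3_test (a b : R3 R) n (D : set (R3 R)) : obox a b `<=` D ->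
  test_function D (bump3 a b n).
Proof.
move=> abD; split.
  move=> k; apply: CnM; last by apply: Cn_bump; exact: Cn_c3.
  by apply: CnM; apply: Cn_bump; [exact: Cn_c1|exact: Cn_c2].
case: (posnP n) => [->|n0].
  exists set0; split; [exact: compact0|exact: sub0set|].
  move=> x _; rewrite /bump3; have [->|/bump_supp[//]] := eqVneq (bump a.1.1 b.1.1 0 x.1.1) 0.
  by rewrite !mul0r.
pose e : R := n%:R^-1.
have e0 : 0 < e by rewrite invr_gt0 ltr0n.
exists ((`[a.1.1 + e, b.1.1 - e] `*` `[a.1.2 + e, b.1.2 - e]) `*` `[a.2 + e, b.2 - e]); split.
- by do ?apply: compact_setX; exact: segment_compact.
- move=> x [[]] /=; rewrite !in_itv /= => /andP[h1 h2] /andP[h3 h4] /andP[h5 h6].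
  apply: abD; do !split; rewrite /= in_itv /=; apply/andP; split; lra.
- have nz (p q : R) : p * q != 0 -> p != 0 /\ q != 0.
    by rewrite mulf_eq0 negb_or => /andP[].
  move=> x nx; apply/eqP/negPn/negP => /nz[/nz[/bump_supp[_ h1] /bump_supp[_ h2]] /bump_supp[_ h3]].
  by apply: nx; do !split; rewrite /= in_itv /=.
Qed.

Lemma bump3_cvg (a b x : R3 R) : bump3 a b n x @[n --> \oo] --> (\1_(obox a b) x : R).
Proof.
rewrite indicE; case: (boolP (x \in obox a b)) => [|/negP] xab.
  move: xab; rewrite inE => -[[]] /=; rewrite !in_itv /= => h1 h2 h3.
  apply: cvg_near_cst; near=> n; rewrite /bump3.
  have -> : bump a.1.1 b.1.1 n x.1.1 = 1 by near: n; exact: bump_cvg.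
  have -> : bump a.1.2 b.1.2 n x.1.2 = 1 by near: n; exact: bump_cvg.
  have -> : bump a.2 b.2 n x.2 = 1 by near: n; exact: bump_cvg.
  by rewrite !mulr1.
have -> : (fun n => bump3 a b n x) = (fun _ => 0%:R); last exact: cvg_cst.
apply/funext => n; rewrite /bump3.
have [h1|h1] := boolP (a.1.1 < x.1.1 < b.1.1); last by rewrite bump_out // !mul0r.
have [h2|h2] := boolP (a.1.2 < x.1.2 < b.1.2); last by rewrite [X in _ * X * _]bump_out // mulr0 mul0r.
have [h3|h3] := boolP (a.2 < x.2 < b.2); last by rewrite [X in _ * X]bump_out // mulr0.
by exfalso; apply: xab; rewrite inE; do !split; rewrite /= in_itv /=.
Unshelve. all: by end_near. Qed.

Lemma obox_measurable (a b : R3 R) : measurable (obox a b : set (mR3 R)).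
Proof. by do ?apply: measurableX; exact: measurable_itv. Qed.

(** The bumps are admissible test functions and converge to the indicator of the box while staying
    below 1, so dominated convergence applies. *)
Lemma int_obox0 (D : set (mR3 R)) (g : R3 R -> R) (a b : R3 R) :
  measurable D -> obox a b `<=` D -> leb3.-integrable D (EFin \o g) ->
  (forall phi, test_function D phi -> \int[leb3]_(x in D) (g x * phi x) = 0) ->
  (\int[leb3]_(x in obox a b) (g x)%:E = 0)%E.
Proof.
move=> mD abD gi H.
have mg : measurable_fun D g by apply/measurable_EFinP; case/integrableP: gi.
have mb n : measurable_fun D (bump3 a b n : mR3 R -> R).
  apply: continuous_measurable_R3; apply: (@Cn_continuous _ 0).
  by have [/(_ 0%N)] := @bump3_test a b n _ (@subset_refl _ _).
have bound n x : `|g x * bump3 a b n x| <= `|g x|.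
  rewrite normrM (ger0_norm (bump3_ge0 _ _ _ _)).
  by rewrite -[leRHS]mulr1 ler_wpM2l ?bump3_le1.
have mi : measurable_fun D (fun x => g x * \1_(obox a b) x).
  apply: measurable_funM => //; apply: measurable_indic; exact: obox_measurable.
have ptcvg x : g x * bump3 a b n x @[n --> \oo] --> g x * \1_(obox a b) x.
  by apply: cvgMr; exact: bump3_cvg.
have hcvg := @dct _ _ _ leb3 D (fun n x => g x * bump3 a b n x)
  (fun x => g x * \1_(obox a b) x) (fun x => `|g x|) mD
  (fun n => measurable_funM mg (mb n)) mi (fun x _ => ptcvg x) (fun n x _ => bound n x)
  (integrable_abse gi).
have z n : (\int[leb3]_(x in D) (g x * bump3 a b n x)%:E = 0)%E.
  rewrite -[LHS]fineK; first by have := H _ (bump3_test n abD); rewrite /Rintegral => ->.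
  apply: integrable_fin_num => //; apply: le_integrable gi => //.
    by apply/measurable_EFinP; exact: measurable_funM.
  by move=> x _; rewrite /= lee_fin; exact: bound.
have : (\int[leb3]_(x in D) (g x * \1_(obox a b) x)%:E = 0)%E.
  by rewrite -(cvg_lim _ hcvg) //; under eq_fun do rewrite z; rewrite lim_cst.
have -> : (\int[leb3]_(x in obox a b) (g x)%:E = \int[leb3]_(x in D `&` obox a b) (g x)%:E)%E.
  by rewrite (setIidr abD).
move=> <-; rewrite (integral_mkcondr _ D (obox a b)).
apply: eq_integral => x _; rewrite patchE indicE.
by case: ifPn => _; rewrite ?mulr1 ?mulr0.
Qed.

Lemma obox_setI (a b c d : R3 R) : exists a' b', obox a b `&` obox c d = obox a' b'.
Proof.
exists (Num.max a.1.1 c.1.1, Num.max a.1.2 c.1.2, Num.max a.2 c.2),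
  (Num.min b.1.1 d.1.1, Num.min b.1.2 d.1.2, Num.min b.2 d.2).
apply/seteqP; split => x; rewrite /obox /= !in_itv /= !gt_max !lt_min.
- move=> [[[/andP[-> ->] /andP[-> ->]] /andP[-> ->]]].
  by move=> [[/andP[-> ->] /andP[-> ->]] /andP[-> ->]].
- move=> [[/andP[/andP[-> ->] /andP[-> ->]] /andP[/andP[-> ->] /andP[-> ->]]]].
  by move=> /andP[/andP[-> ->] /andP[-> ->]].
Qed.

Lemma ball_obox (c : R3 R) (e : R) : exists a b, ball c e = obox a b.
Proof.
exists (c.1.1 - e, c.1.2 - e, c.2 - e), (c.1.1 + e, c.1.2 + e, c.2 + e).
apply/seteqP; split => x; rewrite /obox /= !in_itv /=.
- by move=> [[] /=]; rewrite /ball /= !ltr_distlC.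
- by move=> [[h1 h2] h3]; do !split; rewrite /ball /= ltr_distlC.
Qed.

Definition oboxes : set (set (R3 R)) := [set A | exists a b, A = obox a b].

Lemma oboxes_open (U : set (R3 R)) : open U -> <<s oboxes >> U.
Proof.
move=> /open_bigcup_balls[c [e ->]].
apply: (@bigcupT_measurable _ (g_sigma_algebraType oboxes)) => n.
by apply: sub_sigma_algebra; have [a [b ->]] := ball_obox (c n) (e n); exists a, b.
Qed.

(** The identity, with the sigma-algebra generated by boxes on its source, is measurable because
    each coordinate is: open sets are countable unions of balls, hence of boxes. It is written as a
    triple so that measurability of pairs applies. *)
Lemma measurable_oboxes (A : set (mR3 R)) : measurable A -> <<s oboxes >> A.
Proof.
move=> mA.
pose X := g_sigma_algebraType oboxes.
have mc (f : R3 R -> R) : continuous f -> measurable_fun [set: X] (f : X -> mR).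
  move=> fc; apply: measurable_of_preimage_open => U oU; rewrite setTI.
  by apply: oboxes_open; apply: open_comp => // x _; exact: fc.
have h : measurable_fun [set: X] ((fun x => ((x.1.1, x.1.2), x.2)) : X -> mR3 R).
  apply: (@measurable_fun_pair _ _ _ X (mR * mR)%type mR).
    apply: (@measurable_fun_pair _ _ _ X mR mR).
      by apply: mc; exact: c1_continuous.
    by apply: mc; exact: c2_continuous.
  by apply: mc; exact: c3_continuous.
have := h (@measurableT _ X) A mA; rewrite setTI.
by congr (<<s oboxes >> _); apply/seteqP; split => -[[? ?] ?].
Qed.

(** Dynkin's theorem: the sets over which [g] has zero integral inside the box form a lambda-system
    containing the boxes, a family closed under intersection that generates the sigma-algebra. *)
Lemma box_ae0 (g : R3 R -> R) (a b : R3 R) :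
  leb3.-integrable (obox a b : set (mR3 R)) (EFin \o g) ->
  (forall c d, obox c d `<=` obox a b -> (\int[leb3]_(x in obox c d) (g x)%:E = 0)%E) ->
  ae_eq leb3 (obox a b : set (mR3 R)) (EFin \o g) (cst 0%E).
Proof.
move=> gi H; have mQ := obox_measurable a b.
have key E : measurable (E : set (mR3 R)) ->
    (\int[leb3]_(x in E `&` obox a b) (g x)%:E = 0)%E.
  pose HH := [set E : set (mR3 R) | measurable E /\
    (\int[leb3]_(x in E `&` obox a b) (g x)%:E = 0)%E].
  have giS (F : set (mR3 R)) : measurable F -> leb3.-integrable (F `&` obox a b) (EFin \o g).
    by move=> mF; apply: integrableS gi => //; exact: measurableI.
  have mG : @measurable _ (mR3 R) = <<s oboxes >>.
    apply/seteqP; split; first exact: measurable_oboxes.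
    apply: smallest_sub; first exact: sigma_algebra_measurable.
    by move=> _ [c [d ->]]; exact: obox_measurable.
  have GI : setI_closed oboxes.
    move=> _ _ [c [d ->]] [c' [d' ->]]; have [e [f ->]] := obox_setI c d c' d'.
    by exists e, f.
  move=> mE; have [//] : HH E.
  apply: (dynkin_induction mG GI) => //.
  - by split => //; rewrite setTI; exact: H.
  - move=> _ [c [d ->]]; split; first exact: obox_measurable.
    have [e [f ef]] := obox_setI c d a b; rewrite ef; apply: H.
    by rewrite -ef; exact: subIsetr.
  - move=> F _ [mF F0]; split; first exact: measurableC.
    have mFc := measurableC mF.
    have U : (F `&` obox a b) `|` (~` F `&` obox a b) = obox a b.
      by rewrite -setIUl setUCr setTI.
    have := @integral_setU _ _ _ leb3 _ _ (EFin \o g)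
       (measurableI _ _ mF mQ) (measurableI _ _ mFc mQ).
    rewrite U H // F0 add0e => <- //.
    + by case/integrableP : gi.
    + by apply/disj_setPS => x [[Fx _] [nFx _]]; exact: (nFx Fx).
  - move=> F mF tF HF; split; first exact: bigcupT_measurable.
    rewrite setI_bigcupl integral_bigcup.
    + by apply: eseries0 => n _ _; case: (HF n).
    + exact: trivIset_setIr.
    + by move=> n; exact: measurableI.
    + by rewrite -setI_bigcupl; apply: giS; exact: bigcupT_measurable.
  - by rewrite -mG.
apply: integral_ae_eq => //.
move=> E EQ mE; rewrite integral0 -(setIidl EQ); exact: key.
Qed.

(** An open set is a countable union of balls of the maximum norm, which are boxes, and countably
    many null sets form a null set. *)
Lemma orthogonal_test_ae0 (D : set (R3 R)) (g : R3 R -> R) : open D ->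
  leb3.-integrable (D : set (mR3 R)) (EFin \o g) ->
  (forall phi, test_function D phi -> \int[leb3]_(x in (D : set (mR3 R))) (g x * phi x) = 0) ->
  {ae leb3, forall x, D x -> g x = 0}.
Proof.
move=> oD gi H; have mD := open_measurable_R3 oD.
have [c [e DE]] := open_bigcup_balls oD.
have hn n : {ae leb3, forall x, ball (c n) (e n) x -> g x = 0}.
  have sub : ball (c n) (e n) `<=` D by move=> x xn; rewrite DE; exists n.
  have [a [b ab]] := ball_obox (c n) (e n); rewrite ab in sub *.
  have gQ : leb3.-integrable (obox a b : set (mR3 R)) (EFin \o g).
    by apply: integrableS gi => //; exact: obox_measurable.
  have := box_ae0 gQ _; have h c' d' : obox c' d' `<=` obox a b ->
      (\int[leb3]_(x in obox c' d') (g x)%:E = 0)%E.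
    move=> cd; apply: (@int_obox0 D) => //; exact: (subset_trans cd).
  move=> /(_ h); apply: filterS => x hx xab; have := hx xab => /= -[].
  by [].
have := @ae_foralln _ _ _ leb3 _ hn; apply: filterS => x hx.
by rewrite DE => -[n _ xn]; exact: (hx n).
Qed.

Lemma test_function_bounded (D : set (R3 R)) phi : test_function D phi ->
  exists B, forall x : R3 R, `|phi x| <= B.
Proof.
move=> [phis [K [cK _ Kphi]]]; have [M M0 KM] := compact_sub_cube cK.
have [B B0 hB] := continuous_bounded_cube M (phis 0%N : continuous phi).
exists B => x; have [/hB//|xM] := pselect (cube M x).
by rewrite Kphi ?normr0 // => /KM.
Qed.

(** Serves to identify the derivative picked by the choice operator in [wpartial] with any weak
    derivative computed by hand. *)
Lemma wpd_unique (D : set (R3 R)) i (u g1 g2 : R3 R -> R) : open D ->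
  leb3.-integrable (D : set (mR3 R)) (EFin \o g1) ->
  leb3.-integrable (D : set (mR3 R)) (EFin \o g2) ->
  wpd D i u g1 -> wpd D i u g2 -> {ae leb3, forall x, D x -> g1 x = g2 x}.
Proof.
move=> oD i1 i2 h1 h2; have mD := open_measurable_R3 oD.
have i12 : leb3.-integrable (D : set (mR3 R)) (EFin \o (fun x => g1 x - g2 x)).
  by have := integrableB mD i1 i2; apply: eq_integrable.
have H : forall phi, test_function D phi ->
    \int[leb3]_(x in (D : set (mR3 R))) ((g1 x - g2 x) * phi x) = 0.
  move=> phi tphi; have [B hB] := test_function_bounded tphi.
  have mphi : measurable_fun (D : set (mR3 R)) phi.
    by apply: continuous_measurable_R3; case: tphi => /(_ 0%N).
  have j1 := integrable_mul_bounded mD i1 mphi (fun x _ => hB x).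
  have j2 := integrable_mul_bounded mD i2 mphi (fun x _ => hB x).
  have -> : (fun x => (g1 x - g2 x) * phi x) = (fun x => g1 x * phi x - g2 x * phi x).
    by apply/funext => x; rewrite mulrBl.
  rewrite RintegralB //; apply/eqP; rewrite subr_eq0; apply/eqP.
  by apply: oppr_inj; rewrite -h1 // -h2.
have [N [mN N0 sN]] := orthogonal_test_ae0 oD i12 H.
exists N; split => // x /= hx; apply: sN => /= h; apply: hx => Dx.
by apply/eqP; rewrite -subr_eq0 h.
Qed.

End FL.

(** * Integration by parts up to a surface where the trace vanishes *)

Section ZeroTrace.
Context {R : realType}.
Notation mR := (measurableTypeR R).
Notation mu := (@lebesgue_measure R).

Lemma disc_sub_square (r : R) : 0 <= r -> disc r `<=` square r.
Proof.
move=> r0 y yd; rewrite /disc /= /sqn in yd.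
have h1 := sqr_ge0 y.1; have h2 := sqr_ge0 y.2.
by split; rewrite /= in_itv /= -ler_norml -ler_sqr ?nnegrE // real_normK ?num_real //; lra.
Qed.

Lemma disc_finite (r : R) : (leb2 (disc r : set (mR * mR)) < +oo)%E.
Proof.
have -> : disc r = disc `|r| by apply/seteqP; split => y; rewrite /disc /= real_normK ?num_real.
apply: le_lt_trans (leb2_square `|r|); apply: le_measure; rewrite ?inE.
- exact: disc_measurable.
- by apply: measurableX; exact: measurable_itv.
- exact: disc_sub_square.
Qed.

Lemma disc_vol (r : R) : exists2 v : R, 0 <= v & (leb2 (disc r : set (mR * mR)) = v%:E)%E.
Proof.
have h := disc_finite r; have h0 : (0 <= leb2 (disc r : set (mR * mR)))%E by [].
exists (fine (leb2 (disc r : set (mR * mR)))); first exact: fine_ge0.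
by rewrite fineK // ge0_fin_numE.
Qed.

Lemma itv_length (a T : R) : 0 <= T -> (mu `]a, (a + T)%R[%classic = T%:E)%E.
Proof.
move=> T0; rewrite lebesgue_measure_itv /= lte_fin ltrDl; case: ltP => h.
  by rewrite -EFinB; congr (_%:E); ring.
by have -> : T = 0 by apply: le_anti; rewrite h.
Qed.

Lemma slab_vol (m r T : R) : 0 <= T ->
  (leb3 (slab (disc r) (zc m) T : set (mR3 R)) = T%:E * leb2 (disc r : set (mR * mR)))%E.
Proof.
move=> T0; rewrite -[LHS]mul1e -(integral_cst _ (slab_measurable m r T) 1%E).
rewrite slab_integral //; [|exact: slab_measurable|exact: disc_measurable].
rewrite -integral_cst; last exact: disc_measurable.
apply: eq_integral => y _; rewrite integral_cst ?measurable_itv // mul1e.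
exact: itv_length.
Qed.

(* [zeta] is 0 near the lateral surface of the cone and 1 away from a strip of
   width comparable to [d]. *)
Definition zreg (m d : R) (x : R3 R) : R := m * Num.sqrt (sqn x.1 + d ^+ 2).
Definition zeta (m d : R) (x : R3 R) : R := step (d^-1 * (x.2 - zreg m d x)).

Lemma Cn_sqn n : Cn n (fun x : R3 R => sqn x.1).
Proof.
apply: CnD; under eq_fun do rewrite expr2; apply: CnM; exact: Cn_c1 || exact: Cn_c2.
Qed.

(** The term [d ^+ 2] under the root smooths the cone along its axis, while lifting the graph by at
    most [m * d]. *)
Lemma Cn_zreg n m d : 0 < d -> Cn n (zreg m d).
Proof.
move=> d0; apply: CnM; first exact: Cn_cst.
apply: Cn_sqrt; first by move=> x; rewrite ltr_wpDl ?sqn_ge0 // exprn_gt0.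
by apply: CnD; [exact: Cn_sqn|exact: Cn_cst].
Qed.

Lemma Cn_zeta n m d : 0 < d -> Cn n (zeta m d).
Proof.
move=> d0; apply: Cn_step; apply: CnM; first exact: Cn_cst.
by apply: CnB; [exact: Cn_c3|exact: Cn_zreg].
Qed.

Lemma zreg_ge m d x : 0 <= m -> zc m x.1 <= zreg m d x.
Proof.
move=> m0; rewrite /zreg /zc ler_wpM2l //; apply: ler_wsqrtr; by rewrite lerDl sqr_ge0.
Qed.

Lemma zreg_le m d x : 0 <= m -> 0 < d -> zreg m d x <= zc m x.1 + m * d.
Proof.
move=> m0 d0; rewrite /zreg /zc -mulrDr ler_wpM2l //.
rewrite -ler_sqr ?nnegrE ?sqrtr_ge0 ?addr_ge0 ?sqrtr_ge0 ?(ltW d0) //.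
rewrite sqr_sqrtr ?addr_ge0 ?sqn_ge0 ?sqr_ge0 //.
rewrite sqrrD sqr_sqrtr ?sqn_ge0 // lerD2r lerDl.
by rewrite mulrn_wge0 // mulr_ge0 ?sqrtr_ge0 // ltW.
Qed.

Lemma zeta_ge0 m d x : 0 <= zeta m d x. Proof. exact: step_ge0. Qed.
Lemma zeta_le1 m d x : zeta m d x <= 1. Proof. exact: step_le1. Qed.

Lemma zeta_supp m d x : 0 < d -> ~~ (zreg m d x < x.2) -> zeta m d x = 0.
Proof.
by move=> d0 h; rewrite /zeta step0 // pmulr_rle0 ?invr_gt0 // subr_le0 leNgt.
Qed.

Lemma zeta_one m d x : 0 < d -> zreg m d x + d <= x.2 -> zeta m d x = 1.
Proof.
move=> d0 h; rewrite /zeta step1 // -(@ler_pM2l _ d) // mulrA divff ?gt_eqF // mul1r mulr1.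
by rewrite lerBrDl.
Qed.

Lemma evec_le1 (i : 'I_3) : [/\ `|(evec i : R3 R).1.1| <= 1, `|(evec i : R3 R).1.2| <= 1
  & `|(evec i : R3 R).2| <= 1].
Proof. by case: (ord3P i) => ->; rewrite /evec /=; split; rewrite ?normr1 ?normr0. Qed.

Lemma is_derive_sqn (x v : R3 R) :
  is_derive x v (fun x : R3 R => sqn x.1) (2 * (x.1.1 * v.1.1 + x.1.2 * v.1.2)).
Proof.
have h1 := is_derive_c1 x v; have h2 := is_derive_c2 x v.
have := is_deriveD (is_deriveM h1 h1) (is_deriveM h2 h2).
have -> : (fun y : R3 R => y.1.1) * (fun y : R3 R => y.1.1) +
          (fun y : R3 R => y.1.2) * (fun y : R3 R => y.1.2) = (fun x : R3 R => sqn x.1).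
  by apply/funext => y; rewrite /sqn !expr2.
by move=> h; apply: (is_derive_val h); rewrite /GRing.scale /=; ring.
Qed.

(** The derivative lives where [zreg < x.2 < zreg + d], and [zreg] exceeds [zc] by at most [m * d];
    hence a strip of height at most [(m + 2) * d]. The gradient of [zreg] is bounded independently
    of [d], which leaves the factor 1 / d. *)
Lemma derive_zeta_bound m : 0 <= m -> exists2 C, 0 <= C &
  forall d (x : R3 R) i, 0 < d -> `|'D_(evec i) (zeta m d) x| <= C / d /\
  (~~ (zc m x.1 < x.2 < zc m x.1 + (m + 2) * d) -> 'D_(evec i) (zeta m d) x = 0).
Proof.
move=> m0; have [B B0 hB] := @dstep_bound R.
exists (B * (1 + 2 * m)); first by apply: mulr_ge0; [exact: ltW|lra].
move=> d x i d0; have [e1 e2 e3] := evec_le1 i.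
have q0 : 0 < sqn x.1 + d ^+ 2 by rewrite ltr_wpDl ?sqn_ge0 // exprn_gt0.
pose s := Num.sqrt (sqn x.1 + d ^+ 2).
have s0 : 0 < s by rewrite sqrtr_gt0.
have s2 : s ^+ 2 = sqn x.1 + d ^+ 2 by rewrite sqr_sqrtr // ltW.
pose dz := m * ((2 * s)^-1 * (2 * (x.1.1 * (evec i : R3 R).1.1 + x.1.2 * (evec i : R3 R).1.2))).
have hz : is_derive x (evec i) (zreg m d) dz.
  have h1 : is_derive x (evec i) (fun x : R3 R => sqn x.1 + d ^+ 2)
     (2 * (x.1.1 * (evec i : R3 R).1.1 + x.1.2 * (evec i : R3 R).1.2)).
    have := is_deriveD (is_derive_sqn x (evec i)) (is_derive_cst (d ^+ 2) x (evec i)).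
    by move=> h; apply: (is_derive_val h); rewrite addr0.
  have h2 := is_derive_comp1 (is_derive1_sqrt q0) h1.
  exact: (is_deriveZ m h2).
have hl : is_derive x (evec i) (fun x => d^-1 * (x.2 - zreg m d x)) (d^-1 * ((evec i : R3 R).2 - dz)).
  exact: (is_deriveZ d^-1 (is_deriveB (is_derive_c3 x (evec i)) hz)).
have hD := is_derive_comp1 (is_derive_step _) hl.
have -> : 'D_(evec i) (zeta m d) x = dstep (d^-1 * (x.2 - zreg m d x)) * (d^-1 * ((evec i : R3 R).2 - dz)).
  exact: derive_val.
split.
  rewrite normrM ger0_norm ?dstep_ge0 // normrM ger0_norm ?invr_ge0 ?(ltW d0) //.
  have hdz : `|dz| <= 2 * m.
    have x1 : `|x.1.1| <= s.
      rewrite -ler_sqr ?nnegrE ?(ltW s0) // real_normK ?num_real // s2 /sqn.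
      by have := sqr_ge0 x.1.2; have := sqr_ge0 d; lra.
    have x2 : `|x.1.2| <= s.
      rewrite -ler_sqr ?nnegrE ?(ltW s0) // real_normK ?num_real // s2 /sqn.
      by have := sqr_ge0 x.1.1; have := sqr_ge0 d; lra.
    rewrite /dz normrM ger0_norm // mulrC ler_wpM2r //.
    have -> z : (2 * s)^-1 * (2 * z) = s^-1 * z by field; rewrite gt_eqF.
    rewrite normrM ger0_norm ?invr_ge0 ?(ltW s0) //.
    rewrite mulrC ler_pdivrMr //; apply: le_trans (ler_normD _ _) _; rewrite !normrM.
    have a1 := ler_pM (normr_ge0 _) (normr_ge0 _) x1 e1.
    have a2 := ler_pM (normr_ge0 _) (normr_ge0 _) x2 e2.
    lra.
  have h : `|(evec i : R3 R).2 - dz| <= 1 + 2 * m.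
    by apply: le_trans (ler_normB _ _) _; apply: lerD.
  have := ler_pM (dstep_ge0 _) (normr_ge0 _) (hB (d^-1 * (x.2 - zreg m d x))) h.
  by move=> h'; rewrite mulrCA mulrC ler_wpM2r // invr_ge0 ltW.
move=> h.
have [g|g] := leP x.2 (zreg m d x).
  by rewrite dstep0 ?mul0r // pmulr_rle0 ?invr_gt0 // subr_le0.
have zg := zreg_ge d x m0; have zl := zreg_le x m0 d0.
have xg : zc m x.1 < x.2 := le_lt_trans zg g.
move: h; rewrite xg /= -leNgt => h.
rewrite dstep1 ?mul0r // -(@ler_pM2l _ d) // mulrA divff ?gt_eqF // mul1r mulr1 lerBrDl.
by apply: le_trans h; lra.
Qed.

Lemma enorm_cube (rho : R) (x : R3 R) : enorm x <= rho -> cube rho x.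
Proof.
move=> h; have := sqr_enorm x; have r0 : 0 <= rho := le_trans (enorm_ge0 x) h.
have h2 : enorm x ^+ 2 <= rho ^+ 2 by rewrite ler_sqr ?nnegrE ?enorm_ge0.
rewrite /sqn => E; have q1 := sqr_ge0 x.1.1; have q2 := sqr_ge0 x.1.2; have q3 := sqr_ge0 x.2.
by apply/cubeP; split; rewrite -ler_sqr ?nnegrE // real_normK ?num_real //; lra.
Qed.

Lemma enorm_le_compact (rho : R) (F : set (R3 R)) : closed F ->
  compact ([set x | enorm x <= rho] `&` F).
Proof.
move=> cF; apply: (@subclosed_compact _ _ (cube rho)).
- apply: closedI => //.
  have -> : [set x : R3 R | enorm x <= rho] = enorm @^-1` `]-oo, rho].
    by apply/seteqP; split => x /=; rewrite in_itv.
  by apply: closed_comp => [x _|]; [exact: enorm_continuous|exact: interval_closed].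
- exact: cube_compact.
- by move=> x [/enorm_cube].
Qed.

Definition tcone (m h : R) : set (R3 R) := [set x | zc m x.1 < x.2] `&` eball h.

Lemma tcone_open m h : open (tcone m h).
Proof.
apply: openI; last exact: eball_open.
have -> : [set x : R3 R | zc m x.1 < x.2] = (fun x : R3 R => x.2 - zc m x.1) @^-1` `]0, +oo[.
  by apply/seteqP; split => x /=; rewrite in_itv /= subr_gt0 andbT.
by apply: open_comp => [x _|]; [exact: height_continuous|exact: interval_open].
Qed.

(** [zreg] lies strictly above [zc], which keeps the support off the lateral surface and the apex,
    and [rho < h] keeps it off the spherical cap. *)
Lemma zeta_test m d rho h psi : 0 < m -> 0 < d -> rho < h -> smooth psi ->
  supported_in [set x : R3 R | enorm x <= rho] psi ->
  test_function (tcone m h) (fun x => psi x * zeta m d x).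
Proof.
move=> m0 d0 rh psis spsi; split; first by move=> n; apply: CnM; [exact: psis|exact: Cn_zeta].
exists ([set x | enorm x <= rho] `&` [set x | zreg m d x <= x.2]); split.
- apply: enorm_le_compact.
  have -> : [set x : R3 R | zreg m d x <= x.2] = (fun x : R3 R => x.2 - zreg m d x) @^-1` `[0, +oo[.
    by apply/seteqP; split => x /=; rewrite in_itv /= subr_ge0 andbT.
  apply: closed_comp => [x _|]; last exact: interval_closed.
  by apply: cvgB; [exact: c3_continuous|exact: (Cn_continuous (Cn_zreg 0 m d0))].
- move=> x [xr xz]; split; last exact: le_lt_trans xr rh.
  apply: lt_le_trans xz; rewrite /zc /zreg ltr_pM2l //.
  by rewrite ltr_sqrt ?ltrDl ?exprn_gt0 // ltr_wpDl ?sqn_ge0 // exprn_gt0.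
- move=> x /not_andP[xr|xz]; first by rewrite spsi ?mul0r.
  by rewrite zeta_supp ?mulr0 //; apply/negP => /ltW.
Qed.

(** Zero trace and [slab_strip] bound the L^2 norm on the strip by a multiple of [T]; Cauchy-Schwarz
    against the volume of the strip adds a factor sqrt(T). An exponent above 1 is needed to absorb a
    cutoff gradient of size 1 / T. *)
Lemma strip_L1 (m r0 E : R) (u p : R3 R -> R) (t : R * R -> R) :
  0 <= m -> 0 < r0 -> smooth_approx m r0 r0 u p t ->
  {ae leb2, forall y, disc r0 y -> t y = 0} -> 0 <= E ->
  (\int[leb3]_(x in slab (disc r0) (zc m) r0) (p x ^+ 2)%:E <= E%:E)%E ->
  exists2 C, 0 <= C & forall T, 0 < T <= r0 ->
   (\int[leb3]_(x in slab (disc r0) (zc m) T) `|u x|%:E <= (C * (T * Num.sqrt T))%:E)%E.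
Proof.
move=> m0 r00 uapp t0 E0 pfin; have [mu_ mp mt _] := uapp.
have mS0 := slab_measurable m r0 r0; have mD := @disc_measurable R r0.
have mp2 : measurable_fun (slab (disc r0) (zc m) r0 : set (mR3 R)) (fun x => p x ^+ 2).
  exact: measurable_sqr.
have [v v0 hv] := disc_vol r0.
exists (4 * Num.sqrt E * Num.sqrt v); first by rewrite !mulr_ge0 ?sqrtr_ge0.
move=> T /andP[T0 Tr].
have mS := slab_measurable m r0 T.
have SS : slab (disc r0) (zc m) T `<=` slab (disc r0) (zc m) r0.
  by move=> x [xd /andP[x1 x2]]; split=> //; rewrite x1 (lt_le_trans x2) // lerD2l.
have mu' := measurable_funS mS0 SS mu_.
pose M := 1 + 2 * T + 4 * T ^+ 2.
have T20 : 0 <= T ^+ 2 by exact: sqr_ge0.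
have M0 : 0 <= M by rewrite /M; lra.
have H : (\int[leb3]_(x in slab (disc r0) (zc m) T) (1 * u x ^+ 2)%:E +
     \int[leb2]_(y in disc r0) (0 * t y ^+ 2)%:E <=
   4%:E * (\int[leb2]_(y in disc r0) (2 * T * t y ^+ 2)%:E +
     (\int[leb3]_(x in slab (disc r0) (zc m) T) (0 * u x ^+ 2)%:E +
      \int[leb3]_(x in slab (disc r0) (zc m) T) (4 * T ^+ 2 * p x ^+ 2)%:E)))%E.
  apply: (@trace_limit R m r0 r0 (slab (disc r0) (zc m) T) (cst 1) (cst 0) (cst (4 * T ^+ 2))
    (cst 0) (cst (2 * T)) M u p t mS SS uapp M0).
  - by split; exact: measurable_cst.
  - exact: measurable_cst.
  - exact: measurable_cst.
  - by move=> x _; rewrite /cst /M; split; apply/andP; split; lra.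
  - by move=> x _; rewrite /cst /M; split; apply/andP; split; lra.
  - move=> f fC; rewrite /cst.
    under eq_integral do rewrite mul1r.
    under [X in (_ + X <= _)%E]eq_integral do rewrite mul0r.
    under [X in (_ <= _ + (X + _))%E]eq_integral do rewrite mul0r.
    by rewrite !integral0 adde0 add0e; exact: slab_strip.
have H1 : (\int[leb3]_(x in slab (disc r0) (zc m) T) (u x ^+ 2)%:E <= ((4 * T * Num.sqrt E) ^+ 2)%:E)%E.
  move: H; under eq_integral do rewrite mul1r.
  under [X in (_ + X <= _)%E]eq_integral do rewrite mul0r.
  under [X in (_ <= _ * (_ + (X + _)))%E]eq_integral do rewrite mul0r.
  have -> : (\int[leb2]_(y in disc r0) (2 * T * t y ^+ 2)%:E = 0)%E.
    transitivity (\int[leb2]_(y in disc r0) (cst 0%E y : \bar R))%E; last exact: integral0.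
    apply: ae_eq_integral => //.
      by apply/measurable_EFinP; apply: measurable_funM => //; exact: measurable_sqr.
    have [N [mN N0 sN]] := t0.
    exists N; split=> // y hy; apply: sN => hy'; apply: hy => yd /=.
    by rewrite hy' // expr0n mulr0.
  rewrite !integral0 adde0 !add0e => H; apply: (le_trans H).
  rewrite int_Zl //; first last.
  - lra.
  - by move=> x _; exact: sqr_ge0.
  - exact: measurable_funS mp2.
  rewrite exprMn sqr_sqrtr //.
  have -> : (4 * T) ^+ 2 * E = 4 * (4 * T ^+ 2 * E) by ring.
  rewrite [leRHS]EFinM; apply: lee_wpmul2l; first by rewrite lee_fin.
  rewrite [leRHS]EFinM; apply: lee_wpmul2l; first by rewrite lee_fin; lra.
  apply: le_trans pfin; apply: ge0_subset_integral => //; first exact/measurable_EFinP.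
  by move=> x _; rewrite lee_fin sqr_ge0.
have H2 : (\int[leb3]_(x in slab (disc r0) (zc m) T) (cst (1:R) x ^+ 2)%:E <= ((Num.sqrt T * Num.sqrt v) ^+ 2)%:E)%E.
  under eq_integral do rewrite /cst /= expr1n.
  rewrite integral_cst // mul1e slab_vol ?(ltW T0) // hv -EFinM lee_fin.
  by rewrite exprMn !sqr_sqrtr // ltW.
have A0 : 0 <= 4 * T * Num.sqrt E by rewrite !mulr_ge0 ?sqrtr_ge0 // ltW.
have B0 : 0 <= Num.sqrt T * Num.sqrt v by rewrite mulr_ge0 ?sqrtr_ge0.
have := cauchy_schwarz_int mS mu' (measurable_cst (1 : R)) A0 B0 H1 H2.
under eq_integral do rewrite /cst mulr1.
move=> H3; apply: (le_trans H3); rewrite lee_fin le_eqVlt; apply/orP; left; apply/eqP; ring.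
Qed.

End ZeroTrace.

Section ZeroTrace2.
Context {R : realType}.
Notation mR := (measurableTypeR R).

Lemma int_eq_supp d (T : measurableType d) (mu : {measure set T -> \bar R}) (S D : set T)
  (f : T -> R) : S `<=` D -> (forall x, D x -> ~ S x -> f x = 0) ->
  (\int[mu]_(x in D) (f x)%:E = \int[mu]_(x in S) (f x)%:E)%E.
Proof.
move=> SD f0; rewrite integral_mkcond [RHS]integral_mkcond; congr integral.
apply/funext => x; rewrite !patchE; case: ifPn; rewrite ?inE ?notin_setE => xD.
  by case: ifPn => //; rewrite notin_setE => xS; rewrite f0.
by case: ifPn => //; rewrite inE => /SD.
Qed.

Section zero_trace.
Variables (m r0 h rho E : R) (u p p3 : R3 R -> R) (t : R * R -> R) (i : 'I_3) (psi : R3 R -> R).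
Hypotheses (m0 : 0 < m) (r00 : 0 < r0) (rr : rho < r0) (rh : rho < h) (rho0 : 0 <= rho).
Notation D := (tcone m h : set (mR3 R)).
Hypotheses (ui : leb3.-integrable D (EFin \o u)) (pi : leb3.-integrable D (EFin \o p)).
Hypotheses (up : wpd (tcone m h) i u p) (uapp : smooth_approx m r0 r0 u p3 t)
  (t0 : {ae leb2, forall y, disc r0 y -> t y = 0}) (E0 : 0 <= E)
  (pfin : (\int[leb3]_(x in slab (disc r0) (zc m) r0) (p3 x ^+ 2)%:E <= E%:E)%E).
Hypotheses (psis : smooth psi) (spsi : supported_in [set x : R3 R | enorm x <= rho] psi).
Hypothesis hr : slab (disc r0) (zc m) r0 `<=` D.

(** The weak derivative only sees test functions vanishing near the lateral surface, so it is
    applied to [psi] times [zeta m (d n)]. The term with the derivative of the cutoff is at most a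
    constant times (1 / d) d^(3/2), by [strip_L1]; the two others converge by domination. *)
Lemma zero_trace_ibp :
  \int[leb3]_(x in D) (u x * 'D_(evec i) psi x) = - \int[leb3]_(x in D) (p x * psi x).
Proof.
have oD : open D := @tcone_open R m h; have mD : measurable D by exact: open_measurable_R3.
have mu_ : measurable_fun D u by apply/measurable_EFinP; case/integrableP: ui.
have mp : measurable_fun D p by apply/measurable_EFinP; case/integrableP: pi.
have Kcl : closed [set x : R3 R | enorm x <= rho].
  have -> : [set x : R3 R | enorm x <= rho] = enorm @^-1` `]-oo, rho].
    by apply/seteqP; split => x /=; rewrite in_itv.
  by apply: closed_comp => [x _|]; [exact: enorm_continuous|exact: interval_closed].
have bnd_ (f : R3 R -> R) : continuous f -> (forall x, ~ (enorm x <= rho) -> f x = 0) ->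
    exists2 B, 0 <= B & forall x, `|f x| <= B.
  move=> fc f0; have [B B0 hB] := continuous_bounded_cube rho fc.
  exists B => // x; have [xr|xr] := pselect (enorm x <= rho); last by rewrite f0 ?normr0.
  by apply: hB; exact: enorm_cube.
have psc := Cn_continuous (psis 0%N).
have dpsc : continuous ('D_(evec i) psi) := Cn_continuous (Cn_derive i (psis 1%N)).
have [B B0 hB] := bnd_ _ psc spsi.
have [B1 B10 hB1] := bnd_ _ dpsc (@derive_supp R psi _ (evec i) Kcl spsi).
have [C C0 hC] := derive_zeta_bound (ltW m0).
have [C2 C20 hC2] := strip_L1 (ltW m0) r00 uapp t0 E0 pfin.
pose d n : R := n.+1%:R^-1.
have d0 n : 0 < d n by rewrite invr_gt0.
have dcvg : d n @[n --> \oo] --> 0 by exact: cvg_harmonic.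
pose z n := zeta m (d n).
have zc1 n : Cn 1 (z n) by exact: Cn_zeta.
have zcont n : continuous (z n) := Cn_continuous (zc1 n).
have dzcont n : continuous ('D_(evec i) (z n)) := Cn_continuous (Cn_derive i (zc1 n)).
have zlim (x : R3 R) : D x -> z n x @[n --> \oo] --> (1 : R).
  move=> [xz _]; apply: cvg_near_cst.
  have e0 : 0 < (x.2 - zc m x.1) / (m + 1) by rewrite divr_gt0 ?subr_gt0 // ltr_wpDl // ltW.
  move/cvgrPdist_lt : dcvg => /(_ _ e0); apply: filterS => n.
  have m1 : 0 < m + 1 by rewrite ltr_wpDl // ltW.
  rewrite sub0r normrN gtr0_norm // ltr_pdivlMr // => hn.
  by rewrite /z zeta_one //; have := zreg_le x (ltW m0) (d0 n); lra.
have mc (f : R3 R -> R) : continuous f -> measurable_fun D (f : mR3 R -> R) by exact: continuous_measurable_R3.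
have bd (a b c : R) n x : `|b| <= c -> `|a * b * z n x| <= c * `|a|.
  move=> bc; have z1 : `|z n x| <= 1 by rewrite ger0_norm; [exact: zeta_le1|exact: zeta_ge0].
  rewrite normrM -[leRHS]mulr1; apply: ler_pM => //.
  by rewrite normrM mulrC; apply: ler_pM.
have L1 : \int[leb3]_(x in D) (u x * 'D_(evec i) psi x * z n x) @[n --> \oo] -->
    \int[leb3]_(x in D) (u x * 'D_(evec i) psi x).
  apply: (@Rdct _ _ _ leb3 D _ _ (fun x => B1 * `|u x|)) => //.
  - move=> n; apply: measurable_funM; last exact: mc.
    by apply: measurable_funM => //; exact: mc.
  - by apply: measurable_funM => //; exact: mc.
  - by move=> x Dx; rewrite -[X in _ --> X]mulr1; apply: cvgMr; exact: zlim.
  - by move=> n x _; apply: bd.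
  - exact: (integrableZl mD B1 (integrable_norm ui)).
have L2 : \int[leb3]_(x in D) (p x * psi x * z n x) @[n --> \oo] -->
    \int[leb3]_(x in D) (p x * psi x).
  apply: (@Rdct _ _ _ leb3 D _ _ (fun x => B * `|p x|)) => //.
  - move=> n; apply: measurable_funM; last exact: mc.
    by apply: measurable_funM => //; exact: mc.
  - by apply: measurable_funM => //; exact: mc.
  - by move=> x Dx; rewrite -[X in _ --> X]mulr1; apply: cvgMr; exact: zlim.
  - by move=> n x _; apply: bd.
  - exact: (integrableZl mD B (integrable_norm pi)).
have L3 : \int[leb3]_(x in D) (u x * (psi x * 'D_(evec i) (z n) x)) @[n --> \oo] --> 0.
  pose K := B * C * C2 * (m + 2) * Num.sqrt (m + 2).
  have m20 : 0 < m + 2 by rewrite ltr_wpDl // ltW.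
  apply/cvgrPdist_le => e e0.
  have K0 : 0 <= K by rewrite !mulr_ge0 ?sqrtr_ge0 // ltW.
  have K1 : 0 < K + 1 by rewrite ltr_wpDl.
  (* The first bound keeps the strip of height [(m + 2) * d n] inside the slab of height [r0]; the
     second makes [K] times the root of [d n] at most [e]. *)
  have e1 : 0 < Num.min (r0 / (m + 2)) ((e / (K + 1)) ^+ 2).
    by rewrite lt_min divr_gt0 //= exprn_gt0 // divr_gt0.
  move/cvgrPdist_lt : dcvg => /(_ _ e1); apply: filterS => n.
  rewrite sub0r normrN gtr0_norm // lt_min => /andP[dn1 dn2].
  rewrite sub0r normrN.
  pose T := (m + 2) * d n.
  have T0 : 0 < T by rewrite mulr_gt0.
  have Tr : T <= r0 by rewrite /T mulrC -ler_pdivlMr // ltW.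
  have mS := slab_measurable m r0 T.
  have SD : slab (disc r0) (zc m) T `<=` D.
    move=> x [xd /andP[x1 x2]]; apply: hr; split=> //.
    by rewrite x1 (lt_le_trans x2) // lerD2l.
  have mf : measurable_fun D (fun x => u x * (psi x * 'D_(evec i) (z n) x)).
    by apply: measurable_funM => //; apply: measurable_funM; exact: mc.
  apply: (le_trans (proj2 (@Rint_bound _ _ _ leb3 D mD _ (K * Num.sqrt (d n)) mf _))).
    rewrite (@int_eq_supp _ _ leb3 (slab (disc r0) (zc m) T)) //; last first.
      move=> x Dx nS; have [xr|xr] := pselect (enorm x <= rho); last first.
        by rewrite spsi // mul0r mulr0 normr0.
      have [_ ->] := hC (d n) x i (d0 n); first by rewrite !mulr0 normr0.
      apply/negP => h'; apply: nS; split=> //; rewrite /disc /=.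
      have := sqr_enorm x; have := sqr_ge0 x.2.
      have : enorm x ^+ 2 < r0 ^+ 2.
        by rewrite ltr_sqr ?nnegrE ?enorm_ge0 ?(ltW r00) //; exact: le_lt_trans rr.
      lra.
    have muS := measurable_funS mD SD mu_.
    apply: (@le_trans _ _ (\int[leb3]_(x in slab (disc r0) (zc m) T) (B * (C / d n) * `|u x|)%:E)%E).
      apply: int_le => //.
      - by apply: measurableT_comp => //; exact: measurable_funS mf.
      - by apply: measurable_funM => //; exact: measurableT_comp.
      - move=> x _; rewrite !normrM mulrC; apply: ler_pM; rewrite ?mulr_ge0 //.
        by apply: ler_pM => //; have [] := hC (d n) x i (d0 n).
    have BC0 : 0 <= B * (C / d n) by rewrite mulr_ge0 // divr_ge0 // ltW.
    rewrite int_Zl //; last by apply: measurableT_comp.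
    have T1 : 0 < T <= r0 by rewrite T0.
    apply: (@le_trans _ _ ((B * (C / d n))%:E * (C2 * (T * Num.sqrt T))%:E)%E).
      by apply: lee_wpmul2l; [rewrite lee_fin|exact: hC2].
    rewrite -EFinM lee_fin le_eqVlt; apply/orP; left; apply/eqP.
    rewrite /K /T sqrtrM ?(ltW m20) //; have dn0 : d n != 0 by rewrite gt_eqF.
    by field.
  have h1 : Num.sqrt (d n) <= e / (K + 1).
    have e2 : 0 <= e / (K + 1) by rewrite divr_ge0 // ltW.
    by rewrite -ler_sqr ?nnegrE ?sqrtr_ge0 // sqr_sqrtr ltW.
  apply: (@le_trans _ _ (K * (e / (K + 1)))); first by rewrite ler_wpM2l.
  by rewrite mulrCA ler_piMr ?(ltW e0) // ler_pdivrMr // mul1r lerDl.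
have H n : \int[leb3]_(x in D) (p x * psi x * z n x) =
   - (\int[leb3]_(x in D) (u x * 'D_(evec i) psi x * z n x))
   - (\int[leb3]_(x in D) (u x * (psi x * 'D_(evec i) (z n) x))).
  have dE x : 'D_(evec i) (fun x => psi x * z n x) x = psi x * 'D_(evec i) (z n) x + z n x * 'D_(evec i) psi x.
    have h1 := CnS_derive (psis 1%N) i x; have h2 := CnS_derive (zc1 n) i x.
    by have h3 := is_deriveM h1 h2; rewrite (@derive_val _ _ _ _ _ _ _ h3).
  have := up (zeta_test m0 (d0 n) rh psis spsi).
  have E1 : \int[leb3]_(x in D) (u x * 'D_(evec i) (fun x => psi x * z n x) x) =
    \int[leb3]_(x in D) (u x * (psi x * 'D_(evec i) (z n) x) + u x * 'D_(evec i) psi x * z n x).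
    by apply: eq_Rintegral => x _; rewrite dE; ring.
  have E2 : \int[leb3]_(x in D) (p x * psi x * z n x) = \int[leb3]_(x in D) (p x * (psi x * z n x)).
    by apply: eq_Rintegral => x _; rewrite mulrA.
  have [B2 hB2] : exists B2, forall x, `|psi x * 'D_(evec i) (z n) x| <= B2.
    exists (B * (C / d n)) => x; rewrite normrM; apply: ler_pM => //.
    by have [] := hC (d n) x i (d0 n).
  have i1 : leb3.-integrable D (EFin \o (fun x => u x * (psi x * 'D_(evec i) (z n) x))).
    apply: (@integrable_mul_bounded _ _ _ leb3 D u _ B2) => //.
    by apply: measurable_funM; exact: mc.
  have i2 : leb3.-integrable D (EFin \o (fun x => u x * 'D_(evec i) psi x * z n x)).
    have -> : (fun x => u x * 'D_(evec i) psi x * z n x) = (fun x => u x * ('D_(evec i) psi x * z n x)).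
      by apply/funext => x; rewrite (mulrA (u x)).
    apply: (@integrable_mul_bounded _ _ _ leb3 D u _ B1) => //.
      by apply: measurable_funM; exact: mc.
    move=> x _; rewrite normrM -[leRHS]mulr1; apply: ler_pM => //.
    by rewrite ger0_norm; [exact: zeta_le1|exact: zeta_ge0].
  rewrite E1 (RintegralD mD i1 i2) -E2 => E3.
  by rewrite -[LHS]opprK -E3 opprD addrC.
have H' : (fun n => \int[leb3]_(x in D) (p x * psi x * z n x)) =
    - (fun n => \int[leb3]_(x in D) (u x * 'D_(evec i) psi x * z n x))
    - (fun n => \int[leb3]_(x in D) (u x * (psi x * 'D_(evec i) (z n) x))).
  by apply/funext => n; exact: H.
have := cvgB (cvgN L1) L3; rewrite subr0 -H' => L4.
by rewrite (cvg_unique _ L2 (L4 _ _)) ?opprK //; exact: norm_hausdorff.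
Qed.

End zero_trace.
End ZeroTrace2.

(** * The harmonic test function *)

Section Test.
Context {R : realType}.
Implicit Types (x v : R3 R) (e rho : R).

Lemma is_derive_pow (V : normedModType R) (f : V -> R) (a v : V) (df : R) n : is_derive a v f df ->
  is_derive a v (fun y => f y ^+ n) (n%:R * f a ^+ n.-1 * df).
Proof.
move=> h; elim: n => [|n ih].
  rewrite mul0r mul0r; under eq_fun do rewrite expr0; exact: is_derive_cst.
under eq_fun do rewrite exprS.
have := is_deriveM h ih; move=> h2; apply: (is_derive_val h2).
rewrite /GRing.scale /=; case: n {ih h2} => [|n] /=; first by rewrite expr0; ring.
by rewrite exprS -[n.+2%:R]natr1; ring.
Qed.

Lemma is_deriveDE (V : normedModType R) (f g : V -> R) (x v : V) (df dg : R) : is_derive x v f df -> is_derive x v g dg ->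
  is_derive x v (fun y => f y + g y) (df + dg).
Proof. exact: is_deriveD. Qed.

Lemma is_deriveBE (V : normedModType R) (f g : V -> R) (x v : V) (df dg : R) : is_derive x v f df -> is_derive x v g dg ->
  is_derive x v (fun y => f y - g y) (df - dg).
Proof. exact: is_deriveB. Qed.

Lemma is_deriveME (V : normedModType R) (f g : V -> R) (x v : V) (df dg : R) : is_derive x v f df -> is_derive x v g dg ->
  is_derive x v (fun y => f y * g y) (f x * dg + g x * df).
Proof. exact: is_deriveM. Qed.

Lemma is_deriveZE (V : normedModType R) (c : R) (f : V -> R) (x v : V) (df : R) : is_derive x v f df ->
  is_derive x v (fun y => c * f y) (c * df).
Proof. exact: is_deriveZ. Qed.

Lemma sum3 (F : 'I_3 -> R) : \sum_(i < 3) F i = F i1 + F i2 + F i3.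
Proof.
rewrite !big_ord_recl big_ord0 addr0 addrA; congr (_ + _ + _); congr (F _); exact: val_inj.
Qed.

Definition sqdist e x : R := sqn x.1 + (x.2 + e) ^+ 2.

(* agrees with the squared distance to (0, 0, -e) away from that point, and is positive *)
Definition sqdist_reg e x : R :=
  sqdist e x * step (2 / e ^+ 2 * sqdist e x - 1) +
  e ^+ 2 * (1 - step (2 / e ^+ 2 * sqdist e x - 1)).

Definition invdist e x : R := (Num.sqrt (sqdist_reg e x))^-1.

(* [a R^3], with [a = x3 + e] and [R] the inverse distance to (0, 0, -e), is a
   dipole field; [kern] is -e times its vertical derivative, hence harmonic in
   the upper half space. *)
Definition kern e x : R :=
  e * (3 * (x.2 + e) ^+ 2 * invdist e x ^+ 5 - invdist e x ^+ 3).

(** Equal to 1 up to distance rho / 2 and to 0 from squared distance rho^2 / 2 on, hence supported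
    in the ball of radius [rho]. It is written in terms of the squared norm to be smooth at the
    apex. *)
Definition cutoff rho x : R := 1 - step (4 / rho ^+ 2 * dot x x - 1).

Lemma sqdist_ge0 e x : 0 <= sqdist e x.
Proof. by rewrite addr_ge0 ?sqn_ge0 ?sqr_ge0. Qed.

Lemma sqdist_reg_gt0 e x : 0 < e -> 0 < sqdist_reg e x.
Proof.
move=> e0; have e20 : 0 < e ^+ 2 by rewrite exprn_gt0.
have n0 := sqdist_ge0 e x; rewrite /sqdist_reg.
set s := step _; have s0 : 0 <= s := step_ge0 _; have s1 : s <= 1 := step_le1 _.
have [s00|s0'] := eqVneq s 0; first by rewrite s00 mulr0 add0r subr0 mulr1.
have np : 0 < sqdist e x.
  rewrite lt_neqAle n0 andbT eq_sym; apply: contra s0' => /eqP h.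
  by rewrite /s step0 // h mulr0 sub0r oppr_le0.
have sp : 0 < s by rewrite lt_neqAle eq_sym s0' s0.
apply: ltr_pwDl; first exact: mulr_gt0.
by apply: mulr_ge0; [exact: ltW|rewrite subr_ge0].
Qed.

(** At nonnegative height [sqdist e x] is at least e^2, where the argument of [step] has reached 1;
    the modification is confined to the ball of radius [e] about (0, 0, -e). *)
Lemma sqdist_regE e x : 0 < e -> 0 <= x.2 -> sqdist_reg e x = sqdist e x.
Proof.
move=> e0 x0; rewrite /sqdist_reg step1; first by rewrite mulr1 subrr mulr0 addr0.
have e20 : 0 < e ^+ 2 by rewrite exprn_gt0.
have : e ^+ 2 <= sqdist e x.
  have h : e ^+ 2 <= (x.2 + e) ^+ 2 by rewrite ler_sqr ?nnegrE ?addr_ge0 ?(ltW e0) // lerDr.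
  by apply: le_trans h _; rewrite lerDr sqn_ge0.
have c0 : 0 < 2 / e ^+ 2 by rewrite divr_gt0.
move=> h; have h1 := ler_wpM2l (ltW c0) h.
have h2 : 2 / e ^+ 2 * e ^+ 2 = 2 by rewrite divfK // gt_eqF.
rewrite h2 in h1; lra.
Qed.

Lemma Cn_sqdist n e : Cn n (sqdist e).
Proof.
apply: CnD; first exact: Cn_sqn.
under eq_fun do rewrite expr2.
by apply: CnM; apply: CnD; (exact: Cn_c3 || exact: Cn_cst).
Qed.

Lemma Cn_pow n k (f : R3 R -> R) : Cn n f -> Cn n (fun x => f x ^+ k).
Proof.
move=> fC; elim: k => [|k ih].
  by under eq_fun do rewrite expr0; exact: Cn_cst.
by under eq_fun do rewrite exprS; exact: CnM.
Qed.

Lemma Cn_invdist n e : 0 < e -> Cn n (invdist e).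
Proof.
move=> e0; apply: CnV; first by move=> x; rewrite gt_eqF // sqrtr_gt0 sqdist_reg_gt0.
apply: Cn_sqrt; first by move=> x; exact: sqdist_reg_gt0.
have hs : Cn n (fun x => step (2 / e ^+ 2 * sqdist e x - 1)).
  by apply: Cn_step; apply: CnB; [apply: CnM; [exact: Cn_cst|exact: Cn_sqdist]|exact: Cn_cst].
apply: CnD; apply: CnM => //; first exact: Cn_sqdist.
  exact: Cn_cst.
by apply: CnB => //; exact: Cn_cst.
Qed.

Lemma Cn_kern n e : 0 < e -> Cn n (kern e).
Proof.
move=> e0; apply: CnM; first exact: Cn_cst.
apply: CnB; last by apply: Cn_pow; exact: Cn_invdist.
apply: CnM; last by apply: Cn_pow; exact: Cn_invdist.
apply: CnM; first exact: Cn_cst.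
by apply: Cn_pow; apply: CnD; [exact: Cn_c3|exact: Cn_cst].
Qed.

Lemma Cn_dot n : Cn n (fun x : R3 R => dot x x).
Proof.
apply: CnD; last by apply: CnM; exact: Cn_c3.
by apply: CnD; apply: CnM; (exact: Cn_c1 || exact: Cn_c2).
Qed.

Lemma Cn_cutoff n rho : Cn n (cutoff rho).
Proof.
apply: CnB; first exact: Cn_cst.
apply: Cn_step; apply: CnB; last exact: Cn_cst.
by apply: CnM; [exact: Cn_cst|exact: Cn_dot].
Qed.

Section harmonic.
Variables (e : R) (e0 : 0 < e).

Lemma invdist_gt0 x : 0 < invdist e x.
Proof. by rewrite invr_gt0 sqrtr_gt0 sqdist_reg_gt0. Qed.

Lemma invdist_sqr x : 0 <= x.2 -> invdist e x ^+ 2 * sqdist e x = 1.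
Proof.
move=> x0; rewrite -sqdist_regE // /invdist exprVn sqr_sqrtr ?(ltW (sqdist_reg_gt0 _ _)) //.
by rewrite mulVf // gt_eqF // sqdist_reg_gt0.
Qed.

Lemma invdist_le x a : 0 <= x.2 -> 0 <= a -> a ^+ 2 <= sqdist e x -> invdist e x * a <= 1.
Proof.
move=> x0 a0 h; rewrite -(@ler_sqr R) ?nnegrE ?mulr_ge0 ?(ltW (invdist_gt0 _)) //.
rewrite exprMn expr1n -(invdist_sqr x0) ler_wpM2l ?sqr_ge0 //.
Qed.

Lemma is_derive_invdist x v : 0 < x.2 -> is_derive x v (invdist e)
  (- (x.1.1 * v.1.1 + x.1.2 * v.1.2 + (x.2 + e) * v.2) * invdist e x ^+ 3).
Proof.
move=> x0.
have N0 : 0 < sqdist e x by rewrite -(sqdist_regE e0 (ltW x0)) sqdist_reg_gt0.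
have ha : is_derive x v (fun x : R3 R => x.2 + e) (v.2 : R).
  by have := is_deriveD (is_derive_c3 x v) (is_derive_cst e x v); rewrite addr0.
have hN : is_derive x v (sqdist e) (2 * (x.1.1 * v.1.1 + x.1.2 * v.1.2) + 2 * (x.2 + e) * v.2).
  have := is_deriveD (is_derive_sqn x v) (is_derive_pow 2 ha).
  by move=> h; apply: (is_derive_val h); rewrite expr1.
have hs := is_derive_comp1 (is_derive1_sqrt N0) hN.
have s0 : 0 < Num.sqrt (sqdist e x) by rewrite sqrtr_gt0.
have hi := is_derive_comp1 (is_derive1_inv (lt0r_neq0 s0)) hs.
have h : is_derive x v (fun x => (Num.sqrt (sqdist e x))^-1)
  (- (x.1.1 * v.1.1 + x.1.2 * v.1.2 + (x.2 + e) * v.2) * invdist e x ^+ 3).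
  apply: (is_derive_val hi); rewrite /invdist (sqdist_regE e0 (ltW x0)).
  by field; rewrite gt_eqF.
apply: near_eq_is_derive h.
have : \forall y \near x, 0 < y.2.
  have := @c3_continuous R x => /(_ _ (lt_nbhsr x0)); exact.
by apply: filterS => y y0; rewrite /invdist sqdist_regE // ltW.
Qed.

Definition dkern x v : R :=
  e * (6 * (x.2 + e) * v.2 * invdist e x ^+ 5 +
   (3 * invdist e x ^+ 5 - 15 * (x.2 + e) ^+ 2 * invdist e x ^+ 7) *
   (x.1.1 * v.1.1 + x.1.2 * v.1.2 + (x.2 + e) * v.2)).

Lemma is_derive_kern x v : 0 < x.2 -> is_derive x v (kern e) (dkern x v).
Proof.
move=> x0; have hR := is_derive_invdist v x0.
have ha : is_derive x v (fun x : R3 R => x.2 + e) (v.2 : R).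
  by have := is_deriveD (is_derive_c3 x v) (is_derive_cst e x v); rewrite addr0.
have h1 := is_deriveME (is_deriveZE 3 (is_derive_pow 2 ha)) (is_derive_pow 5 hR).
have := is_deriveZE e (is_deriveBE h1 (is_derive_pow 3 hR)).
move=> h; apply: (is_derive_val h); rewrite /dkern /=; ring.
Qed.

Lemma is_derive_dkern x v : 0 < x.2 -> is_derive x v (fun x => dkern x v)
  (let R := invdist e x in let a := x.2 + e in
   let q := x.1.1 * v.1.1 + x.1.2 * v.1.2 + a * v.2 in
   e * (6 * v.2 ^+ 2 * R ^+ 5 - 60 * a * v.2 * q * R ^+ 7 + 105 * a ^+ 2 * q ^+ 2 * R ^+ 9
    - 15 * q ^+ 2 * R ^+ 7 + (3 * R ^+ 5 - 15 * a ^+ 2 * R ^+ 7) * dot v v)).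
Proof.
move=> x0; have hR := is_derive_invdist v x0.
have ha : is_derive x v (fun x : R3 R => x.2 + e) (v.2 : R).
  by have := is_deriveD (is_derive_c3 x v) (is_derive_cst e x v); rewrite addr0.
have hq := is_deriveDE (is_deriveDE (is_deriveME (is_derive_c1 x v) (is_derive_cst v.1.1 x v))
  (is_deriveME (is_derive_c2 x v) (is_derive_cst v.1.2 x v))) (is_deriveME ha (is_derive_cst v.2 x v)).
have h1 := is_deriveME (is_deriveME (is_deriveZE 6 ha) (is_derive_cst v.2 x v)) (is_derive_pow 5 hR).
have h2 := is_deriveBE (is_deriveZE 3 (is_derive_pow 5 hR))
  (is_deriveME (is_deriveZE 15 (is_derive_pow 2 ha)) (is_derive_pow 7 hR)).
have := is_deriveZE e (is_deriveDE h1 (is_deriveME h2 hq)).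
move=> h; apply: (is_derive_val h); rewrite /dot /= /cst; ring.
Qed.

Lemma near_height (x : R3 R) : 0 < x.2 -> \forall y \near x, 0 < y.2.
Proof. by move=> x0; have := @c3_continuous R x => /(_ _ (lt_nbhsr x0)); exact. Qed.

Lemma kern_harmonic x : 0 < x.2 ->
  \sum_(i < 3) 'D_(evec i) ('D_(evec i) (kern e)) x = 0.
Proof.
move=> x0.
have E i : 'D_(evec i) ('D_(evec i) (kern e)) x =
   (let R := invdist e x in let a := x.2 + e in let v := evec i : R3 _ in
   let q := x.1.1 * v.1.1 + x.1.2 * v.1.2 + a * v.2 in
   e * (6 * v.2 ^+ 2 * R ^+ 5 - 60 * a * v.2 * q * R ^+ 7 + 105 * a ^+ 2 * q ^+ 2 * R ^+ 9
    - 15 * q ^+ 2 * R ^+ 7 + (3 * R ^+ 5 - 15 * a ^+ 2 * R ^+ 7) * dot v v)).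
  rewrite -(@derive_val _ _ _ _ _ _ _ (is_derive_dkern (evec i) x0)).
  apply: near_eq_derive; apply: filterS (near_height x0) => y y0.
  by have h := is_derive_kern (evec i) y0; rewrite (@derive_val _ _ _ _ _ _ _ h).
rewrite (eq_bigr _ (fun i _ => E i)) sum3 /dot /=.
have h := invdist_sqr (ltW x0); rewrite /sqdist /sqn in h.
set r := invdist e x in h *; set a := x.2 + e in h *.
rewrite !(mulr0, mulr1, addr0, add0r, mul0r, expr0n, expr1n) /=.
(* With N the squared distance to the pole, the sum is a combination of multiples of r^2 N - 1,
   which vanishes because [r] is the inverse distance. *)
transitivity (e * (15 * r ^+ 5 - 15 * r ^+ 5 * (r ^+ 2 * (x.1.1 ^+ 2 + x.1.2 ^+ 2 + a ^+ 2))
   + 105 * a ^+ 2 * r ^+ 7 * (r ^+ 2 * (x.1.1 ^+ 2 + x.1.2 ^+ 2 + a ^+ 2) - 1))); last first.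
  by rewrite h; ring.
ring.
Qed.

End harmonic.
End Test.

(** * Size of the kernel and Laplacian of its truncation *)

Section TestBounds.
Context {R : realType}.
Implicit Types (x v : R3 R) (e rho : R).

Definition testf rho e x : R := cutoff rho x * kern e x.

Lemma Cn_testf n rho e : 0 < e -> Cn n (testf rho e).
Proof. by move=> e0; apply: CnM; [exact: Cn_cutoff|exact: Cn_kern]. Qed.

Lemma cutoff_ge0 rho x : 0 <= cutoff rho x.
Proof. by rewrite subr_ge0 step_le1. Qed.

Lemma cutoff_le1 rho x : cutoff rho x <= 1.
Proof. by rewrite gerBl step_ge0. Qed.

Lemma cutoff0 rho x : 0 < rho -> rho ^+ 2 / 2 <= dot x x -> cutoff rho x = 0.
Proof.
move=> r0 h; have r2 : 0 < rho ^+ 2 by rewrite exprn_gt0.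
rewrite /cutoff step1 ?subrr //.
have h1 : 2 <= 4 / rho ^+ 2 * dot x x.
  have -> : 2 = 4 / rho ^+ 2 * (rho ^+ 2 / 2) :> R by field; rewrite gt_eqF.
  by rewrite ler_wpM2l // divr_ge0 // ltW.
lra.
Qed.

Lemma cutoff1 rho x : 0 < rho -> dot x x <= rho ^+ 2 / 4 -> cutoff rho x = 1.
Proof.
move=> r0 h; have r2 : 0 < rho ^+ 2 by rewrite exprn_gt0.
rewrite /cutoff step0 ?subr0 //.
have h1 : 4 / rho ^+ 2 * dot x x <= 1.
  have E : 4 / rho ^+ 2 * (rho ^+ 2 / 4) = 1 by field; rewrite gt_eqF.
  by apply: le_trans (ler_wpM2l _ h) _; rewrite ?E // divr_ge0 // ltW.
lra.
Qed.

Lemma dot_enorm x : dot x x = enorm x ^+ 2.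
Proof. by rewrite sqr_sqrtr // dot_ge0. Qed.

Lemma cutoff_supp rho x : 0 < rho -> ~ (enorm x <= rho) -> cutoff rho x = 0.
Proof.
move=> r0 /negP; rewrite -ltNge => h; apply: cutoff0 => //; rewrite dot_enorm.
have : rho ^+ 2 <= enorm x ^+ 2 by rewrite ler_sqr ?nnegrE ?enorm_ge0 ?(ltW r0) // ltW.
have := sqr_ge0 rho; lra.
Qed.

Lemma testf_supp rho e : 0 < rho -> supported_in [set x | enorm x <= rho] (testf rho e).
Proof. by move=> r0 x h; rewrite /testf cutoff_supp ?mul0r. Qed.

Lemma enorm_le_closed rho : closed [set x : R3 R | enorm x <= rho].
Proof.
have -> : [set x : R3 R | enorm x <= rho] = enorm @^-1` `]-oo, rho].
  by apply/seteqP; split => x /=; rewrite in_itv.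
by apply: closed_comp => [x _|]; [exact: enorm_continuous|exact: interval_closed].
Qed.

Lemma cs_bounded rho (f : R3 R -> R) : continuous f -> (forall x, ~ (enorm x <= rho) -> f x = 0) ->
  exists2 B, 0 <= B & forall x, `|f x| <= B.
Proof.
move=> fc f0; have [B B0 hB] := continuous_bounded_cube rho fc.
exists B => // x; have [xr|xr] := pselect (enorm x <= rho); last by rewrite f0 ?normr0.
by apply: hB; exact: enorm_cube.
Qed.

(** Strictly inside the plateau the cutoff is locally constant; a neighbourhood of neighbourhoods
    serves the second derivative. *)
Lemma Dcutoff_in rho i x : 0 < rho -> dot x x < rho ^+ 2 / 4 ->
  'D_(evec i) (cutoff rho) x = 0 /\ 'D_(evec i) ('D_(evec i) (cutoff rho)) x = 0.
Proof.
move=> r0 h.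
have nb : \forall y \near x, dot y y < rho ^+ 2 / 4.
  by have := @dot_continuous R x => /(_ _ (lt_nbhsl h)); exact.
have nb' : \forall y \near x, \forall z \near y, dot z z < rho ^+ 2 / 4 by exact: near_join.
have D0 y : (\forall z \near y, dot z z < rho ^+ 2 / 4) -> 'D_(evec i) (cutoff rho) y = 0.
  move=> nz; rewrite -(@derive_cst R (R3 R) R 1 y (evec i)); apply: near_eq_derive.
  by apply: filterS nz => z hz; rewrite cutoff1 // ltW.
split; first exact: D0.
rewrite -(@derive_cst R (R3 R) R 0 x (evec i)); apply: near_eq_derive.
by apply: filterS nb' => z hz; exact: D0.
Qed.

Lemma Dcutoff_bound rho i : 0 < rho -> exists2 B, 0 <= B &
  forall x, `|'D_(evec i) (cutoff rho) x| <= B /\ `|'D_(evec i) ('D_(evec i) (cutoff rho)) x| <= B.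
Proof.
move=> r0; have C2 := Cn_cutoff 2 rho; have C1 := Cn_derive i C2; have C0 := Cn_derive i C1.
have s0 : forall x, ~ [set x : R3 R | enorm x <= rho] x -> cutoff rho x = 0 by move=> x; exact: cutoff_supp.
have s1 := @derive_supp R _ _ (evec i) (@enorm_le_closed rho) s0.
have s2 := @derive_supp R _ _ (evec i) (@enorm_le_closed rho) s1.
have [B1 B10 h1] := cs_bounded (Cn_continuous C1) s1.
have [B2 B20 h2] := cs_bounded (Cn_continuous C0) s2.
exists (B1 + B2); first exact: addr_ge0.
by move=> x; split; [apply: le_trans (h1 x) _; rewrite lerDl|apply: le_trans (h2 x) _; rewrite lerDr].
Qed.

Lemma derive2M (f g : R3 R -> R) i x : Cn 2 f -> Cn 2 g ->
  'D_(evec i) ('D_(evec i) (fun x => f x * g x)) x =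
  'D_(evec i) ('D_(evec i) f) x * g x + 2 * ('D_(evec i) f x * 'D_(evec i) g x)
  + f x * 'D_(evec i) ('D_(evec i) g) x.
Proof.
move=> fC gC; have f1 := CnS_derive fC; have g1 := CnS_derive gC.
have f2 := CnS_derive (Cn_derive i fC); have g2 := CnS_derive (Cn_derive i gC).
have -> : 'D_(evec i) (fun x => f x * g x) = (fun x => f x * 'D_(evec i) g x + g x * 'D_(evec i) f x).
  apply/funext => y; have h := is_deriveME (f1 i y) (g1 i y).
  by rewrite (@derive_val _ _ _ _ _ _ _ h).
have h := is_deriveDE (is_deriveME (f1 i x) (g2 i x)) (is_deriveME (g1 i x) (f2 i x)).
rewrite (@derive_val _ _ _ _ _ _ _ h).
move: (f x) (g x) ('D_(evec i) f x) ('D_(evec i) g x) ('D_(evec i) ('D_(evec i) f) x)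
  ('D_(evec i) ('D_(evec i) g) x) => a b c d a2 b2.
ring.
Qed.

Lemma normr_comb (a b c d A B C D : R) : `|a| <= A -> `|b| <= B -> `|c| <= C -> `|d| <= D ->
  `|a * b + 2 * (c * d)| <= A * B + 2 * (C * D).
Proof.
move=> ha hb hc hd; apply: le_trans (ler_normD _ _) _; rewrite !normrM [`|2|]ger0_norm //.
have a1 := ler_pM (normr_ge0 _) (normr_ge0 _) ha hb.
have a2 := ler_pM (normr_ge0 _) (normr_ge0 _) hc hd.
lra.
Qed.

Section bounds.
Variables (e : R) (e0 : 0 < e).
Notation r x := (invdist e x).

Let r0 x : 0 <= r x. Proof. by rewrite ltW // invdist_gt0. Qed.

Lemma invdist_components x : 0 <= x.2 ->
  [/\ r x * `|x.1.1| <= 1, r x * `|x.1.2| <= 1 & r x * (x.2 + e) <= 1].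
Proof.
move=> x0; have a0 : 0 <= x.2 + e by rewrite addr_ge0 // ltW.
have q1 := sqr_ge0 x.1.1; have q2 := sqr_ge0 x.1.2; have q3 := sqr_ge0 (x.2 + e).
by split; apply: invdist_le => //; rewrite /sqdist /sqn ?real_normK ?num_real //; lra.
Qed.

Lemma kern_bound x : 0 <= x.2 -> `|kern e x| <= 4 * e * r x ^+ 3.
Proof.
move=> x0; have [_ _ h] := invdist_components x0.
have a0 : 0 <= x.2 + e by rewrite addr_ge0 // ltW.
have h2 : (r x * (x.2 + e)) ^+ 2 <= 1 by rewrite expr_le1 ?mulr_ge0.
have r3 : 0 <= e * r x ^+ 3 by rewrite mulr_ge0 ?exprn_ge0 // ltW.
have -> : kern e x = e * r x ^+ 3 * (3 * (r x * (x.2 + e)) ^+ 2 - 1) by rewrite /kern; ring.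
rewrite normrM ger0_norm //.
have -> : 4 * e * r x ^+ 3 = e * r x ^+ 3 * 4 by ring.
rewrite ler_wpM2l // ler_norml; have := sqr_ge0 (r x * (x.2 + e)); lra.
Qed.

Lemma dkern_bound x i : 0 <= x.2 -> `|dkern e x (evec i)| <= 24 * e * r x ^+ 4.
Proof.
move=> x0; have [h1 h2 h3] := invdist_components x0; have [v1 v2 v3] := evec_le1 (R := R) i.
have a0 : 0 <= x.2 + e by rewrite addr_ge0 // ltW.
set q := x.1.1 * (evec i : R3 R).1.1 + x.1.2 * (evec i : R3 R).1.2 + (x.2 + e) * (evec i : R3 R).2.
have hq : `|r x * q| <= 1.
  rewrite /q; case: (ord3P i) => ->; rewrite /evec /= !(mulr0, mulr1, addr0, add0r).
  - by rewrite normrM ger0_norm.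
  - by rewrite normrM ger0_norm.
  - by rewrite ger0_norm ?mulr_ge0.
have h32 : 0 <= (r x * (x.2 + e)) ^+ 2 <= 1 by rewrite sqr_ge0 expr_le1 ?mulr_ge0.
have r4 : 0 <= e * r x ^+ 4 by rewrite mulr_ge0 ?exprn_ge0 // ltW.
have -> : dkern e x (evec i) = e * r x ^+ 4 * (6 * (r x * (x.2 + e) * (evec i : R3 R).2) +
   (3 - 15 * (r x * (x.2 + e)) ^+ 2) * (r x * q)) by rewrite /dkern -/q; ring.
have -> : 24 * e * r x ^+ 4 = e * r x ^+ 4 * 24 by ring.
rewrite normrM ger0_norm // ler_wpM2l //.
have k1 : `|r x * (x.2 + e) * (evec i : R3 R).2| <= 1.
  rewrite normrM -[leRHS]mulr1; apply: ler_pM => //.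
  by rewrite ger0_norm ?mulr_ge0.
have k2 : `|3 - 15 * (r x * (x.2 + e)) ^+ 2| <= 18 by rewrite ler_norml; lra.
apply: le_trans (ler_normD _ _) _; rewrite !normrM [`|6|]ger0_norm //.
have k3 := ler_pM (normr_ge0 _) (normr_ge0 _) k2 hq.
rewrite !normrM in k1 k3; lra.
Qed.

End bounds.

(** [kern] is harmonic at positive height, so only terms with a derivative of [cutoff] remain. They
    live at distance at least rho / 2 from the apex, where the inverse distance is at most 2 / rho,
    so that [kern] and its gradient are O(e). *)
Lemma laplacian_testf rho : 0 < rho -> exists2 C, 0 <= C & forall e x, 0 < e -> 0 < x.2 ->
  `|\sum_(i < 3) 'D_(evec i) ('D_(evec i) (testf rho e)) x| <= C * e.
Proof.
move=> r0.
have [B B0 hB] : exists2 B, 0 <= B & forall i x,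
    `|'D_(evec i) (cutoff rho) x| <= B /\ `|'D_(evec i) ('D_(evec i) (cutoff rho)) x| <= B.
  have [B1 B10 h1] := Dcutoff_bound i1 r0; have [B2 B20 h2] := Dcutoff_bound i2 r0.
  have [B3 B30 h3] := Dcutoff_bound i3 r0; exists (B1 + B2 + B3); first by rewrite !addr_ge0.
  move=> i x; case: (ord3P i) => ->.
  - by have [] := h1 x; split; lra.
  - by have [] := h2 x; split; lra.
  - by have [] := h3 x; split; lra.
pose k := 2 / rho; have k0 : 0 <= k by rewrite divr_ge0 // ltW.
have C0 : 0 <= 3 * (B * (4 * k ^+ 3) + 2 * (B * (24 * k ^+ 4))).
  have := exprn_ge0 3 k0; have := exprn_ge0 4 k0 => k4 k3.
  have k5 : 0 <= B * (4 * k ^+ 3) by apply: mulr_ge0 => //; lra.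
  have k6 : 0 <= B * (24 * k ^+ 4) by apply: mulr_ge0 => //; lra.
  lra.
exists (3 * (B * (4 * k ^+ 3) + 2 * (B * (24 * k ^+ 4)))) => //.
move=> e x e0 x0.
have T2 := Cn_kern 2 e0; have c2 := Cn_cutoff 2 rho.
under eq_bigr => i _ do rewrite (derive2M i x c2 T2).
rewrite big_split /= -mulr_sumr kern_harmonic // mulr0 addr0.
have hk i : 'D_(evec i) (kern e) x = dkern e x (evec i).
  by have h := is_derive_kern e0 (evec i) x0; rewrite (@derive_val _ _ _ _ _ _ _ h).
have [xs|xs] := ltP (dot x x) (rho ^+ 2 / 4).
  rewrite big1 ?normr0; last first.
    by move=> i _; have [-> ->] := Dcutoff_in i r0 xs; rewrite !mul0r mulr0 addr0.
  by apply: mulr_ge0 => //; exact: ltW.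
have rk : invdist e x <= k.
  have h : (rho / 2) ^+ 2 <= sqdist e x.
    have -> : (rho / 2) ^+ 2 = rho ^+ 2 / 4 by field.
    apply: le_trans xs _; rewrite /dot /sqdist /sqn.
    have : 0 <= 2 * x.2 * e + e ^+ 2 by rewrite addr_ge0 ?sqr_ge0 // !mulr_ge0 // ltW.
    by move=> h; rewrite -!expr2; lra.
  have := invdist_le e0 (ltW x0) (divr_ge0 (ltW r0) (ler0n _ 2)) h.
  by rewrite -ler_pdivlMr ?divr_gt0 // mul1r invf_div.
have ri0 : 0 <= invdist e x by rewrite ltW // invdist_gt0.
have kb : `|kern e x| <= 4 * k ^+ 3 * e.
  apply: le_trans (kern_bound e0 (ltW x0)) _.
  rewrite [leRHS]mulrAC ler_wpM2l ?mulr_ge0 ?(ltW e0) //.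
  by rewrite ler_pXn2r ?nnegrE.
have db i : `|'D_(evec i) (kern e) x| <= 24 * k ^+ 4 * e.
  rewrite hk; apply: le_trans (dkern_bound e0 i (ltW x0)) _.
  rewrite [leRHS]mulrAC ler_wpM2l ?mulr_ge0 ?(ltW e0) //.
  by rewrite ler_pXn2r ?nnegrE.
have t i : `|'D_(evec i) ('D_(evec i) (cutoff rho)) x * kern e x +
   2 * ('D_(evec i) (cutoff rho) x * 'D_(evec i) (kern e) x)| <=
   (B * (4 * k ^+ 3) + 2 * (B * (24 * k ^+ 4))) * e.
  have [b1 b2] := hB i x.
  have -> : (B * (4 * k ^+ 3) + 2 * (B * (24 * k ^+ 4))) * e =
    B * (4 * k ^+ 3 * e) + 2 * (B * (24 * k ^+ 4 * e)) by ring.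
  exact: normr_comb.
apply: le_trans (ler_norm_sum _ _ _) _; rewrite sum3.
apply: le_trans (lerD (lerD (t i1) (t i2)) (t i3)) _.
by rewrite le_eqVlt; apply/orP; left; apply/eqP; ring.
Qed.

End TestBounds.

(** * Integrals of negative powers over the disc and the slab *)

Section PowerIntegrals.
Context {R : realType}.
Notation mR := (measurableTypeR R).
Notation mu := (@lebesgue_measure R).
Implicit Types (b c e r : R).

(** One-dimensional majorant: products of such profiles dominate negative powers of the distance,
    which replaces polar coordinates. *)
Definition pw c e b (s : R) : R := (c * `|s| + e) `^ (- b).

Lemma pw_ge0 c e b s : 0 <= pw c e b s. Proof. exact: powR_ge0. Qed.

Lemma powR_continuous_pos (T : topologicalType) (g : T -> R) (a : R) : continuous g ->
  (forall s, 0 < g s) -> continuous (fun s => g s `^ a : R).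
Proof.
move=> gc g0 s.
have h : {for g s, continuous (fun u : R => u `^ a : R)}.
  apply: differentiable_continuous; apply/derivable1_diffP.
  by case: (is_derive1_powR a (g0 s)).
exact: (continuous_comp (gc s) h).
Qed.

Lemma powR_le_opp (x y b : R) : 0 <= b -> 0 < x -> x <= y -> y `^ (- b) <= x `^ (- b).
Proof.
move=> b0 x0 xy; have y0 : 0 < y := lt_le_trans x0 xy.
rewrite !powRN lef_pV2 ?posrE ?powR_gt0 //.
by apply: ge0_ler_powR; rewrite ?nnegrE // ltW.
Qed.

Section oneD.
Variables (c e b : R).
Hypotheses (c0 : 0 < c) (e0 : 0 < e) (b1 : 1 < b).

Lemma pw_base_gt0 (s : R) : 0 < c * `|s| + e.
Proof. by rewrite ltr_wpDl // mulr_ge0 // ltW. Qed.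

Lemma pw_continuous : continuous (pw c e b).
Proof.
apply: powR_continuous_pos; last exact: pw_base_gt0.
move=> s; apply: cvgD; last exact: cvg_cst.
by apply: cvgMr; exact: norm_continuous.
Qed.

Lemma is_derive_pw_prim (k t : R) : 0 < k * t + e -> k != 0 ->
  is_derive t 1 (fun s => - (k * (b - 1))^-1 * (k * s + e) `^ (1 - b)) ((k * t + e) `^ (- b)).
Proof.
move=> t0 k0; have b0 : b - 1 != 0 by rewrite gt_eqF // subr_gt0.
have h1 : is_derive t 1 (fun s : R => k * s + e) k.
  by have := is_derive_affine k e t; under eq_fun do rewrite mulrC.
have h2 := @is_derive1_comp R (fun u => u `^ (1 - b)) (fun s : R => k * s + e) t _ _
  (is_derive1_powR (1 - b) t0) h1.
have := is_deriveZ (- (k * (b - 1))^-1) h2.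
move=> h; apply: (is_derive_val h).
have -> : 1 - b - 1 = - b by ring.
rewrite /GRing.scale /=; field; by rewrite k0 b0.
Qed.

(** Here [k] is [c] or [- c], according to the side of 0 on which the interval lies; it gives the
    primitive the right sign. *)
Lemma int_pw_half (k : R) (a a' : R) : a < a' -> k != 0 ->
  (forall s, s \in `[a, a'] -> k * s = c * `|s|) ->
  (\int[mu]_(s in `[a, a']) (pw c e b s)%:E <=
   (- (k * (b - 1))^-1 * (k * a' + e) `^ (1 - b) + (k * (b - 1))^-1 * (k * a + e) `^ (1 - b))%:E)%E.
Proof.
move=> aa k0 hk.
have H : (\int[mu]_(s in `[a, a']) (pw c e b s)%:E <=
   ((fun s => - (k * (b - 1))^-1 * (k * s + e) `^ (1 - b)) a' -
    (fun s => - (k * (b - 1))^-1 * (k * s + e) `^ (1 - b)) a)%:E +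
   \int[mu]_(s in `[a, a']) (cst (0:R) s)%:E)%E.
  apply: (@FTC_le R (fun s => - (k * (b - 1))^-1 * (k * s + e) `^ (1 - b)) (pw c e b) (pw c e b) (cst 0) a a' aa).
  - move=> s sa; rewrite /pw -hk //; apply: is_derive_pw_prim => //.
    by rewrite hk //; exact: pw_base_gt0.
  - by apply: continuous_subspaceT; exact: pw_continuous.
  - by apply: continuous_subspaceT; exact: pw_continuous.
  - by apply: continuous_subspaceT; exact: cst_continuous.
  - by move=> s _; rewrite addr0.
apply: (le_trans H); rewrite /cst integral0 adde0 lee_fin.
by rewrite [in leLHS]mulNr [in leLHS]mulNr opprK mulNr.
Qed.

Lemma int_pw r : 0 < r ->
  (\int[mu]_(s in `[(- r)%R, r]) (pw c e b s)%:E <= (2 / (c * (b - 1)) * e `^ (1 - b))%:E)%E.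
Proof.
move=> r0; have b0 : 0 < b - 1 by rewrite subr_gt0.
have mpw D : measurable_fun (D : set mR) (fun s => (pw c e b s)%:E).
  by apply/measurable_EFinP; apply: measurable_funTS; apply: continuous_measurable_fun; exact: pw_continuous.
have pE s : (0 <= (pw c e b s)%:E)%E by rewrite lee_fin pw_ge0.
have SU : [set` `[(- r)%R, r]] = [set` `[(- r)%R, 0[] `|` [set` `[0, r]].
  apply/seteqP; split => s /=; rewrite !in_itv /=.
    by move=> /andP[s1 s2]; have [s0|s0] := ltP s 0; [left; rewrite s1|right].
  by case=> /andP[s1 s2]; apply/andP; split; lra.
rewrite SU ge0_integral_setU //=; last first.
  apply/disj_set2P; apply/seteqP; split => // s /=; rewrite !in_itv /=.
  by move=> [/andP[_ s1] /andP[s2 _]]; lra.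
have rn : - r < 0 by rewrite oppr_lt0.
have cn : - c != 0 by rewrite oppr_eq0 gt_eqF.
have h1 : (\int[mu]_(s in `[0%R, r]) (pw c e b s)%:E <= ((c * (b - 1))^-1 * e `^ (1 - b))%:E)%E.
  apply: (le_trans (@int_pw_half c 0 r r0 (lt0r_neq0 c0) _)).
    by move=> s; rewrite in_itv /= => /andP[s0 _]; rewrite ger0_norm.
  rewrite lee_fin mulr0 add0r gerDr mulNr oppr_le0 mulr_ge0 ?powR_ge0 //.
  by rewrite invr_ge0 mulr_ge0 // ltW.
have h2 : (\int[mu]_(s in `[(- r)%R, 0%R]) (pw c e b s)%:E <= ((c * (b - 1))^-1 * e `^ (1 - b))%:E)%E.
  apply: (le_trans (@int_pw_half (- c) (- r) 0 rn cn _)).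
    by move=> s; rewrite in_itv /= => /andP[_ s0]; rewrite ler0_norm // mulrN mulNr.
  rewrite lee_fin mulr0 add0r [- c * (b - 1)]mulNr invrN opprK gerDl mulNr oppr_le0.
  by rewrite mulr_ge0 ?powR_ge0 // invr_ge0 mulr_ge0 // ltW.
have h3 : (\int[mu]_(s in `[(- r)%R, 0%R[) (pw c e b s)%:E <= \int[mu]_(s in `[(- r)%R, 0%R]) (pw c e b s)%:E)%E.
  apply: ge0_subset_integral => //.
  by move=> s /=; rewrite !in_itv /= => /andP[-> /ltW].
apply: le_trans (leeD (le_trans h3 h2) h1) _.
by rewrite -EFinD lee_fin le_eqVlt; apply/orP; left; apply/eqP; ring.
Qed.

End oneD.

Lemma prod_integral2 (f g : mR -> R) : measurable_fun setT f -> measurable_fun setT g ->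
  (forall s, 0 <= f s) -> (forall s, 0 <= g s) ->
  (\int[leb2]_y (f y.1 * g y.2)%:E = \int[mu]_s (f s)%:E * \int[mu]_s (g s)%:E)%E.
Proof.
move=> mf mg f0 g0; rewrite tonelli2; last first.
- apply/measurable_EFinP; apply: measurable_funM.
    by apply: (measurableT_comp mf); exact: measurable_fst.
  by apply: (measurableT_comp mg); exact: measurable_snd.
- by move=> y; rewrite lee_fin mulr_ge0.
rewrite /=; under eq_integral do rewrite (int_Zl _ measurableT mg (fun s _ => g0 s) (f0 _)) //.
rewrite -ge0_integralZr //; [exact/measurable_EFinP|by move=> s _; rewrite lee_fin|].
by apply: integral_ge0 => s _; rewrite lee_fin.
Qed.

Lemma prod_integral3 (f : mR * mR -> R) (g : mR -> R) : measurable_fun setT f ->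
  measurable_fun setT g -> (forall s, 0 <= f s) -> (forall s, 0 <= g s) ->
  (\int[leb3]_x (f x.1 * g x.2)%:E = \int[leb2]_y (f y)%:E * \int[mu]_s (g s)%:E)%E.
Proof.
move=> mf mg f0 g0; rewrite tonelli3; last first.
- apply/measurable_EFinP; apply: measurable_funM.
    by apply: (measurableT_comp mf); exact: measurable_fst.
  by apply: (measurableT_comp mg); exact: measurable_snd.
- by move=> y; rewrite lee_fin mulr_ge0.
rewrite /=; under eq_integral do rewrite (int_Zl _ measurableT mg (fun s _ => g0 s) (f0 _)) //.
rewrite -ge0_integralZr //; [exact/measurable_EFinP|by move=> s _; rewrite lee_fin|].
by apply: integral_ge0 => s _; rewrite lee_fin.
Qed.

Definition pwr c e b r : mR -> R := (pw c e b) \_ `[(- r)%R, r].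

Lemma pwr_ge0 c e b r s : 0 <= pwr c e b r s.
Proof. by rewrite /pwr patchE; case: ifP => // _; exact: pw_ge0. Qed.

Lemma measurable_pwr c e b r : 0 < c -> 0 < e -> measurable_fun setT (pwr c e b r).
Proof.
move=> c0 e0; apply/(measurable_restrictT _ _).1 => //.
apply: measurable_funTS; apply: continuous_measurable_fun; exact: (@pw_continuous c e b c0 e0).
Qed.

Lemma int_pwr c e b r : 0 < c -> 0 < e -> 1 < b -> 0 < r ->
  (\int[mu]_s (pwr c e b r s)%:E <= (2 / (c * (b - 1)) * e `^ (1 - b))%:E)%E.
Proof.
move=> c0 e0 b1 r0; apply: le_trans (int_pw c0 e0 b1 r0).
rewrite [leRHS]integral_mkcond le_eqVlt; apply/orP; left; apply/eqP.
by apply: eq_integral => s _; rewrite /pwr !patchE; case: ifP.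
Qed.

(** Each coordinate is at most the planar norm, so the power -2 b is dominated by a product of two
    profiles of exponent -b, each of integral O(e^(1 - b)). *)
Lemma disc_powR c b r : 0 < c -> 1 < b -> 0 < r -> exists2 K, 0 <= K & forall e, 0 < e ->
  (\int[leb2]_(y in disc r) ((zc c y + e) `^ (- (2 * b)))%:E <= (K * e `^ (2 - 2 * b))%:E)%E.
Proof.
move=> c0 b1 r0; have b0 : 0 < b - 1 by rewrite subr_gt0.
pose k := 2 / (c * (b - 1)); have k0 : 0 <= k by rewrite divr_ge0 // mulr_ge0 // ltW.
exists (k ^+ 2); first exact: sqr_ge0.
move=> e e0; have mp := @measurable_pwr c e b r c0 e0.
apply: (@le_trans _ _ (\int[leb2]_y (pwr c e b r y.1 * pwr c e b r y.2)%:E)%E); last first.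
  rewrite prod_integral2 //; [|exact: pwr_ge0|exact: pwr_ge0].
  have h := int_pwr c0 e0 b1 r0.
  have i0 : (0 <= \int[mu]_s (pwr c e b r s)%:E)%E.
    by apply: integral_ge0 => s _; rewrite lee_fin pwr_ge0.
  apply: le_trans (lee_pmul i0 i0 h h) _.
  rewrite -EFinM lee_fin -/k.
  have -> : 2 - 2 * b = (1 - b) + (1 - b) by ring.
  rewrite [e `^ (_ + (1 - b))]powRD; last by rewrite (gt_eqF e0) implybT.
  by rewrite le_eqVlt; apply/orP; left; apply/eqP; ring.
rewrite integral_mkcond; apply: ge0_le_integral => //.
- by move=> y _; rewrite patchE; case: ifP => // _; rewrite lee_fin powR_ge0.
- apply/(measurable_restrictT _ _).1; first exact: disc_measurable.
  apply/measurable_EFinP; apply: continuous_measurable_R2.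
  apply: (@powR_continuous_pos _ (fun y => zc c y + e)).
    by move=> y; apply: cvgD; [exact: zc_continuous|exact: cvg_cst].
  by move=> y; rewrite ltr_wpDl // zc_ge0 // ltW.
- apply/measurable_EFinP; apply: measurable_funM.
    by apply: (measurableT_comp mp); exact: measurable_fst.
  by apply: (measurableT_comp mp); exact: measurable_snd.
move=> y _; rewrite patchE; case: ifPn; rewrite ?inE => yd; last first.
  by rewrite lee_fin mulr_ge0 // pwr_ge0.
have [h1 h2] := disc_sub_square (ltW r0) yd.
rewrite lee_fin /pwr !patchE !mem_set //.
have q0 := sqn_ge0 y.
have z1 : c * `|y.1| <= zc c y.
  rewrite ler_wpM2l ?(ltW c0) // -ler_sqr ?nnegrE ?sqrtr_ge0 // real_normK ?num_real //.
  by rewrite sqr_sqrtr // lerDl sqr_ge0.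
have z2 : c * `|y.2| <= zc c y.
  rewrite ler_wpM2l ?(ltW c0) // -ler_sqr ?nnegrE ?sqrtr_ge0 // real_normK ?num_real //.
  by rewrite sqr_sqrtr // lerDr sqr_ge0.
have zp : 0 < zc c y + e by rewrite ltr_wpDl // zc_ge0 // ltW.
have -> : - (2 * b) = - b + - b by ring.
rewrite powRD; last by rewrite (gt_eqF zp) implybT.
have bb : 0 <= b by lra.
apply: ler_pM; rewrite ?powR_ge0 // /pw; apply: powR_le_opp => //;
  by rewrite ?lerD2r // ltr_wpDl // mulr_ge0 // ltW.
Qed.

(** As in the plane, with a third factor for the vertical variable: on the slab the height dominates
    [m] times each horizontal coordinate, so the power -3 b splits into three profiles. *)
Lemma slab_powR m r b : 0 < m -> 0 < r -> 1 < b -> exists2 K, 0 <= K & forall e, 0 < e ->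
  (\int[leb3]_(x in slab (disc r) (zc m) r) ((x.2 + e) `^ (- (3 * b)))%:E
    <= (K * e `^ (3 - 3 * b))%:E)%E.
Proof.
move=> m0 r0 b1; have b0 : 0 < b - 1 by rewrite subr_gt0.
have bb : 0 <= b by lra.
(* Heights in the slab are below m r + r. *)
pose r' := (m + 1) * r; have r'0 : 0 < r' by rewrite mulr_gt0 // addr_gt0.
pose k := 2 / (m * (b - 1)); have k0 : 0 <= k by rewrite divr_ge0 // mulr_ge0 // ltW.
pose k' := 2 / (1 * (b - 1)); have k'0 : 0 <= k' by rewrite divr_ge0 // mulr_ge0 // ltW.
exists (k ^+ 2 * k'); first by rewrite mulr_ge0 ?sqr_ge0.
move=> e e0; have mp := @measurable_pwr m e b r m0 e0.
have mp' := @measurable_pwr 1 e b r' ltr01 e0.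
have mpp : measurable_fun setT (fun y : mR * mR => pwr m e b r y.1 * pwr m e b r y.2).
  apply: measurable_funM.
    by apply: (measurableT_comp mp); exact: measurable_fst.
  by apply: (measurableT_comp mp); exact: measurable_snd.
have pp0 (y : mR * mR) : 0 <= pwr m e b r y.1 * pwr m e b r y.2 by rewrite mulr_ge0 // pwr_ge0.
apply: (@le_trans _ _ (\int[leb3]_x (pwr m e b r x.1.1 * pwr m e b r x.1.2 * pwr 1 e b r' x.2)%:E)%E); last first.
  rewrite (prod_integral3 mpp mp') //; last exact: pwr_ge0.
  rewrite prod_integral2 //; [|exact: pwr_ge0|exact: pwr_ge0].
  have h := int_pwr m0 e0 b1 r0; have h' := int_pwr (@ltr01 R) e0 b1 r'0.
  have i0 c' r'' : (0 <= \int[mu]_s (pwr c' e b r'' s)%:E)%E.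
    by apply: integral_ge0 => s _; rewrite lee_fin pwr_ge0.
  apply: le_trans (lee_pmul (mule_ge0 (i0 _ _) (i0 _ _)) (i0 _ _) (lee_pmul (i0 _ _) (i0 _ _) h h) h') _.
  rewrite -!EFinM lee_fin -/k -/k'.
  have -> : 3 - 3 * b = (1 - b) + ((1 - b) + (1 - b)) by ring.
  have ee : e != 0 by rewrite gt_eqF.
  rewrite [e `^ (_ + (1 - b + _))]powRD; last by rewrite ee implybT.
  rewrite [e `^ (_ + (1 - b))]powRD; last by rewrite ee implybT.
  by rewrite le_eqVlt; apply/orP; left; apply/eqP; ring.
have hx (x : R3 R) : slab (disc r) (zc m) r x -> 0 <= x.2.
  by move=> [_ /andP[h _]]; apply: le_trans (ltW h); rewrite zc_ge0 // ltW.
rewrite integral_mkcond; apply: ge0_le_integral => //.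
- by move=> x _; rewrite patchE; case: ifP => // _; rewrite lee_fin powR_ge0.
- apply/(measurable_restrictT _ _).1; first exact: slab_measurable.
  apply/measurable_EFinP; apply: (@eq_measurable_fun _ _ _ _ _ (fun x : mR3 R => (`|x.2| + e) `^ (- (3 * b)) : R)).
    by move=> x; rewrite inE => /hx x0; rewrite ger0_norm.
  apply: continuous_measurable_R3; apply: (@powR_continuous_pos _ (fun x : R3 R => `|x.2| + e)).
    by move=> x; apply: cvgD; [apply: cvg_norm; exact: c3_continuous|exact: cvg_cst].
  by move=> x; rewrite ltr_wpDl.
- apply/measurable_EFinP; apply: measurable_funM.
    by apply: (measurableT_comp mpp); exact: measurable_fst.
  by apply: (measurableT_comp mp'); exact: measurable_snd.
move=> x _; rewrite patchE; case: ifPn; rewrite ?inE => xd; last first.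
  by rewrite lee_fin mulr_ge0 // pwr_ge0.
have x0 := hx _ xd; have [yd /andP[z1 z2]] := xd.
have [h1 h2] := disc_sub_square (ltW r0) yd.
have y1 : `|x.1.1| <= Num.sqrt (sqn x.1).
  by rewrite -ler_sqr ?nnegrE ?sqrtr_ge0 // real_normK ?num_real // sqr_sqrtr ?sqn_ge0 // lerDl sqr_ge0.
have y2 : `|x.1.2| <= Num.sqrt (sqn x.1).
  by rewrite -ler_sqr ?nnegrE ?sqrtr_ge0 // real_normK ?num_real // sqr_sqrtr ?sqn_ge0 // lerDr sqr_ge0.
have sr : Num.sqrt (sqn x.1) <= r.
  by rewrite -ler_sqr ?nnegrE ?sqrtr_ge0 ?(ltW r0) // sqr_sqrtr ?sqn_ge0 // ltW.
have h3 : x.2 \in `[- r', r'].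
  rewrite in_itv /= -ler_norml ger0_norm //; apply: le_trans (ltW z2) _.
  by rewrite /r' mulrDl mul1r lerD2r ler_wpM2l // ltW.
rewrite lee_fin /pwr !patchE !mem_set //.
have z1' : m * Num.sqrt (sqn x.1) <= x.2 := ltW z1.
have l1 : m * `|x.1.1| <= x.2 by apply: le_trans z1'; rewrite ler_wpM2l // ltW.
have l2 : m * `|x.1.2| <= x.2 by apply: le_trans z1'; rewrite ler_wpM2l // ltW.
have l3 : 1 * `|x.2| <= x.2 by rewrite mul1r ger0_norm.
have zp : 0 < x.2 + e by rewrite ltr_wpDl.
have -> : - (3 * b) = - b + - b + - b by ring.
rewrite powRD; last by rewrite (gt_eqF zp) implybT.
rewrite powRD; last by rewrite (gt_eqF zp) implybT.
apply: ler_pM; rewrite ?mulr_ge0 ?powR_ge0 //; first apply: ler_pM; rewrite ?powR_ge0 //;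
  by rewrite /pw; apply: powR_le_opp => //; rewrite ?lerD2r // ltr_wpDl // mulr_ge0 // ltW.
Qed.

End PowerIntegrals.

(** * The mass of the kernel on the lateral surface *)

Section GraphIntegral.
Context {R : realType}.
Notation mR := (measurableTypeR R).
Notation mu := (@lebesgue_measure R).

Section fixed.
Variables (m rho e : R).
Hypotheses (m0 : 0 < m) (rho0 : 0 < rho) (e0 : 0 < e).

(* profiles on the graph as functions of [q = s^2 + t^2] *)
Definition ga (q : R) : R := m * Num.sqrt q + e.
Definition gr (q : R) : R := (Num.sqrt (q + ga q ^+ 2))^-1.
Definition gk (q : R) : R := ga q * gr q ^+ 3.
Definition gw : R := 4 / rho ^+ 2 * (1 + m ^+ 2).
Definition gx (q : R) : R := 1 - step (gw * q - 1).
Definition gdx (q : R) : R := - (dstep (gw * q - 1) * gw).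

(** The derivative in [s] of [s * gk q * gx q], written out; [gx] is the cutoff on the graph, where
    the squared distance to the apex is (1 + m^2) q. At the origin division by 0 gives the quotient
    [s ^+ 2 / Num.sqrt q] the value 0, which is its limit. *)
Definition gD (s t : R) : R :=
  let q := s ^+ 2 + t ^+ 2 in let g := s ^+ 2 / Num.sqrt q in
  gk q * gx q + (m * g * gr q ^+ 3 - 3 * ga q * gr q ^+ 5 * (s ^+ 2 + ga q * m * g)) * gx q
  + 2 * s ^+ 2 * gk q * gdx q.

Lemma gw_gt0 : 0 < gw.
Proof.
have h1 : 0 < 1 + m ^+ 2 by rewrite ltr_pwDl // sqr_ge0.
by rewrite mulr_gt0 // divr_gt0 // exprn_gt0.
Qed.

Lemma ga_gt0 q : 0 < ga q.
Proof. by rewrite ltr_wpDl // mulr_ge0 ?sqrtr_ge0 // ltW. Qed.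

Lemma grN_gt0 q : 0 <= q -> 0 < q + ga q ^+ 2.
Proof. by move=> q0; rewrite ltr_wpDl // exprn_gt0 // ga_gt0. Qed.

Lemma gr_gt0 q : 0 <= q -> 0 < gr q.
Proof. by move=> q0; rewrite invr_gt0 sqrtr_gt0 grN_gt0. Qed.

Lemma gr_sqr q : 0 <= q -> gr q ^+ 2 * (q + ga q ^+ 2) = 1.
Proof.
move=> q0; rewrite /gr exprVn sqr_sqrtr ?(ltW (grN_gt0 q0)) // mulVf // gt_eqF // grN_gt0 //.
Qed.

Lemma ga_continuous : continuous ga.
Proof. by move=> q; apply: cvgD; [apply: cvgMr; exact: sqrt_continuous|exact: cvg_cst]. Qed.

Lemma gr_continuous (q : R) : 0 <= q -> {for q, continuous gr}.
Proof.
move=> q0; apply: cvgV; first by rewrite gt_eqF // sqrtr_gt0 grN_gt0.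
apply: (@continuous_comp _ _ _ (fun q => q + ga q ^+ 2) Num.sqrt); last exact: sqrt_continuous.
apply: cvgD; first exact: cvg_id.
by rewrite expr2; under eq_fun do rewrite expr2; apply: cvgM; exact: ga_continuous.
Qed.

Lemma gk_continuous (q : R) : 0 <= q -> {for q, continuous gk}.
Proof.
move=> q0; apply: cvgM; first exact: ga_continuous.
have h := gr_continuous q0; rewrite !exprS expr0.
under eq_fun do rewrite !exprS expr0.
by apply: cvgM => //; apply: cvgM => //; apply: cvgM => //; exact: cvg_cst.
Qed.

Lemma gx_continuous : continuous gx.
Proof.
move=> q; apply: cvgB; first exact: cvg_cst.
apply: (@continuous_comp _ _ _ (fun q => gw * q - 1) step); last exact: step_continuous.
by apply: cvgB; [apply: cvgMr; exact: cvg_id|exact: cvg_cst].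
Qed.

Lemma gdx_continuous : continuous gdx.
Proof.
move=> q; apply: cvgN; apply: cvgM; last exact: cvg_cst.
apply: (@continuous_comp _ _ _ (fun q => gw * q - 1) dstep); last exact: dstep_continuous.
by apply: cvgB; [apply: cvgMr; exact: cvg_id|exact: cvg_cst].
Qed.

Lemma is_derive_ga (q : R) : 0 < q -> is_derive q 1 ga (m * (2 * Num.sqrt q)^-1).
Proof.
move=> q0; have := is_deriveD (is_deriveZ m (is_derive1_sqrt q0)) (is_derive_cst e q 1).
by rewrite addr0.
Qed.

Lemma is_derive_gk (q : R) : 0 < q -> is_derive q 1 gk
  (m / (2 * Num.sqrt q) * gr q ^+ 3 -
   3 * ga q * gr q ^+ 5 * (1 / 2 + ga q * (m / (2 * Num.sqrt q)))).
Proof.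
move=> q0; have N0 := grN_gt0 (ltW q0); have ha := is_derive_ga q0.
have hs0 : 0 < Num.sqrt (q + ga q ^+ 2) by rewrite sqrtr_gt0.
have h1 : is_derive q 1 (fun q : R => q + ga q ^+ 2) _ := is_deriveDE (is_derive_id q 1) (is_derive_pow 2 ha).
have h2 := @is_derive1_comp R Num.sqrt _ q _ _ (is_derive1_sqrt N0) h1.
have h3 : is_derive q 1 gr _ := @is_derive1_comp R (@GRing.inv R) _ q _ _ (is_derive1_inv (lt0r_neq0 hs0)) h2.
have h4 := is_deriveME ha (is_derive_pow 3 h3).
apply: (is_derive_val h4); rewrite /= /gr.
have sq : Num.sqrt q != 0 by rewrite gt_eqF // sqrtr_gt0.
have := lt0r_neq0 hs0.
set B := Num.sqrt (q + ga q ^+ 2) => B0.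
by field; rewrite B0 sq.
Qed.

Lemma is_derive_gx (q : R) : is_derive q 1 gx (gdx q).
Proof.
have h1 : is_derive q 1 (fun q : R => gw * q - 1) gw.
  have := is_derive_affine gw (- 1) q; by under eq_fun do rewrite mulrC.
have h2 := @is_derive1_comp R step _ q _ _ (is_derive_step _) h1.
have := is_deriveB (is_derive_cst (1 : R) q 1) h2.
by rewrite sub0r.
Qed.

(** The square root inside [ga] blocks the chain rule at the origin. There the factor [s] helps: the
    slope is [gk * gx], which is continuous. *)
Lemma is_derive_gF (s t : R) :
  is_derive s 1 (fun s => gk (s ^+ 2 + t ^+ 2) * gx (s ^+ 2 + t ^+ 2) * s) (gD s t).
Proof.
have [q0|q0] := ltP 0 (s ^+ 2 + t ^+ 2).
  have hq : is_derive s 1 (fun s : R => s ^+ 2 + t ^+ 2) (2 * s).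
    have := is_deriveD (is_deriveM (is_derive_id s 1) (is_derive_id s 1)) (is_derive_cst (t ^+ 2) s 1).
    have -> : (id * id + cst (t ^+ 2) : R -> R) = (fun s : R => s ^+ 2 + t ^+ 2).
      by apply/funext => z; rewrite /= expr2.
    by move=> h; apply: (is_derive_val h); rewrite /GRing.scale /=; ring.
  have h1 := @is_derive1_comp R gk _ s _ _ (is_derive_gk q0) hq.
  have h2 := @is_derive1_comp R gx _ s _ _ (is_derive_gx _) hq.
  have := is_deriveME (is_deriveME h1 h2) (is_derive_id s 1).
  move=> h; apply: (is_derive_val h); rewrite /gD /=.
  have sq : Num.sqrt (s ^+ 2 + t ^+ 2) != 0 by rewrite gt_eqF // sqrtr_gt0.
  by field.
have [s0 t0] : s = 0 /\ t = 0.
  have h1 := sqr_ge0 s; have h2 := sqr_ge0 t.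
  by split; apply/eqP; rewrite -sqrf_eq0; apply/eqP; lra.
rewrite s0 t0; apply/is_derive1_caratheodory.
exists (fun s => gk (s ^+ 2 + 0 ^+ 2) * gx (s ^+ 2 + 0 ^+ 2)); split.
- by move=> z; rewrite mulr0 !subr0.
- have hc : {for (0 : R), continuous (fun s : R => s ^+ 2 + 0 ^+ 2)}.
    by apply: cvgD; [under eq_fun do rewrite expr2; rewrite expr2; apply: cvgM; exact: cvg_id|exact: cvg_cst].
  apply: cvgM.
    apply: (continuous_comp hc); apply: gk_continuous.
    by rewrite addr_ge0 // sqr_ge0.
  by apply: (continuous_comp hc); exact: gx_continuous.
- by rewrite /gD !expr0n /= !(mulr0, mul0r, addr0, subr0).
Qed.

End fixed.
End GraphIntegral.

Section GraphIntegral2.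
Context {R : realType}.
Notation mR := (measurableTypeR R).
Notation mu := (@lebesgue_measure R).

Lemma continuous_pow (T : topologicalType) (f : T -> R) n (x : T) : {for x, continuous f} ->
  {for x, continuous (fun y => f y ^+ n)}.
Proof.
move=> fc; elim: n => [|n ih].
  have -> : (fun y => f y ^+ 0) = cst 1 by apply/funext => y; rewrite expr0.
  exact: cst_continuous.
have -> : (fun y => f y ^+ n.+1) = (fun y => f y * f y ^+ n) by apply/funext => y; rewrite exprS.
exact: (cvgM fc ih).
Qed.

(** The ratio is at most [Num.sqrt (sqn y)], hence tends to 0 at the origin, the value that division
    by 0 assigns there. *)
Lemma sqn_ratio_continuous : continuous (fun y : R * R => y.1 ^+ 2 / Num.sqrt (sqn y)).
Proof.
move=> y.
have c1 : {for y, continuous (fun y : R * R => y.1 ^+ 2)}.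
  by apply: continuous_pow; exact: fst_continuous2.
have c2 : {for y, continuous (fun y : R * R => Num.sqrt (sqn y))}.
  by apply: (@continuous_comp _ _ _ sqn Num.sqrt); [exact: sqn_continuous|exact: sqrt_continuous].
have [q0|q0] := ltP 0 (sqn y).
  by apply: cvgM => //; apply: cvgV => //; rewrite gt_eqF // sqrtr_gt0.
have s0 : Num.sqrt (sqn y) = 0 by rewrite ler0_sqrtr.
rewrite /continuous_at s0 invr0 mulr0.
apply/cvgr0Pnorm_lt => e e0.
have : \forall z \near y, `|Num.sqrt (sqn z)| < e.
  have c3 : Num.sqrt (sqn z) @[z --> y] --> (0 : R) by rewrite -s0; exact: c2.
  by move/cvgr0Pnorm_lt : c3; apply.
apply: filterS => z; apply: le_lt_trans.
have h1 := sqr_ge0 z.1; have h2 := sqr_ge0 z.2.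
have [q1|q1] := ltP 0 (sqn z); last by rewrite ler0_sqrtr // invr0 mulr0 normr0.
have s1 : 0 < Num.sqrt (sqn z) by rewrite sqrtr_gt0.
rewrite normrM ger0_norm // ger0_norm ?invr_ge0 ?(ltW s1) // ler_pdivrMr // ger0_norm ?(ltW s1) //.
by rewrite -expr2 sqr_sqrtr ?sqn_ge0 // /sqn lerDl.
Qed.

Section fixed.
Variables (m rho e : R).
Hypotheses (m0 : 0 < m) (rho0 : 0 < rho) (e0 : 0 < e).
Notation D := (gD m rho e).

Let qc (f : R -> R) : (forall q, 0 <= q -> {for q, continuous f}) -> continuous (fun y : R * R => f (sqn y)).
Proof.
by move=> fc y; apply: (@continuous_comp _ _ _ sqn f); [exact: sqn_continuous|apply: fc; exact: sqn_ge0].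
Qed.

Lemma gD_continuous : continuous (fun y : R * R => D y.1 y.2).
Proof.
have kc := @qc (gk m e) (gk_continuous m0 e0).
have xc := @qc (gx m rho) (fun q _ => @gx_continuous R m rho q).
have dc := @qc (gdx m rho) (fun q _ => @gdx_continuous R m rho q).
have ac := @qc (ga m e) (fun q _ => @ga_continuous R m e q).
have rc := @qc (gr m e) (gr_continuous m0 e0).
have gc := sqn_ratio_continuous.
have powc n (f : R * R -> R) : continuous f -> continuous (fun y => f y ^+ n).
  by move=> fc y; apply: continuous_pow; exact: fc.
have cM (f g : R * R -> R) : continuous f -> continuous g -> continuous (fun y => f y * g y).
  by move=> fc hc y; apply: cvgM; [exact: fc|exact: hc].
have cD (f g : R * R -> R) : continuous f -> continuous g -> continuous (fun y => f y + g y).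
  by move=> fc hc y; apply: cvgD; [exact: fc|exact: hc].
have cB (f g : R * R -> R) : continuous f -> continuous g -> continuous (fun y => f y - g y).
  by move=> fc hc y; apply: cvgB; [exact: fc|exact: hc].
have cc (a : R) : continuous (fun _ : R * R => a) by exact: cst_continuous.
have s2 := powc 2%N _ (@fst_continuous2 R).
have r3 := powc 3%N _ rc; have r5 := powc 5%N _ rc.
apply: (cD _ _ (cD _ _ (cM _ _ kc xc) (cM _ _ (cB _ _ (cM _ _ (cM _ _ (cc m) gc) r3)
  (cM _ _ (cM _ _ (cM _ _ (cc 3) ac) r5) (cD _ _ s2 (cM _ _ (cM _ _ ac (cc m)) gc)))) xc))
  (cM _ _ (cM _ _ (cM _ _ (cc 2) s2) kc) dc)).
Qed.

Lemma gx_out q : rho ^+ 2 <= q -> gx m rho q = 0 /\ gdx m rho q = 0.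
Proof.
move=> h; have r2 : 0 < rho ^+ 2 by rewrite exprn_gt0.
have h1 : 1 <= gw m rho * q - 1.
  have : 4 <= gw m rho * q.
    have -> : 4 = 4 / rho ^+ 2 * 1 * rho ^+ 2 :> R by field; rewrite gt_eqF.
    have k0 : 0 <= 4 / rho ^+ 2 by rewrite divr_ge0 // ltW.
    apply: ler_pM => //; [by rewrite mulr1|exact: ltW|].
    by rewrite /gw ler_wpM2l // lerDl sqr_ge0.
  lra.
by rewrite /gx /gdx step1 // dstep1 // subrr mul0r oppr0.
Qed.

Lemma gD_out s t : rho < `|s| \/ rho < `|t| -> D s t = 0.
Proof.
move=> h; have hq : rho ^+ 2 <= s ^+ 2 + t ^+ 2.
  have h1 := sqr_ge0 s; have h2 := sqr_ge0 t.
  have k (z : R) : rho < `|z| -> rho ^+ 2 <= z ^+ 2.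
    by move=> hz; rewrite -(real_normK (num_real z)) ler_sqr ?nnegrE ?(ltW rho0) // ltW.
  by case: h => /k; lra.
by have [x0 d0] := gx_out hq; rewrite /gD x0 d0 !mulr0 !addr0.
Qed.

Lemma gD_slice0 t : (\int[mu]_s (D s t)%:E = 0)%E.
Proof.
apply: (@int_derive0_1D R (fun s => gk m e (s ^+ 2 + t ^+ 2) * gx m rho (s ^+ 2 + t ^+ 2) * s) (fun s => D s t) (rho + rho)).
- by rewrite addr_gt0.
- by move=> s; exact: is_derive_gF.
- have -> : (fun s => D s t) = (fun y : R * R => D y.1 y.2) \o (fun s => (s, t)) by [].
  move=> s; apply: continuous_comp; last exact: gD_continuous.
  by apply: (@continuous_pair _ _ _ id (fun=> t)) => u; [exact: cvg_id|exact: cvg_cst].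
- have [-> _] : gx m rho ((- (rho + rho)) ^+ 2 + t ^+ 2) = 0 /\ gdx m rho ((- (rho + rho)) ^+ 2 + t ^+ 2) = 0.
    by apply: gx_out; have := sqr_ge0 t; have := sqr_ge0 rho; rewrite sqrrN => h1 h2; nra.
  by rewrite mulr0 mul0r.
- have [-> _] : gx m rho ((rho + rho) ^+ 2 + t ^+ 2) = 0 /\ gdx m rho ((rho + rho) ^+ 2 + t ^+ 2) = 0.
    by apply: gx_out; have := sqr_ge0 t; have := sqr_ge0 rho; nra.
  by rewrite mulr0 mul0r.
- move=> s; rewrite in_itv /= -ler_norml -ltNge => h; apply: gD_out; left.
  by apply: lt_trans h; rewrite ltrDl.
Qed.

Lemma gD_integrable : leb2.-integrable setT (EFin \o (fun y : R * R => D y.1 y.2)).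
Proof.
by apply: (@continuous_cs_integrable2 _ _ rho); [exact: gD_continuous|move=> y /gD_out].
Qed.

Lemma swap_continuous : continuous (fun y : R * R => (y.2, y.1)).
Proof. by apply: continuous_pair; [exact: snd_continuous2|exact: fst_continuous2]. Qed.

Lemma gD_swap_integrable : leb2.-integrable setT (EFin \o (fun y : R * R => D y.2 y.1)).
Proof.
apply: (@continuous_cs_integrable2 _ _ rho); last by move=> y [h|h]; apply: gD_out; [right|left].
move=> y; apply: (@continuous_comp _ _ _ (fun y : R * R => (y.2, y.1)) (fun y : R * R => D y.1 y.2)).
  exact: swap_continuous.
exact: gD_continuous.
Qed.

Lemma int_gD : (\int[leb2]_y (D y.1 y.2)%:E = 0)%E.
Proof.
rewrite (fubini2_21 gD_integrable) /=; under eq_integral do rewrite gD_slice0.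
exact: integral0.
Qed.

Lemma int_gD_swap : (\int[leb2]_y (D y.2 y.1)%:E = 0)%E.
Proof.
rewrite (fubini2_12 gD_swap_integrable) /=; under eq_integral do rewrite gD_slice0.
exact: integral0.
Qed.

(** Minus [gk] times the scalar product of [y] with the gradient of the cutoff, the gradient of
    [gx (sqn y)] being 2 y [gdx]. *)
Definition gB (y : R * R) : R := - (2 * sqn y * gk m e (sqn y) * gdx m rho (sqn y)).

(** With a the height above the pole (0, 0, -e), a point of the graph satisfies e = a - m |y| and
    r^2 (q + a^2) = 1; these two relations turn the planar divergence of y a r^3 into [kern]. The
    term [gB] compensates for the part of the divergence that falls on the cutoff. *)
Lemma testf_graph (y : R * R) : testf rho e (y, zc m y) = D y.1 y.2 + D y.2 y.1 + gB y.
Proof.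
have z0 : 0 <= zc m y by rewrite zc_ge0 // ltW.
have q0 := sqn_ge0 y.
have ic : invdist e (y, zc m y) = gr m e (sqn y).
  by rewrite /invdist sqdist_regE.
have xx : cutoff rho (y, zc m y) = gx m rho (sqn y).
  have dE : dot (y, zc m y) (y, zc m y) = (1 + m ^+ 2) * sqn y.
    have zz : zc m y * zc m y = m ^+ 2 * sqn y by rewrite /zc mulrACA -!expr2 sqr_sqrtr.
    by rewrite /dot /= zz /sqn; ring.
  by rewrite /cutoff dE mulrA.
rewrite /testf xx /kern ic /= -/(ga m e (sqn y)).
rewrite /gD /gB /gk [y.2 ^+ 2 + y.1 ^+ 2]addrC -/(sqn y).
have hr := gr_sqr m0 e0 q0.
set r := gr m e (sqn y) in hr *; set x := gx _ _ _; set dx := gdx _ _ _.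
have hS : Num.sqrt (sqn y) ^+ 2 = sqn y by rewrite sqr_sqrtr.
have hg : y.1 ^+ 2 / Num.sqrt (sqn y) + y.2 ^+ 2 / Num.sqrt (sqn y) = Num.sqrt (sqn y).
  rewrite -mulrDl -/(sqn y) -{1}hS expr2.
  have [->|h] := eqVneq (Num.sqrt (sqn y)) 0; first by rewrite mul0r mul0r.
  by rewrite mulfK.
have ha : ga m e (sqn y) = m * Num.sqrt (sqn y) + e by [].
move: (y.1 ^+ 2 / _) (y.2 ^+ 2 / _) hg => g1 g2 hg.
have hq : y.1 ^+ 2 + y.2 ^+ 2 = sqn y by [].
move: hS hg ha hr hq; set S := Num.sqrt (sqn y); set a := ga m e (sqn y); set q := sqn y.
move: (y.1 ^+ 2) (y.2 ^+ 2) => p1 p2 hS hg ha hr hq.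
have e_ : e = a - m * S by rewrite ha; ring.
have -> : e * (3 * a ^+ 2 * r ^+ 5 - r ^+ 3) = 2 * a * r ^+ 3 + m * S * r ^+ 3
   - 3 * a * r ^+ 5 * (q + a * m * S).
  have -> : 3 * a * r ^+ 5 * (q + a * m * S) = 3 * a * r ^+ 3 * (r ^+ 2 * (q + a ^+ 2))
     - 3 * a * r ^+ 5 * (a ^+ 2 - a * (m * S)) by ring.
  by rewrite hr e_; ring.
rewrite -hg -hq; ring.
Qed.

Lemma int_testf_graph :
  (\int[leb2]_y (testf rho e (y, zc m y))%:E = \int[leb2]_y (gB y)%:E)%E.
Proof.
have gBi : leb2.-integrable setT (EFin \o gB).
  apply: (@continuous_cs_integrable2 _ _ rho).
    apply: (@qc (fun q => - (2 * q * gk m e q * gdx m rho q))) => q q0.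
    apply: cvgN; apply: cvgM; last exact: gdx_continuous.
    by apply: cvgM; [apply: cvgMr; exact: cvg_id|exact: gk_continuous].
  move=> y h; have [_ d0] : gx m rho (sqn y) = 0 /\ gdx m rho (sqn y) = 0.
    apply: gx_out; have h1 := sqr_ge0 y.1; have h2 := sqr_ge0 y.2.
    have k (z : R) : rho < `|z| -> rho ^+ 2 <= z ^+ 2.
      by move=> hz; rewrite -(real_normK (num_real z)) ler_sqr ?nnegrE ?(ltW rho0) // ltW.
    by rewrite /sqn; case: h => /k; lra.
  by rewrite /gB d0 mulr0 oppr0.
under eq_integral do rewrite testf_graph EFinD EFinD.
rewrite integralD //; last by apply: integrableD => //; [exact: gD_integrable|exact: gD_swap_integrable].
rewrite integralD //; [|exact: gD_integrable|exact: gD_swap_integrable].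
by rewrite int_gD int_gD_swap !add0e.
Qed.

End fixed.

Lemma pos_integral (f : R * R -> R) (y0 : R * R) : continuous f -> (forall y, 0 <= f y) ->
  0 < f y0 -> (0 < \int[leb2]_y (f y)%:E)%E.
Proof.
move=> fc f0 fy0.
have /nbhs_ballP[d /= d0 hd] : \forall y \near y0, f y0 / 2 < f y.
  have h : f y0 / 2 < f y0 by rewrite ltr_pdivrMr // ltr_pMr // ltr1n.
  by have := fc y0 => /(_ _ (lt_nbhsr h)); exact.
pose I (a : R) : set mR := [set` `](a - d), (a + d)[].
have mI a : measurable (I a) by exact: measurable_itv.
have lI a : (mu (I a) = (2 * d)%:E)%E.
  rewrite /I lebesgue_measure_itv /= lte_fin ltrD2l gtrN // -EFinB.
  by congr (_%:E); ring.
have mB : measurable (I y0.1 `*` I y0.2 : set (mR * mR)) by exact: measurableX.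
apply: (@lt_le_trans _ _ (\int[leb2]_(y in I y0.1 `*` I y0.2) (f y0 / 2)%:E)%E); last first.
  apply: (@le_trans _ _ (\int[leb2]_(y in I y0.1 `*` I y0.2) (f y)%:E)%E).
    apply: int_le => //.
    - exact: continuous_measurable_R2.
    - by move=> y _; rewrite divr_ge0 // f0.
    - move=> y [y1 y2]; apply: ltW; apply: hd; move: y1 y2; rewrite /I /= !in_itv /= -!ltr_distlC.
      by move=> h1 h2; split; rewrite /ball /=.
  apply: ge0_subset_integral => //.
    by apply/measurable_EFinP; exact: continuous_measurable_R2.
  by move=> y _; rewrite lee_fin.
rewrite integral_cst //.
have -> : (leb2 (I y0.1 `*` I y0.2 : set (mR * mR)) = (2 * d)%:E * (2 * d)%:E)%E.
  by rewrite -{1}(lI y0.1) -(lI y0.2); exact: product_measure1E.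
by rewrite -!EFinM lte_fin !mulr_gt0 // divr_gt0.
Qed.

(* On the graph, [kern] is the planar divergence of [y a R^3]; integrating by
   parts leaves [- a R^3 y . grad cutoff], which is nonnegative. *)
Lemma graph_integral_lower (m rho : R) : 0 < m -> 0 < rho -> exists2 c, 0 < c &
  forall e, 0 < e <= 1 -> (c%:E <= \int[leb2]_y (testf rho e (y, zc m y))%:E)%E.
Proof.
move=> m0 rho0; have w0 := gw_gt0 m rho0.
(* The minorant is independent of [e]: [ga] is bounded below by its value without [e], and [gr]
   decreases in [e], hence is at least its value at 1. *)
pose h := gr m 1.
pose f (y : R * R) := 2 * sqn y * (m * Num.sqrt (sqn y) * h (sqn y) ^+ 3) *
  (dstep (gw m rho * sqn y - 1) * gw m rho).
have f0 y : 0 <= f y.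
  have q0 := sqn_ge0 y.
  have h0 : 0 <= h (sqn y) by rewrite invr_ge0 sqrtr_ge0.
  have h3 := exprn_ge0 3 h0; have s0 := sqrtr_ge0 (sqn y).
  apply: mulr_ge0; last by apply: mulr_ge0; [exact: dstep_ge0|exact: ltW].
  apply: mulr_ge0; first exact: mulr_ge0.
  by apply: mulr_ge0 => //; apply: mulr_ge0 => //; exact: ltW.
have fc : continuous f.
  move=> y; apply: (@continuous_comp _ _ _ sqn (fun q => 2 * q * (m * Num.sqrt q * h q ^+ 3) *
     (dstep (gw m rho * q - 1) * gw m rho))); first exact: sqn_continuous.
  have hc : {for sqn y, continuous h}.
    exact: (gr_continuous m0 ltr01 (sqn_ge0 y)).
  apply: cvgM.
    apply: cvgM; first by apply: cvgMr; exact: cvg_id.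
    apply: cvgM; first by apply: cvgMr; exact: sqrt_continuous.
    exact: continuous_pow.
  apply: cvgM; last exact: cvg_cst.
  apply: (@continuous_comp _ _ _ (fun q => gw m rho * q - 1) dstep); last exact: dstep_continuous.
  by apply: cvgB; [apply: cvgMr; exact: cvg_id|exact: cvg_cst].
(* At this point [gw m rho * sqn y0 - 1] is 1 / 2, the middle of the transition, where [dstep] is
   positive. *)
pose y0 : R * R := (Num.sqrt ((3 / 2) / gw m rho), 0).
have q0E : sqn y0 = (3 / 2) / gw m rho.
  by rewrite /sqn /= sqr_sqrtr ?divr_ge0 ?(ltW w0) // expr0n addr0.
have q0 : 0 < sqn y0 by rewrite q0E !divr_gt0.
have fy0 : 0 < f y0.
  rewrite /f; apply: mulr_gt0.
    apply: mulr_gt0; first by rewrite mulr_gt0.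
    have h0 : 0 < h (sqn y0) by apply: gr_gt0 => //; exact: ltW.
    apply: mulr_gt0; last exact: exprn_gt0.
    by apply: mulr_gt0; rewrite ?sqrtr_gt0.
  rewrite mulr_gt0 // q0E mulrCA divff ?gt_eqF // mulr1.
  have -> : 3 / 2 - 1 = 1 / 2 :> R by field.
  rewrite /dstep divr_gt0 ?exprn_gt0 ?sden_gt0 // addr_gt0 // mulr_gt0 // flat_gt0 //; lra.
have fi : leb2.-integrable setT (EFin \o f).
  apply: (@continuous_cs_integrable2 _ _ rho) => // y hy.
  have [_ d0] : gx m rho (sqn y) = 0 /\ gdx m rho (sqn y) = 0.
    apply: gx_out => //; have h1 := sqr_ge0 y.1; have h2 := sqr_ge0 y.2.
    have k (z : R) : rho < `|z| -> rho ^+ 2 <= z ^+ 2.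
      by move=> hz; rewrite -(real_normK (num_real z)) ler_sqr ?nnegrE ?(ltW rho0) // ltW.
    by rewrite /sqn; case: hy => /k; lra.
  by move/eqP: d0; rewrite /gdx oppr_eq0 /f => /eqP ->; rewrite mulr0.
have If := pos_integral fc f0 fy0.
have Ifin : (\int[leb2]_y (f y)%:E \is a fin_num)%E by exact: integrable_fin_num.
exists (fine (\int[leb2]_y (f y)%:E)%E).
  by rewrite -lte_fin fineK.
move=> e /andP[e0 e1]; rewrite fineK // int_testf_graph //.
apply: int_le => //.
- exact: continuous_measurable_R2.
- apply: (@eq_measurable_fun _ _ _ _ _ (fun y : mR * mR => testf rho e (y, zc m y)
     - gD m rho e y.1 y.2 - gD m rho e y.2 y.1)).
    by move=> y _; rewrite testf_graph //; ring.
  apply: measurable_funB; first apply: measurable_funB.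
  + exact: (@measurable_bd R m _ (Cn_testf 1 rho e0) setT).
  + by apply/measurable_EFinP; case/integrableP: (gD_integrable m0 rho0 e0).
  + by apply/measurable_EFinP; case/integrableP: (gD_swap_integrable m0 rho0 e0).
- move=> y _; rewrite /f /gB /gdx mulrN opprK; have qy := sqn_ge0 y.
  have d0 : 0 <= dstep (gw m rho * sqn y - 1) * gw m rho.
    by apply: mulr_ge0; [exact: dstep_ge0|exact: ltW].
  rewrite ler_wpM2r // ler_wpM2l //; first exact: mulr_ge0.
  have s0 := sqrtr_ge0 (sqn y).
  have h0 : 0 <= h (sqn y) by rewrite ltW // gr_gt0.
  have k0 : 0 <= gr m e (sqn y) by rewrite ltW // gr_gt0.
  have ms : 0 <= m * Num.sqrt (sqn y) by apply: mulr_ge0 => //; exact: ltW.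
  apply: ler_pM => //; [exact: exprn_ge0|by rewrite /ga lerDl ltW|].
  rewrite ler_pXn2r ?nnegrE //.
  rewrite /h /gr lef_pV2 ?posrE ?sqrtr_gt0 ?grN_gt0 //.
  rewrite ler_wsqrtr // lerD2l ler_sqr ?nnegrE ?(ltW (ga_gt0 _ _ _)) //.
  by rewrite /ga lerD2l.
Qed.

End GraphIntegral2.

(** * Real and imaginary parts *)

Section RealParts.
Context {R : realType}.
Notation mR := (measurableTypeR R).

(** Indexed by a boolean so that one statement and one proof cover the real and the imaginary
    part. *)
Definition part (b : bool) (z : R[i]) : R := if b then complex.Re z else complex.Im z.

Lemma partB b z1 z2 : part b (z1 - z2) = part b z1 - part b z2.
Proof. by case: b z1 z2 => -[a1 b1] [a2 b2]. Qed.

Lemma partD b z1 z2 : part b (z1 + z2) = part b z1 + part b z2.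
Proof. by case: b z1 z2 => -[a1 b1] [a2 b2]. Qed.

Lemma part_mulr b z (r : R) : part b (z * r%:C%C) = part b z * r.
Proof. by case: b z => -[x y] /=; ring. Qed.

Lemma normc_sqr (z : R[i]) : Normc.normc z ^+ 2 = part true z ^+ 2 + part false z ^+ 2.
Proof. by case: z => x y; rewrite /part /= sqr_sqrtr // addr_ge0 // sqr_ge0. Qed.

Lemma normc_ge0 (z : R[i]) : 0 <= Normc.normc z.
Proof. by case: z => x y; exact: sqrtr_ge0. Qed.

Lemma part_le b z : `|part b z| <= Normc.normc z.
Proof.
rewrite -ler_sqr ?nnegrE ?normc_ge0 // real_normK ?num_real // normc_sqr.
by case: b; rewrite ?lerDl ?lerDr sqr_ge0.
Qed.

Lemma normc_le z : Normc.normc z <= `|part true z| + `|part false z|.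
Proof.
rewrite -ler_sqr ?nnegrE ?normc_ge0 ?addr_ge0 // normc_sqr sqrrD !real_normK ?num_real //.
by rewrite addrAC lerDl mulrn_wge0 // mulr_ge0.
Qed.

Section norms.
Context d (T : measurableType d) (mu : {measure set T -> \bar R}).
Variables (D : set T) (mD : measurable D).

Lemma cmeasurable_part b (f : T -> R[i]) : cmeasurable D f -> measurable_fun D (fun x => part b (f x)).
Proof. by case=> h1 h2; case: b. Qed.

Lemma measurable_normc_sqr (f : T -> R[i]) : cmeasurable D f ->
  measurable_fun D (fun x => Normc.normc (f x) ^+ 2).
Proof.
move=> mf; under eq_fun do rewrite normc_sqr.
by apply: measurable_funD; apply: measurable_sqr; exact: cmeasurable_part.
Qed.

Lemma L2norm_le (f : T -> R[i]) (c : R) : 0 <= c -> (L2norm mu D f <= c%:E)%E ->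
  (\int[mu]_(x in D) (Normc.normc (f x) ^+ 2)%:E <= (c ^+ 2)%:E)%E.
Proof.
move=> c0; rewrite /L2norm.
have : (0 <= \int[mu]_(x in D) (Normc.normc (f x) ^+ 2)%:E)%E.
  by apply: integral_ge0 => x _; rewrite lee_fin sqr_ge0.
case: (integral _ _ _) => [s| |] //=; rewrite !lee_fin => s0 h.
by rewrite -(sqr_sqrtr s0) ler_sqr ?nnegrE ?sqrtr_ge0.
Qed.

Lemma int_part_le (f : T -> R[i]) (c : \bar R) b : cmeasurable D f ->
  (\int[mu]_(x in D) (Normc.normc (f x) ^+ 2)%:E <= c)%E ->
  (\int[mu]_(x in D) (part b (f x) ^+ 2)%:E <= c)%E.
Proof.
move=> mf; apply: le_trans; apply: int_le => //.
- by apply: measurable_sqr; exact: cmeasurable_part.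
- exact: measurable_normc_sqr.
- by move=> x _; exact: sqr_ge0.
- by move=> x _; rewrite normc_sqr; case: b; rewrite ?lerDl ?lerDr sqr_ge0.
Qed.

Definition L2r (u : T -> R) := measurable_fun D u /\ (\int[mu]_(x in D) (u x ^+ 2)%:E < +oo)%E.

Lemma in_L2_part b (f : T -> R[i]) : in_L2 mu D f -> L2r (fun x => part b (f x)).
Proof.
move=> [mf hf]; split; first exact: cmeasurable_part.
have h : (\int[mu]_(x in D) (Normc.normc (f x) ^+ 2)%:E < +oo)%E.
  move: hf; rewrite /L2norm.
  have : (0 <= \int[mu]_(x in D) (Normc.normc (f x) ^+ 2)%:E)%E.
    by apply: integral_ge0 => x _; rewrite lee_fin sqr_ge0.
  by case: (integral _ _ _) => [s| |] //= _ _; exact: ltry.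
by apply: le_lt_trans h; exact: int_part_le.
Qed.

Lemma L2r_bound u : L2r u -> exists2 E, 0 <= E & (\int[mu]_(x in D) (u x ^+ 2)%:E <= E%:E)%E.
Proof.
move=> [mu_ h]; have h0 : (0 <= \int[mu]_(x in D) (u x ^+ 2)%:E)%E.
  by apply: integral_ge0 => x _; rewrite lee_fin sqr_ge0.
exists (fine (\int[mu]_(x in D) (u x ^+ 2)%:E)); first exact: fine_ge0.
by rewrite fineK // ge0_fin_numE.
Qed.

Lemma L2rP (u : T -> R) (E : R) : measurable_fun D u -> (\int[mu]_(x in D) (u x ^+ 2)%:E <= E%:E)%E -> L2r u.
Proof. by move=> mu_ h; split => //; exact: le_lt_trans h (ltry _). Qed.

Lemma L2rB u w : L2r u -> L2r w -> L2r (fun x => u x - w x).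
Proof.
move=> Lu Lw; have [mu_ _] := Lu; have [mw _] := Lw.
have [E E0 hE] := L2r_bound Lu; have [G G0 hG] := L2r_bound Lw.
apply: (@L2rP _ (2 * E + 2 * G)); first exact: measurable_funB.
apply: (@le_trans _ _ (\int[mu]_(x in D) (2 * u x ^+ 2 + 2 * w x ^+ 2)%:E)%E).
  apply: int_le => //.
  - by apply: measurable_sqr; exact: measurable_funB.
  - by apply: measurable_funD; apply: measurable_funM => //; exact: measurable_sqr.
  - by move=> x _; exact: sqr_ge0.
  - by move=> x _; have := sqr_ge0 (u x + w x); rewrite sqrrD sqrrB; lra.
rewrite int_addZ //; [|exact: measurable_sqr|exact: measurable_sqr|
  by move=> x _; exact: sqr_ge0|by move=> x _; exact: sqr_ge0].
by rewrite [leRHS]EFinD; apply: leeD; rewrite [leRHS]EFinM; apply: lee_wpmul2l => //; rewrite lee_fin.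
Qed.

Lemma L2r_integrable u : (mu D < +oo)%E -> L2r u -> mu.-integrable D (EFin \o u).
Proof.
move=> fD Lu; have [mu_ _] := Lu; have [E E0 hE] := L2r_bound Lu.
pose V := fine (mu D); have VE : (mu D = V%:E)%E by rewrite fineK // ge0_fin_numE.
have V0 : 0 <= V by rewrite fine_ge0.
have h1 : (\int[mu]_(x in D) (u x ^+ 2)%:E <= (Num.sqrt E ^+ 2)%:E)%E by rewrite sqr_sqrtr.
have h2 : (\int[mu]_(x in D) (cst (1 : R) x ^+ 2)%:E <= (Num.sqrt V ^+ 2)%:E)%E.
  under eq_integral do rewrite /cst /= expr1n.
  by rewrite integral_cst // mul1e VE sqr_sqrtr.
have := cauchy_schwarz_int mD mu_ (measurable_cst (1 : R)) (sqrtr_ge0 _) (sqrtr_ge0 _) h1 h2.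
under eq_integral do rewrite /cst mulr1.
by move=> h; have [] := Rint_bound mD mu_ h.
Qed.

End norms.

Lemma L2r_subset d (T : measurableType d) (mu : {measure set T -> \bar R}) (D D' : set T) u :
  measurable D -> measurable D' -> D' `<=` D -> L2r mu D u -> L2r mu D' u.
Proof.
move=> mD mD' s [mu_ h]; have mu' := measurable_funS mD s mu_; split=> //.
apply: le_lt_trans h; apply: ge0_subset_integral => //.
  by apply/measurable_EFinP; exact: measurable_sqr.
by move=> x _; rewrite lee_fin sqr_ge0.
Qed.

Lemma part_cint b d (T : measurableType d) (mu : {measure set T -> \bar R}) (D : set T) (f : T -> R[i]) :
  part b (cint mu D f) = \int[mu]_(x in D) part b (f x).
Proof. by case: b. Qed.

Lemma complex_eqP (z1 z2 : R[i]) : (forall b, part b z1 = part b z2) -> z1 = z2.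
Proof. by case: z1 z2 => [a1 b1] [a2 b2] h; have := h true; have := h false; rewrite /part /= => -> ->. Qed.

Lemma partN b z : part b (- z) = - part b z.
Proof. by case: b z => -[x y]. Qed.

Lemma weak_partial_wpd D i (u g : R3 R -> R[i]) b : is_weak_partial D i u g ->
  wpd D i (fun x => part b (u x)) (fun x => part b (g x)).
Proof.
move=> h phi phiD; have := congr1 (part b) (h phi phiD).
rewrite partN !part_cint.
by under eq_Rintegral do rewrite part_mulr; under [in RHS]eq_Rintegral do rewrite part_mulr.
Qed.

Lemma wpd_weak_partial D i (u g : R3 R -> R[i]) :
  (forall b, wpd D i (fun x => part b (u x)) (fun x => part b (g x))) -> is_weak_partial D i u g.
Proof.
move=> h phi phiD; apply: complex_eqP => b; have := h b phi phiD.
rewrite partN !part_cint.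
by under eq_Rintegral do rewrite -part_mulr; under [in RHS]eq_Rintegral do rewrite -part_mulr.
Qed.

(** Membership in H^1 makes the set offered to the choice operator nonempty, so a genuine derivative
    and not the default is returned. *)
Lemma wpartialP (D : set (R3 R)) (u : R3 R -> R[i]) : in_H1 D u -> forall i, in_L2 leb3 D (wpartial D i u) /\
  is_weak_partial D i u (wpartial D i u).
Proof.
move=> [_ h] i; rewrite /wpartial.
exact: (@xgetPex _ (fun=> 0) [set g | in_L2 leb3 D g /\ is_weak_partial D i u g] (h i)).
Qed.

Lemma test_function_sub (D D' : set (R3 R)) phi : D' `<=` D -> test_function D' phi -> test_function D phi.
Proof.
move=> s [h [K [cK KD sK]]]; split=> //; exists K; split=> //; exact: subset_trans s.
Qed.

Lemma wpd_subset (D D' : set (R3 R)) i u g : D' `<=` D -> wpd D i u g -> wpd D' i u g.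
Proof.
move=> s h phi phiD; have := h phi (test_function_sub s phiD).
have [phis [K [cK KD sK]]] := phiD.
have kcl : closed K by apply: compact_closed => //; exact: norm_hausdorff.
have d0 : forall x, ~ D' x -> 'D_(evec i) phi x = 0.
  move=> x Dx; apply: (@derive_supp R phi K (evec i) kcl) => //.
  by move=> /KD.
have p0 : forall x, ~ D' x -> phi x = 0 by move=> x Dx; apply: sK => /KD.
have E (f f' : R3 R -> R) : (forall x, ~ D' x -> f' x = 0) ->
    \int[leb3]_(x in (D : set (mR3 R))) (f x * f' x) = \int[leb3]_(x in (D' : set (mR3 R))) (f x * f' x).
  move=> g0; rewrite (@Rint_supp R D (fun x => f x * f' x)); last first.
    by move=> x Dx; rewrite g0 ?mulr0 // => /s.
  by rewrite (@Rint_supp R D' (fun x => f x * f' x)) // => x Dx; rewrite g0 ?mulr0.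
by rewrite (E u _ d0) (E g _ p0).
Qed.

Lemma wpdB (D : set (R3 R)) i u1 u2 g1 g2 : open D ->
  leb3.-integrable (D : set (mR3 R)) (EFin \o u1) -> leb3.-integrable (D : set (mR3 R)) (EFin \o u2) ->
  leb3.-integrable (D : set (mR3 R)) (EFin \o g1) -> leb3.-integrable (D : set (mR3 R)) (EFin \o g2) ->
  wpd D i u1 g1 -> wpd D i u2 g2 -> wpd D i (fun x => u1 x - u2 x) (fun x => g1 x - g2 x).
Proof.
move=> oD iu1 iu2 ig1 ig2 h1 h2 phi phiD.
have mD : measurable (D : set (mR3 R)) by exact: open_measurable_R3.
have [phis [K [cK KD sK]]] := phiD.
have kcl : closed K by apply: compact_closed => //; exact: norm_hausdorff.
have dphiD : exists B, forall x, `|'D_(evec i) phi x| <= B.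
  have [M M0 KM] := compact_sub_cube cK.
  have [B B0 hB] := continuous_bounded_cube M (Cn_continuous (Cn_derive i (phis 1%N))).
  exists B => x; have [/hB//|xM] := pselect (cube M x).
  by rewrite (@derive_supp R phi K (evec i) kcl sK) ?normr0 // => /KM.
have [B hB] := test_function_bounded phiD; have [B' hB'] := dphiD.
have mp : measurable_fun (D : set (mR3 R)) phi by apply: continuous_measurable_R3; exact: (phis 0%N).
have mdp : measurable_fun (D : set (mR3 R)) ('D_(evec i) phi).
  by apply: continuous_measurable_R3; exact: Cn_continuous (Cn_derive i (phis 1%N)).
have e1 : \int[leb3]_(x in (D : set (mR3 R))) ((u1 x - u2 x) * 'D_(evec i) phi x) =
   \int[leb3]_(x in (D : set (mR3 R))) (u1 x * 'D_(evec i) phi x) -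
   \int[leb3]_(x in (D : set (mR3 R))) (u2 x * 'D_(evec i) phi x).
  rewrite -RintegralB //; first by apply: eq_Rintegral => x _; rewrite mulrBl.
    exact: (@integrable_mul_bounded _ _ _ leb3 D u1 _ B').
  exact: (@integrable_mul_bounded _ _ _ leb3 D u2 _ B').
have e2 : \int[leb3]_(x in (D : set (mR3 R))) ((g1 x - g2 x) * phi x) =
   \int[leb3]_(x in (D : set (mR3 R))) (g1 x * phi x) -
   \int[leb3]_(x in (D : set (mR3 R))) (g2 x * phi x).
  rewrite -RintegralB //; first by apply: eq_Rintegral => x _; rewrite mulrBl.
    exact: (@integrable_mul_bounded _ _ _ leb3 D g1 _ B).
  exact: (@integrable_mul_bounded _ _ _ leb3 D g2 _ B).
by rewrite e1 e2 (h1 phi phiD) (h2 phi phiD) opprB addrC opprK.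
Qed.

Lemma bounded_leb3 (D : set (R3 R)) : open D -> bounded_set D -> (leb3 (D : set (mR3 R)) < +oo)%E.
Proof.
move=> oD bD; have [M M0 DM] := bounded_sub_cube bD.
apply: le_lt_trans (leb3_cube M); apply: le_measure; rewrite ?inE //.
- exact: open_measurable_R3.
- exact: cube_measurable.
Qed.

Lemma continuous_L2r (D : set (R3 R)) f : open D -> bounded_set D -> continuous f ->
  L2r leb3 (D : set (mR3 R)) f.
Proof.
move=> oD bD fc; have [M M0 DM] := bounded_sub_cube bD.
have [B B0 hB] := continuous_bounded_cube M fc.
have mD : measurable (D : set (mR3 R)) by exact: open_measurable_R3.
have mf : measurable_fun (D : set (mR3 R)) f by exact: continuous_measurable_R3.
split=> //; apply: (@le_lt_trans _ _ (\int[leb3]_(x in (D : set (mR3 R))) (B ^+ 2)%:E)%E).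
  apply: int_le => //.
  - exact: measurable_sqr.
  - by move=> x _; exact: sqr_ge0.
  - move=> x /DM /hB h; rewrite -(real_normK (num_real (f x))).
    by rewrite ler_sqr ?nnegrE.
rewrite integral_cst //; have := bounded_leb3 oD bD; have := measure_ge0 leb3 (D : set (mR3 R)).
move=> h0 h1; have -> : leb3 (D : set (mR3 R)) = (fine (leb3 (D : set (mR3 R))))%:E.
  by rewrite fineK // ge0_fin_numE.
by rewrite -EFinM ltry.
Qed.

Lemma part_csmooth b f : csmooth f -> smooth (fun x : R3 R => part b (f x)).
Proof. by case=> h1 h2; case: b. Qed.

Lemma parts_in_L2 d (T : measurableType d) (mu : {measure set T -> \bar R}) (D : set T) (f : T -> R[i]) :
  measurable D -> (forall b, L2r mu D (fun x => part b (f x))) -> in_L2 mu D f.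
Proof.
move=> mD h; have [m1 _] := h true; have [m2 _] := h false; split; first by split.
have [E1 E10 h1] := L2r_bound (h true); have [E2 E20 h2] := L2r_bound (h false).
rewrite /L2norm; have : (\int[mu]_(x in D) (Normc.normc (f x) ^+ 2)%:E <= (1 * E1 + 1 * E2)%:E)%E.
  apply: (@le_trans _ _ (\int[mu]_(x in D) (1 * part true (f x) ^+ 2 + 1 * part false (f x) ^+ 2)%:E)%E).
    by under eq_integral do rewrite normc_sqr -[part true _ ^+ 2]mul1r -[part false _ ^+ 2]mul1r.
  rewrite int_addZ //; [|exact: measurable_sqr|exact: measurable_sqr|
    by move=> x _; exact: sqr_ge0|by move=> x _; exact: sqr_ge0].
  by rewrite EFinD !EFinM; apply: leeD; apply: lee_wpmul2l => //; rewrite lee_fin.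
have : (0 <= \int[mu]_(x in D) (Normc.normc (f x) ^+ 2)%:E)%E.
  by apply: integral_ge0 => x _; rewrite lee_fin sqr_ge0.
by case: (integral _ _ _) => [s| |] //= _ _; exact: ltry.
Qed.

Lemma H1norm_le (D : set (R3 R)) u (c : R) : 0 <= c -> (H1norm D u <= c%:E)%E ->
  (L2norm leb3 D u <= c%:E)%E /\ forall i, (L2norm leb3 D (wpartial D i u) <= c%:E)%E.
Proof.
move=> c0; rewrite /H1norm.
have L0 f : (0 <= L2norm leb3 D f)%E.
  by rewrite /L2norm; exact: sqrte_ge0.
have sq0 f : (0 <= L2norm leb3 D f ^+ 2)%E by rewrite expe_ge0.
have key (a : \bar R) : (0 <= a)%E -> (a ^+ 2 <= (c ^+ 2)%:E)%E -> (a <= c%:E)%E.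
  case: a => [r| |] //=; rewrite !lee_fin => r0.
  by rewrite -expr2 ler_sqr ?nnegrE.
move=> h.
have H : (L2norm leb3 D u ^+ 2 + \sum_(i < 3) L2norm leb3 D (wpartial D i u) ^+ 2 <= (c ^+ 2)%:E)%E.
  move: h; have : (0 <= L2norm leb3 D u ^+ 2 + \sum_(i < 3) L2norm leb3 D (wpartial D i u) ^+ 2)%E.
    by apply: adde_ge0 => //; apply: sume_ge0.
  case: (_ + _)%E => [s| |] //=; rewrite !lee_fin => s0 h.
  by rewrite -(sqr_sqrtr s0) ler_sqr ?nnegrE ?sqrtr_ge0.
split; first apply: key => //.
  by apply: le_trans H; rewrite leeDl // sume_ge0.
move=> i; apply: key => //; apply: le_trans H.
apply: (@le_trans _ _ (\sum_(i < 3) L2norm leb3 D (wpartial D i u) ^+ 2)%E); last by rewrite leeDr.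
rewrite [leRHS](bigD1 i) //=.
rewrite leeDl //; apply: sume_ge0 => j _; exact: sq0.
Qed.

End RealParts.

(** * Volume terms of Green's formula *)

Section VolumeTerms.
Context {R : realType}.
Notation mR := (measurableTypeR R).
Notation mu := (@lebesgue_measure R).

Lemma leb2_set0 : leb2 ([set 0] : set (mR * mR)) = 0%E.
Proof.
have -> : [set 0] = [set 0] `*` [set 0] :> set (mR * mR).
  by apply/seteqP; split => [y ->//|[y1 y2] [/= -> ->]].
pose z : set mR := [set 0].
have E : (mu2 (z `*` z) = mu z * mu z)%E by apply: product_measure1E; exact: measurable_set1.
by rewrite [LHS]E lebesgue_measure_set1 mule0.
Qed.

Lemma cvg_le_near (a : nat -> \bar R) (e : R) : a n @[n --> \oo] --> 0%E -> 0 < e ->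
  \forall n \near \oo, (a n <= e%:E)%E.
Proof.
move=> ac e0; have e0' : (0 < e%:E)%E by rewrite lte_fin.
have h : \forall n \near \oo, (a n < e%:E)%E := ac _ (open_ereal_lt' e0').
by apply: filterS h => n /ltW.
Qed.

Section seq.
Variables (en : nat -> R) (en0 : forall n, 0 < en n).
Hypothesis enc : en n @[n --> \oo] --> (0 : R).

Lemma wt1_cvg (s : R) : 0 < s -> wt1 (en n) s @[n --> \oo] --> (0 : R).
Proof.
move=> s0; have -> : (0 : R) = 0 / (`|s| + 0) by rewrite mul0r.
apply: cvgM; first exact: enc.
apply: cvgV; first by rewrite addr0 normr_eq0 gt_eqF.
by apply: cvgD; [exact: cvg_cst|exact: enc].
Qed.

(** The weights stay below 1 and tend to 0 at every positive height, so [g ^+ 2] itself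
    dominates. *)
Lemma weighted_cvg d (T : measurableType d) (nu : {measure set T -> \bar R}) (S : set T)
    (g s : T -> R) : measurable S -> L2r nu S g ->
  measurable_fun S s -> {ae nu, forall x, S x -> 0 < s x} ->
  (forall n, measurable_fun S (fun x => wt1 (en n) (s x))) ->
  (\int[nu]_(x in S) (wt1 (en n) (s x) * g x ^+ 2)%:E @[n --> \oo] --> 0)%E.
Proof.
move=> mS Lg ms s0 mw; have [mg gfin] := Lg.
have mg2 : measurable_fun S (fun x => g x ^+ 2) by exact: measurable_sqr.
have gi : nu.-integrable S (EFin \o (fun x => g x ^+ 2)).
  apply/integrableP; split; first exact/measurable_EFinP.
  under eq_integral do rewrite /= ger0_norm ?sqr_ge0 //.
  exact: gfin.
have mfn n : measurable_fun S (fun x => (wt1 (en n) (s x) * g x ^+ 2)%:E).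
  by apply/measurable_EFinP; exact: measurable_funM.
have h1 : {ae nu, forall x, S x -> (wt1 (en n) (s x) * g x ^+ 2)%:E @[n --> \oo] --> (cst 0%E x : \bar R)}.
  have [N [mN N0 sN]] := s0; exists N; split=> // x hx; apply: sN => hx'; apply: hx => Sx.
  apply: cvg_EFin; first exact: nearW.
  have -> : (0 : R) = 0 * g x ^+ 2 by rewrite mul0r.
  by apply: cvgMl; exact: wt1_cvg (hx' Sx).
have h2 : {ae nu, forall x n, S x -> (`|(wt1 (en n) (s x) * g x ^+ 2)%:E| <= (EFin \o (fun x => (g x ^+ 2)%R)) x)%E}.
  apply: aeW => x n Sx; rewrite /= lee_fin ger0_norm; last first.
    by rewrite mulr_ge0 ?sqr_ge0 // wt1_ge0.
  by rewrite ler_piMl ?sqr_ge0 // wt1_le1.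
have [_ _] := dominated_convergence mS mfn (measurable_cst (0%E : \bar R)) h1 gi h2.
by rewrite integral0.
Qed.

Section geom.
Variables (m r0 : R).
Hypotheses (m0 : 0 < m) (r00 : 0 < r0).
Notation S0 := (slab (disc r0) (zc m) r0 : set (mR3 R)).
Notation Dr := (disc r0 : set (mR * mR)).

(** Hardy's inequality for a function with arbitrary trace: the foot term carries [wt1] and vanishes
    in the limit together with the two volume terms. *)
Lemma hardy_seq (f q : R3 R -> R) (t : R * R -> R) (eps : R) : smooth_approx m r0 r0 f q t ->
  L2r leb3 S0 f -> L2r leb3 S0 q -> L2r leb2 Dr t -> 0 < eps ->
  \forall n \near \oo, (\int[leb3]_(x in S0) (wt2 (en n) x.2 * f x ^+ 2)%:E <= eps%:E)%E.
Proof.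
move=> fa Lf Lq Lt eps0.
have mS0 := slab_measurable m r0 r0; have mD := @disc_measurable R r0.
have mc (w : R -> R) (D : set (mR3 R)) : continuous w -> measurable_fun D (fun x : mR3 R => w x.2).
  exact: measurable_wt.
have c1 := weighted_cvg mS0 Lf (measurable_funTS (continuous_measurable_R3 (D := setT) (@c3_continuous R))) _
  (fun n => mc _ _ (wt1_continuous (en0 n))).
have c2 := weighted_cvg mS0 Lq (measurable_funTS (continuous_measurable_R3 (D := setT) (@c3_continuous R))) _
  (fun n => mc _ _ (wt1_continuous (en0 n))).
have c3 := weighted_cvg mD Lt (measurable_funTS (continuous_measurable_R2 (D := setT) (@zc_continuous R m))) _
  (fun n => @measurable_wt_zc R m _ Dr (wt1_continuous (en0 n))).
have pS : {ae leb3, forall x, S0 x -> 0 < x.2}.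
  by apply: aeW => x [_ /andP[h _]]; apply: le_lt_trans h; rewrite zc_ge0 // ltW.
(* The graph touches height 0 at the apex only, a null set of the base. *)
have pD : {ae leb2, forall y, Dr y -> 0 < zc m y}.
  exists [set 0]; split; [|exact: leb2_set0|].
    have -> : [set 0] = [set 0] `*` [set 0] :> set (mR * mR).
      by apply/seteqP; split => [y ->//|[y1 y2] [/= -> ->]].
    exact: measurableX.
  move=> y h; apply: contrapT => y0; apply: h => _.
  rewrite mulr_gt0 // sqrtr_gt0 lt_neqAle sqn_ge0 andbT eq_sym.
  apply/eqP => q0; apply: y0; have h1 := sqr_ge0 y.1; have h2 := sqr_ge0 y.2.
  move: q0; rewrite /sqn => q0.
  have y1 : y.1 = 0 by apply/eqP; rewrite -sqrf_eq0; apply/eqP; lra.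
  have y2 : y.2 = 0 by apply/eqP; rewrite -sqrf_eq0; apply/eqP; lra.
  by rewrite /= [y]surjective_pairing y1 y2.
(* Three terms, and the factor 4 of [trace_limit]. *)
have e12 : 0 < eps / 12 by rewrite divr_gt0.
have n1 := cvg_le_near (c1 pS) e12.
have n2 := cvg_le_near (c2 pS) e12.
have n3 := cvg_le_near (c3 pD) e12.
near=> n.
have H1 : (\int[leb3]_(x in S0) (wt1 (en n) x.2 * f x ^+ 2)%:E <= (eps / 12)%:E)%E by near: n.
have H2 : (\int[leb3]_(x in S0) (wt1 (en n) x.2 * q x ^+ 2)%:E <= (eps / 12)%:E)%E by near: n.
have H3 : (\int[leb2]_(y in Dr) (wt1 (en n) (zc m y) * t y ^+ 2)%:E <= (eps / 12)%:E)%E by near: n.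
have e0 := en0 n; set e := en n in e0 H1 H2 H3 *.
have ei0 : 0 <= e^-1 by rewrite invr_ge0 ltW.
(* A common bound of the weights: [wt1] is at most 1 and [wt2] at most 1 / e. *)
have M0 : 0 <= 1 + e^-1 by rewrite addr_ge0.
have H : (\int[leb3]_(x in S0) (wt2 e x.2 * f x ^+ 2)%:E +
     \int[leb2]_(y in Dr) (0 * t y ^+ 2)%:E <=
   4%:E * (\int[leb2]_(y in Dr) (wt1 e (zc m y) * t y ^+ 2)%:E +
     (\int[leb3]_(x in S0) (wt1 e x.2 * f x ^+ 2)%:E +
      \int[leb3]_(x in S0) (wt1 e x.2 * q x ^+ 2)%:E)))%E.
  apply: (@trace_limit R m r0 r0 S0 (fun x => wt2 e x.2) (fun x => wt1 e x.2) (fun x => wt1 e x.2)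
    (cst 0) (fun y => wt1 e (zc m y)) (1 + e^-1) f q t) => //.
  - by split; apply: mc; [exact: wt2_continuous|exact: wt1_continuous|exact: wt1_continuous].
  - exact: (@measurable_wt_zc R m _ Dr (wt1_continuous e0)).
  - move=> x _; rewrite wt2_ge0 // wt1_ge0 //; have := wt1_le1 x.2 e0; have := wt2_le x.2 e0.
    move=> a b; split=> //=; first by apply: le_trans a _; rewrite lerDr.
      by apply: le_trans b _; rewrite lerDl.
    by apply: le_trans b _; rewrite lerDl.
  - move=> y _; rewrite /cst lexx wt1_ge0 //; have := wt1_le1 (zc m y) e0 => a.
    by split=> //=; apply: le_trans a _; rewrite lerDl.
  - move=> g gC; under [X in (_ + X <= _)%E]eq_integral do rewrite /cst mul0r.
    rewrite integral0 adde0.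
    apply: (le_trans (slab_hardy r0 gC (ltW m0) r00 e0)).
    apply: leeD => //; under eq_integral do rewrite EFinD.
    rewrite ge0_integralD //.
    + by move=> x _; rewrite lee_fin mulr_ge0 ?sqr_ge0 // wt1_ge0.
    + apply/measurable_EFinP; apply: measurable_funM; first exact: mc (wt1_continuous e0).
      by apply: measurable_sqr; exact: measurable_f.
    + by move=> x _; rewrite lee_fin mulr_ge0 ?sqr_ge0 // wt1_ge0.
    + apply/measurable_EFinP; apply: measurable_funM; first exact: mc (wt1_continuous e0).
      by apply: measurable_sqr; exact: measurable_df.
move: H; under [X in (_ + X <= _)%E]eq_integral do rewrite /cst mul0r.
rewrite integral0 adde0 => H; apply: (le_trans H).
have -> : eps%:E = (4%:E * ((eps / 12)%:E + ((eps / 12)%:E + (eps / 12)%:E)))%E.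
  by rewrite -!EFinD -EFinM; congr (_%:E); field.
by apply: lee_wpmul2l; [rewrite lee_fin|apply: leeD => //; exact: leeD].
Unshelve. all: by end_near. Qed.

End geom.
End seq.

Section testL2.
Variables (m r0 rho : R).
Hypotheses (m0 : 0 < m) (r00 : 0 < r0).
Notation S0 := (slab (disc r0) (zc m) r0 : set (mR3 R)).

Lemma testf_le e x : 0 < e -> 0 <= x.2 -> `|testf rho e x| <= 4 * e * (x.2 + e) ^- 3.
Proof.
move=> e0 x0; have p0 : 0 < x.2 + e by rewrite ltr_wpDl.
rewrite normrM ger0_norm ?cutoff_ge0 //.
apply: (@le_trans _ _ `|kern e x|); first by rewrite ler_piMl ?cutoff_le1.
apply: (le_trans (kern_bound e0 x0)).
rewrite ler_wpM2l ?mulr_ge0 ?(ltW e0) // -exprVn.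
have r_0 : 0 <= invdist e x by rewrite ltW // invdist_gt0.
rewrite ler_pXn2r ?nnegrE ?invr_ge0 ?(ltW p0) //.
by have [_ _] := invdist_components e0 x0; rewrite -ler_pdivlMr // mul1r.
Qed.

(** By scaling: the square of [testf] divided by [wt2] is at most 16 e (x3 + e)^(-4), and the power
    -4 = -3 (4/3) integrates over the slab to O(1 / e). *)
Lemma testf_weighted_L2 : exists2 K, 0 <= K & forall e, 0 < e ->
  (\int[leb3]_(x in S0) ((testf rho e x) ^+ 2 / wt2 e x.2)%:E <= K%:E)%E.
Proof.
have b1 : 1 < 4 / 3 :> R by lra.
have [K K0 hK] := slab_powR m0 r00 b1.
exists (16 * K); first by rewrite mulr_ge0.
move=> e e0; have mS0 := slab_measurable m r0 r0.
have hx (x : R3 R) : S0 x -> 0 <= x.2.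
  by move=> [_ /andP[h _]]; apply: le_trans (ltW h); rewrite zc_ge0 // ltW.
have mp : measurable_fun S0 (fun x => (x.2 + e) `^ (- (3 * (4 / 3))) : R).
  apply: (@eq_measurable_fun _ _ _ _ _ (fun x : mR3 R => (`|x.2| + e) `^ (- (3 * (4 / 3))) : R)).
    by move=> x; rewrite inE => /hx x0; rewrite ger0_norm.
  apply: continuous_measurable_R3; apply: (@powR_continuous_pos _ _ (fun x : R3 R => `|x.2| + e)).
    by move=> x; apply: cvgD; [apply: cvg_norm; exact: c3_continuous|exact: cvg_cst].
  by move=> x; rewrite ltr_wpDl.
have mt : measurable_fun S0 (fun x => testf rho e x ^+ 2 / wt2 e x.2).
  apply: measurable_funM.
    apply: measurable_sqr => //; apply: continuous_measurable_R3.
    exact: Cn_continuous (Cn_testf 0 rho e0).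
  apply: (@measurable_wt R (fun s => (wt2 e s)^-1)) => s; apply: cvgV; first by rewrite gt_eqF // wt2_gt0.
  exact: wt2_continuous.
apply: (@le_trans _ _ (\int[leb3]_(x in S0) (16 * e * (x.2 + e) `^ (- (3 * (4 / 3))))%:E)%E).
  apply: int_le => //.
  - by apply: measurable_funM => //; exact: measurable_cst.
  - by move=> x _; rewrite divr_ge0 ?sqr_ge0 // wt2_ge0.
  - move=> x /hx x0; have p0 : 0 < x.2 + e by rewrite ltr_wpDl.
    have -> : - (3 * (4 / 3)) = - 4%:R :> R by field.
    rewrite powR_invn ?(ltW p0) // ler_pdivrMr ?wt2_gt0 //.
    rewrite /wt2 ger0_norm //.
    have -> : 16 * e * (x.2 + e) ^- 4 * (e / (x.2 + e) ^+ 2) = (4 * e * (x.2 + e) ^- 3) ^+ 2.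
      by field; rewrite gt_eqF.
    rewrite -(real_normK (num_real (testf rho e x))) ler_sqr ?nnegrE ?testf_le //.
    by rewrite mulr_ge0 ?mulr_ge0 ?(ltW e0) // invr_ge0 exprn_ge0 // ltW.
rewrite int_Zl //; last by rewrite mulr_ge0 // ltW.
  apply: (@le_trans _ _ ((16 * e)%:E * (K * e `^ (3 - 3 * (4 / 3)))%:E)%E).
    by apply: lee_wpmul2l; [rewrite lee_fin mulr_ge0 // ltW|exact: hK].
  have -> : 3 - 3 * (4 / 3) = -1 :> R by field.
  rewrite powR_inv1 ?(ltW e0) // -EFinM lee_fin le_eqVlt; apply/orP; left; apply/eqP.
  by field; rewrite gt_eqF.
by move=> x _; exact: powR_ge0.
Qed.

End testL2.

(* Cauchy-Schwarz with the weight [wt2], then the Hardy inequality, which bounds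
   the weighted norm of [f] by quantities that vanish by dominated convergence. *)
Lemma lower_order_term (m r0 rho : R) (en : nat -> R) (f q : R3 R -> R) (t : R * R -> R) (eps : R) :
  0 < m -> 0 < r0 -> (forall n, 0 < en n) -> en n @[n --> \oo] --> (0 : R) ->
  smooth_approx m r0 r0 f q t ->
  L2r leb3 (slab (disc r0) (zc m) r0 : set (mR3 R)) f ->
  L2r leb3 (slab (disc r0) (zc m) r0 : set (mR3 R)) q ->
  L2r leb2 (disc r0 : set (mR * mR)) t -> 0 < eps ->
  \forall n \near \oo,
    (\int[leb3]_(x in slab (disc r0) (zc m) r0) `|f x * testf rho (en n) x|%:E <= eps%:E)%E.
Proof.
move=> m0 r00 en0 enc fa Lf Lq Lt eps0.
have mS0 := slab_measurable m r0 r0; have [mf _] := Lf.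
have [K K0 hK] := testf_weighted_L2 rho m0 r00.
pose a := eps / (Num.sqrt K + 1).
have k1 : 0 < Num.sqrt K + 1 by rewrite ltr_wpDl ?sqrtr_ge0.
have a0 : 0 < a by rewrite divr_gt0.
have a2 : 0 < a ^+ 2 by rewrite exprn_gt0.
have := hardy_seq en0 enc m0 r00 fa Lf Lq Lt a2.
apply: filterS => n hn; have e0 := en0 n; set e := en n in e0 hn *.
have w0 (x : R3 R) : 0 < Num.sqrt (wt2 e x.2) by rewrite sqrtr_gt0 wt2_gt0.
have mw : measurable_fun (slab (disc r0) (zc m) r0 : set (mR3 R)) (fun x => Num.sqrt (wt2 e x.2)).
  apply: (@measurable_wt R (fun s => Num.sqrt (wt2 e s))) => s.
  by apply: (@continuous_comp _ _ _ (wt2 e) Num.sqrt); [exact: wt2_continuous|exact: sqrt_continuous].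
have mwi : measurable_fun (slab (disc r0) (zc m) r0 : set (mR3 R)) (fun x => (Num.sqrt (wt2 e x.2))^-1).
  apply: (@measurable_wt R (fun s => (Num.sqrt (wt2 e s))^-1)) => s.
  apply: cvgV; first by rewrite gt_eqF // sqrtr_gt0 wt2_gt0.
  by apply: (@continuous_comp _ _ _ (wt2 e) Num.sqrt); [exact: wt2_continuous|exact: sqrt_continuous].
have mt : measurable_fun (slab (disc r0) (zc m) r0 : set (mR3 R)) (testf rho e).
  by apply: continuous_measurable_R3; exact: Cn_continuous (Cn_testf 0 rho e0).
have h1 : (\int[leb3]_(x in slab (disc r0) (zc m) r0) ((f x * Num.sqrt (wt2 e x.2)) ^+ 2)%:E <= (a ^+ 2)%:E)%E.
  apply: le_trans hn; rewrite le_eqVlt; apply/orP; left; apply/eqP; apply: eq_integral => x _.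
  by rewrite exprMn sqr_sqrtr ?wt2_ge0 // mulrC.
have h2 : (\int[leb3]_(x in slab (disc r0) (zc m) r0) ((testf rho e x * (Num.sqrt (wt2 e x.2))^-1) ^+ 2)%:E <= (Num.sqrt K ^+ 2)%:E)%E.
  rewrite sqr_sqrtr //; apply: le_trans (hK _ e0); rewrite le_eqVlt; apply/orP; left; apply/eqP.
  by apply: eq_integral => x _; rewrite exprMn exprVn sqr_sqrtr ?wt2_ge0.
have := cauchy_schwarz_int mS0 (measurable_funM mf mw) (measurable_funM mt mwi) (ltW a0) (sqrtr_ge0 K) h1 h2.
under eq_integral => x _.
  have -> : f x * Num.sqrt (wt2 e x.2) * (testf rho e x * (Num.sqrt (wt2 e x.2))^-1) = f x * testf rho e x.
    by field; rewrite gt_eqF.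
  over.
move=> H; apply: (le_trans H); rewrite lee_fin /a mulrAC ler_pdivrMr // ler_wpM2l ?(ltW eps0) //.
by rewrite lerDl.
Qed.

Lemma smooth_derive (f : R3 R -> R) i : smooth f -> smooth ('D_(evec i) f).
Proof. by move=> fs n; exact: Cn_derive i (fs n.+1). Qed.

(** [zero_trace_ibp], applied with each partial derivative of [testf] as test function, moves the
    second derivative onto the kernel. The sum is the Laplacian, of size O(e) by [laplacian_testf],
    against the integrable [u]. *)
Lemma gradient_term (m r0 h rho E : R) (u : R3 R -> R) (p : 'I_3 -> R3 R -> R) (t : R * R -> R) :
  0 < m -> 0 < r0 -> 0 < rho -> rho < r0 -> rho < h ->
  slab (disc r0) (zc m) r0 `<=` tcone m h ->
  leb3.-integrable (tcone m h : set (mR3 R)) (EFin \o u) ->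
  (forall i, leb3.-integrable (tcone m h : set (mR3 R)) (EFin \o p i)) ->
  (forall i, wpd (tcone m h) i u (p i)) ->
  smooth_approx m r0 r0 u (p i3) t -> {ae leb2, forall y, disc r0 y -> t y = 0} -> 0 <= E ->
  (\int[leb3]_(x in slab (disc r0) (zc m) r0) (p i3 x ^+ 2)%:E <= E%:E)%E ->
  exists2 C, 0 <= C & forall e, 0 < e ->
  `|\sum_(i < 3) \int[leb3]_(x in (tcone m h : set (mR3 R))) (p i x * 'D_(evec i) (testf rho e) x)| <= C * e.
Proof.
move=> m0 r00 rho0 rr rh hS ui pi up ua t0 E0 hE.
have oD := @tcone_open R m h; have mD : measurable (tcone m h : set (mR3 R)) by exact: open_measurable_R3.
have [C C0 hC] := laplacian_testf rho0.
have mu_ : measurable_fun (tcone m h : set (mR3 R)) u by apply/measurable_EFinP; case/integrableP: ui.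
pose U := \int[leb3]_(x in (tcone m h : set (mR3 R))) `|u x|.
have U0 : 0 <= U by apply: Rintegral_ge0 => x _.
exists (C * U); first exact: mulr_ge0.
move=> e e0; pose phi := testf rho e.
have phis : smooth phi by move=> n; exact: Cn_testf.
have sphi := testf_supp e rho0.
have scl := @enorm_le_closed R rho.
have dsp i : supported_in [set x : R3 R | enorm x <= rho] ('D_(evec i) phi).
  exact: (@derive_supp R phi _ (evec i) scl sphi).
have ibp i := zero_trace_ibp m0 r00 rr rh ui (pi i) (up i) ua t0 E0 hE
  (smooth_derive i phis) (dsp i) hS.
pose L i x := 'D_(evec i) ('D_(evec i) phi) x.
have Lc i : continuous (L i).
  exact: Cn_continuous (smooth_derive i (smooth_derive i phis) 0%N).
have mL i : measurable_fun (tcone m h : set (mR3 R)) (L i) by exact: continuous_measurable_R3.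
have Ls i := @derive_supp R _ _ (evec i) scl (dsp i).
have Li i : leb3.-integrable (tcone m h : set (mR3 R)) (EFin \o (fun x => u x * L i x)).
  have [B B0 hB] := cs_bounded (Lc i) (Ls i).
  by apply: (@integrable_mul_bounded _ _ _ leb3 _ u _ B).
have E3 : \sum_(i < 3) \int[leb3]_(x in (tcone m h : set (mR3 R))) (p i x * 'D_(evec i) phi x) =
   - \int[leb3]_(x in (tcone m h : set (mR3 R))) (u x * (L i1 x + L i2 x + L i3 x)).
  rewrite sum3.
  have -> : \int[leb3]_(x in (tcone m h : set (mR3 R))) (u x * (L i1 x + L i2 x + L i3 x)) =
      \int[leb3]_(x in (tcone m h : set (mR3 R))) (u x * L i1 x) +
      \int[leb3]_(x in (tcone m h : set (mR3 R))) (u x * L i2 x) +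
      \int[leb3]_(x in (tcone m h : set (mR3 R))) (u x * L i3 x).
    rewrite -RintegralD // -RintegralD //; last exact: (integrableD mD (Li i1) (Li i2)).
    by apply: eq_Rintegral => x _; rewrite !mulrDr.
  have P i : \int[leb3]_(x in (tcone m h : set (mR3 R))) (p i x * 'D_(evec i) phi x) =
      - \int[leb3]_(x in (tcone m h : set (mR3 R))) (u x * L i x).
    by rewrite [X in - X](ibp i) opprK.
  rewrite !opprD; congr (_ + _ + _); exact: P.
rewrite E3 normrN.
have LE x : tcone m h x -> `|L i1 x + L i2 x + L i3 x| <= C * e.
  move=> [xz _]; have x0 : 0 < x.2 by apply: le_lt_trans xz; rewrite zc_ge0 // ltW.
  by have := hC e x e0 x0; rewrite sum3.
have mLL : measurable_fun (tcone m h : set (mR3 R)) (fun x => L i1 x + L i2 x + L i3 x).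
  by apply: measurable_funD; [exact: measurable_funD|].
have uLi : leb3.-integrable (tcone m h : set (mR3 R)) (EFin \o (fun x => u x * (L i1 x + L i2 x + L i3 x))).
  by apply: (@integrable_mul_bounded _ _ _ leb3 _ u _ (C * e)).
apply: (le_trans (le_normr_Rintegral mD uLi)).
rewrite -mulrA [U * e]mulrC mulrA /U -RintegralZl //; last exact: (integrable_norm ui).
apply: le_Rintegral => //.
- exact: (integrable_norm uLi).
- exact: (integrableZl mD (C * e) (integrable_norm ui)).
- by move=> x Dx; rewrite normrM mulrC ler_wpM2r //; exact: LE.
Qed.

End VolumeTerms.

(** * The kernel on the lateral surface; the trace inequality *)

Section BoundaryTerms.
Context {R : realType}.
Notation mR := (measurableTypeR R).
Notation mu := (@lebesgue_measure R).

Definition graph (m : R) (y : R * R) : R3 R := (y, zc m y).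

Lemma enorm_graph (m : R) y : 0 < m -> enorm (graph m y) = Num.sqrt (1 + m ^+ 2) / m * zc m y.
Proof.
move=> m0; have q0 := sqn_ge0 y.
have z0 : 0 <= zc m y by rewrite zc_ge0 // ltW.
have -> : Num.sqrt (1 + m ^+ 2) / m * zc m y = Num.sqrt (1 + m ^+ 2) * Num.sqrt (sqn y).
  by rewrite /zc; field; rewrite gt_eqF.
apply/eqP; rewrite -(@eqrXn2 _ 2) ?enorm_ge0 ?mulr_ge0 ?sqrtr_ge0 //.
rewrite sqr_enorm !exprMn (sqr_sqrtr (addr_ge0 ler01 (sqr_ge0 m))) (sqr_sqrtr q0) /=.
by apply/eqP; ring.
Qed.

Lemma testf_graph_out (m r0 rho e : R) y : 0 < m -> 0 < rho -> rho < r0 -> ~ disc r0 y ->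
  testf rho e (graph m y) = 0.
Proof.
move=> m0 rho0 rr yd; apply: (testf_supp e rho0) => /= h; apply: yd; rewrite /disc /=.
have h2 : enorm (graph m y) ^+ 2 < r0 ^+ 2.
  rewrite ltr_sqr ?nnegrE ?enorm_ge0 ?(ltW (lt_trans rho0 rr)) //.
  exact: le_lt_trans rr.
move: h2; rewrite sqr_enorm /=; have := sqr_ge0 (zc m y); lra.
Qed.

Lemma graph_continuous (m : R) : continuous (graph m).
Proof.
by apply: (@continuous_pair _ _ _ id (zc m)) => y; [exact: cvg_id|exact: zc_continuous].
Qed.

Lemma testf_graph_continuous (m rho e : R) : 0 < e -> continuous (fun y => testf rho e (graph m y)).
Proof.
move=> e0 y; apply: (@continuous_comp _ _ _ (graph m) (testf rho e)); first exact: graph_continuous.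
exact: (Cn_continuous (Cn_testf 0 rho e0)).
Qed.

Section fixed.
Variables (m r0 rho : R).
Hypotheses (m0 : 0 < m) (r00 : 0 < r0).
Notation Dr := (disc r0 : set (mR * mR)).

Lemma testf_graph_le (e : R) y : 0 < e ->
  `|testf rho e (graph m y)| <= 4 * e * (zc m y + e) ^- 3.
Proof. by move=> e0; apply: testf_le => //=; rewrite zc_ge0 // ltW. Qed.

Let zp (e : R) y : 0 < e -> 0 < zc m y + e.
Proof. by move=> e0; rewrite ltr_wpDl // zc_ge0 // ltW. Qed.

Let mpow (e a : R) : 0 < e -> measurable_fun Dr (fun y => (zc m y + e) `^ a : R).
Proof.
move=> e0; apply: continuous_measurable_R2; apply: (@powR_continuous_pos _ _ (fun y => zc m y + e)).
  by move=> y; apply: cvgD; [exact: zc_continuous|exact: cvg_cst].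
by move=> y; exact: zp.
Qed.

(** The square is at most 16 e^2 (z + e)^(-6), with z the height, and integrates over the disc to
    O(e^(-2)). This growth is the price of testing against a trace error known in L^2, and the
    reason why [e] has to shrink more slowly than the approximation error. *)
Lemma testf_graph_L2 : exists2 K, 0 <= K & forall e, 0 < e ->
  (\int[leb2]_(y in Dr) (testf rho e (graph m y) ^+ 2)%:E <= ((K / e) ^+ 2)%:E)%E.
Proof.
have b1 : 1 < 3 :> R by lra.
have [K K0 hK] := disc_powR m0 b1 r00.
exists (4 * Num.sqrt K); first by rewrite mulr_ge0 ?sqrtr_ge0.
move=> e e0; have mD := @disc_measurable R r0.
apply: (@le_trans _ _ (\int[leb2]_(y in Dr) (16 * e ^+ 2 * (zc m y + e) `^ (- (2 * 3)))%:E)%E).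
  apply: int_le => //.
  - apply: measurable_sqr => //; apply: continuous_measurable_R2; exact: testf_graph_continuous.
  - by apply: measurable_funM; [exact: measurable_cst|exact: mpow].
  - by move=> y _; exact: sqr_ge0.
  - move=> y _; have p0 := zp y e0.
    have -> : - (2 * 3) = - 6%:R :> R by ring.
    rewrite powR_invn ?(ltW p0) //.
    have -> : 16 * e ^+ 2 * (zc m y + e) ^- 6 = (4 * e * (zc m y + e) ^- 3) ^+ 2.
      by field; rewrite gt_eqF.
    rewrite -(real_normK (num_real (testf rho e (graph m y)))) ler_sqr ?nnegrE ?testf_graph_le //.
    by rewrite mulr_ge0 ?mulr_ge0 ?(ltW e0) // invr_ge0 exprn_ge0 // ltW.
have e2 : 0 <= 16 * e ^+ 2 by rewrite mulr_ge0 ?sqr_ge0.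
rewrite int_Zl //; [|exact: mpow|by move=> y _; exact: powR_ge0].
apply: (@le_trans _ _ ((16 * e ^+ 2)%:E * (K * e `^ (2 - 2 * 3))%:E)%E).
  by apply: lee_wpmul2l; [rewrite lee_fin|exact: hK].
have -> : 2 - 2 * 3 = - 4%:R :> R by ring.
rewrite powR_invn ?(ltW e0) // -EFinM lee_fin le_eqVlt; apply/orP; left; apply/eqP.
rewrite !exprMn sqr_sqrtr //; by field; rewrite gt_eqF.
Qed.

(** The integrand is of order e (z + e)^(a - 3), with z the height, and integrates to O(e^a); the
    exponent 3 - a exceeds the dimension 2 because a < 1. *)
Lemma testf_graph_holder (a : R) : 0 < a < 1 -> exists2 K, 0 <= K & forall e, 0 < e ->
  (\int[leb2]_(y in Dr) (`|testf rho e (graph m y)| * enorm (graph m y) `^ a)%:E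
     <= (K * e `^ a)%:E)%E.
Proof.
move=> /andP[a0 a1].
have b1 : 1 < (3 - a) / 2 by lra.
have [K K0 hK] := disc_powR m0 b1 r00.
pose c := (Num.sqrt (1 + m ^+ 2) / m) `^ a.
have c0 : 0 <= c by exact: powR_ge0.
exists (4 * c * K); first by rewrite mulr_ge0 // mulr_ge0.
move=> e e0; have mD := @disc_measurable R r0.
have m1 : 0 <= Num.sqrt (1 + m ^+ 2) / m by rewrite divr_ge0 ?sqrtr_ge0 // ltW.
have z0 y : 0 <= zc m y by rewrite zc_ge0 // ltW.
have c4 : 0 <= 4 * c * e by rewrite mulr_ge0 ?mulr_ge0 // ltW.
have mt : measurable_fun Dr (fun y => testf rho e (graph m y)).
  by apply: continuous_measurable_R2; exact: testf_graph_continuous.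
apply: (@le_trans _ _ (\int[leb2]_(y in Dr) (4 * c * e * (zc m y + e) `^ (- (2 * ((3 - a) / 2))))%:E)%E).
  apply: int_le => //.
  - apply: measurable_funM; first exact: measurableT_comp.
    apply: (measurableT_comp (measurable_powR a)); apply: continuous_measurable_R2 => y.
    by apply: (@continuous_comp _ _ _ (graph m) (@enorm R)); [exact: graph_continuous|exact: enorm_continuous].
  - by apply: measurable_funM; [exact: measurable_cst|exact: mpow].
  - by move=> y _; rewrite mulr_ge0 // powR_ge0.
  - move=> y _; have p0 := zp y e0.
    rewrite enorm_graph // powRM //; rewrite -/c.
    have -> : - (2 * ((3 - a) / 2)) = - 3%:R + a :> R by field.
    rewrite powRD; last by rewrite (gt_eqF p0) implybT.
    rewrite powR_invn ?(ltW p0) //.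
    have -> : 4 * c * e * ((zc m y + e) ^- 3 * (zc m y + e) `^ a) =
      4 * e * (zc m y + e) ^- 3 * (c * (zc m y + e) `^ a) by ring.
    apply: ler_pM => //; first by rewrite mulr_ge0 // powR_ge0.
      exact: testf_graph_le.
    rewrite ler_wpM2l //; apply: ge0_ler_powR; rewrite ?nnegrE ?(ltW a0) ?(ltW p0) //.
    by rewrite lerDl ltW.
rewrite int_Zl //; [|exact: mpow|by move=> y _; exact: powR_ge0].
apply: (@le_trans _ _ ((4 * c * e)%:E * (K * e `^ (2 - 2 * ((3 - a) / 2)))%:E)%E).
  by apply: lee_wpmul2l; [rewrite lee_fin|exact: hK].
have -> : 2 - 2 * ((3 - a) / 2) = a + -1 :> R by field.
rewrite powRD; last by rewrite (gt_eqF e0) implybT.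
rewrite powR_inv1 ?(ltW e0) // -EFinM lee_fin le_eqVlt; apply/orP; left; apply/eqP.
by field; rewrite gt_eqF.
Qed.

(** [slab_trace] passed through [trace_limit], whose general shape is met by weights 0 and 1 in the
    remaining places. *)
Lemma trace_inequality (f q : R3 R -> R) (t : R * R -> R) : smooth_approx m r0 r0 f q t ->
  (\int[leb2]_(y in Dr) (t y ^+ 2)%:E <=
   4%:E * ((r0^-1 + 1)%:E * \int[leb3]_(x in slab (disc r0) (zc m) r0) (f x ^+ 2)%:E +
     \int[leb3]_(x in slab (disc r0) (zc m) r0) (q x ^+ 2)%:E))%E.
Proof.
move=> fa; have mS0 := slab_measurable m r0 r0; have mD := @disc_measurable R r0.
have [mf mq mt _] := fa.
have ri : 0 <= r0^-1 by rewrite invr_ge0 ltW.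
have R1 : 0 <= r0^-1 + 1 by rewrite addr_ge0.
have R2 : 1 <= r0^-1 + 1 by rewrite lerDr.
have H : (\int[leb3]_(x in slab (disc r0) (zc m) r0) (0 * f x ^+ 2)%:E +
     \int[leb2]_(y in Dr) (1 * t y ^+ 2)%:E <=
   4%:E * (\int[leb2]_(y in Dr) (0 * t y ^+ 2)%:E +
     (\int[leb3]_(x in slab (disc r0) (zc m) r0) ((r0^-1 + 1) * f x ^+ 2)%:E +
      \int[leb3]_(x in slab (disc r0) (zc m) r0) (1 * q x ^+ 2)%:E)))%E.
  apply: (@trace_limit R m r0 r0 (slab (disc r0) (zc m) r0) (cst 0) (cst (r0^-1 + 1)) (cst 1)
    (cst 1) (cst 0) (r0^-1 + 1) f q t) => //.
  - by move=> x _; rewrite /cst !lexx ler01 R1 R2.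
  - by move=> y _; rewrite /cst lexx ler01 R1 R2.
  - move=> g gC; rewrite /cst.
    under [X in (X + _ <= _)%E]eq_integral do rewrite mul0r.
    under [X in (_ <= X + _)%E]eq_integral do rewrite mul0r.
    under [X in (_ + X <= _)%E]eq_integral do rewrite mul1r.
    under [X in (_ <= _ + (_ + X))%E]eq_integral do rewrite mul1r.
    rewrite !integral0 !add0e; apply: (le_trans (slab_trace m r0 gC r00)).
    under [X in (X <= _)%E]eq_integral do rewrite EFinD.
    rewrite ge0_integralD //.
    + by move=> x _; rewrite lee_fin mulr_ge0 ?sqr_ge0 // addr_ge0.
    + apply/measurable_EFinP; apply: measurable_funM; first exact: measurable_cst.
      by apply: measurable_sqr; exact: measurable_f.
    + by move=> x _; rewrite lee_fin sqr_ge0.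
    + by apply/measurable_EFinP; apply: measurable_sqr; exact: measurable_df.
move: H.
under [X in (X + _ <= _)%E]eq_integral do rewrite mul0r.
under [X in (_ <= _ * (X + _))%E]eq_integral do rewrite mul0r.
under [X in (_ + X <= _)%E]eq_integral do rewrite mul1r.
under [X in (_ <= _ * (_ + (_ + X)))%E]eq_integral do rewrite mul1r.
rewrite !integral0 !add0e int_Zl //; first exact: measurable_sqr.
by move=> x _; exact: sqr_ge0.
Qed.

End fixed.
End BoundaryTerms.

(** * Herglotz wave functions *)

Section Herglotz.
Context {R : realType}.
Notation mR := (measurableTypeR R).
Notation mu := (@lebesgue_measure R).
Notation SD := (sph_dom : set (mR * mR)).

Lemma mvt_bound (f df : R -> R) (C a b : R) : (forall x : R, is_derive x 1 f (df x)) ->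
  (forall x, `|x - a| <= `|b - a| -> `|df x| <= C) -> `|f b - f a| <= C * `|b - a|.
Proof.
move=> fd hC.
have fc : continuous f.
  by move=> x; apply: differentiable_continuous; apply/derivable1_diffP; case: (fd x).
have [ab|ba|->] := ltgtP a b; last by rewrite !subrr normr0 mulr0.
- have [c cab ->] := MVT ab (fun x _ => fd x) (continuous_subspaceT fc).
  rewrite normrM ler_wpM2r //; apply: hC; move: cab; rewrite in_itv /= => /andP[c1 c2].
  by rewrite !ger0_norm ?subr_ge0 ?(ltW c1) ?(ltW ab) // lerD2r ltW.
- have [c cab E] := MVT ba (fun x _ => fd x) (continuous_subspaceT fc).
  rewrite distrC E normrM [`|b - a|]distrC ler_wpM2r //; apply: hC.
  move: cab; rewrite in_itv /= => /andP[c1 c2].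
  by rewrite !ler0_norm ?subr_le0 ?(ltW c2) ?(ltW ba) // lerN2 lerD2r ltW.
Qed.

Lemma cos_lipschitz (a b : R) : `|cos b - cos a| <= `|b - a|.
Proof.
rewrite -[leRHS]mul1r; apply: (@mvt_bound cos (fun x => - sin x) 1 a b (fun x => is_derive_cos x)) => x _.
by rewrite normrN; rewrite ler_norml sin_geN1 sin_le1.
Qed.

Lemma sin_lipschitz (a b : R) : `|sin b - sin a| <= `|b - a|.
Proof.
rewrite -[leRHS]mul1r; apply: (@mvt_bound sin cos 1 a b (fun x => is_derive_sin x)) => x _.
by rewrite ler_norml cos_geN1 cos_le1.
Qed.

(** Mean value bound for x -> cos (u + x) + x sin u, whose derivative sin u - sin (u + x) is at most
    |x|. Its uniformity in [u] allows integration over the sphere. *)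
Lemma cos_taylor (u d : R) : `|cos (u + d) - cos u + d * sin u| <= d ^+ 2.
Proof.
pose f x := cos (u + x) + x * sin u.
have fd (x : R) : is_derive x 1 f (- sin (u + x) + sin u).
  have h1 : is_derive x 1 (fun x : R => u + x) 1.
    by have := is_deriveDE (is_derive_cst u x 1) (is_derive_id x 1); rewrite add0r.
  have h2 := @is_derive1_comp R cos _ x _ _ (is_derive_cos _) h1.
  have h3 := is_deriveME (is_derive_id x 1) (is_derive_cst (sin u) x 1).
  have := is_deriveDE h2 h3; move=> h; apply: (is_derive_val h); rewrite /cst /=; ring.
have := @mvt_bound f _ `|d| 0 d fd.
rewrite /f mul0r !addr0 subr0 => H.
have -> : cos (u + d) - cos u + d * sin u = cos (u + d) + d * sin u - cos u by ring.
rewrite -(real_normK (num_real d)) expr2; apply: H => x; rewrite subr0 => xd.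
apply: le_trans xd; rewrite addrC -normrN opprB.
apply: (le_trans (sin_lipschitz _ _)); by rewrite [u + x]addrC addrK.
Qed.

Lemma sph_continuous (z : R3 R) : continuous (fun t : R * R => dot (sph t) z).
Proof.
have c1 (f : R -> R) : continuous f -> continuous (fun t : R * R => f t.1).
  by move=> fc t; apply: (@continuous_comp _ _ _ fst f); [exact: fst_continuous2|exact: fc].
have c2 (f : R -> R) : continuous f -> continuous (fun t : R * R => f t.2).
  by move=> fc t; apply: (@continuous_comp _ _ _ snd f); [exact: snd_continuous2|exact: fc].
have s1 := c1 _ (@continuous_sin R); have k1 := c1 _ (@continuous_cos R).
have s2 := c2 _ (@continuous_sin R); have k2 := c2 _ (@continuous_cos R).
move=> t; apply: cvgD; last by apply: cvgMl; exact: k1.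
by apply: cvgD; apply: cvgMl; apply: cvgM; (exact: s1 || exact: s2 || exact: k2).
Qed.

Lemma sph_norm (t : R * R) : dot (sph t) (sph t) = 1.
Proof.
have h1 := cos2Dsin2 t.1; have h2 := cos2Dsin2 t.2; rewrite /dot /sph /=.
have -> : sin t.1 * cos t.2 * (sin t.1 * cos t.2) + sin t.1 * sin t.2 * (sin t.1 * sin t.2)
  + cos t.1 * cos t.1 = sin t.1 ^+ 2 * (cos t.2 ^+ 2 + sin t.2 ^+ 2) + cos t.1 ^+ 2 by ring.
by rewrite h2 mulr1 addrC.
Qed.

Lemma dot_le (x y : R3 R) : `|dot x y| <= enorm x * enorm y.
Proof.
rewrite -ler_sqr ?nnegrE ?mulr_ge0 ?enorm_ge0 // real_normK ?num_real // exprMn.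
rewrite /enorm !sqr_sqrtr ?dot_ge0 // /dot.
set a := x.1.1; set b := x.1.2; set c := x.2; set a' := y.1.1; set b' := y.1.2; set c' := y.2.
have h : 0 <= (a * b' - b * a') ^+ 2 + (a * c' - c * a') ^+ 2 + (b * c' - c * b') ^+ 2.
  by rewrite !addr_ge0 ?sqr_ge0.
have -> : (a * a + b * b + c * c) * (a' * a' + b' * b' + c' * c') =
  (a * a' + b * b' + c * c') ^+ 2 + ((a * b' - b * a') ^+ 2 + (a * c' - c * a') ^+ 2 + (b * c' - c * b') ^+ 2) by ring.
by rewrite lerDl.
Qed.

Lemma sph_dot_le t (x : R3 R) : `|dot (sph t) x| <= enorm x.
Proof. have E : enorm (sph t) = 1 by rewrite /enorm sph_norm sqrtr1.
by have := dot_le (sph t) x; rewrite E mul1r. Qed.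

Lemma dotD (x y z : R3 R) : dot x (y + z) = dot x y + dot x z.
Proof. by rewrite /dot /=; ring. Qed.

Lemma dotZ (x y : R3 R) (h : R) : dot x (h *: y) = h * dot x y.
Proof. by rewrite /dot /= /GRing.scale /=; ring. Qed.

Lemma sph_dom_measurable : measurable SD.
Proof. by apply: measurableX; exact: measurable_itv. Qed.

Lemma sph_dom_finite : exists2 V, 0 <= V & leb2 SD = V%:E.
Proof.
have h0 : (0 <= leb2 SD)%E by [].
have hf : (leb2 SD < +oo)%E.
  have E : (mu2 SD = mu [set` `[(0%R : R), pi]] * mu [set` `[(0%R : R), (2 * pi)%R]])%E.
    by apply: product_measure1E; exact: measurable_itv.
  rewrite [ltLHS]E !lebesgue_measure_itv /=; do 2 case: ifP => _; rewrite ?mule0 ?mul0e //.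
  by rewrite -!EFinB -EFinM ltry.
by exists (fine (leb2 SD)); [exact: fine_ge0|rewrite fineK // ge0_fin_numE].
Qed.

Section fixed.
Variable k : R.

(** Both parts of a Herglotz function are combinations of such integrals. Keeping a free phase [c]
    lets the sine be a cosine with phase -pi/2, so that a derivative is an integral of the same kind
    with a new density and a shifted phase. *)
Definition osc (a : R * R -> R) (c : R) (x : R3 R) : R :=
  \int[leb2]_(t in SD) (a t * cos (k * dot (sph t) x + c)).

Definition L1s (a : R * R -> R) := leb2.-integrable SD (EFin \o a).

Let mSD := sph_dom_measurable.

Let argc (c : R) (x : R3 R) : continuous (fun t : R * R => k * dot (sph t) x + c).
Proof. by move=> t; apply: cvgD; [apply: cvgMr; exact: sph_continuous|exact: cvg_cst]. Qed.

Let mcos (c : R) (x : R3 R) : measurable_fun SD (fun t => cos (k * dot (sph t) x + c)).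
Proof.
apply: continuous_measurable_R2 => t.
by apply: (@continuous_comp _ _ _ (fun t => k * dot (sph t) x + c) cos); [exact: argc|exact: continuous_cos].
Qed.

Let mL1 a : L1s a -> measurable_fun SD a.
Proof. by case/integrableP => + _; move/measurable_EFinP. Qed.

Lemma osc_integrable a c x : L1s a -> leb2.-integrable SD (EFin \o (fun t => a t * cos (k * dot (sph t) x + c))).
Proof.
move=> ai; apply: (@integrable_mul_bounded _ _ _ leb2 SD a _ 1) => // t _.
by rewrite ler_norml cos_geN1 cos_le1.
Qed.

Lemma L1s_mul a (f : R * R -> R) B : L1s a -> continuous f -> (forall t, `|f t| <= B) ->
  L1s (fun t => a t * f t).
Proof.
move=> ai fc fB; apply: (@integrable_mul_bounded _ _ _ leb2 SD a _ B) => //.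
exact: continuous_measurable_R2.
Qed.

Lemma Rint_le_mul (a G : R * R -> R) (B : R) : L1s a -> measurable_fun SD G -> 0 <= B ->
  (forall t, `|G t| <= B) ->
  `|\int[leb2]_(t in SD) (a t * G t)| <= B * \int[leb2]_(t in SD) `|a t|.
Proof.
move=> ai mG B0 hB.
have i1 : leb2.-integrable SD (EFin \o (fun t => a t * G t)).
  by apply: (@integrable_mul_bounded _ _ _ leb2 SD a _ B).
apply: (le_trans (le_normr_Rintegral mSD i1)).
rewrite -RintegralZl //; last exact: (integrable_norm ai).
apply: le_Rintegral => //.
- exact: (integrable_norm i1).
- exact: (integrableZl mSD B (integrable_norm ai)).
- by move=> t _; rewrite normrM mulrC ler_wpM2r.
Qed.

Lemma osc_bound a c x : L1s a -> `|osc a c x| <= \int[leb2]_(t in SD) `|a t|.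
Proof.
move=> ai; rewrite -[leRHS]mul1r; apply: Rint_le_mul => // t.
by rewrite ler_norml cos_geN1 cos_le1.
Qed.

Lemma oscB a c x y : L1s a -> osc a c x - osc a c y =
  \int[leb2]_(t in SD) (a t * (cos (k * dot (sph t) x + c) - cos (k * dot (sph t) y + c))).
Proof.
move=> ai; rewrite /osc -RintegralB //; [|exact: osc_integrable|exact: osc_integrable].
by apply: eq_Rintegral => t _; rewrite mulrBr.
Qed.

Lemma osc_lipschitz a c x y : L1s a ->
  `|osc a c x - osc a c y| <= `|k| * enorm (x - y) * \int[leb2]_(t in SD) `|a t|.
Proof.
move=> ai; rewrite oscB //; apply: Rint_le_mul => //.
- exact: measurable_funB.
- by rewrite mulr_ge0 // enorm_ge0.
- move=> t; apply: (le_trans (cos_lipschitz _ _)).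
  have -> : k * dot (sph t) x + c - (k * dot (sph t) y + c) = k * dot (sph t) (x - y).
    by rewrite /dot /=; ring.
  by rewrite normrM ler_wpM2l // sph_dot_le.
Qed.

Lemma osc_continuous a c : L1s a -> continuous (osc a c).
Proof.
move=> ai x; apply/cvgrPdist_lt => e e0.
pose A := \int[leb2]_(t in SD) `|a t|.
have A0 : 0 <= A by apply: Rintegral_ge0 => t _.
have K1 : 0 < `|k| * A + 1 by rewrite ltr_wpDl // mulr_ge0.
have e1 : 0 < e / (`|k| * A + 1) by rewrite divr_gt0.
have hc : continuous (fun y : R3 R => enorm (x - y)).
  apply: (@continuous_slice R (R3 R) R (@enorm R) (fun y : R3 R => (x : R3 R) - y)) => [y|]; last exact: enorm_continuous.
  by apply: cvgB; [exact: cvg_cst|exact: cvg_id].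
have h0 : enorm (x - x) < e / (`|k| * A + 1).
  by rewrite subrr /enorm /dot /= !mulr0 !addr0 sqrtr0.
have : \forall y \near x, enorm (x - y) < e / (`|k| * A + 1).
  by have := hc x => /(_ _ (lt_nbhsl h0)); exact.
apply: filterS => y hy; apply: le_lt_trans (osc_lipschitz c x y ai) _; rewrite -/A.
rewrite mulrAC; apply: (@le_lt_trans _ _ (`|k| * A * (e / (`|k| * A + 1)))).
  by rewrite ler_wpM2l ?mulr_ge0 // ltW.
rewrite mulrCA gtr_pMr // ltr_pdivrMr // mul1r ltrDl //.
Qed.

(** [cos_taylor] under the integral bounds the remainder by a multiple of h^2, so differentiation
    under the integral sign reduces to [is_derive_quadratic]. *)
Lemma is_derive_osc a c x v : L1s a -> is_derive x v (osc a c)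
  (osc (fun t => a t * (- (k * dot (sph t) v))) (c - pi / 2) x).
Proof.
move=> ai; pose b t := - (k * dot (sph t) v).
have bB t : `|b t| <= `|k| * enorm v.
  by rewrite normrN normrM ler_wpM2l // sph_dot_le.
have bc : continuous b by move=> t; apply: cvgN; apply: cvgMr; exact: sph_continuous.
have abi : L1s (fun t => a t * b t) by exact: L1s_mul ai bc bB.
set d := osc _ _ x.
pose A := \int[leb2]_(t in SD) `|a t|.
apply/is_derive_line0.
pose r (h : R) := osc a c (h *: v + x) - osc a c x - h * d.
have rb (h : R) : `|r h| <= (`|k| * enorm v) ^+ 2 * A * h ^+ 2.
  have E : r h = \int[leb2]_(t in SD) (a t * (cos (k * dot (sph t) (h *: v + x) + c) - cos (k * dot (sph t) x + c)
     - h * (b t * sin (k * dot (sph t) x + c)))).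
    rewrite /r oscB // /d /osc -RintegralZl //; last first.
      exact: (osc_integrable (c - pi / 2) x abi).
    rewrite -RintegralB //.
    - apply: eq_Rintegral => t _; have -> : k * dot (sph t) x + (c - pi / 2) = k * dot (sph t) x + c - pi / 2 by ring.
      by rewrite cosB cos_pihalf sin_pihalf mulr0 add0r mulr1 /b; ring.
    - apply: (@integrable_mul_bounded _ _ _ leb2 SD a _ 2) => //; first exact: measurable_funB.
      move=> t _; apply: (le_trans (ler_normB _ _)).
      have h1 : `|cos (k * dot (sph t) (h *: v + x) + c)| <= 1 by rewrite ler_norml cos_geN1 cos_le1.
      have h2 : `|cos (k * dot (sph t) x + c)| <= 1 by rewrite ler_norml cos_geN1 cos_le1.
      lra.
    - exact: (integrableZl mSD h (osc_integrable (c - pi / 2) x abi)).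
  rewrite E mulrAC; apply: (le_trans (Rint_le_mul (B := (`|k| * enorm v) ^+ 2 * h ^+ 2) ai _ _ _)) => //.
  - apply: measurable_funB; first exact: measurable_funB.
    apply: continuous_measurable_R2 => t; apply: cvgMr; apply: cvgM; first exact: bc.
    by apply: (@continuous_comp _ _ _ (fun t => k * dot (sph t) x + c) sin); [exact: argc|exact: continuous_sin].
  - by rewrite mulr_ge0 ?sqr_ge0.
  - move=> t; pose dd := - (h * b t).
    have -> : k * dot (sph t) (h *: v + x) + c = k * dot (sph t) x + c + dd.
      by rewrite dotD dotZ /dd /b; ring.
    have -> : h * (b t * sin (k * dot (sph t) x + c)) = - (dd * sin (k * dot (sph t) x + c)).
      by rewrite /dd; ring.
    rewrite opprK; apply: (le_trans (cos_taylor _ _)).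
    rewrite /dd sqrrN exprMn mulrC ler_wpM2r ?sqr_ge0 // -(real_normK (num_real (b t))).
    by rewrite ler_sqr ?nnegrE ?mulr_ge0 ?enorm_ge0.
have r0 : r 0 = 0 by rewrite /r scale0r add0r subrr mul0r subr0.
have h1 := is_derive_quadratic r0 rb.
have h2 : is_derive (0 : R) 1 (fun h : R => h * d + osc a c x) d by exact: is_derive_affine.
have := is_deriveDE h1 h2; rewrite add0r.
by have -> : (fun h => r h + (h * d + osc a c x)) = (fun h => osc a c (h *: v + x))
  by apply/funext => h; rewrite /r; ring.
Qed.

(** Differentiation multiplies the density by a bounded continuous factor, so the induction keeps
    density and phase general. *)
Lemma Cn_osc n a c : L1s a -> Cn n (osc a c).
Proof.
elim: n a c => [|n ih] a c ai; first exact: osc_continuous.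
apply: (@Cn_of_derive _ _ _ (fun i => osc (fun t => a t * (- (k * dot (sph t) (evec i)))) (c - pi / 2))).
- exact: osc_continuous.
- by move=> i x; exact: is_derive_osc.
- move=> i; apply: ih; apply: (@L1s_mul _ _ (`|k| * enorm (evec i : R3 R))) => //.
    by move=> t; apply: cvgN; apply: cvgMr; exact: sph_continuous.
  by move=> t; rewrite normrN normrM ler_wpM2l // sph_dot_le.
Qed.

End fixed.
End Herglotz.

(** * Bounds for Herglotz functions by the norm of the kernel *)

Section HerglotzBounds.
Context {R : realType}.
Notation mR := (measurableTypeR R).
Notation SD := (sph_dom : set (mR * mR)).

Definition sph_weight (g : R3 R -> R[i]) b (t : R * R) : R := part b (g (sph t)) * sin t.1.

Lemma closed_measurable_R3 (F : set (R3 R)) : closed F -> measurable (F : set (mR3 R)).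
Proof.
by move=> cF; rewrite -[F]setCK; apply: measurableC; apply: open_measurable_R3; exact: closed_openC.
Qed.

Lemma measurable_sphere : measurable (sphere : set (mR3 R)).
Proof.
apply: closed_measurable_R3.
have -> : sphere = enorm @^-1` `[1, 1] :> set (R3 R).
  apply/seteqP; split => x; rewrite /sphere /= in_itv /=; first by move=> ->; rewrite lexx.
  by move=> /andP[h1 h2]; apply/eqP; rewrite eq_le h1 h2.
by apply: closed_comp => [x _|]; [exact: enorm_continuous|exact: interval_closed].
Qed.

Lemma measurable_sph (D : set (mR * mR)) : measurable_fun D (sph : mR * mR -> mR3 R).
Proof.
have c1 (f : R -> R) : continuous f -> continuous (fun t : R * R => f t.1).
  by move=> fc t; apply: (@continuous_comp _ _ _ fst f); [exact: fst_continuous2|exact: fc].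
have c2 (f : R -> R) : continuous f -> continuous (fun t : R * R => f t.2).
  by move=> fc t; apply: (@continuous_comp _ _ _ snd f); [exact: snd_continuous2|exact: fc].
have s1 := c1 _ (@continuous_sin R); have k1 := c1 _ (@continuous_cos R).
have s2 := c2 _ (@continuous_sin R); have k2 := c2 _ (@continuous_cos R).
apply: measurable_funTS.
apply: measurable_fun_pair; last by apply: continuous_measurable_R2; exact: k1.
apply: measurable_fun_pair; apply: continuous_measurable_R2 => t; apply: cvgM;
  (exact: s1 || exact: s2 || exact: k2).
Qed.

Lemma measurable_sph_part (g : R3 R -> R[i]) b : cmeasurable (sphere : set (mR3 R)) g ->
  measurable_fun SD (fun t => part b (g (sph t))).
Proof.
move=> mg; have mb := cmeasurable_part b mg.
apply: (measurable_comp measurable_sphere _ mb (@measurable_sph SD)).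
by move=> _ [t _ <-]; rewrite /sphere /= /enorm sph_norm sqrtr1.
Qed.

Lemma sin_sph_ge0 (t : R * R) : SD t -> 0 <= sin t.1.
Proof. by move=> [h _]; apply: sin_ge0_pi; move: h; rewrite /= in_itv. Qed.

Lemma measurable_sin1 : measurable_fun SD (fun t : R * R => sin t.1).
Proof.
apply: continuous_measurable_R2 => t.
by apply: (@continuous_comp _ _ _ fst sin); [exact: fst_continuous2|exact: continuous_sin].
Qed.

(** Cauchy-Schwarz with the Jacobian sin split into two square roots: one completes the L^2 norm on
    the sphere, the other is bounded on a domain of finite measure. *)
Lemma sph_weight_L1 : exists2 C, 0 <= C & forall g b (N : R), 0 <= N -> in_L2_sphere g ->
  (sphere_L2norm g <= N%:E)%E ->
  L1s (sph_weight g b) /\ \int[leb2]_(t in SD) `|sph_weight g b t| <= C * N.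
Proof.
have [V V0 hV] := @sph_dom_finite R.
exists (Num.sqrt V); first exact: sqrtr_ge0.
move=> g b N N0 [mg _] hN.
have mSD := @sph_dom_measurable R.
have mp b' := measurable_sph_part b' mg; have ms := measurable_sin1.
have s0 (t : R * R) : SD t -> Num.sqrt (sin t.1) ^+ 2 = sin t.1.
  by move=> /sin_sph_ge0 h; rewrite sqr_sqrtr.
have mq : measurable_fun SD (fun t : R * R => Num.sqrt (sin t.1)).
  apply: continuous_measurable_R2 => t.
  apply: (@continuous_comp _ _ _ (fun t : R * R => sin t.1) Num.sqrt); last exact: sqrt_continuous.
  by apply: (@continuous_comp _ _ _ fst sin); [exact: fst_continuous2|exact: continuous_sin].
have h0 : (\int[leb2]_(t in SD) (Normc.normc (g (sph t)) ^+ 2 * sin t.1)%:E <= (N ^+ 2)%:E)%E.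
  move: hN; rewrite /sphere_L2norm.
  have : (0 <= \int[leb2]_(t in SD) (Normc.normc (g (sph t)) ^+ 2 * sin t.1)%:E)%E.
    by apply: integral_ge0 => t ht; rewrite lee_fin mulr_ge0 ?sqr_ge0 // sin_sph_ge0.
  case: (integral _ _ _) => [s| |] //=; rewrite !lee_fin => s0' h.
  by rewrite -(sqr_sqrtr s0') ler_sqr ?nnegrE ?sqrtr_ge0.
have h1 : (\int[leb2]_(t in SD) ((part b (g (sph t)) * Num.sqrt (sin t.1)) ^+ 2)%:E <= (N ^+ 2)%:E)%E.
  apply: le_trans h0; apply: int_le => //.
  - by apply: measurable_sqr => //; exact: measurable_funM.
  - apply: measurable_funM => //; under eq_fun do rewrite normc_sqr.
    by apply: measurable_funD; exact: measurable_sqr.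
  - by move=> t _; exact: sqr_ge0.
  - move=> t ht; rewrite exprMn s0 // ler_wpM2r ?sin_sph_ge0 //.
    by rewrite normc_sqr; case: (b); rewrite ?lerDl ?lerDr sqr_ge0.
have h2 : (\int[leb2]_(t in SD) (Num.sqrt (sin t.1) ^+ 2)%:E <= (Num.sqrt V ^+ 2)%:E)%E.
  rewrite sqr_sqrtr // -hV -[leRHS]mul1e -integral_cst //.
  apply: int_le => //.
  - exact: measurable_sqr.
  - by move=> t ht; rewrite s0 // sin_le1.
have := cauchy_schwarz_int mSD (measurable_funM (mp b) mq) mq N0 (sqrtr_ge0 V) h1 h2.
have -> : (\int[leb2]_(t in SD) `|part b (g (sph t)) * Num.sqrt (sin t.1) * Num.sqrt (sin t.1)|%:E =
   \int[leb2]_(t in SD) `|sph_weight g b t|%:E)%E.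
  by apply: eq_integral => t; rewrite inE => ht; rewrite -mulrA -expr2 s0.
move=> H; have mw : measurable_fun SD (sph_weight g b) by exact: measurable_funM.
have [i1 _] := Rint_bound mSD mw H; split => //.
rewrite mulrC -lee_fin; apply: le_trans H.
by rewrite /Rintegral fineK // integrable_fin_num //; exact: (integrable_norm i1).
Qed.

Lemma herglotz_parts (k : R) g x : (forall b, L1s (sph_weight g b)) ->
  part true (herglotz k g x) = osc k (sph_weight g true) 0 x - osc k (sph_weight g false) (- (pi / 2)) x /\
  part false (herglotz k g x) = osc k (sph_weight g false) 0 x + osc k (sph_weight g true) (- (pi / 2)) x.
Proof.
move=> gi; rewrite /herglotz /sphere_cint !part_cint.
have mSD := @sph_dom_measurable R.
split.
  rewrite /osc -RintegralB //; [|exact: osc_integrable|exact: osc_integrable].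
  apply: eq_Rintegral => t _; rewrite part_mulr /sph_weight cosBpihalf addr0.
  by case: (g (sph t)) => a1 a2 /=; ring.
rewrite /osc -RintegralD //; [|exact: osc_integrable|exact: osc_integrable].
apply: eq_Rintegral => t _; rewrite part_mulr /sph_weight cosBpihalf addr0.
by case: (g (sph t)) => a1 a2 /=; ring.
Qed.

(** Each part is a combination of two integrals [osc], whose size and Lipschitz constant are
    controlled by the L^1 norm of the density; the resulting constant serves all kernels at once. *)
Lemma herglotz_bounds (k : R) : exists2 C, 0 <= C & forall g (N : R), 0 <= N ->
  in_L2_sphere g -> (sphere_L2norm g <= N%:E)%E ->
  [/\ csmooth (herglotz k g),
      forall b x y, `|part b (herglotz k g x) - part b (herglotz k g y)| <= C * N * enorm (x - y) &
      forall b x, `|part b (herglotz k g x)| <= C * N].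
Proof.
have [C C0 hC] := sph_weight_L1.
have K0 : 0 <= 2 * C + 2 * `|k| * C by rewrite addr_ge0 // !mulr_ge0.
exists (2 * C + 2 * `|k| * C) => // g N N0 gL hN.
have gi b : L1s (sph_weight g b) by have [] := hC g b N N0 gL hN.
have gb b : \int[leb2]_(t in SD) `|sph_weight g b t| <= C * N by have [] := hC g b N N0 gL hN.
have P x := herglotz_parts k x gi.
have CN : 0 <= C * N by rewrite mulr_ge0.
have kCN : 0 <= `|k| * C * N by rewrite !mulr_ge0.
have lip b c x y : `|osc k (sph_weight g b) c x - osc k (sph_weight g b) c y| <= `|k| * enorm (x - y) * (C * N).
  by apply: (le_trans (osc_lipschitz k c x y (gi b))); rewrite ler_wpM2l // mulr_ge0 // enorm_ge0.
have bd b c x : `|osc k (sph_weight g b) c x| <= C * N.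
  by apply: (le_trans (osc_bound k c x (gi b))).
split.
- split => n.
    have -> : (fun x => complex.Re (herglotz k g x)) =
      (fun x => osc k (sph_weight g true) 0 x - osc k (sph_weight g false) (- (pi / 2)) x).
      by apply/funext => x; exact: (P x).1.
    by apply: CnB; exact: Cn_osc.
  have -> : (fun x => complex.Im (herglotz k g x)) =
      (fun x => osc k (sph_weight g false) 0 x + osc k (sph_weight g true) (- (pi / 2)) x).
    by apply/funext => x; exact: (P x).2.
  by apply: CnD; exact: Cn_osc.
- move=> b x y; have e0 := enorm_ge0 (x - y).
  have hh : `|k| * enorm (x - y) * (C * N) + `|k| * enorm (x - y) * (C * N) <=
      (2 * C + 2 * `|k| * C) * N * enorm (x - y).
    have -> : `|k| * enorm (x - y) * (C * N) + `|k| * enorm (x - y) * (C * N) =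
      2 * `|k| * C * N * enorm (x - y) by ring.
    by rewrite ler_wpM2r // ler_wpM2r // lerDr mulr_ge0.
  case: b; rewrite ?(P x).1 ?(P y).1 ?(P x).2 ?(P y).2; apply: le_trans hh.
    have -> : osc k (sph_weight g true) 0 x - osc k (sph_weight g false) (- (pi / 2)) x
      - (osc k (sph_weight g true) 0 y - osc k (sph_weight g false) (- (pi / 2)) y) =
      (osc k (sph_weight g true) 0 x - osc k (sph_weight g true) 0 y) -
      (osc k (sph_weight g false) (- (pi / 2)) x - osc k (sph_weight g false) (- (pi / 2)) y) by ring.
    by apply: (le_trans (ler_normB _ _)); apply: lerD; exact: lip.
  have -> : osc k (sph_weight g false) 0 x + osc k (sph_weight g true) (- (pi / 2)) x
      - (osc k (sph_weight g false) 0 y + osc k (sph_weight g true) (- (pi / 2)) y) =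
      (osc k (sph_weight g false) 0 x - osc k (sph_weight g false) 0 y) +
      (osc k (sph_weight g true) (- (pi / 2)) x - osc k (sph_weight g true) (- (pi / 2)) y) by ring.
  by apply: (le_trans (ler_normD _ _)); apply: lerD; exact: lip.
- move=> b x.
  have hh : C * N + C * N <= (2 * C + 2 * `|k| * C) * N.
    have -> : C * N + C * N = 2 * C * N by ring.
    by rewrite ler_wpM2r // lerDl !mulr_ge0.
  case: b; rewrite ?(P x).1 ?(P x).2; apply: le_trans hh.
    by apply: (le_trans (ler_normB _ _)); apply: lerD; exact: bd.
  by apply: (le_trans (ler_normD _ _)); apply: lerD; exact: bd.
Qed.

End HerglotzBounds.

(** * The surface measure near the apex *)

Section Surface.
Context {R : realType}.
Notation mR := (measurableTypeR R).

Lemma measurable_graph (m : R) : measurable_fun setT (graph m : mR * mR -> mR3 R).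
Proof.
apply: measurable_fun_pair; first exact: measurable_id.
by apply: continuous_measurable_R2; exact: zc_continuous.
Qed.

Lemma enorm_triangle (x y : R3 R) : enorm (x + y) <= enorm x + enorm y.
Proof.
rewrite -ler_sqr ?nnegrE ?addr_ge0 ?enorm_ge0 // sqrrD -!dot_enorm.
have -> : dot (x + y) (x + y) = dot x x + 2 * dot x y + dot y y by rewrite /dot /=; ring.
rewrite lerD2r lerD2l mulr2n; have := le_trans (ler_norm _) (dot_le x y); lra.
Qed.

Lemma enorm_sub_le (x y : R3 R) : `|enorm x - enorm y| <= enorm (x - y).
Proof.
have h1 := enorm_triangle (x - y) y; have h2 := enorm_triangle (y - x) x.
have E : enorm (y - x) = enorm (x - y) by rewrite /enorm /dot /=; congr Num.sqrt; ring.
rewrite !subrK in h1 h2; rewrite E in h2; rewrite ler_norml; lra.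
Qed.

Lemma prod_norm_le (y : R * R) : `|y.1| <= `|y| /\ `|y.2| <= `|y|.
Proof. by rewrite [`|y|]prod_normE !le_max !lexx orbT. Qed.

(** The norm on the right is the maximum norm; the factor 2 bounds the Euclidean norm by it. *)
Lemma zc_lipschitz (m : R) (y y' : R * R) : 0 <= m -> `|zc m y - zc m y'| <= m * 2 * `|y - y'|.
Proof.
move=> m0; have E z : Num.sqrt (sqn z) = enorm ((z, 0) : R3 R).
  by rewrite /enorm /dot /sqn /= mulr0 addr0 !expr2.
rewrite /zc !E -mulrBr normrM ger0_norm // -mulrA ler_wpM2l //.
apply: (le_trans (enorm_sub_le _ _)).
have -> : ((y, 0) : R3 R) - (y', 0) = (y - y', 0).
  by rewrite -[RHS]/((y - y', 0 : R)) ; congr (_, _); rewrite /= subr0.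
have [h1 h2] := prod_norm_le (y - y').
set z := y - y' in h1 h2 *.
rewrite -ler_sqr ?nnegrE ?enorm_ge0 ?mulr_ge0 // sqr_enorm /= expr0n addr0 /sqn.
rewrite -(real_normK (num_real z.1)) -(real_normK (num_real z.2)).
have k1 : `|z.1| ^+ 2 <= `|z| ^+ 2 by rewrite ler_sqr ?nnegrE.
have k2 : `|z.2| ^+ 2 <= `|z| ^+ 2 by rewrite ler_sqr ?nnegrE.
rewrite exprMn; have := sqr_ge0 `|z|; lra.
Qed.

Lemma is_derive_zc (m : R) (y v : R * R) : 0 < sqn y ->
  is_derive y v (zc m) (m * ((2 * Num.sqrt (sqn y))^-1 * (2 * (y.1 * v.1 + y.2 * v.2)))).
Proof.
move=> q0; apply/is_derive_line0.
have c1 : is_derive (0 : R) 1 (fun h : R => h * v.1 + y.1) v.1 by exact: is_derive_affine.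
have c2 : is_derive (0 : R) 1 (fun h : R => h * v.2 + y.2) v.2 by exact: is_derive_affine.
have h := is_deriveDE (is_derive_pow 2 c1) (is_derive_pow 2 c2).
have q1 : 0 < (0 * v.1 + y.1) ^+ 2 + (0 * v.2 + y.2) ^+ 2 by rewrite !mul0r !add0r.
have h2 := @is_derive1_comp R Num.sqrt (fun h : R => (h * v.1 + y.1) ^+ 2 + (h * v.2 + y.2) ^+ 2)
  0 _ _ (is_derive1_sqrt q1) h.
have h3 := is_deriveZE m h2.
apply: (is_derive_val h3); rewrite !mul0r !add0r /= !expr1 /sqn.
by congr (_ * (_ * _)); ring.
Qed.

Lemma area_element_zc (m : R) (y : R * R) : y != 0 -> area_element (zc m) y = Num.sqrt (1 + m ^+ 2).
Proof.
move=> y0.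
have q0 : 0 < sqn y.
  rewrite lt_neqAle sqn_ge0 andbT eq_sym; apply: contra y0 => /eqP q0.
  have h1 := sqr_ge0 y.1; have h2 := sqr_ge0 y.2; move: q0; rewrite /sqn => q0.
  have y1 : y.1 = 0 by apply/eqP; rewrite -sqrf_eq0; apply/eqP; lra.
  have y2 : y.2 = 0 by apply/eqP; rewrite -sqrf_eq0; apply/eqP; lra.
  by rewrite [y]surjective_pairing y1 y2.
rewrite /area_element.
rewrite (@derive_val _ _ _ _ _ _ _ (is_derive_zc m (1, 0) q0)).
rewrite (@derive_val _ _ _ _ _ _ _ (is_derive_zc m (0, 1) q0)) /= !mulr1 !mulr0 addr0 add0r.
have s0 : Num.sqrt (sqn y) != 0 by rewrite gt_eqF // sqrtr_gt0.
have E : (m * ((2 * Num.sqrt (sqn y))^-1 * (2 * y.1))) ^+ 2 + (m * ((2 * Num.sqrt (sqn y))^-1 * (2 * y.2))) ^+ 2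
   = m ^+ 2.
  have -> : (m * ((2 * Num.sqrt (sqn y))^-1 * (2 * y.1))) ^+ 2 + (m * ((2 * Num.sqrt (sqn y))^-1 * (2 * y.2))) ^+ 2
    = m ^+ 2 * (sqn y / Num.sqrt (sqn y) ^+ 2) by rewrite /sqn; field.
  by rewrite sqr_sqrtr ?sqn_ge0 // divff ?mulr1 // gt_eqF.
by congr Num.sqrt; rewrite -addrA E.
Qed.

Section fixed.
Variables (Om : set (R3 R)) (sigma : {measure set (mR3 R) -> \bar R}) (m h : R).
Hypotheses (m0 : 0 < m) (h0 : 0 < h) (sigma_surf : is_surface_measure Om sigma).
Hypothesis Om_cone : Om `&` eball h = tcone m h.

Lemma cone_chart : graph_chart Om (eball h) (1, 0, 0) (0, 1, 0) (0, 0, 1) (zc m).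
Proof.
split.
- exact: eball_open.
- by rewrite /dot /= !mulr0 !mulr1 !addr0 !add0r.
- by rewrite /dot /= !mulr0 !mul0r !addr0.
- by exists (m * 2) => y y'; apply: zc_lipschitz; exact: ltW.
- rewrite Om_cone /tcone; congr (_ `&` _); apply/funext => x; rewrite /dot /=.
  rewrite !mulr0 !mulr1 !addr0 !add0r.
  by have -> : (x.1.1, x.1.2) = x.1 by case: x => -[].
Qed.

Lemma graph_pointE : graph_point (1, 0, 0) (0, 1, 0) (0, 0, 1) (zc m) = graph m.
Proof.
apply/funext => -[y1 y2]; rewrite /graph_point /graph.
rewrite -[LHS]/((y1 * 1 + y2 * 0 + zc m (y1, y2) * 0, y1 * 0 + y2 * 1 + zc m (y1, y2) * 0,
  y1 * 0 + y2 * 0 + zc m (y1, y2) * 1)).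
by rewrite !mulr0 !mulr1 !addr0 !add0r.
Qed.

(** The coordinate axes form a chart on [eball h], and the area element of the cone is constant away
    from the apex. *)
Lemma surface_measure_graph (A : set (mR3 R)) : measurable A -> A `<=` bnd Om `&` eball h ->
  sigma A = ((Num.sqrt (1 + m ^+ 2))%:E * leb2 (graph m @^-1` A : set (mR * mR)))%E.
Proof.
move=> mA AB; have [_ H] := sigma_surf; rewrite (H _ _ _ _ _ cone_chart A mA AB) graph_pointE.
have mgA : measurable (graph m @^-1` A : set (mR * mR)).
  by rewrite -[X in measurable X]setTI; exact: measurable_graph.
have m00 : measurable ([set 0] : set (mR * mR)).
  have -> : [set 0] = [set 0] `*` [set 0] :> set (mR * mR).
    by apply/seteqP; split => [y ->//|[y1 y2] [/= -> ->]].
  exact: measurableX.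
rewrite -integral_cst //; apply: ae_eq_integral => //.
(* The value of [area_element] at the apex, where [zc] is not smooth, is left unspecified; a
   function that is constant except at one point is measurable. *)
- apply/measurable_EFinP; pose c := Num.sqrt (1 + m ^+ 2).
  have -> : area_element (zc m) = (fun y : mR * mR => c + (area_element (zc m) 0 - c) * \1_([set 0]) y).
    apply/funext => y; rewrite indicE; have [->|y0] := eqVneq y 0.
      by rewrite mem_set //= mulr1 addrC subrK.
    by rewrite memNset ?mulr0 ?addr0 ?area_element_zc //= => /eqP; apply/negP.
  by apply: measurable_funD => //; apply: measurable_funM => //; exact: measurable_indic.
- exists [set 0]; split => //; first exact: leb2_set0.
  move=> y hy; apply: contrapT => y0; apply: hy => _; congr (_%:E).
  by rewrite area_element_zc //; apply/eqP.
Qed.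

(** Points just above the graph lie in [Om], so the point is adherent; the point itself lies outside
    [Om], hence outside its interior. *)
Lemma graph_bnd y : enorm (graph m y) < h -> bnd Om (graph m y).
Proof.
move=> hy; split.
- move=> B nB.
  have cs : continuous (fun s : R => (y, zc m y + s) : R3 R).
    apply: continuous_pair => s; first exact: cvg_cst.
    by apply: cvgD; [exact: cvg_cst|exact: cvg_id].
  have E0 : (y, zc m y + 0) = graph m y by rewrite addr0.
  have n1 : \forall s \near (0 : R), (B `&` eball h) (y, zc m y + s).
    apply: (cs 0); rewrite /= E0; apply: filterI => //.
    by apply: open_nbhs_nbhs; split => //; exact: eball_open.
  have /nbhs_ballP[d /= d0 hd] := n1.
  have bd : ball (0 : R) d (d / 2).
    by rewrite /ball /= sub0r normrN ger0_norm ?divr_ge0 ?(ltW d0) // ltr_pdivrMr // ltr_pMr // ltr1n.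
  have [xB xh] := hd _ bd.
  exists (y, zc m y + d / 2); split => //.
  have : (Om `&` eball h) (y, zc m y + d / 2).
    by rewrite Om_cone; split => //=; rewrite ltrDl divr_gt0.
  by case.
- move=> /interior_subset xO.
  have : (Om `&` eball h) (graph m y) by split.
  by rewrite Om_cone => -[/=]; rewrite ltxx.
Qed.

(** A point below the graph has a neighbourhood that misses [Om], a point above it one contained in
    [Om]. *)
Lemma bnd_graph x : bnd Om x -> eball h x -> x = graph m x.1.
Proof.
move=> [xc xi] xh; have [x2|x2|E] := ltgtP x.2 (zc m x.1); last by rewrite /graph -E; case: (x).
- exfalso.
  have : nbhs x ([set z : R3 R | z.2 < zc m z.1] `&` eball h).
    apply: open_nbhs_nbhs; split; last by split.
    apply: openI; last exact: eball_open.
    have -> : [set z : R3 R | z.2 < zc m z.1] = (fun x : R3 R => x.2 - zc m x.1) @^-1` `]-oo, 0[.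
      by apply/seteqP; split => z /=; rewrite in_itv /= subr_lt0.
    by apply: open_comp => [z _|]; [exact: height_continuous|exact: interval_open].
  move=> /xc[z [zO [z2 zh]]].
  have : (Om `&` eball h) z by split.
  by rewrite Om_cone => -[/= z3 _]; move: (lt_trans z2 z3); rewrite ltxx.
- exfalso; apply: xi; have : nbhs x (tcone m h).
    by apply: open_nbhs_nbhs; split; [exact: tcone_open|split].
  by rewrite -Om_cone /interior; apply: filterS => z [].
Qed.

Definition gpatch r : set (mR3 R) := [set x | disc r x.1 /\ x.2 = zc m x.1].

Lemma gpatch_measurable r : measurable (gpatch r).
Proof.
have -> : gpatch r = (fst @^-1` disc r) `&` ((fun x : R3 R => x.2 - zc m x.1) @^-1` `[0, 0]).
  apply/seteqP; split => x /=; rewrite in_itv /=.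
    by move=> [xd ->]; rewrite subrr lexx.
  by move=> [xd /andP[h1 h2]]; split=> //; lra.
apply: measurableI.
  by apply: open_measurable_R3; apply: open_comp => [x _|]; [exact: R3fst_continuous|exact: disc_open].
apply: closed_measurable_R3.
by apply: closed_comp => [x _|]; [exact: height_continuous|exact: interval_closed].
Qed.

Lemma gpatch_preimage r : graph m @^-1` gpatch r = disc r.
Proof. by apply/seteqP; split => y /=; [case|split]. Qed.

Let phi_pack : {mfun (mR * mR)%type >-> mR3 R} :=
  HB.pack (graph m : mR * mR -> mR3 R) (isMeasurableFun.Build _ _ _ _ _ (measurable_graph m)).
Let c0 : 0 <= Num.sqrt (1 + m ^+ 2). Proof. exact: sqrtr_ge0. Qed.

(** On the patch [sigma] coincides with the image of the planar measure under [graph], scaled by the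
    area factor; [phi_pack] bundles [graph] as a measurable map for that purpose. *)
Lemma ge0_surface_integral r (F : mR3 R -> \bar R) :
  (forall y, disc r y -> enorm (graph m y) < h) ->
  measurable_fun (gpatch r) F -> (forall x, gpatch r x -> 0 <= F x)%E ->
  (\int[sigma]_(x in gpatch r) F x =
   (Num.sqrt (1 + m ^+ 2))%:E * \int[leb2]_(y in disc r) F (graph m y))%E.
Proof.
move=> hr mF F0; have mG := gpatch_measurable r.
have GE x : gpatch r x -> x = graph m x.1 by move=> [_ E]; rewrite /graph -E; case: (x).
rewrite (@eq_measure_integral _ _ _ _ (mscale (NngNum c0) (pushforward leb2 phi_pack))).
  rewrite ge0_integral_mscale //= ge0_integral_pushforward //.
    by rewrite gpatch_preimage.
  exact: measurable_graph.
  by move=> x; rewrite inE => /F0.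
move=> A mA AG; rewrite surface_measure_graph // => x /AG xG; split.
  by rewrite (GE _ xG); apply: graph_bnd; apply: hr; case: xG.
by rewrite (GE _ xG) /eball /=; apply: hr; case: xG.
Qed.

(** Positive and negative parts are transported separately; integrability excludes a difference of
    infinities. *)
Lemma surface_integral r (F : mR3 R -> R) :
  (forall y, disc r y -> enorm (graph m y) < h) ->
  measurable_fun (gpatch r) F ->
  leb2.-integrable (disc r : set (mR * mR)) (EFin \o (fun y => F (graph m y))) ->
  \int[sigma]_(x in gpatch r) F x =
  Num.sqrt (1 + m ^+ 2) * \int[leb2]_(y in (disc r : set (mR * mR))) F (graph m y).
Proof.
move=> hr mF Fi; have mFE : measurable_fun (gpatch r) (EFin \o F) by exact/measurable_EFinP.
have P := ge0_surface_integral hr (measurable_funepos mFE) (fun x _ => funepos_ge0 _ x).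
have N := ge0_surface_integral hr (measurable_funeneg mFE) (fun x _ => funeneg_ge0 _ x).
have Pf := integrable_pos_fin_num (@disc_measurable R r) Fi.
have Nf := integrable_neg_fin_num (@disc_measurable R r) Fi.
have E : (\int[sigma]_(x in gpatch r) (F x)%:E =
   (Num.sqrt (1 + m ^+ 2))%:E * \int[leb2]_(y in disc r) (F (graph m y))%:E)%E.
  pose fg := EFin \o (fun y : R * R => F (graph m y)).
  have P' : (\int[sigma]_(x in gpatch r) (EFin \o F)^\+ x =
    (Num.sqrt (1 + m ^+ 2))%:E * \int[leb2]_(y in disc r) fg^\+ y)%E.
    by rewrite P; congr (_ * _)%E; apply: eq_integral => y _; rewrite !funeposE.
  have N' : (\int[sigma]_(x in gpatch r) (EFin \o F)^\- x =
    (Num.sqrt (1 + m ^+ 2))%:E * \int[leb2]_(y in disc r) fg^\- y)%E.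
    by rewrite N; congr (_ * _)%E; apply: eq_integral => y _; rewrite !funenegE.
  rewrite [LHS](integralE _ _ (EFin \o F)) P' N' -muleBr //; last by apply: fin_num_adde_defr; exact: Pf.
  by congr (_ * _)%E; rewrite -integralE.
rewrite /Rintegral E fineM //.
exact: (integrable_fin_num (@disc_measurable R r) Fi).
Qed.

End fixed.
End Surface.

(** * Weak derivatives and traces on the truncated cone *)

Section Linking.
Context {R : realType}.
Notation mR := (measurableTypeR R).

Lemma ae_imp2 d (T : measurableType d) (mu : {measure set T -> \bar R}) (P Q S : T -> Prop) :
  (forall x, P x -> Q x -> S x) ->
  {ae mu, forall x, P x} -> {ae mu, forall x, Q x} -> {ae mu, forall x, S x}.
Proof. by move=> PQS; apply: (@filterS2 _ _ (ae_filter_ringOfSetsType mu)). Qed.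

Lemma ae_imp d (T : measurableType d) (mu : {measure set T -> \bar R}) (P S : T -> Prop) :
  (forall x, P x -> S x) -> {ae mu, forall x, P x} -> {ae mu, forall x, S x}.
Proof. by move=> PS; apply: (@filterS _ _ (ae_filter_ringOfSetsType mu)). Qed.

Lemma in_H1_part (D : set (R3 R)) u : open D -> bounded_set D -> in_H1 D u -> forall b,
  [/\ L2r leb3 (D : set (mR3 R)) (fun x => part b (u x)),
      leb3.-integrable (D : set (mR3 R)) (EFin \o (fun x => part b (u x))),
      forall i, L2r leb3 (D : set (mR3 R)) (fun x => part b (wpartial D i u x)),
      forall i, leb3.-integrable (D : set (mR3 R)) (EFin \o (fun x => part b (wpartial D i u x))) &
      forall i, wpd D i (fun x => part b (u x)) (fun x => part b (wpartial D i u x))].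
Proof.
move=> oD bD uH b; have mD : measurable (D : set (mR3 R)) by exact: open_measurable_R3.
have fD := bounded_leb3 oD bD; have [uL _] := uH; have W := wpartialP uH.
have L1 := in_L2_part mD b uL.
have L2 i := in_L2_part mD b (W i).1.
split => // [|i|i]; [exact: L2r_integrable|exact: L2r_integrable|].
exact: weak_partial_wpd (W i).2.
Qed.

(** [wpartial] is a choice, so it is neither linear nor compatible with restriction on the nose.
    This identification almost everywhere yields the rules for smooth functions, differences and
    restrictions that follow. *)
Lemma in_H1_wpd (D : set (R3 R)) u (g : 'I_3 -> R3 R -> R[i]) : open D -> bounded_set D ->
  (forall b, L2r leb3 (D : set (mR3 R)) (fun x => part b (u x))) ->
  (forall b i, L2r leb3 (D : set (mR3 R)) (fun x => part b (g i x))) ->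
  (forall b i, wpd D i (fun x => part b (u x)) (fun x => part b (g i x))) ->
  in_H1 D u /\ forall b i,
    {ae leb3, forall x, D x -> part b (wpartial D i u x) = part b (g i x)}.
Proof.
move=> oD bD uL gL ug; have mD : measurable (D : set (mR3 R)) by exact: open_measurable_R3.
have uH : in_H1 D u.
  split; first exact: parts_in_L2.
  move=> i; exists (g i); split; first exact: parts_in_L2.
  exact: wpd_weak_partial.
split=> // b i; have [_ _ _ W1 W2] := in_H1_part oD bD uH b.
apply: (wpd_unique oD (W1 i) _ (W2 i) (ug b i)).
exact: L2r_integrable (bounded_leb3 oD bD) (gL b i).
Qed.

Lemma in_H1_smooth (D : set (R3 R)) f : open D -> bounded_set D -> csmooth f ->
  in_H1 D f /\ forall b i,
    {ae leb3, forall x, D x -> part b (wpartial D i f x) = 'D_(evec i) (fun x => part b (f x)) x}.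
Proof.
move=> oD bD fs.
pose g i x := Complex ('D_(evec i) (fun x => part true (f x)) x) ('D_(evec i) (fun x => part false (f x)) x).
have E b i : (fun x => part b (g i x)) = 'D_(evec i) (fun x => part b (f x)) by case: b.
have [] := @in_H1_wpd D f g oD bD.
- by move=> b; apply: continuous_L2r => //; exact: (part_csmooth b fs 0%N).
- move=> b i; rewrite E; apply: continuous_L2r => //.
  exact: Cn_continuous (Cn_derive i (part_csmooth b fs 1%N)).
- by move=> b i; rewrite E; apply: smooth_wpd; exact: (part_csmooth b fs 1%N).
move=> h1 h2; split=> // b i; have [N [mN N0 sN]] := h2 b i; exists N; split=> // x hx.
by apply: sN => hx'; apply: hx => Dx; rewrite hx' //; exact: (congr1 (fun f => f x) (E b i)).
Qed.

Lemma in_H1B (D : set (R3 R)) u1 u2 : open D -> bounded_set D -> in_H1 D u1 -> in_H1 D u2 ->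
  in_H1 D (fun x => u1 x - u2 x) /\ forall b i,
    {ae leb3, forall x, D x -> part b (wpartial D i (fun x => u1 x - u2 x) x) =
      part b (wpartial D i u1 x) - part b (wpartial D i u2 x)}.
Proof.
move=> oD bD H1 H2; have mD : measurable (D : set (mR3 R)) by exact: open_measurable_R3.
have [] := @in_H1_wpd D (fun x => u1 x - u2 x) (fun i x => wpartial D i u1 x - wpartial D i u2 x) oD bD.
- move=> b; have [L1 _ _ _ _] := in_H1_part oD bD H1 b; have [L2 _ _ _ _] := in_H1_part oD bD H2 b.
  by under eq_fun do rewrite partB; exact: L2rB.
- move=> b i; have [_ _ L1 _ _] := in_H1_part oD bD H1 b; have [_ _ L2 _ _] := in_H1_part oD bD H2 b.
  by under eq_fun do rewrite partB; exact: L2rB.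
- move=> b i; have [_ i1 _ j1 w1] := in_H1_part oD bD H1 b.
  have [_ i2 _ j2 w2] := in_H1_part oD bD H2 b.
  have -> : (fun x => part b (u1 x - u2 x)) = (fun x => part b (u1 x) - part b (u2 x)).
    by apply/funext => x; rewrite partB.
  have -> : (fun x => part b (wpartial D i u1 x - wpartial D i u2 x)) =
      (fun x => part b (wpartial D i u1 x) - part b (wpartial D i u2 x)).
    by apply/funext => x; rewrite partB.
  exact: wpdB.
move=> h1 h2; split=> // b i; have [N [mN N0 sN]] := h2 b i; exists N; split=> // x hx.
by apply: sN => hx'; apply: hx => Dx; rewrite hx' // partB.
Qed.

Lemma in_H1_restrict (D D' : set (R3 R)) u : open D -> bounded_set D -> open D' -> D' `<=` D ->
  in_H1 D u -> in_H1 D' u /\ forall b i,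
    {ae leb3, forall x, D' x -> part b (wpartial D' i u x) = part b (wpartial D i u x)}.
Proof.
move=> oD bD oD' s uH.
have mD : measurable (D : set (mR3 R)) by exact: open_measurable_R3.
have mD' : measurable (D' : set (mR3 R)) by exact: open_measurable_R3.
have bD' : bounded_set D'
  by move: bD => [M [Mr HM]]; exists M; split=> // x Mx y /s; exact: HM.
apply: in_H1_wpd => //.
- by move=> b; have [L1 _ _ _ _] := in_H1_part oD bD uH b; exact: L2r_subset L1.
- by move=> b i; have [_ _ L1 _ _] := in_H1_part oD bD uH b; exact: L2r_subset (L1 i).
- by move=> b i; have [_ _ _ _ w] := in_H1_part oD bD uH b; exact: wpd_subset (w i).
Qed.

Lemma ae_eq_L2_le (S D : set (mR3 R)) (f g : R3 R -> R) (E : \bar R) : measurable S -> measurable D ->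
  S `<=` D -> measurable_fun D f -> measurable_fun D g ->
  {ae leb3, forall x, D x -> f x = g x} ->
  (\int[leb3]_(x in D) (f x ^+ 2)%:E <= E)%E -> (\int[leb3]_(x in S) (g x ^+ 2)%:E <= E)%E.
Proof.
move=> mS mD s mf mg fg h.
apply: (@le_trans _ _ (\int[leb3]_(x in D) (g x ^+ 2)%:E)%E).
  apply: ge0_subset_integral => //; first by apply/measurable_EFinP; exact: measurable_sqr.
  by move=> x _; rewrite lee_fin sqr_ge0.
have -> : (\int[leb3]_(x in D) (g x ^+ 2)%:E = \int[leb3]_(x in D) (f x ^+ 2)%:E)%E; last by [].
apply: ae_eq_integral => //; [by apply/measurable_EFinP; exact: measurable_sqr|
  by apply/measurable_EFinP; exact: measurable_sqr|].
have [N [mN N0 sN]] := fg; exists N; split=> // x hx; apply: sN => hx'; apply: hx => Dx.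
by rewrite hx'.
Qed.

Section trace.
Variables (Om : set (R3 R)) (sigma : {measure set (mR3 R) -> \bar R}) (m h r0 : R).
Hypotheses (oOm : open Om) (bOm : bounded_set Om).
Hypotheses (m0 : 0 < m) (h0 : 0 < h) (r00 : 0 < r0) (sigma_surf : is_surface_measure Om sigma).
Hypothesis Om_cone : Om `&` eball h = tcone m h.
Hypothesis hr : forall y, disc r0 y -> enorm (graph m y) < h.
Hypothesis hS : slab (disc r0) (zc m) r0 `<=` tcone m h.
Notation S0 := (slab (disc r0) (zc m) r0 : set (mR3 R)).
Notation Dr := (disc r0 : set (mR * mR)).

Lemma bnd_measurable : measurable (bnd Om : set (mR3 R)).
Proof.
apply: measurableD; first by apply: closed_measurable_R3; exact: closed_closure.
by apply: open_measurable_R3; exact: open_interior.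
Qed.

Lemma gpatch_bnd : gpatch m r0 `<=` bnd Om.
Proof.
move=> x [xd E]; have -> : x = graph m x.1 by rewrite /graph -E; case: (x).
by apply: (graph_bnd Om_cone); exact: hr.
Qed.

Lemma measurable_trace (F : R3 R -> R) : measurable_fun (bnd Om : set (mR3 R)) F ->
  measurable_fun Dr (fun y => F (graph m y)).
Proof.
move=> mF; have mb := bnd_measurable.
apply: (measurable_comp mb _ mF (measurable_funTS (measurable_graph m))).
by move=> _ [y yd <-]; apply: gpatch_bnd; split.
Qed.

(** The area factor is at least 1, so planar integrals of nonnegative functions are dominated by
    surface integrals. *)
Lemma trace_L2_le (f : R3 R -> R[i]) (c : R) b : cmeasurable (bnd Om : set (mR3 R)) f ->
  (\int[sigma]_(x in bnd Om) (Normc.normc (f x) ^+ 2)%:E <= c%:E)%E ->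
  (\int[leb2]_(y in Dr) (part b (f (graph m y)) ^+ 2)%:E <= c%:E)%E.
Proof.
move=> mf hc; have mb := bnd_measurable; have mG := gpatch_measurable m r0.
have mp := cmeasurable_part b mf.
have mp2 : measurable_fun (bnd Om : set (mR3 R)) (fun x => part b (f x) ^+ 2) by exact: measurable_sqr.
have mpG := measurable_funS mb gpatch_bnd mp2.
have h1 := int_part_le mb b mf hc.
have h2 : (\int[sigma]_(x in gpatch m r0) (part b (f x) ^+ 2)%:E <= c%:E)%E.
  apply: le_trans h1; apply: ge0_subset_integral => //; first exact/measurable_EFinP.
  - by move=> x _; rewrite lee_fin sqr_ge0.
  - exact: gpatch_bnd.
have := @ge0_surface_integral R Om sigma m h m0 sigma_surf Om_cone r0 (EFin \o (fun x => part b (f x) ^+ 2)) hr.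
move=> H; have {H} := H _ _.
rewrite /= => H; rewrite H in h2; first last.
- by move=> x _; rewrite lee_fin sqr_ge0.
- exact/measurable_EFinP.
apply: le_trans h2; rewrite -[leLHS]mul1e; apply: lee_wpmul2r.
  by apply: integral_ge0 => y _; rewrite lee_fin sqr_ge0.
rewrite lee_fin -[leLHS]sqrtr1 ler_wsqrtr // lerDl sqr_ge0 //.
Qed.

(** Translates [is_trace] to the slab. The H^1 norm there involves the weak derivative chosen for
    the difference of a smooth function and [v]; [in_H1B] and [in_H1_smooth] identify it with the
    difference of a classical derivative and the one chosen for [v]. *)
Lemma trace_smooth_approx v tv b : in_H1 Om v -> is_trace Om sigma v tv ->
  smooth_approx m r0 r0 (fun x => part b (v x)) (fun x => part b (wpartial Om i3 v x))
    (fun y => part b (tv (graph m y))) /\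
  L2r leb2 Dr (fun y => part b (tv (graph m y))).
Proof.
move=> vH [[mtv tvL] [un [uns c1 c2]]].
have mOm : measurable (Om : set (mR3 R)) by exact: open_measurable_R3.
have mS0 := slab_measurable m r0 r0; have mb := bnd_measurable.
have SOm : S0 `<=` Om by move=> x /hS; rewrite -Om_cone => -[].
have [vL vi wL wi wp] := in_H1_part oOm bOm vH b.
have mt : measurable_fun Dr (fun y => part b (tv (graph m y))).
  by apply: (@measurable_trace (fun x => part b (tv x))); exact: cmeasurable_part.
split; last first.
  have [E E0 hE] : exists2 E, 0 <= E & (\int[sigma]_(x in bnd Om) (Normc.normc (tv x) ^+ 2)%:E <= E%:E)%E.
    move: tvL; rewrite /L2norm.
    have : (0 <= \int[sigma]_(x in bnd Om) (Normc.normc (tv x) ^+ 2)%:E)%E.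
      by apply: integral_ge0 => x _; rewrite lee_fin sqr_ge0.
    by case: (integral _ _ _) => [s| |] //= s0 _; exists s.
  by apply: (@L2rP _ _ _ leb2 Dr _ E) => //; exact: trace_L2_le.
split => //.
- by have [mv _] := vL; exact: measurable_funS mv.
- by have [mw _] := wL i3; exact: measurable_funS mw.
move=> de de0; have sd0 : 0 < Num.sqrt de by rewrite sqrtr_gt0.
have n1 := cvg_le_near c1 sd0; have n2 := cvg_le_near c2 sd0.
have [n [hn1 hn2]] : exists n, (H1norm Om (fun x => (un n x - v x)%R) <= (Num.sqrt de)%:E)%E /\
    (L2norm sigma (bnd Om) (fun x => (un n x - tv x)%R) <= (Num.sqrt de)%:E)%E.
  by near \oo => n; exists n; split; near: n.
exists (fun x => part b (un n x)).
have us := part_csmooth b (uns n).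
have [k1 k2] := H1norm_le (ltW sd0) hn1.
have sq : Num.sqrt de ^+ 2 = de by rewrite sqr_sqrtr // ltW.
have [uH udE] := in_H1_smooth oOm bOm (uns n).
have [dH dE] := in_H1B oOm bOm uH vH.
have [dL _ dwL _ _] := in_H1_part oOm bOm dH b.
have [md _] := dH.1.
split.
- exact: us 1%N.
- have := int_part_le mOm b md (L2norm_le (ltW sd0) k1); rewrite sq => h1.
  apply: le_trans h1; apply: (@le_trans _ _ (\int[leb3]_(x in S0) (part b (un n x - v x) ^+ 2)%:E)%E).
    by under eq_integral do rewrite -partB.
  apply: ge0_subset_integral => //.
    by apply/measurable_EFinP; apply: measurable_sqr; have [] := dL.
  by move=> x _; rewrite lee_fin sqr_ge0.
- have mw := (wpartialP dH i3).1.1.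
  have := int_part_le mOm b mw (L2norm_le (ltW sd0) (k2 i3)); rewrite sq => h1.
  apply: (ae_eq_L2_le mS0 mOm SOm _ _ _ h1).
  + by have [] := dwL i3.
  + apply: measurable_funB; last by have [] := wL i3.
    apply: continuous_measurable_R3; exact: Cn_continuous (Cn_derive i3 (us 1%N)).
  + by apply: ae_imp2 (dE b i3) (udE b i3) => x e1 e2 Dx; rewrite e1 // e2.
- have mut : cmeasurable (bnd Om : set (mR3 R)) (fun x => un n x - tv x).
    have mm b' : measurable_fun (bnd Om : set (mR3 R)) (fun x => part b' (un n x - tv x)).
      under eq_fun do rewrite partB; apply: measurable_funB; last exact: cmeasurable_part.
      by apply: continuous_measurable_R3; exact: (part_csmooth b' (uns n) 0%N).
    by split; [exact: (mm true)|exact: (mm false)].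
  have := L2norm_le (ltW sd0) hn2; rewrite sq => h1.
  have := trace_L2_le b mut h1.
  by under eq_integral do rewrite partB.
Unshelve. all: by end_near. Qed.

(** A [sigma]-null subset of the patch has a null preimage in the plane since the area factor is not
    0. *)
Lemma trace_ae (P : R3 R -> Prop) : {ae sigma, forall x, gpatch m r0 x -> P x} ->
  {ae leb2, forall y, Dr y -> P (graph m y)}.
Proof.
move=> [N [mN N0 sN]].
have mG := gpatch_measurable m r0.
have mNG : measurable (N `&` gpatch m r0) by exact: measurableI.
have s : N `&` gpatch m r0 `<=` bnd Om `&` eball h.
  move=> x [_ xG]; split; first exact: gpatch_bnd.
  move: xG => [xd E]; have -> : x = graph m x.1 by rewrite /graph -E; case: (x).
  exact: hr.
have := surface_measure_graph m0 sigma_surf Om_cone mNG s.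
have -> : sigma (N `&` gpatch m r0) = 0%E.
  by apply: (@subset_measure0 _ _ _ sigma _ N) => //; exact: subIsetl.
move=> /esym /eqP; rewrite mule_eq0 => /orP[|/eqP H].
  by rewrite eqe gt_eqF // sqrtr_gt0 ltr_pwDl // sqr_ge0.
exists (graph m @^-1` (N `&` gpatch m r0)); split => //.
  by rewrite -[X in measurable X]setTI; exact: measurable_graph.
move=> y hy; have yd : Dr y by apply: contrapT => h'; apply: hy.
split; last by split.
by apply: sN => hP; apply: hy => _; apply: hP; split.
Qed.

End trace.

Lemma smooth_approxB m r0 T u1 p1 t1 u2 p2 t2 :
  smooth_approx m r0 T u1 p1 t1 -> smooth_approx m r0 T u2 p2 t2 ->
  smooth_approx m r0 T (fun x => u1 x - u2 x) (fun x => p1 x - p2 x) (fun y => t1 y - t2 y : R).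
Proof.
move=> [mu1 mp1 mt1 h1] [mu2 mp2 mt2 h2].
split; [exact: measurable_funB|exact: measurable_funB|exact: measurable_funB|].
move=> de de0; have d4 : 0 < de / 4 by rewrite divr_gt0.
have [f1 [C1 a1 b1 c1]] := h1 _ d4; have [f2 [C2 a2 b2 c2]] := h2 _ d4.
exists (fun x => f1 x - f2 x).
have key d (X : measurableType d) (nu : {measure set X -> \bar R}) (D : set X) (g1 g2 : X -> R) :
    measurable D -> measurable_fun D g1 -> measurable_fun D g2 ->
    (\int[nu]_(x in D) (g1 x ^+ 2)%:E <= (de / 4)%:E)%E ->
    (\int[nu]_(x in D) (g2 x ^+ 2)%:E <= (de / 4)%:E)%E ->
    (\int[nu]_(x in D) ((g1 x - g2 x) ^+ 2)%:E <= de%:E)%E.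
  move=> mD m1 m2 e1 e2.
  apply: (@le_trans _ _ (\int[nu]_(x in D) (2 * g1 x ^+ 2 + 2 * g2 x ^+ 2)%:E)%E).
    apply: int_le => //.
    - by apply: measurable_sqr; exact: measurable_funB.
    - by apply: measurable_funD; apply: measurable_funM => //; exact: measurable_sqr.
    - by move=> x _; exact: sqr_ge0.
    - by move=> x _; have := sqr_ge0 (g1 x + g2 x); rewrite sqrrD sqrrB; lra.
  rewrite int_addZ //; [|exact: measurable_sqr|exact: measurable_sqr|
    by move=> x _; exact: sqr_ge0|by move=> x _; exact: sqr_ge0].
  have -> : de%:E = (2%:E * (de / 4)%:E + 2%:E * (de / 4)%:E)%E.
    by rewrite -!EFinM -EFinD; congr (_%:E); field.
  by apply: leeD; apply: lee_wpmul2l => //; rewrite lee_fin.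
have mS := slab_measurable m r0 T; have mD := @disc_measurable R r0.
have mc (f : R3 R -> R) : Cn 1 f -> measurable_fun (slab (disc r0) (zc m) T : set (mR3 R)) f.
  by move=> fC; apply: continuous_measurable_R3; exact: Cn_continuous fC.
have mdc (f : R3 R -> R) : Cn 1 f -> measurable_fun (slab (disc r0) (zc m) T : set (mR3 R)) ('D_(evec i3) f).
  by move=> fC; apply: continuous_measurable_R3; exact: Cn_continuous (Cn_derive i3 fC).
split.
- exact: CnB.
- have E x : f1 x - f2 x - (u1 x - u2 x) = (f1 x - u1 x) - (f2 x - u2 x) by ring.
  under eq_integral do rewrite E.
  by apply: key => //; apply: measurable_funB => //; exact: mc.
- have E x : 'D_(evec i3) (fun x => f1 x - f2 x) x - (p1 x - p2 x) =
      ('D_(evec i3) f1 x - p1 x) - ('D_(evec i3) f2 x - p2 x).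
    have h := is_deriveBE (CnS_derive C1 i3 x) (CnS_derive C2 i3 x).
    by rewrite (@derive_val _ _ _ _ _ _ _ h) !opprB addrACA [_ - p1 x + _]addrC; ring.
  under eq_integral do rewrite E.
  by apply: key => //; apply: measurable_funB => //; exact: mdc.
- have E y : f1 (y, zc m y) - f2 (y, zc m y) - (t1 y - t2 y) =
     (f1 (y, zc m y) - t1 y) - (f2 (y, zc m y) - t2 y) by ring.
  under eq_integral do rewrite E.
  by apply: key => //; apply: measurable_funB => //; exact: measurable_bd.
Qed.

Lemma smooth_approx_smooth m r0 T f : Cn 1 f ->
  smooth_approx m r0 T f ('D_(evec i3) f) (fun y => f (graph m y) : R).
Proof.
move=> fC; split.
- by apply: continuous_measurable_R3; exact: Cn_continuous fC.
- by apply: continuous_measurable_R3; exact: Cn_continuous (Cn_derive i3 fC).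
- exact: (@measurable_bd R m f fC).
move=> de de0; exists f; split=> //.
- by under eq_integral do rewrite subrr expr0n; rewrite integral0 lee_fin ltW.
- by under eq_integral do rewrite subrr expr0n; rewrite integral0 lee_fin ltW.
- by under eq_integral do rewrite subrr expr0n; rewrite integral0 lee_fin ltW.
Qed.

End Linking.

(** * Localisation of Green's formula near the apex *)

Section Functional.
Context {R : realType}.
Notation mR := (measurableTypeR R).

Lemma Rint_eq_supp d (T : measurableType d) (mu : {measure set T -> \bar R}) (D D' : set T) (f : T -> R) :
  (forall x, f x = 0 \/ (D x <-> D' x)) -> \int[mu]_(x in D) f x = \int[mu]_(x in D') f x.
Proof.
move=> h; rewrite Rintegral_mkcond [RHS]Rintegral_mkcond; congr Rintegral; apply/funext => x.
rewrite !patchE; have [f0|[h1 h2]] := h x; first by case: ifPn; case: ifPn.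
by case: ifPn => [|/negP] xD; case: ifPn => [|/negP] xD' //; exfalso;
  [apply: xD'; move: xD; rewrite !inE|apply: xD; move: xD'; rewrite !inE].
Qed.

Lemma integrable_ae_le d (T : measurableType d) (mu : {measure set T -> \bar R}) (D : set T) (f G : T -> R) :
  measurable D -> measurable_fun D f -> mu.-integrable D (EFin \o G) ->
  {ae mu, forall x, D x -> `|f x| <= G x} -> mu.-integrable D (EFin \o f).
Proof.
move=> mD mf Gi fG; have mG : measurable_fun D G by apply/measurable_EFinP; case/integrableP: Gi.
apply/integrableP; split; first exact/measurable_EFinP.
have /integrableP[_] := integrable_norm Gi.
apply: le_lt_trans; apply: ae_ge0_le_integral => //.
- by apply/measurable_EFinP; exact: measurableT_comp.
- by apply/measurable_EFinP; apply: measurableT_comp => //; exact: measurableT_comp.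
apply: (ae_imp _ fG) => x h Dx; rewrite /= lee_fin normr_id.
by apply: le_trans (h Dx) (ler_norm _).
Qed.

Lemma cmeasurableM d (T : measurableType d) (D : set T) (f g : T -> R[i]) :
  cmeasurable D f -> cmeasurable D g -> cmeasurable D (fun x => f x * g x).
Proof.
move=> [f1 f2] [g1 g2]; split.
- rewrite (_ : (fun x => _) = (fun x => complex.Re (f x) * complex.Re (g x) - complex.Im (f x) * complex.Im (g x))).
    by apply: measurable_funB; exact: measurable_funM.
  by apply/funext => x; case: (f x) (g x) => [a b] [c e].
- rewrite (_ : (fun x => _) = (fun x => complex.Re (f x) * complex.Im (g x) + complex.Im (f x) * complex.Re (g x))).
    by apply: measurable_funD; exact: measurable_funM.
  by apply/funext => x; case: (f x) (g x) => [a b] [c e].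
Qed.

Lemma cmeasurable_cst d (T : measurableType d) (D : set T) (c : R[i]) : cmeasurable D (fun=> c).
Proof. by split; exact: measurable_cst. Qed.

Lemma cmeasurable_parts d (T : measurableType d) (D : set T) (f : T -> R[i]) :
  (forall b, measurable_fun D (fun x => part b (f x))) -> cmeasurable D f.
Proof. by move=> h; split; [exact: (h true)|exact: (h false)]. Qed.

Lemma part_mul_le b (a z : R[i]) (M : R) : Normc.normc a <= M ->
  `|part b (a * z)| <= M * (`|part true z| + `|part false z|).
Proof.
move=> h; apply: le_trans (part_le _ _) _; rewrite Normc.normcM.
apply: ler_pM => //; [exact: normc_ge0|exact: normc_ge0|exact: normc_le].
Qed.

Lemma part_sum b (F : 'I_3 -> R[i]) : part b (\sum_(i < 3) F i) = \sum_(i < 3) part b (F i).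
Proof. by apply: (big_morph (part b)); [move=> x y; exact: partD|case: b]. Qed.

Section normal.
Variables (Om : set (R3 R)) (m h r0 rho : R).
Hypotheses (oOm : open Om) (bOm : bounded_set Om) (r00 : 0 < r0) (rho0 : 0 < rho) (rr : rho < r0) (rh : rho < h) (m0 : 0 < m).
Hypothesis Om_cone : Om `&` eball h = tcone m h.
Hypothesis hS : slab (disc r0) (zc m) r0 `<=` tcone m h.
Notation S0 := (slab (disc r0) (zc m) r0 : set (mR3 R)).
Notation T := (tcone m h : set (mR3 R)).

Lemma tcone_near_slab x : tcone m h x -> enorm x <= rho -> slab (disc r0) (zc m) r0 x.
Proof.
move=> [xz xh] xr; have xr2 : enorm x < r0 by exact: le_lt_trans rr.
have E : enorm x ^+ 2 = sqn x.1 + x.2 ^+ 2.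
  by rewrite -dot_enorm /dot /sqn -!expr2.
have q2 := sqr_ge0 x.2; have q0 := sqn_ge0 x.1.
have h2 : enorm x ^+ 2 < r0 ^+ 2 by rewrite ltr_sqr ?nnegrE ?enorm_ge0 // ltW.
split; first by rewrite /disc /=; lra.
rewrite xz /=; have z0 : 0 <= zc m x.1 by rewrite zc_ge0 // ltW.
have : x.2 < r0; last by lra.
by rewrite ltNge; apply/negP => h3; have : r0 ^+ 2 <= x.2 ^+ 2;
  [rewrite ler_sqr ?nnegrE ?(ltW r00) // (le_trans (ltW r00))|lra].
Qed.

(** The support of [phi] lies in the ball of radius [rho], where [Om] is the cone. The gradient term
    is written on the whole truncated cone, as [gradient_term] expects, and the other one on the
    slab, as [lower_order_term] does. *)
Lemma normal_derivative_part u f phi b : in_H1 Om u ->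
  leb3.-integrable (Om : set (mR3 R)) (EFin \o (fun x => part b (f x))) -> Cn 1 phi ->
  supported_in [set x : R3 R | enorm x <= rho] phi ->
  part b (normal_derivative Om u f phi) =
  \sum_(i < 3) \int[leb3]_(x in T) (part b (wpartial Om i u x) * 'D_(evec i) phi x) +
  \int[leb3]_(x in S0) (part b (f x) * phi x).
Proof.
move=> uH fi phiC sphi.
have mOm : measurable (Om : set (mR3 R)) by exact: open_measurable_R3.
have [_ _ _ wi _] := in_H1_part oOm bOm uH b.
have scl := @enorm_le_closed R rho.
have dsp i := @derive_supp R phi _ (evec i) scl sphi.
have [B B0 hB] := cs_bounded (Cn_continuous phiC) sphi.
have dc i : continuous ('D_(evec i) phi) := Cn_continuous (Cn_derive i phiC).
have Wi i : leb3.-integrable (Om : set (mR3 R)) (EFin \o (fun x => part b (wpartial Om i u x) * 'D_(evec i) phi x)).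
  have [B' B0' hB'] := cs_bounded (dc i) (dsp i).
  apply: (@integrable_mul_bounded _ _ _ leb3 _ _ _ B' mOm (wi i)) => //.
  exact: continuous_measurable_R3.
have Fi : leb3.-integrable (Om : set (mR3 R)) (EFin \o (fun x => part b (f x) * phi x)).
  apply: (@integrable_mul_bounded _ _ _ leb3 _ _ _ B mOm fi) => //.
  by apply: continuous_measurable_R3; exact: Cn_continuous phiC.
have near_T x : enorm x <= rho -> (Om x <-> tcone m h x).
  move=> xr; rewrite -Om_cone; split; [move=> xO; split => //|by case].
  by rewrite /eball /=; exact: le_lt_trans rh.
rewrite /normal_derivative part_cint.
under eq_Rintegral do rewrite partD part_sum part_mulr.
under eq_Rintegral do under eq_bigr do rewrite part_mulr.
have -> : \int[leb3]_(x in (Om : set (mR3 R)))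
    (\sum_(i < 3) part b (wpartial Om i u x) * 'D_(evec i) phi x + part b (f x) * phi x) =
  \int[leb3]_(x in (Om : set (mR3 R))) (part b (wpartial Om i1 u x) * 'D_(evec i1) phi x) +
  \int[leb3]_(x in (Om : set (mR3 R))) (part b (wpartial Om i2 u x) * 'D_(evec i2) phi x) +
  \int[leb3]_(x in (Om : set (mR3 R))) (part b (wpartial Om i3 u x) * 'D_(evec i3) phi x) +
  \int[leb3]_(x in (Om : set (mR3 R))) (part b (f x) * phi x).
  have I12 := integrableD mOm (Wi i1) (Wi i2); have I123 := integrableD mOm I12 (Wi i3).
  rewrite -RintegralD // -RintegralD // -RintegralD //.
  by apply: eq_Rintegral => x _; rewrite sum3.
have DT i : \int[leb3]_(x in (Om : set (mR3 R))) (part b (wpartial Om i u x) * 'D_(evec i) phi x) =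
    \int[leb3]_(x in T) (part b (wpartial Om i u x) * 'D_(evec i) phi x).
  apply: Rint_eq_supp => x; have [xr|xr] := pselect (enorm x <= rho); first by right; exact: near_T.
  by left; rewrite dsp ?mulr0.
rewrite sum3; congr (_ + _ + _ + _); [exact: DT|exact: DT|exact: DT|].
apply: Rint_eq_supp => x; have [xr|xr] := pselect (enorm x <= rho); last by left; rewrite sphi ?mulr0.
right; split; first by move=> /(near_T _ xr) xT; exact: tcone_near_slab.
by move=> /hS; rewrite -Om_cone => -[].
Qed.

End normal.
End Functional.

Lemma normcD (R : rcfType) (x y : R[i]) :
  Normc.normc (x + y) <= Normc.normc x + Normc.normc y.
Proof. exact: (@le_normcD R x y). Qed.

Lemma int_add (R : realType) d (T : measurableType d) (mu : {measure set T -> \bar R}) (D : set T)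
  (f1 f2 : T -> R) : measurable D -> measurable_fun D f1 -> measurable_fun D f2 ->
  (forall x, 0 <= f1 x) -> (forall x, 0 <= f2 x) ->
  (\int[mu]_(x in D) (f1 x + f2 x)%:E = \int[mu]_(x in D) (f1 x)%:E + \int[mu]_(x in D) (f2 x)%:E)%E.
Proof.
move=> mD mf1 mf2 h1 h2; under eq_integral do rewrite EFinD.
by rewrite ge0_integralD //; [by move=> x _; rewrite lee_fin|exact/measurable_EFinP|by move=> x _; rewrite lee_fin|exact/measurable_EFinP].
Qed.

Lemma balance (R : zmodType) (a b c d e f : R) : a + b = c + d + e -> f = b - d -> e = a - c + f.
Proof.
move=> E ->; have -> : a - c + (b - d) = (a + b) - (c + d) by rewrite opprD addrACA.
by rewrite E addrC addKr.
Qed.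

(** Arithmetic for four lower order integrals and one gradient term, each at most [de]. *)
Lemma absorb (R : realType) (K de c X Y : R) : 0 <= K -> 0 <= de -> 1 <= c -> 0 <= X ->
  c * X <= Y + K * (de + de + (de + de)) -> Y <= de -> X <= 5 * (K + 1) * de.
Proof.
move=> K0 d0 c1 X0 h hY; have : X <= c * X by rewrite ler_peMl.
have : 0 <= K * de by rewrite mulr_ge0.
by move: h; rewrite !mulrDr !mulrDl; lra.
Qed.

(** * The boundary functional *)

Section Conductive.
Context {R : realType}.
Notation mR := (measurableTypeR R).
Variables (Om Gam : set (R3 R)) (sigma : {measure set (mR3 R) -> \bar R}) (m h r0 rho k : R).
Variables (V q eta v w tv tw : R3 R -> R[i]).
Hypotheses (oOm : open Om) (bOm : bounded_set Om) (sigma_surf : is_surface_measure Om sigma).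
Hypotheses (m0 : 0 < m) (h0 : 0 < h) (r00 : 0 < r0) (rho0 : 0 < rho) (rr : rho < r0) (rh : rho < h).
Hypothesis Om_cone : Om `&` eball h = tcone m h.
Hypothesis hr : forall y, disc r0 y -> enorm (graph m y) < h.
Hypothesis hS : slab (disc r0) (zc m) r0 `<=` tcone m h.
Hypothesis hG : gpatch m r0 `<=` Gam.
Hypothesis hK : forall x, bnd Om x -> enorm x <= rho -> Gam x.
Hypothesis GamO : Gam `<=` bnd Om.
Hypotheses (V_bnd : in_Linfty leb3 (Om : set (mR3 R)) V) (q_def : q = (fun x => 1 + V x)).
Hypothesis (eta_bnd : in_Linfty sigma (bnd Om : set (mR3 R)) eta).
Hypotheses (vH : in_H1 Om v) (wH : in_H1 Om w) (tvT : is_trace Om sigma v tv) (twT : is_trace Om sigma w tw).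
Hypothesis tE : {ae sigma, forall x, Gam x -> tw x = tv x}.
Notation lapw := (fun x => - ((k ^+ 2)%:C%C * q x * w x)).
Notation lapv := (fun x => - ((k ^+ 2)%:C%C * v x)).
Hypothesis hN : forall phi, boundary_test Om Gam phi ->
  normal_derivative Om w lapw phi = normal_derivative Om v lapv phi +
    cint sigma Gam (fun x => eta x * tv x * (phi x)%:C%C).
Notation S0 := (slab (disc r0) (zc m) r0 : set (mR3 R)).
Notation Dr := (disc r0 : set (mR * mR)).
Notation bf b := (fun y => part b (eta (graph m y) * tv (graph m y))).

Let mOm : measurable (Om : set (mR3 R)). Proof. exact: open_measurable_R3. Qed.
Let SOm : S0 `<=` Om. Proof. by move=> x /hS; rewrite -Om_cone => -[]. Qed.
Let absp (u : R3 R -> R[i]) x := `|part true (u x)| + `|part false (u x)|.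

Let absp_int u : in_H1 Om u -> leb3.-integrable (Om : set (mR3 R)) (EFin \o absp u).
Proof.
move=> uH; have [_ it _ _ _] := in_H1_part oOm bOm uH true; have [_ jf _ _ _] := in_H1_part oOm bOm uH false.
exact: (integrableD mOm (integrable_norm it) (integrable_norm jf)).
Qed.

Let absp_ge0 u x : 0 <= absp u x.
Proof. by rewrite addr_ge0. Qed.

(** [q] is bounded by 1 + M, so the difference of the two right-hand sides is controlled by [w] and
    [v] themselves. It is not a multiple of [w - v], so the zero trace cannot be exploited for
    it. *)
Lemma laplacian_terms_bound b : exists2 K, 0 <= K &
  [/\ leb3.-integrable (Om : set (mR3 R)) (EFin \o (fun x => part b (lapw x))),
      leb3.-integrable (Om : set (mR3 R)) (EFin \o (fun x => part b (lapv x))) &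
      {ae leb3, forall x, Om x -> `|part b (lapw x) - part b (lapv x)| <= K * (absp w x + absp v x)}].
Proof.
have [mV [M0 hM0]] := V_bnd.
(* An essential bound could be negative on a negligible domain; the maximum with 0 makes it usable
   as a factor. *)
pose M := Num.max M0 0; have M_ge0 : 0 <= M by rewrite le_max lexx orbT.
have hM : {ae leb3, forall x, Om x -> Normc.normc (V x) <= M}.
  by apply: ae_imp hM0 => x hx Ox; rewrite le_max hx.
have [[mv _] _] := vH; have [[mw _] _] := wH.
have k2 : 0 <= k ^+ 2 by exact: sqr_ge0.
have nk : Normc.normc ((k ^+ 2)%:C%C : R[i]) = k ^+ 2.
  by rewrite /= expr0n addr0 sqrtr_sqr ger0_norm.
have mq : cmeasurable (Om : set (mR3 R)) q.
  apply: cmeasurable_parts => b'; rewrite q_def.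
  rewrite (_ : (fun x => _) = (fun x => part b' 1 + part b' (V x))); last by apply/funext => x; rewrite partD.
  by apply: measurable_funD => //; exact: cmeasurable_part.
have mlw : measurable_fun (Om : set (mR3 R)) (fun x => part b (lapw x)).
  rewrite (_ : (fun x => _) = (fun x => - part b ((k ^+ 2)%:C%C * q x * w x))); last by apply/funext => x; rewrite partN.
  apply: measurable_funN; apply: cmeasurable_part; apply: cmeasurableM => //.
  by apply: cmeasurableM => //; exact: cmeasurable_cst.
have mlv : measurable_fun (Om : set (mR3 R)) (fun x => part b (lapv x)).
  rewrite (_ : (fun x => _) = (fun x => - part b ((k ^+ 2)%:C%C * v x))); last by apply/funext => x; rewrite partN.
  by apply: measurable_funN; apply: cmeasurable_part; apply: cmeasurableM => //; exact: cmeasurable_cst.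
have bv x : `|part b (lapv x)| <= k ^+ 2 * absp v x.
  by rewrite partN normrN; apply: part_mul_le; rewrite nk.
have bw : {ae leb3, forall x, Om x -> `|part b (lapw x)| <= k ^+ 2 * (1 + M) * absp w x}.
  apply: ae_imp hM => x hx Ox; rewrite partN normrN; apply: part_mul_le.
  rewrite Normc.normcM nk ler_wpM2l // q_def; apply: le_trans (normcD _ _) _.
  by rewrite Normc.normc1 lerD2l hx.
exists (k ^+ 2 * (1 + M)); first by rewrite mulr_ge0 // addr_ge0.
split.
- exact: (integrable_ae_le mOm mlw (integrableZl mOm (k ^+ 2 * (1 + M)) (absp_int wH)) bw).
- apply: (integrable_ae_le mOm mlv (integrableZl mOm (k ^+ 2) (absp_int vH))).
  by apply: ae_imp bw => x _ _; exact: bv.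
apply: ae_imp bw => x hx Ox; apply: le_trans (ler_normB _ _) _; rewrite mulrDr lerD ?hx //.
apply: le_trans (bv x) _; rewrite ler_wpM2r ?absp_ge0 // ler_peMr // lerDl //.
Qed.

Lemma measurable_eta_trace b : measurable_fun (bnd Om : set (mR3 R)) (fun x => part b (eta x * tv x)).
Proof.
by apply: cmeasurable_part; apply: cmeasurableM; [case: eta_bnd|case: tvT => -[]].
Qed.

(** [eta] is bounded almost everywhere for [sigma], hence along the graph by [trace_ae], and the
    trace is in L^2 of a disc of finite area. *)
Lemma eta_trace_integrable b : leb2.-integrable Dr (EFin \o bf b).
Proof.
have mD := @disc_measurable R r0.
have [_ [M0 hM0]] := eta_bnd.
pose M := Num.max M0 0; have M_ge0 : 0 <= M by rewrite le_max lexx orbT.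
have hM : {ae leb2, forall y, Dr y -> Normc.normc (eta (graph m y)) <= M}.
  apply: (@trace_ae _ Om sigma m h r0 m0 sigma_surf Om_cone hr (fun x => Normc.normc (eta x) <= M)).
  apply: ae_imp hM0 => x hx xG; rewrite le_max hx //.
  exact: (gpatch_bnd Om_cone hr).
have L b' : leb2.-integrable Dr (EFin \o (fun y => part b' (tv (graph m y)))).
  apply: L2r_integrable; [exact: disc_measurable|exact: disc_finite|].
  by have [] := trace_smooth_approx oOm bOm m0 sigma_surf Om_cone hr hS b' vH tvT.
have mf : measurable_fun Dr (bf b).
  exact: (measurable_trace (F := fun x => part b (eta x * tv x)) Om_cone hr (measurable_eta_trace b)).
apply: (integrable_ae_le mD mf
  (integrableZl mD M (integrableD mD (integrable_norm (L true)) (integrable_norm (L false))))).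
by apply: ae_imp hM => y hy yD; apply: part_mul_le; exact: hy.
Qed.

(** Within [rho] of the apex, [Gam] and the patch are the same set, both being the graph; beyond it
    the test function is 0. *)
Lemma boundary_integral b e : 0 < e ->
  part b (cint sigma Gam (fun x => eta x * tv x * (testf rho e x)%:C%C)) =
  Num.sqrt (1 + m ^+ 2) * \int[leb2]_(y in Dr) (bf b y * testf rho e (graph m y)).
Proof.
move=> e0; rewrite part_cint; under eq_Rintegral do rewrite part_mulr.
have phiC : continuous (testf rho e) by exact: (Cn_continuous (Cn_testf 0 rho e0)).
have sphi := testf_supp e rho0.
have [B B0 hB] := cs_bounded phiC sphi.
have mD := @disc_measurable R r0.
rewrite -(@surface_integral R Om sigma m h m0 sigma_surf Om_cone r0
  (fun x => part b (eta x * tv x) * testf rho e x) hr).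
- apply: Rint_eq_supp => x; have [xr|xr] := pselect (enorm x <= rho); last by left; rewrite sphi ?mulr0.
  right; split=> [xG|/hG //].
  have E : x = graph m x.1 by apply: (bnd_graph Om_cone (GamO xG)); rewrite /eball /=; exact: le_lt_trans rh.
  split; last by rewrite {1}E.
  apply: contrapT => xd; have xr2 : enorm x < r0 by exact: le_lt_trans rr.
  apply: xd; rewrite /disc /=; have q2 := sqr_ge0 x.2.
  have h2 : enorm x ^+ 2 < r0 ^+ 2 by rewrite ltr_sqr ?nnegrE ?enorm_ge0 // ltW.
  by apply: le_lt_trans h2; rewrite -dot_enorm /dot /sqn -!expr2 lerDl.
- apply: measurable_funM; last exact: continuous_measurable_R3.
  apply: measurable_funS (measurable_eta_trace b); first exact: bnd_measurable.
  exact: (gpatch_bnd Om_cone hr).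
- apply: (@integrable_mul_bounded _ _ _ leb2 _ _ _ B mD (eta_trace_integrable b)) => //.
  by apply: continuous_measurable_R2; exact: testf_graph_continuous.
Qed.

(** Testing the conductive condition with [testf] expresses the surface integral as a gradient term
    plus lower order terms. The zero trace of [w - v] serves the gradient term; the lower order
    terms are estimated for [v] and [w] separately, in real and imaginary part, whose traces do not
    vanish, hence the Hardy inequality with a foot term. *)
Lemma boundary_functional_vanishes b (en : nat -> R) : (forall n, 0 < en n) ->
  en n @[n --> \oo] --> (0 : R) -> forall eps, 0 < eps ->
  \forall n \near \oo, `|\int[leb2]_(y in Dr) (bf b y * testf rho (en n) (graph m y))| <= eps.
Proof.
move=> en0 enc eps eps0.
have mS0 := slab_measurable m r0 r0; have mT : measurable (tcone m h : set (mR3 R)).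
  by apply: open_measurable_R3; exact: tcone_open.
have TOm : tcone m h `<=` Om by rewrite -Om_cone => x [].
have oT := @tcone_open R m h.
have [K K0 [iw iv hF]] := laplacian_terms_bound b.
have [wL wi wdL wdi wwp] := in_H1_part oOm bOm wH b.
have [vL vi vdL vdi vwp] := in_H1_part oOm bOm vH b.
have sav b' := trace_smooth_approx oOm bOm m0 sigma_surf Om_cone hr hS b' vH tvT.
have saw b' := trace_smooth_approx oOm bOm m0 sigma_surf Om_cone hr hS b' wH twT.
pose u x := part b (w x) - part b (v x).
pose p i x := part b (wpartial Om i w x) - part b (wpartial Om i v x).
have restr f : leb3.-integrable (Om : set (mR3 R)) (EFin \o f) -> leb3.-integrable (tcone m h : set (mR3 R)) (EFin \o f).
  exact: (integrableS mOm mT TOm).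
have uw : leb3.-integrable (tcone m h : set (mR3 R)) (EFin \o u).
  exact: (integrableB mT (restr _ wi) (restr _ vi)).
have pw_ i : leb3.-integrable (tcone m h : set (mR3 R)) (EFin \o p i).
  exact: (integrableB mT (restr _ (wdi i)) (restr _ (vdi i))).
have up i : wpd (tcone m h) i u (p i).
  by apply: wpdB => //; [exact: restr|exact: restr|exact: restr|exact: restr|exact: wpd_subset (wwp i)|exact: wpd_subset (vwp i)].
have sau := smooth_approxB (saw b).1 (sav b).1.
have t0 : {ae leb2, forall y, disc r0 y -> part b (tw (graph m y)) - part b (tv (graph m y)) = 0}.
  have : {ae leb2, forall y, disc r0 y -> tw (graph m y) = tv (graph m y)}.
    apply: (@trace_ae _ Om sigma m h r0 m0 sigma_surf Om_cone hr (fun x => tw x = tv x)).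
    by apply: ae_imp tE => x hx /hG; exact: hx.
  by move=> H; apply: ae_imp H => y hy /hy ->; rewrite subrr.
have pL : L2r leb3 S0 (p i3).
  by apply: (L2r_subset mOm mS0 SOm); exact: L2rB.
have [E E0 hE] := L2r_bound pL.
have [C C0 hC] := gradient_term m0 r00 rho0 rr rh hS uw pw_ up sau t0 E0 hE.
pose c := Num.sqrt (1 + m ^+ 2).
have c1 : 1 <= c by rewrite /c -[leLHS]sqrtr1 ler_wsqrtr // lerDl sqr_ge0.
(* One gradient term and [K] times four lower order integrals, all at most [de], add up to at most 5
   (K + 1) de. *)
pose de := eps / (5 * (K + 1)).
have de0 : 0 < de by rewrite divr_gt0 // mulr_gt0 // ltr_wpDl.
have LS b' f : in_H1 Om f -> L2r leb3 S0 (fun x => part b' (f x)) /\ L2r leb3 S0 (fun x => part b' (wpartial Om i3 f x)).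
  move=> fH; have [l1 _ l2 _ _] := in_H1_part oOm bOm fH b'.
  by split; apply: (L2r_subset mOm mS0 SOm).
have low b' f tf (fH : in_H1 Om f) (ft : is_trace Om sigma f tf) : \forall n \near \oo,
    (\int[leb3]_(x in slab (disc r0) (zc m) r0) `|part b' (f x) * testf rho (en n) x|%:E <= de%:E)%E.
  have [sa tl] := trace_smooth_approx oOm bOm m0 sigma_surf Om_cone hr hS b' fH ft.
  by have [l1 l2] := LS b' _ fH; exact: (lower_order_term rho m0 r00 en0 enc sa l1 l2 tl de0).
have n1 := low true _ _ vH tvT; have n2 := low false _ _ vH tvT.
have n3 := low true _ _ wH twT; have n4 := low false _ _ wH twT.
have n5 : \forall n \near \oo, C * en n <= de.
  have : C * en n @[n --> \oo] --> C * 0 by apply: cvgM => //; exact: cvg_cst.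
  rewrite mulr0 => /cvgr_lt /(_ _ de0); apply: filterS => n; exact: ltW.
near=> n; have e0 := en0 n.
have hn1 : (\int[leb3]_(x in slab (disc r0) (zc m) r0) `|part true (v x) * testf rho (en n) x|%:E <= de%:E)%E
  by near: n.
have hn2 : (\int[leb3]_(x in slab (disc r0) (zc m) r0) `|part false (v x) * testf rho (en n) x|%:E <= de%:E)%E
  by near: n.
have hn3 : (\int[leb3]_(x in slab (disc r0) (zc m) r0) `|part true (w x) * testf rho (en n) x|%:E <= de%:E)%E
  by near: n.
have hn4 : (\int[leb3]_(x in slab (disc r0) (zc m) r0) `|part false (w x) * testf rho (en n) x|%:E <= de%:E)%E
  by near: n.
have hn5 : C * en n <= de by near: n.
have phis : smooth (testf rho (en n)) by move=> j; exact: Cn_testf.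
have sphi := testf_supp (en n) rho0.
have [B B0 hB] := cs_bounded (phis 0%N) sphi.
have mphi : measurable_fun S0 (testf rho (en n)) by apply: continuous_measurable_R3; exact: (phis 0%N).
have bt : boundary_test Om Gam (testf rho (en n)).
  split=> //; exists [set x : R3 R | enorm x <= rho]; split=> //;
    first by rewrite -[X in compact X]setIT; apply: enorm_le_compact; exact: closedT.
  by move=> x [/= xr xb]; exact: hK.
have I := congr1 (part b) (hN bt).
rewrite partD boundary_integral // in I.
rewrite !(@normal_derivative_part R Om m h r0 rho) // in I; try exact: (phis 1%N).
pose Fphi x := (part b (lapw x) - part b (lapv x)) * testf rho (en n) x.
have iS f : leb3.-integrable (Om : set (mR3 R)) (EFin \o f) ->
    leb3.-integrable S0 (EFin \o (fun x => f x * testf rho (en n) x)).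
  move=> fi; apply: (@integrable_mul_bounded _ _ _ leb3 _ _ _ B mS0) => //.
  exact: (integrableS mOm mS0 SOm).
have G : \sum_(i < 3) \int[leb3]_(x in (tcone m h : set (mR3 R))) (p i x * 'D_(evec i) (testf rho (en n)) x) =
    \sum_(i < 3) \int[leb3]_(x in (tcone m h : set (mR3 R))) (part b (wpartial Om i w x) * 'D_(evec i) (testf rho (en n)) x) -
    \sum_(i < 3) \int[leb3]_(x in (tcone m h : set (mR3 R))) (part b (wpartial Om i v x) * 'D_(evec i) (testf rho (en n)) x).
  rewrite -sumrB; apply: eq_bigr => i _.
  have dc : continuous ('D_(evec i) (testf rho (en n))) := Cn_continuous (Cn_derive i (phis 1%N)).
  have [B' _ hB'] := cs_bounded dc (@derive_supp R _ _ (evec i) (@enorm_le_closed R rho) sphi).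
  have iT f : leb3.-integrable (Om : set (mR3 R)) (EFin \o f) ->
    leb3.-integrable (tcone m h : set (mR3 R)) (EFin \o (fun x => f x * 'D_(evec i) (testf rho (en n)) x)).
    move=> fi; apply: (@integrable_mul_bounded _ _ _ leb3 _ _ _ B' mT) => //; first exact: restr.
    exact: continuous_measurable_R3.
  rewrite -RintegralB //; [|exact: iT|exact: iT].
  by apply: eq_Rintegral => x _; rewrite mulrBl.
have L0 : \int[leb3]_(x in S0) Fphi x = \int[leb3]_(x in S0) (part b (lapw x) * testf rho (en n) x) -
    \int[leb3]_(x in S0) (part b (lapv x) * testf rho (en n) x).
  rewrite -RintegralB //; [|exact: iS|exact: iS].
  by apply: eq_Rintegral => x _; rewrite /Fphi mulrBl.
have FF : `|\int[leb3]_(x in S0) Fphi x| <= K * (de + de + (de + de)).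
  have mpart f b' : in_H1 Om f -> measurable_fun S0 (fun x => `|part b' (f x) * testf rho (en n) x|).
    move=> fH; apply: measurableT_comp => //; apply: measurable_funM => //.
    by have [[]] := LS b' _ fH.
  have mF : measurable_fun S0 Fphi.
    by apply: measurable_funM => //; apply/measurable_EFinP;
      case/integrableP: (integrableB mS0 (integrableS mOm mS0 SOm iw) (integrableS mOm mS0 SOm iv)).
  have main : (\int[leb3]_(x in S0) `|Fphi x|%:E <= (K * (de + de + (de + de)))%:E)%E; last first.
    by have [] := Rint_bound mS0 mF main.
  pose A b' f x := `|part b' (f x) * testf rho (en n) x|.
  pose As x := (A true w x + A false w x) + (A true v x + A false v x).
  have A0 b' f x : 0 <= A b' f x by exact: normr_ge0.
  have mA2 f : in_H1 Om f -> measurable_fun S0 (fun x => A true f x + A false f x).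
    by move=> fH; apply: measurable_funD; exact: mpart.
  have mAs : measurable_fun S0 As by apply: measurable_funD; exact: mA2.
  have As0 x : 0 <= As x by rewrite !addr_ge0.
  apply: (@le_trans _ _ (\int[leb3]_(x in S0) (K * As x)%:E)%E).
    apply: ae_ge0_le_integral => //.
    - by apply/measurable_EFinP; exact: measurableT_comp.
    - by move=> x _; rewrite lee_fin mulr_ge0.
    - by apply/measurable_EFinP; exact: measurable_funM.
    apply: ae_imp hF => x hx /SOm Ox; rewrite lee_fin /Fphi normrM.
    apply: le_trans (ler_wpM2r (normr_ge0 _) (hx Ox)) _.
    have -> : As x = (absp w x + absp v x) * `|testf rho (en n) x|.
      by rewrite /As /A /absp !normrM !mulrDl.
    by rewrite mulrA.
  rewrite (int_Zl _ mS0) // EFinM lee_wpmul2l ?lee_fin //.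
  rewrite /As int_add //;
    [|exact: mA2|exact: mA2|by move=> x; rewrite addr_ge0|by move=> x; rewrite addr_ge0].
  rewrite !int_add //; try exact: mpart.
  by rewrite !EFinD; apply: leeD; apply: leeD.
have GG := hC _ e0; rewrite G in GG.
set X := \int[leb2]_(y in Dr) _ in I *.
have XE : c * X = (\sum_(i < 3) \int[leb3]_(x in (tcone m h : set (mR3 R))) (part b (wpartial Om i w x) * 'D_(evec i) (testf rho (en n)) x) -
    \sum_(i < 3) \int[leb3]_(x in (tcone m h : set (mR3 R))) (part b (wpartial Om i v x) * 'D_(evec i) (testf rho (en n)) x))
   + \int[leb3]_(x in S0) Fphi x.
  exact: (balance I L0).
have : c * `|X| <= C * en n + K * (de + de + (de + de)).
  have -> : c * `|X| = `|c * X| by rewrite normrM [`|c|]ger0_norm // (le_trans ler01).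
  rewrite XE.
  by apply: le_trans (ler_normD _ _) _; exact: lerD.
move=> h1; have -> : eps = 5 * (K + 1) * de.
  by rewrite /de mulrC divfK // gt_eqF // mulr_gt0 // ltr_wpDl.
exact: absorb K0 (ltW de0) c1 (normr_ge0 X) h1 hn5.
Unshelve. all: by end_near. Qed.

End Conductive.

(** * From the boundary functional to the value at the apex *)

Section Decay.
Context {R : realType}.
Notation mR := (measurableTypeR R).
Variables (m r0 rho h a Mh : R) (eta tv : R3 R -> R[i]).
Hypotheses (m0 : 0 < m) (r00 : 0 < r0) (rho0 : 0 < rho) (rr : rho < r0) (h0 : 0 < h) (a01 : 0 < a < 1) (Mh0 : 0 <= Mh).
Hypothesis hr : forall y, disc r0 y -> enorm (graph m y) < h.
Hypothesis eta_hold : forall y, disc r0 y ->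
  Normc.normc (eta (graph m y) - eta 0) <= Mh * enorm (graph m y) `^ a.
Notation Dr := (disc r0 : set (mR * mR)).
Notation bf b := (fun y => part b (eta (graph m y) * tv (graph m y))).
Hypothesis bfi : forall b, leb2.-integrable Dr (EFin \o bf b).

(** Bound for [eta] at every point of the patch, from its Hoelder continuity at the apex. *)
Let M := Normc.normc (eta 0) + Mh * h `^ a.

Let eta_le y : disc r0 y -> Normc.normc (eta (graph m y)) <= M.
Proof.
move=> yd; rewrite -[X in Normc.normc X](subrK (eta 0)); apply: le_trans (normcD _ _) _.
rewrite addrC lerD2l; apply: le_trans (eta_hold yd) _; rewrite ler_wpM2l //.
have /andP[a0 _] := a01.
by apply: ge0_ler_powR; rewrite ?nnegrE ?enorm_ge0 ?(ltW a0) ?(ltW h0) ?(ltW (hr yd)).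
Qed.

(** Lets the Lipschitz error of a Herglotz function be counted at the Hoelder rate [a < 1], so that
    a single kernel estimate covers both. *)
Let enorm_le_powR y : disc r0 y -> enorm (graph m y) <= h `^ (1 - a) * enorm (graph m y) `^ a.
Proof.
move=> yd; have /andP[a0 a1] := a01; set x := enorm _; have x0 : 0 <= x by exact: enorm_ge0.
have [->|xn] := eqVneq x 0; first by rewrite mulr_ge0 // powR_ge0.
have E : x = x `^ (1 - a) * x `^ a.
  by rewrite -powRD ?subrK ?powRr1 //; apply/implyP => _.
rewrite {1}E ler_wpM2r ?powR_ge0 //.
by apply: ge0_ler_powR; rewrite ?nnegrE ?subr_ge0 ?(ltW a1) ?(ltW h0) ?(ltW (hr yd)).
Qed.

Let M_ge0 : 0 <= M.
Proof. by rewrite addr_ge0 ?normc_ge0 // mulr_ge0 // powR_ge0. Qed.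

(* eta tv - eta0 f0 = eta (tv - f) + eta (f - f0) + (eta - eta0) f0 *)
Lemma integrand_expansion f (C1 N : R) b y : 0 <= C1 -> 0 <= N ->
  (forall b x, `|part b (f x - f 0)| <= C1 * N * enorm x) ->
  (forall b, `|part b (f 0)| <= C1 * N) -> disc r0 y ->
  `|part b (eta (graph m y) * tv (graph m y)) - part b (eta 0 * f 0)| <=
  M * (`|part true (tv (graph m y) - f (graph m y))| + `|part false (tv (graph m y) - f (graph m y))|) +
  (M * (2 * C1 * h `^ (1 - a)) + Mh * (2 * C1)) * N * enorm (graph m y) `^ a.
Proof.
move=> C10 N0 hL hf yd; set x := graph m y.
have -> : part b (eta x * tv x) - part b (eta 0 * f 0) =
  part b (eta x * (tv x - f x)) + (part b (eta x * (f x - f 0)) + part b ((eta x - eta 0) * f 0)).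
  by rewrite -partB -!partD; congr (part b _); ring.
apply: le_trans (ler_normD _ _) _; apply: lerD; first exact: part_mul_le (eta_le yd).
apply: le_trans (ler_normD _ _) _.
have xa0 : 0 <= enorm x `^ a by exact: powR_ge0.
have E (M' H X : R) : (M' * (2 * C1 * H) + Mh * (2 * C1)) * N * X =
    M' * (C1 * N * (H * X) + C1 * N * (H * X)) + Mh * X * (C1 * N + C1 * N) by ring.
rewrite E; apply: lerD.
- apply: le_trans (part_mul_le b (f x - f 0) (eta_le yd)) _; rewrite ler_wpM2l //.
  apply: le_trans (lerD (hL true x) (hL false x)) _.
  by have := ler_wpM2l (mulr_ge0 C10 N0) (enorm_le_powR yd) => h1; exact: lerD.
- apply: le_trans (part_mul_le b (f 0) (eta_hold yd)) _.
  by rewrite ler_wpM2l ?mulr_ge0 // lerD.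
Qed.

(** The integral of the kernel is at least [c], so a constant is recovered by integrating against
    it. The trace error [d] is paired with [testf_graph_L2], the continuity errors with
    [testf_graph_holder]. The constants are chosen before [f], [N], [d] and [e], which are tied to
    the index only later. *)
Lemma apex_value_bound (C1 : R) : 0 <= C1 -> exists c K1 K2 : R, [/\ 0 < c, 0 <= K1, 0 <= K2 &
  forall f (N d e : R) b, 0 <= N -> 0 <= d -> 0 < e -> e <= 1 ->
  (forall b x, `|part b (f x - f 0)| <= C1 * N * enorm x) ->
  (forall b, `|part b (f 0)| <= C1 * N) ->
  (forall b, measurable_fun Dr (fun y => part b (tv (graph m y) - f (graph m y)))) ->
  (forall b, \int[leb2]_(y in Dr) (part b (tv (graph m y) - f (graph m y)) ^+ 2)%:E <= (d ^+ 2)%:E)%E ->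
  c * `|part b (eta 0 * f 0)| <= `|\int[leb2]_(y in Dr) (bf b y * testf rho e (graph m y))| +
    (K1 * (d / e) + K2 * (N * e `^ a))].
Proof.
move=> C10; have [c c0 hc] := graph_integral_lower m0 rho0.
have [L L0 hL2] := testf_graph_L2 rho m0 r00; have [H H0 hH] := testf_graph_holder rho m0 r00 a01.
pose C3 := M * (2 * C1 * h `^ (1 - a)) + Mh * (2 * C1).
have C30 : 0 <= C3 by rewrite addr_ge0 // mulr_ge0 // ?mulr_ge0 // powR_ge0.
exists c, (M * (2 * L)), (C3 * H); split=> //; [by rewrite !mulr_ge0|by rewrite mulr_ge0|].
move=> f N d e b N0 d0 e0 e1 hL hf mA hA.
have mD := @disc_measurable R r0.
pose phi y := testf rho e (graph m y).
have phic : continuous phi by exact: testf_graph_continuous.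
have mphi : measurable_fun Dr phi by exact: continuous_measurable_R2.
have [B B0 hB] := cs_bounded (Cn_continuous (Cn_testf 0 rho e0)) (testf_supp e rho0).
have phii : leb2.-integrable Dr (EFin \o phi).
  apply: (@L2r_integrable _ _ _ leb2) => //; first exact: disc_finite.
  by apply: (@L2rP _ _ _ leb2 Dr _ ((L / e) ^+ 2)) => //; exact: hL2.
have bphi : leb2.-integrable Dr (EFin \o (fun y => bf b y * phi y)).
  by apply: (@integrable_mul_bounded _ _ _ leb2 _ _ _ B mD (bfi b)) => // y _; exact: hB.
pose z := part b (eta 0 * f 0).
have Iphi : c <= \int[leb2]_(y in Dr) phi y.
  rewrite -lee_fin /Rintegral fineK; last exact: (integrable_fin_num mD phii).
  have e01 : 0 < e <= 1 by rewrite e0.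
  apply: le_trans (hc e e01) _.
  rewrite (@int_eq_supp _ _ _ leb2 Dr setT (fun y => testf rho e (y, zc m y))) // => y _ yd.
  exact: (testf_graph_out e m0 rho0 rr yd).
have zphi : leb2.-integrable Dr (EFin \o (fun y => z * phi y)) by exact: (integrableZl mD z phii).
have bz : measurable_fun Dr (fun y => (bf b y - z) * phi y).
  apply: measurable_funM => //; apply: measurable_funB => //.
  by apply/measurable_EFinP; case/integrableP: (bfi b).
pose A b y := part b (tv (graph m y) - f (graph m y)).
have key : (\int[leb2]_(y in Dr) `|(bf b y - z) * phi y|%:E <=
    (M * (2 * L) * (d / e) + C3 * H * (N * e `^ a))%:E)%E.
  pose G1 y := `|A true y * phi y| + `|A false y * phi y|.
  pose G2 y := `|phi y| * enorm (graph m y) `^ a.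
  have mAp b' : measurable_fun Dr (fun y => `|A b' y * phi y|).
    by apply: measurableT_comp => //; apply: measurable_funM => //; exact: mA.
  have mG1 : measurable_fun Dr G1 by exact: measurable_funD.
  have men : measurable_fun Dr (fun y => enorm (graph m y)).
    apply: continuous_measurable_R2 => y; apply: (@continuous_comp _ _ _ (graph m) enorm).
      exact: graph_continuous.
    exact: enorm_continuous.
  have mG2 : measurable_fun Dr G2.
    apply: measurable_funM; first exact: measurableT_comp.
    exact: (measurableT_comp (measurable_powR a) men).
  have G10 y : 0 <= G1 y by rewrite addr_ge0.
  have G20 y : 0 <= G2 y by rewrite mulr_ge0 // powR_ge0.
  have CN0 : 0 <= C3 * N by rewrite mulr_ge0.
  apply: (@le_trans _ _ (\int[leb2]_(y in Dr) (M * G1 y + C3 * N * G2 y)%:E)%E).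
    apply: int_le => //.
    - exact: measurableT_comp.
    - by apply: measurable_funD; apply: measurable_funM.
    move=> y yd; have := integrand_expansion b C10 N0 hL hf yd => h1.
    rewrite normrM; apply: le_trans (ler_wpM2r (normr_ge0 _) h1) _.
    have E1 : G1 y = (`|A true y| + `|A false y|) * `|phi y|.
      by rewrite /G1 (normrM (A true y)) (normrM (A false y)) mulrDl.
    have E2 (M' s X p c3 : R) : (M' * s + c3 * N * X) * p = M' * (s * p) + c3 * N * (p * X) by ring.
    by rewrite E1 /G2 [leLHS]E2.
  rewrite (int_addZ _ mD) // [leRHS]EFinD; apply: leeD.
    rewrite -[X in (_ <= X%:E)%E]mulrA [leRHS]EFinM; apply: lee_wpmul2l; first by rewrite lee_fin.
    rewrite /G1 int_add //.
    have -> : 2 * L * (d / e) = d * (L / e) + d * (L / e) by ring.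
    have Le : 0 <= L / e by rewrite divr_ge0 // ltW.
    rewrite [leRHS]EFinD; apply: leeD.
    + by apply: cauchy_schwarz_int => //; [exact: mA|exact: hA|exact: hL2].
    + by apply: cauchy_schwarz_int => //; [exact: mA|exact: hA|exact: hL2].
  have -> : C3 * H * (N * e `^ a) = C3 * N * (H * e `^ a) by ring.
  rewrite [leRHS]EFinM; apply: lee_wpmul2l; first by rewrite lee_fin.
  exact: hH.
have [_ kb] := Rint_bound mD bz key.
have E : \int[leb2]_(y in Dr) ((bf b y - z) * phi y) =
    \int[leb2]_(y in Dr) (bf b y * phi y) - z * \int[leb2]_(y in Dr) phi y.
  by rewrite -RintegralZl // -RintegralB //; apply: eq_Rintegral => y _; rewrite mulrBl.
rewrite E in kb.
have h1 : c * `|z| <= `|z * \int[leb2]_(y in Dr) phi y|.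
  by rewrite normrM mulrC ler_wpM2l // (le_trans Iphi) // ler_norm.
apply: le_trans h1 _.
rewrite -[X in `|X| <= _](subKr (\int[leb2]_(y in Dr) (bf b y * phi y))).
by apply: le_trans (ler_normB _ _) _; rewrite lerD2l.
Qed.

End Decay.

(** * Approximation error in the cone and on its lateral surface *)

Section Approximation.
Context {R : realType}.
Notation mR := (measurableTypeR R).
Variables (Om : set (R3 R)) (sigma : {measure set (mR3 R) -> \bar R}) (m h r0 : R) (v tv : R3 R -> R[i]).
Hypotheses (oOm : open Om) (bOm : bounded_set Om) (sigma_surf : is_surface_measure Om sigma).
Hypotheses (m0 : 0 < m) (r00 : 0 < r0).
Hypothesis Om_cone : Om `&` eball h = tcone m h.
Hypothesis hr : forall y, disc r0 y -> enorm (graph m y) < h.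
Hypothesis hS : slab (disc r0) (zc m) r0 `<=` tcone m h.
Hypotheses (vH : in_H1 Om v) (tvT : is_trace Om sigma v tv).
Notation S0 := (slab (disc r0) (zc m) r0 : set (mR3 R)).
Notation Dr := (disc r0 : set (mR * mR)).
Notation T := (tcone m h : set (mR3 R)).

Let TOm : tcone m h `<=` Om. Proof. by rewrite -Om_cone => x []. Qed.
Let oT : open (tcone m h). Proof. exact: tcone_open. Qed.
Let bT : bounded_set (tcone m h).
Proof. by move: bOm => [M [Mr HM]]; exists M; split=> // x Mx y /TOm; exact: HM. Qed.
Let mT : measurable T. Proof. exact: open_measurable_R3. Qed.
Let mOm : measurable (Om : set (mR3 R)). Proof. exact: open_measurable_R3. Qed.

(** The hypothesis concerns the weak derivative chosen on the truncated cone for the difference; it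
    is rewritten with the one chosen on [Om] for [v] and the classical one of [f]. *)
Lemma H1_error f (d : R) b : csmooth f -> 0 <= d ->
  (H1norm (tcone m h) (fun x => (v x - f x)%R) <= d%:E)%E ->
  (\int[leb3]_(x in T) ((part b (v x) - part b (f x)) ^+ 2)%:E <= (d ^+ 2)%:E)%E /\
  (\int[leb3]_(x in T)
    ((part b (wpartial Om i3 v x) - 'D_(evec i3) (fun x => part b (f x)) x) ^+ 2)%:E <= (d ^+ 2)%:E)%E.
Proof.
move=> fs d0 hd.
have [vT vE] := in_H1_restrict oOm bOm oT TOm vH.
have [fH fE] := in_H1_smooth oT bT fs.
have [dH dE] := in_H1B oT bT vT fH.
have [dL _ dwL _ _] := in_H1_part oT bT dH b.
have [_ _ wL _ _] := in_H1_part oOm bOm vH b.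
have [k1 k2] := H1norm_le d0 hd.
split.
  have := int_part_le mT b dH.1.1 (L2norm_le d0 k1).
  by under eq_integral do rewrite partB.
have h1 := int_part_le mT b (wpartialP dH i3).1.1 (L2norm_le d0 (k2 i3)).
apply: (ae_eq_L2_le mT mT _ _ _ _ h1) => //.
- by have [] := dwL i3.
- apply: measurable_funB; first by have [mw _] := wL i3; exact: (measurable_funS mOm TOm mw).
  apply: continuous_measurable_R3; exact: Cn_continuous (Cn_derive i3 (part_csmooth b fs 1%N)).
apply: ae_imp2 (dE b i3) (ae_imp2 (fun x h1 h2 => conj h1 h2) (vE b i3) (fE b i3)) => x e1 [e2 e3] Tx.
by rewrite e1 // e2 // e3.
Qed.

(** The trace inequality applied to [v - f]. Its constant is the root of 4 ((1 / r0 + 1) + 1), for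
    the function and its vertical derivative. *)
Lemma trace_error : exists2 C, 0 <= C & forall f (d : R) b, csmooth f -> 0 <= d ->
  (H1norm (tcone m h) (fun x => (v x - f x)%R) <= d%:E)%E ->
  measurable_fun Dr (fun y => part b (tv (graph m y) - f (graph m y))) /\
  (\int[leb2]_(y in Dr) (part b (tv (graph m y) - f (graph m y)) ^+ 2)%:E <= ((C * d) ^+ 2)%:E)%E.
Proof.
have Q0 : 0 <= 4 * (r0^-1 + 2) by rewrite mulr_ge0 // addr_ge0 // invr_ge0 ltW.
exists (Num.sqrt (4 * (r0^-1 + 2))); first exact: sqrtr_ge0.
move=> f d b fs d0 hd; have [e1 e2] := H1_error b fs d0 hd.
have [sv _] := trace_smooth_approx oOm bOm m0 sigma_surf Om_cone hr hS b vH tvT.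
have fC : Cn 1 (fun x => part b (f x)) := part_csmooth b fs 1%N.
have sa := smooth_approxB sv (smooth_approx_smooth m r0 r0 fC).
have E : (fun y => part b (tv (graph m y) - f (graph m y))) =
  (fun y => part b (tv (graph m y)) - part b (f (graph m y))).
  by apply/funext => y; rewrite partB.
have [ma mb mt _] := sa; split; first by rewrite E.
under eq_integral do rewrite partB.
apply: le_trans (trace_inequality r00 sa) _.
have mS := slab_measurable m r0 r0.
have sub (F : R3 R -> R) : measurable_fun T F -> (\int[leb3]_(x in T) (F x ^+ 2)%:E <= (d ^+ 2)%:E)%E ->
    (\int[leb3]_(x in S0) (F x ^+ 2)%:E <= (d ^+ 2)%:E)%E.
  move=> mF; apply: le_trans; apply: ge0_subset_integral => //.
    by apply/measurable_EFinP; exact: measurable_sqr.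
  by move=> x _; rewrite lee_fin sqr_ge0.
have [mv _ mw _ _] := in_H1_part oOm bOm vH b.
have s1 := sub _ _ e1; have s2 := sub _ _ e2.
rewrite exprMn sqr_sqrtr //.
have -> : 4 * (r0^-1 + 2) * d ^+ 2 = 4 * ((r0^-1 + 1) * d ^+ 2 + d ^+ 2) by ring.
rewrite [leRHS]EFinM [X in (_ <= _ * X)%E]EFinD [X in (_ <= _ * (X + _))%E]EFinM.
apply: lee_wpmul2l; first by rewrite lee_fin.
apply: leeD; last first.
  apply: s2; apply: measurable_funB; first by have [mw' _] := mw i3; exact: (measurable_funS mOm TOm mw').
  by apply: continuous_measurable_R3; exact: Cn_continuous (Cn_derive i3 fC).
apply: lee_wpmul2l; first by rewrite lee_fin addr_ge0 // invr_ge0 ltW.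
apply: s1; apply: measurable_funB; first by have [mv' _] := mv; exact: (measurable_funS mOm TOm mv').
by apply: continuous_measurable_R3; exact: Cn_continuous fC.
Qed.

End Approximation.

Section PowerDecay.
Context {R : realType}.

Lemma powR_nat_cvg0 (t : R) : 0 < t -> (n.+1%:R `^ (- t) : R) @[n --> \oo] --> (0 : R).
Proof.
move=> t0; apply/cvgrPdist_le => e e0.
have x0 : 0 < e `^ (- t^-1) by rewrite powR_gt0.
have near1 : \forall n \near \oo, e `^ (- t^-1) <= n%:R :> R by exact: nbhs_infty_ger.
apply: filterS near1 => n hn; rewrite sub0r normrN ger0_norm ?powR_ge0 //.
have hn1 : e `^ (- t^-1) <= n.+1%:R by apply: le_trans hn _; rewrite ler_nat.
have -> : e = (e `^ (- t^-1)) `^ (- t).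
  by rewrite -powRrM mulrNN mulVf ?gt_eqF // powRr1 // ltW.
by apply: powR_le_opp => //; exact: ltW.
Qed.

End PowerDecay.

(** * Averages over small balls *)

Section Volume.
Context {R : realType}.
Notation mR := (measurableTypeR R).
Notation mu := (@lebesgue_measure R).

Lemma leb3_box (a1 b1 a2 b2 a3 b3 : R) : a1 < b1 -> a2 < b2 -> a3 < b3 ->
  (leb3 (`[a1, b1] `*` `[a2, b2] `*` `[a3, b3] : set (mR3 R)) =
    ((b1 - a1) * (b2 - a2) * (b3 - a3))%:E)%E.
Proof.
move=> h1 h2 h3.
have I a b : a < b -> (mu (`[a, b] : set mR) = (b - a)%:E)%E.
  by move=> ab; rewrite lebesgue_measure_itv /= lte_fin ab EFinB.
have m_ a b : measurable (`[a, b] : set mR) by exact: measurable_itv.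
have E2 : (mu2 ((`[a1, b1] : set mR) `*` (`[a2, b2] : set mR)) = mu (`[a1, b1] : set mR) * mu (`[a2, b2] : set mR))%E.
  exact: (@product_measure1E _ _ mR mR R mu mu).
have E3 := @product_measure1E _ _ (mR * mR)%type mR R mu2 mu
  ((`[a1, b1] : set mR) `*` (`[a2, b2] : set mR)) (`[a3, b3] : set mR) (measurableX (m_ _ _) (m_ _ _)) (m_ _ _).
have -> : (leb3 (`[a1, b1] `*` `[a2, b2] `*` `[a3, b3] : set (mR3 R)) =
    mu (`[a1, b1] : set mR) * mu (`[a2, b2] : set mR) * mu (`[a3, b3] : set mR))%E.
  by rewrite -E2 -E3.
by rewrite !I // -!EFinM.
Qed.

(** An inscribed cube of side s = lam / (2 m + 4) is enough, placed over the square [0, s]^2 at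
    height (2 m + 1) s. Over that square the cone has height at most 2 m s, and the squared norm on
    the cube is at most (2 + (2 m + 2)^2) s^2 < lam^2. *)
Lemma tcone_volume (m : R) : 0 < m -> exists2 c, 0 < c & forall lam, 0 < lam ->
  ((c * lam ^+ 3)%:E <= leb3 (tcone m lam : set (mR3 R)))%E.
Proof.
move=> m0; pose w := 2 * m + 4; have w0 : 0 < w by rewrite addr_gt0 // mulr_gt0.
exists (w^-1 ^+ 3); first by rewrite exprn_gt0 // invr_gt0.
move=> lam l0; pose s := lam / w; have s0 : 0 < s by rewrite divr_gt0.
have ls : lam = w * s by rewrite mulrC divfK // gt_eqF.
pose a3 := (2 * m + 1) * s; pose b3 := a3 + s.
have E := @leb3_box 0 s 0 s a3 b3 s0 s0; rewrite ltrDl in E.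
have -> : (w^-1 ^+ 3 * lam ^+ 3)%:E = ((s - 0) * (s - 0) * (b3 - a3))%:E.
  by congr (_%:E); rewrite /b3 !subr0 addrAC subrr add0r -exprMn [w^-1 * _]mulrC -/s; ring.
rewrite -(E s0); apply: le_measure; rewrite ?inE.
- by do ?apply: measurableX; exact: measurable_itv.
- by apply: open_measurable_R3; exact: tcone_open.
move=> [[x1 x2] x3] [[/= ]]; rewrite !in_itv /= => /andP[p1 q1] /andP[p2 q2] /andP[p3 q3].
have h1 : x1 ^+ 2 <= s ^+ 2 by rewrite ler_sqr ?nnegrE // ltW.
have h2 : x2 ^+ 2 <= s ^+ 2 by rewrite ler_sqr ?nnegrE // ltW.
have s2 : 0 < s ^+ 2 by rewrite exprn_gt0.
have y0 : 0 <= x3 by apply: le_trans p3; rewrite mulr_ge0 ?(ltW s0) // addr_ge0 // mulr_ge0 // ltW.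
split.
- rewrite /= /zc; apply: lt_le_trans p3.
  have : Num.sqrt (sqn (x1, x2)) <= 2 * s.
    have s20 : 0 <= 2 * s by rewrite mulr_ge0 // ltW.
    rewrite -(ger0_norm s20) -sqrtr_sqr; apply: ler_wsqrtr.
    by rewrite /sqn /= exprMn; lra.
  move=> /(ler_wpM2l (ltW m0)) h; apply: le_lt_trans h _.
  have -> : a3 = m * (2 * s) + s by rewrite /a3; ring.
  by rewrite ltrDl.
- apply/eballE; first exact: ltW.
  rewrite /sqn /= ls exprMn.
  have h3 : x3 ^+ 2 <= (w - 2) ^+ 2 * s ^+ 2.
    rewrite -exprMn ler_sqr ?nnegrE //; last first.
      by rewrite mulr_ge0 ?(ltW s0) // /w; have := ltW m0; lra.
    by apply: le_trans q3 _; rewrite /b3 /a3 /w le_eqVlt; apply/orP; left; apply/eqP; ring.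
  have h4 : s ^+ 2 + s ^+ 2 + (w - 2) ^+ 2 * s ^+ 2 < w ^+ 2 * s ^+ 2.
    have -> : s ^+ 2 + s ^+ 2 + (w - 2) ^+ 2 * s ^+ 2 = (2 + (w - 2) ^+ 2) * s ^+ 2 by ring.
    rewrite ltr_pM2r // sqrrB /w; lra.
  by apply: le_lt_trans h4; lra.
Qed.

End Volume.

Section Average.
Context {R : realType}.
Notation mR := (measurableTypeR R).
Variables (Om : set (R3 R)) (m h : R) (v : R3 R -> R[i]).
Hypotheses (oOm : open Om) (bOm : bounded_set Om) (m0 : 0 < m) (h0 : 0 < h).
Hypothesis Om_cone : Om `&` eball h = tcone m h.
Hypothesis mv : cmeasurable (Om : set (mR3 R)) v.
Notation T := (tcone m h : set (mR3 R)).
Notation B lam := (eball lam `&` Om : set (mR3 R)).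

Lemma ball_coneE lam : lam <= h -> eball lam `&` Om = tcone m lam.
Proof.
move=> lh; apply/seteqP; split => x.
- move=> [xl xO]; have : (Om `&` eball h) x by split=> //; exact: lt_le_trans lh.
  by rewrite Om_cone => -[xz _]; split.
- move=> [xz xl]; split=> //; have : tcone m h x by split=> //; exact: lt_le_trans lh.
  by rewrite -Om_cone => -[].
Qed.

Lemma measurable_normc d (X : measurableType d) (D : set X) (f : X -> R[i]) : cmeasurable D f ->
  measurable_fun D (fun x => Normc.normc (f x)).
Proof.
move=> mf; have -> : (fun x => Normc.normc (f x)) = (fun x => Num.sqrt (Normc.normc (f x) ^+ 2)).
  by apply/funext => x; rewrite sqrtr_sqr ger0_norm // normc_ge0.
apply: (measurableT_comp _ (measurable_normc_sqr mf)).
by apply: continuous_measurable_fun; exact: sqrt_continuous.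
Qed.

(** Cauchy-Schwarz against 1 on the small ball, of volume V, gives at most d sqrt(V) <= eps V for
    each part of [v - f]; the oscillation of [f] and its value at 0 give 2 eps for each part. In all
    2 + 4. *)
Lemma average_bound (c C1 lam eps d N : R) (f : R3 R -> R[i]) :
  (forall lam, 0 < lam -> ((c * lam ^+ 3)%:E <= leb3 (tcone m lam : set (mR3 R)))%E) ->
  0 < c -> 0 <= C1 -> 0 < lam -> lam <= h -> 0 <= d -> 0 <= N -> 0 <= eps ->
  (forall b, continuous (fun x => part b (f x))) ->
  (forall b, \int[leb3]_(x in T) ((part b (v x) - part b (f x)) ^+ 2)%:E <= (d ^+ 2)%:E)%E ->
  (forall b x, `|part b (f x - f 0)| <= C1 * N * enorm x) ->
  d ^+ 2 <= eps ^+ 2 * (c * lam ^+ 3) -> C1 * N * lam <= eps -> Normc.normc (f 0) <= eps ->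
  `|(\int[leb3]_(x in B lam) Normc.normc (v x)) / fine (leb3 (B lam))| <= 6 * eps.
Proof.
move=> hc c0 C10 l0 lh d0 N0 eps0 fc hd hL hds hN hf.
have mOm : measurable (Om : set (mR3 R)) by exact: open_measurable_R3.
have oB : open (B lam) by apply: openI => //; exact: eball_open.
have mB : measurable (B lam) by exact: open_measurable_R3.
have mT : measurable T by apply: open_measurable_R3; exact: tcone_open.
have BO : B lam `<=` Om by move=> x [].
have BT : B lam `<=` T.
  by rewrite ball_coneE // => x [xz xl]; split=> //; exact: lt_le_trans lh.
have bB : bounded_set (B lam).
  by move: bOm => [M [Mr HM]]; exists M; split=> // x Mx y /BO; exact: HM.
have fV : (leb3 (B lam) < +oo)%E by exact: bounded_leb3.
set V := fine _; have VE : leb3 (B lam) = V%:E by rewrite fineK // ge0_fin_numE.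
have cV : c * lam ^+ 3 <= V by rewrite -lee_fin -VE ball_coneE //; exact: hc.
have V0 : 0 < V by apply: lt_le_trans cV; rewrite mulr_gt0 // exprn_gt0.
(* The hypothesis on [d] is stated with the lower bound c lam^3 of the volume. *)
have dV : d <= eps * Num.sqrt V.
  rewrite -ler_sqr ?nnegrE ?mulr_ge0 ?sqrtr_ge0 // exprMn sqr_sqrtr ?(ltW V0) //.
  by apply: le_trans hds _; rewrite ler_wpM2l // sqr_ge0.
have mvB b : measurable_fun (B lam) (fun x => part b (v x)).
  by apply: (measurable_funS mOm BO); exact: cmeasurable_part.
have mfB b : measurable_fun (B lam) (fun x => part b (f x)) by exact: continuous_measurable_R3.
have cst1 (r : R) : (\int[leb3]_(x in B lam) r%:E = (r * V)%:E)%E.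
  by rewrite integral_cst // VE -EFinM.
pose D b x := `|part b (v x) - part b (f x)|.
have mD b : measurable_fun (B lam) (D b).
  by apply: measurableT_comp => //; exact: measurable_funB.
have hD b : (\int[leb3]_(x in B lam) (D b x)%:E <= (eps * V)%:E)%E.
  have s1 : (\int[leb3]_(x in B lam) ((part b (v x) - part b (f x)) ^+ 2)%:E <= (d ^+ 2)%:E)%E.
    apply: le_trans (hd b); apply: ge0_subset_integral => //.
      apply/measurable_EFinP; apply: measurable_sqr; apply: measurable_funB.
        apply: (measurable_funS mOm _ (cmeasurable_part b mv)).
        by rewrite -Om_cone => x [].
      exact: continuous_measurable_R3.
    by move=> x _; rewrite lee_fin sqr_ge0.
  have s2 : (\int[leb3]_(x in B lam) (cst (1 : R) x ^+ 2)%:E <= (Num.sqrt V ^+ 2)%:E)%E.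
    by under eq_integral do rewrite /cst /= expr1n; rewrite cst1 mul1r sqr_sqrtr // ltW.
  have := cauchy_schwarz_int mB (measurable_funB (mvB b) (mfB b)) (measurable_cst (1 : R)) d0 (sqrtr_ge0 V) s1 s2.
  under eq_integral do rewrite /cst /= mulr1.
  move=> h1; apply: le_trans h1 _; rewrite lee_fin.
  apply: le_trans (ler_wpM2r (sqrtr_ge0 V) dV) _.
  by rewrite -mulrA -expr2 sqr_sqrtr // ltW.
have mn : measurable_fun (B lam) (fun x => Normc.normc (v x)).
  by apply: (measurable_funS mOm BO); exact: measurable_normc.
have key : (\int[leb3]_(x in B lam) `|Normc.normc (v x)|%:E <= (6 * eps * V)%:E)%E.
  have D0 b x : 0 <= D b x by exact: normr_ge0.
  have e4 : 0 <= 4 * eps by rewrite mulr_ge0.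
  apply: (@le_trans _ _ (\int[leb3]_(x in B lam) ((D true x + D false x) + 4 * eps)%:E)%E).
    apply: int_le => //.
    - exact: measurableT_comp.
    - by apply: measurable_funD => //; exact: measurable_funD.
    move=> x [xl _]; rewrite ger0_norm ?normc_ge0 //; apply: le_trans (normc_le _) _.
    have P b : `|part b (v x)| <= D b x + 2 * eps.
      have -> : part b (v x) = (part b (v x) - part b (f x)) + (part b (f x - f 0) + part b (f 0)).
        by rewrite partB subrK subrK.
      apply: le_trans (ler_normD _ _) _; rewrite /D lerD2l.
      apply: le_trans (ler_normD _ _) _.
      have -> : 2 * eps = eps + eps by ring.
      apply: lerD; last exact: le_trans (part_le _ _) hf.
      apply: le_trans (hL b x) _; apply: le_trans hN; rewrite ler_wpM2l ?mulr_ge0 //.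
      exact: ltW.
    by apply: le_trans (lerD (P true) (P false)) _; rewrite le_eqVlt; apply/orP; left; apply/eqP; ring.
  rewrite int_add //; [|exact: measurable_funD|by move=> x; rewrite addr_ge0].
  rewrite cst1 int_add //.
  have -> : 6 * eps * V = eps * V + eps * V + 4 * eps * V by ring.
  rewrite [leRHS]EFinD; apply: leeD => //; rewrite [leRHS]EFinD; exact: leeD.
have [_ k2] := Rint_bound mB mn key.
by rewrite normrM [`|V^-1|]ger0_norm ?invr_ge0 ?(ltW V0) // ler_pdivrMr.
Qed.

End Average.

(** * Choice of the exponents and of the index *)

Section Limits.
Context {R : realType}.

(** With depth n^(-s) the two errors are multiples of n^(s - beta) and n^(gamma - s a), whose
    exponents are negative. Indices are shifted because the approximations start at 1. *)
Lemma apex_values_vanish (c K1 K2 C a s beta gamma : R) (e0 : R[i]) (z : nat -> R[i]) (X : nat -> bool -> R) :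
  0 < c -> 0 <= K1 -> 0 <= K2 -> e0 != 0 -> s < beta -> gamma < s * a ->
  (forall b eps, 0 < eps -> \forall n \near \oo, X n b <= eps) ->
  (forall n b, c * `|part b (e0 * z n)| <= X n b +
    (K1 * (C * n.+1%:R `^ (- beta) / n.+1%:R `^ (- s)) +
     K2 * (n.+1%:R `^ gamma * (n.+1%:R `^ (- s)) `^ a))) ->
  forall eps, 0 < eps -> \forall n \near \oo, Normc.normc (z n) <= eps.
Proof.
move=> c0 K10 K20 e00 sb ga hX h eps eps0.
have ne0 : 0 < Normc.normc e0.
  by rewrite lt_def normc_ge0 andbT; apply: contraNneq e00 => /Normc.eq0_normc ->.
(* Two parts, each bounded by [de] from [X] plus [de] from the power terms. *)
pose de := c * Normc.normc e0 * eps / 4.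
have de0 : 0 < de by rewrite divr_gt0 // !mulr_gt0.
pose Y n : R := K1 * (C * n.+1%:R `^ (- (beta - s))) + K2 * n.+1%:R `^ (- (s * a - gamma)).
have YE n : K1 * (C * n.+1%:R `^ (- beta) / n.+1%:R `^ (- s)) +
     K2 * (n.+1%:R `^ gamma * (n.+1%:R `^ (- s)) `^ a) = Y n.
  have n0 : (n.+1%:R : R) != 0 by rewrite pnatr_eq0.
  congr (K1 * _ + K2 * _).
    rewrite -mulrA; congr (C * _); rewrite [X in _ / X]powRN invrK -powRD; last by rewrite n0 implybT.
    by rewrite opprB addrC.
  rewrite -powRrM -powRD; last by rewrite n0 implybT.
  by rewrite opprB mulNr.
have Yc : Y n @[n --> \oo] --> (0 : R).
  have -> : (0 : R) = K1 * (C * 0) + K2 * 0 by rewrite !mulr0 addr0.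
  apply: cvgD; first by do 2!apply: cvgMr; apply: powR_nat_cvg0; rewrite subr_gt0.
  by apply: cvgMr; apply: powR_nat_cvg0; rewrite subr_gt0.
have n1 := hX true _ de0; have n2 := hX false _ de0.
have n3 : \forall n \near \oo, Y n <= de.
  by move/cvgr_lt : Yc => /(_ _ de0); apply: filterS => n; exact: ltW.
near=> n.
have hY : Y n <= de by near: n.
have hb b : c * `|part b (e0 * z n)| <= de + de.
  apply: le_trans (h n b) _; rewrite YE; apply: lerD => //.
  by case: b; near: n.
have : c * Normc.normc (e0 * z n) <= (de + de) + (de + de).
  apply: le_trans (lerD (hb true) (hb false)); rewrite -mulrDr ler_wpM2l ?(ltW c0) //.
  exact: normc_le.
rewrite Normc.normcM mulrA.
have -> : de + de + (de + de) = c * Normc.normc e0 * eps by rewrite /de; field.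
by rewrite ler_pM2l // mulr_gt0.
Unshelve. all: by end_near. Qed.

Lemma powR_right_le (r e : R) : 0 < r -> 0 < e -> \forall lam \near 0^'+, lam `^ r <= e.
Proof.
move=> r0 e0; have e1 : 0 < e `^ r^-1 by rewrite powR_gt0.
near=> lam.
have l0 : 0 < lam by near: lam; exact: nbhs_right_gt.
have le : lam <= e `^ r^-1 by near: lam; exact: nbhs_right_le.
have -> : e = (e `^ r^-1) `^ r by rewrite -powRrM mulVf ?gt_eqF // powRr1 // ltW.
by apply: ge0_ler_powR; rewrite ?nnegrE ?(ltW r0) ?(ltW l0) ?(ltW e1).
Unshelve. all: by end_near. Qed.

(* The index n is chosen of the order lam^(-p), where 3 / (2 beta) < p < 1 / gamma. *)
Lemma averages_vanish (A : R -> R) (z : nat -> R) (h c C1 beta gamma : R) :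
  0 < h -> 0 < c -> 0 <= C1 -> 0 < beta -> 0 < gamma -> 3 * gamma < 2 * beta ->
  (forall eps, 0 < eps -> \forall n \near \oo, z n <= eps) ->
  (forall lam eps n, 0 < lam -> lam <= h -> 0 <= eps ->
    (n.+1%:R `^ (- beta)) ^+ 2 <= eps ^+ 2 * (c * lam ^+ 3) ->
    C1 * n.+1%:R `^ gamma * lam <= eps -> z n <= eps -> `|A lam| <= 6 * eps) ->
  A lam @[lam --> 0^'+] --> (0 : R).
Proof.
move=> h0 c0 C10 b0 g0 gb hz H; apply/cvgrPdist_le => eps0 eps00.
pose eps := eps0 / 6; have e0 : 0 < eps by rewrite divr_gt0.
(* Midpoint of the admissible interval, which is nonempty since 3 gamma < 2 beta. *)
pose p := (3 / (2 * beta) + gamma^-1) / 2.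
have b2 : 0 < 2 * beta by rewrite mulr_gt0.
have lt1 : 3 / (2 * beta) < gamma^-1.
  by rewrite ltr_pdivrMr // mulrC ltr_pdivlMr.
have p1 : 3 < 2 * beta * p.
  by rewrite mulrC -ltr_pdivrMr // /p; lra.
have p2 : gamma * p < 1.
  by rewrite mulrC -ltr_pdivlMr // mul1r /p; lra.
have p0 : 0 < p by rewrite divr_gt0 // addr_gt0 ?invr_gt0 // divr_gt0.
(* Spare powers of [lam]: for an index of order lam^(-p) the two requirements hold up to factors
   lam^r1 and lam^r2, which tend to 0. *)
pose r1 := 2 * beta * p - 3; have r10 : 0 < r1 by rewrite subr_gt0.
pose r2 := 1 - gamma * p; have r20 : 0 < r2 by rewrite subr_gt0.
(* The factor 2^gamma comes from bounding the index by twice [x]. *)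
pose K := C1 * 2 `^ gamma + 1.
have K0 : 0 < K by rewrite ltr_wpDl // mulr_ge0 // powR_ge0.
have [N0 _ hN0] := hz _ e0.
have x0 : 0 < (N0.+1%:R : R) `^ (- p^-1) by rewrite powR_gt0.
have m1 := powR_right_le r10 (mulr_gt0 (exprn_gt0 2 e0) c0).
have m2 := powR_right_le r20 (divr_gt0 e0 K0).
near=> lam.
have l0 : 0 < lam by near: lam; exact: nbhs_right_gt.
have lh : lam <= h by near: lam; exact: nbhs_right_le.
have l1 : lam <= 1 by near: lam; exact: nbhs_right_le.
have lN : lam <= N0.+1%:R `^ (- p^-1) by near: lam; exact: nbhs_right_le.
have lr1 : lam `^ r1 <= eps ^+ 2 * c by near: lam.
have lr2 : lam `^ r2 <= eps / K by near: lam.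
have ln : lam != 0 by rewrite gt_eqF.
(* [n] is the integer part of [x], so the index [n.+1] exceeds [x] and, as [x >= 1], is at most
   [2 * x]. *)
pose x := lam `^ (- p); pose n := Num.truncn x.
have xN : N0.+1%:R <= x.
  have -> : N0.+1%:R = (N0.+1%:R `^ (- p^-1)) `^ (- p) :> R.
    by rewrite -powRrM mulrNN mulVf ?gt_eqF // powRr1.
  by apply: powR_le_opp => //; exact: ltW.
have x1 : 1 <= x by apply: le_trans xN; rewrite ler1n.
have xp : 0 < x by exact: lt_le_trans x1.
have /andP[nx xn] : n%:R <= x < n.+1%:R by exact: truncn_itv (ltW xp).
have nN : (N0 <= n)%N.
  by have := le_lt_trans xN xn; rewrite ltr_nat ltnS => /ltnW.
rewrite sub0r normrN; have -> : eps0 = 6 * eps by rewrite /eps; field.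
apply: (H lam eps n l0 lh (ltW e0)).
- have : n.+1%:R `^ (- beta) <= lam `^ (p * beta).
    have -> : lam `^ (p * beta) = x `^ (- beta) by rewrite /x -powRrM mulrNN.
    by apply: powR_le_opp => //; [exact: ltW|exact: ltW].
  rewrite -ler_sqr ?nnegrE ?powR_ge0 // => hh; apply: le_trans hh _.
  have -> : (lam `^ (p * beta)) ^+ 2 = lam `^ r1 * lam ^+ 3.
    rewrite -powR_mulrn ?powR_ge0 // -powRrM -[lam ^+ 3]powR_mulrn ?(ltW l0) // -powRD; last first.
      by rewrite ln implybT.
    by congr (_ `^ _); rewrite /r1; ring.
  by rewrite [leRHS]mulrA ler_wpM2r // exprn_ge0 // ltW.
- have : n.+1%:R `^ gamma <= 2 `^ gamma * lam `^ (- (gamma * p)).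
    have -> : 2 `^ gamma * lam `^ (- (gamma * p)) = (2 * x) `^ gamma.
      by rewrite powRM ?(ltW xp) // /x -powRrM mulNr [p * _]mulrC.
    apply: ge0_ler_powR; rewrite ?nnegrE ?(ltW g0) ?mulr_ge0 ?(ltW xp) //.
    by rewrite -natr1; lra.
  move=> hh; have := ler_wpM2l C10 hh => {}hh.
  apply: le_trans (ler_wpM2r (ltW l0) hh) _.
  have -> : C1 * (2 `^ gamma * lam `^ (- (gamma * p))) * lam = C1 * 2 `^ gamma * lam `^ r2.
    have -> : lam `^ r2 = lam `^ (- (gamma * p)) * lam.
      rewrite -[X in _ * X](powRr1 (ltW l0)) -powRD; last by rewrite ln implybT.
      by congr (_ `^ _); rewrite /r2 addrC.
    by rewrite !mulrA.
  have C2 : 0 <= C1 * 2 `^ gamma by rewrite mulr_ge0 // powR_ge0.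
  apply: le_trans (ler_wpM2l C2 lr2) _.
  by rewrite mulrA ler_pdivrMr // mulrC ler_wpM2l ?(ltW e0) // /K lerDl.
- exact: hN0.
Unshelve. all: by end_near. Qed.

(** Bounding the minimum by 1/2 gives gamma < (5/11) beta, below (2/3) beta; bounding it by [a]
    gives gamma / a < beta, and [s] is the midpoint between these two. *)
Lemma exponent_choice (a beta gamma : R) : 0 < a -> 0 < beta -> 0 < gamma ->
  gamma < 10 / 11 * Num.min a (1 / 2) * beta ->
  3 * gamma < 2 * beta /\ exists s, [/\ 0 < s, s < beta & gamma < s * a].
Proof.
move=> a0 b0 g0 hg.
have min1 : Num.min a (1 / 2) <= a by rewrite ge_min lexx.
have min2 : Num.min a (1 / 2) <= 1 / 2 by rewrite ge_min lexx orbT.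
have c0 : 0 <= 10 / 11 :> R by lra.
split.
  have : gamma < 10 / 11 * (1 / 2) * beta.
    by apply: lt_le_trans hg _; rewrite ler_wpM2r ?(ltW b0) // ler_wpM2l.
  lra.
have gb : gamma < a * beta.
  apply: lt_le_trans hg _; rewrite ler_wpM2r ?(ltW b0) //.
  by apply: le_trans (ler_wpM2l c0 min1) _; rewrite ler_piMl ?(ltW a0) //; lra.
have ga : gamma / a < beta by rewrite ltr_pdivrMr // mulrC.
have q0 : 0 < gamma / a by rewrite divr_gt0.
exists ((gamma / a + beta) / 2); split; [lra|lra|].
by rewrite -ltr_pdivrMr //; lra.
Qed.

(** With [w] the smaller of [h] and the radius of a ball inside [U], the radius is [w / (m + 2)]: a
    slab over the disc stays within (m + 1) r0 + r0 = w of the apex, and a graph point within (m +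
    1) r0, as sqrt(1 + m^2) <= m + 1. *)
Lemma small_patch (m h : R) (U : set (R3 R)) : 0 < m -> 0 < h -> open U -> U 0 ->
  exists r0 : R, [/\ 0 < r0, r0 < h,
    forall y, disc r0 y -> enorm (graph m y) < h /\ U (graph m y),
    slab (disc r0) (zc m) r0 `<=` tcone m h &
    forall x, enorm x <= r0 -> U x].
Proof.
move=> m0 h0 oU U0.
have /nbhs_ballP[d /= d0 hd] : nbhs (0 : R3 R) U by exact: open_nbhs_nbhs.
have dU x : enorm x < d -> U x.
  move=> xd; apply: hd; have /cubeP[k1 k2 k3] := enorm_cube (lexx (enorm x)).
  by split; [split|]; rewrite /ball /= sub0r normrN; exact: le_lt_trans xd.
pose w := Num.min h d; have w0 : 0 < w by rewrite lt_min h0.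
have m2 : 0 < m + 2 by rewrite addr_gt0.
pose r0 := w / (m + 2); have r00 : 0 < r0 by rewrite divr_gt0.
have rw : (m + 2) * r0 = w by rewrite mulrC divfK // gt_eqF.
have r0w : r0 < w.
  by rewrite ltr_pdivrMr // ltr_pMr //; lra.
have wh : w <= h by rewrite ge_min lexx.
have wd : w <= d by rewrite ge_min lexx orbT.
have gw y : disc r0 y -> enorm (graph m y) < w.
  move=> yd; have E : enorm (graph m y) = Num.sqrt (1 + m ^+ 2) * Num.sqrt (sqn y).
    by rewrite enorm_graph // /zc; field; rewrite gt_eqF.
  have s1 : Num.sqrt (1 + m ^+ 2) <= m + 1.
    have m1 : 0 <= m + 1 by rewrite addr_ge0 // ltW.
    rewrite -(ger0_norm m1) -sqrtr_sqr; apply: ler_wsqrtr.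
    by rewrite sqrrD expr1n mulr1; lra.
  have s2 : Num.sqrt (sqn y) <= r0.
    by rewrite -(ger0_norm (ltW r00)) -sqrtr_sqr; apply: ler_wsqrtr; exact: ltW.
  rewrite E; apply: le_lt_trans (ler_pM (sqrtr_ge0 _) (sqrtr_ge0 _) s1 s2) _.
  by rewrite -rw ltr_pM2r // ltrD2l ltr1n.
exists r0; split=> //.
- exact: lt_le_trans wh.
- move=> y yd; have yw := gw y yd.
  by split; [exact: lt_le_trans yw wh|apply: dU; exact: lt_le_trans yw wd].
- move=> x xs; split; first by case: xs => _ /andP[].
  apply: (slab_sub_eball (ltW m0) (ltW r00) (ltW r00) _ xs).
  by rewrite -[X in _ + X]mul1r -mulrDl -addrA rw.
- by move=> x xr; apply: dU; apply: le_lt_trans xr (lt_le_trans r0w wd).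
Qed.

End Limits.

(** * Conclusion: assembling the estimates along the Herglotz sequence *)

Unset Implicit Arguments.

Theorem theorem4p1 (R : realType) (Om Gam : set (R3 R))
  (sigma : {measure set (mR3 R) -> \bar R})
  (k theta0 h alpha1 beta gamma : R)
  (V q eta v w : R3 R -> R[i]) (g : nat -> R3 R -> R[i])
  (Om_dom : bounded_lipschitz_domain Om)
  (Om_compl : connected (~` Om))
  (sigma_surf : is_surface_measure Om sigma)
  (Gam_open : exists2 U : set (R3 R), open U & Gam = bnd Om `&` U)
  (k_gt0 : 0 < k)
  (V_bnd : in_Linfty leb3 Om V) (q_def : q = (fun x => 1 + V x))
  (eta_bnd : in_Linfty sigma (bnd Om) eta)
  (vw_eigen : conductive_eigenpair Om Gam sigma k q eta v w)
  (Gam0 : Gam 0)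
  (theta0_dom : 0 < theta0 < pi / 2)
  (h_gt0 : 0 < h)
  (Om_cone : Om `&` eball h = cone_h theta0 h)
  (q_H2 : in_H2 (cone_h theta0 h) q)
  (alpha1_dom : 0 < alpha1 < 1)
  (eta_holder : holder alpha1 (closure (Gamma_h theta0 h)) eta)
  (beta_gt0 : 0 < beta) (gamma_gt0 : 0 < gamma)
  (gamma_lt : gamma < 10 / 11 * Num.min alpha1 (1 / 2) * beta)
  (g_L2 : forall j : nat, (0 < j)%N -> in_L2_sphere (g j))
  (g_approx : forall j : nat, (0 < j)%N ->
     (H1norm (cone_h theta0 h) (fun x => (v x - herglotz k (g j) x)%R)
        <= (j%:R `^ (- beta))%:E)%E)
  (g_bound : forall j : nat, (0 < j)%N ->
     (sphere_L2norm (g j) <= (j%:R `^ gamma)%:E)%E)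
  (eta0 : eta 0 != 0) :
  (\int[leb3]_(x in eball lam `&` Om) Normc.normc (v x))
    / fine (leb3 (eball lam `&` Om)) @[lam --> 0^'+] --> (0 : R).
Proof.
have [oOm _ bOm _] := Om_dom; have [U oU GamE] := Gam_open.
have [[vH wH] _ _ _ [tv [tw [tvT twT tE hN]]]] := vw_eigen.
have [al0 al1] := andP alpha1_dom; have [th0 thpi] := andP theta0_dom.
pose m := cos theta0 / sin theta0.
have m0 : 0 < m.
  rewrite divr_gt0 //.
    by apply: cos_gt0_pihalf; rewrite thpi andbT (lt_trans _ th0) // oppr_lt0 divr_gt0 // pi_gt0.
  by apply: sin_gt0_pi; rewrite th0 /=; apply: lt_trans thpi _; rewrite ltr_pdivrMr // ltr_pMr ?pi_gt0 // ltr1n.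
have coneT : cone_h theta0 h = tcone m h by rewrite /cone_h coneE.
have Om_T : Om `&` eball h = tcone m h by rewrite Om_cone.
have U0 : U 0 by move: Gam0; rewrite GamE => -[].
have GamO : Gam `<=` bnd Om by rewrite GamE => x [].
have [r0 [r00 r0h hrU hS hU]] := small_patch m0 h_gt0 oU U0.
have hr y : disc r0 y -> enorm (graph m y) < h by case/hrU.
(* Below [r0], so that the support of the test function meets the cone inside the slab and the
   lateral surface inside the patch. *)
pose rho := r0 / 2.
have rho0 : 0 < rho by rewrite divr_gt0.
have rr : rho < r0 by rewrite ltr_pdivrMr // ltr_pMr // ltr1n.
have rh : rho < h := lt_trans rr r0h.
have hG : gpatch m r0 `<=` Gam.
  move=> x xG; rewrite GamE; split; first exact: (gpatch_bnd Om_T hr).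
  case: xG => xd E; have -> : x = graph m x.1 by rewrite /graph -E; case: (x).
  by case: (hrU _ xd).
have hK x : bnd Om x -> enorm x <= rho -> Gam x.
  by move=> xb xr; rewrite GamE; split=> //; apply: hU; exact: le_trans xr (ltW rr).
pose bf b (y : R * R) := part b (eta (graph m y) * tv (graph m y)).
have bfi b : leb2.-integrable (disc r0 : set (measurableTypeR R * measurableTypeR R)) (EFin \o bf b).
  by apply: (eta_trace_integrable oOm bOm sigma_surf m0 Om_T hr hS eta_bnd vH tvT).
(* The Hoelder condition is stated on the boundary of the infinite cone; the description of the
   boundary as a graph is applied to that cone in place of [Om]. *)
have graph_Gamma y : enorm (graph m y) < h -> closure (Gamma_h theta0 h) (graph m y).
  move=> yh; apply: subset_closure; split=> //.
  by apply: (graph_bnd (Om := cone theta0) (m := m) (h := h)).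
have [M0 hM0] := eta_holder; pose Mh := Num.max M0 0.
have Mh0 : 0 <= Mh by rewrite le_max lexx orbT.
have g0 : graph m 0 = 0 by rewrite /graph /zc /sqn /= expr0n addr0 sqrtr0 mulr0.
have eta_hold y : disc r0 y -> Normc.normc (eta (graph m y) - eta 0) <= Mh * enorm (graph m y) `^ alpha1.
  move=> yd; have z0 : closure (Gamma_h theta0 h) 0.
    rewrite -g0; apply: graph_Gamma; apply: hr.
    by rewrite /disc /sqn /= expr0n addr0 exprn_gt0.
  apply: le_trans (hM0 _ _ (graph_Gamma _ (hr y yd)) z0) _.
  by rewrite subr0 ler_wpM2r ?powR_ge0 // le_max lexx.
have [C1 C10 hC1] := herglotz_bounds k.
have [c [K1 [K2 [c0 K10 K20 hc]]]] :=
  apex_value_bound m0 r00 rho0 rr h_gt0 alpha1_dom Mh0 hr eta_hold bfi C10.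
have [C2 C20 hC2] := trace_error oOm bOm sigma_surf m0 r00 Om_T hr hS vH tvT.
have [gb2 [s [s0 sb gs]]] := exponent_choice al0 beta_gt0 gamma_gt0 gamma_lt.
(* Shifted by one, as the approximations are indexed from 1. *)
pose F n := herglotz k (g n.+1).
have n1 n : 1 <= n.+1%:R :> R by rewrite ler1n.
have HF n : [/\ csmooth (F n),
    forall b x y, `|part b (F n x) - part b (F n y)| <= C1 * n.+1%:R `^ gamma * enorm (x - y) &
    forall b x, `|part b (F n x)| <= C1 * n.+1%:R `^ gamma].
  by apply: hC1; [exact: powR_ge0|exact: g_L2|exact: g_bound].
have F0 n b x : `|part b (F n x - F n 0)| <= C1 * n.+1%:R `^ gamma * enorm x.
  by have [_ h2 _] := HF n; rewrite partB; have := h2 b x 0; rewrite subr0.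
have hA n : (H1norm (tcone m h) (fun x => (v x - F n x)%R) <= (n.+1%:R `^ (- beta))%:E)%E.
  by rewrite -coneT; exact: g_approx.
have vanish : forall eps : R, 0 < eps -> \forall n \near \oo, Normc.normc (F n 0) <= eps.
  (* The depth is tied to the index with the exponent [s] between gamma / alpha1 and beta. *)
  pose en n : R := n.+1%:R `^ (- s).
  have en0 n : 0 < en n by rewrite powR_gt0.
  have enc : en n @[n --> \oo] --> (0 : R) by exact: powR_nat_cvg0.
  have en1 n : en n <= 1.
    by have := powR_le_opp (ltW s0) ltr01 (n1 n); rewrite powR1.
  pose X n b := `|\int[leb2]_(y in (disc r0 : set (measurableTypeR R * measurableTypeR R)))
    (bf b y * testf rho (en n) (graph m y))|.
  apply: (apex_values_vanish (X := X) c0 K10 K20 eta0 sb gs (C := C2)) => [b eps eps0|n b].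
    exact: (boundary_functional_vanishes oOm bOm sigma_surf m0 r00 rho0 rr rh Om_T hr hS hG hK GamO
      V_bnd q_def eta_bnd vH wH tvT twT tE hN b en0 enc eps0).
  have [h1 _ h3] := HF n.
  apply: (hc (F n) (n.+1%:R `^ gamma) (C2 * n.+1%:R `^ (- beta)) (en n) b) => //.
  - by rewrite mulr_ge0 // powR_ge0.
  - by move=> b'; have [] := hC2 (F n) _ b' h1 (powR_ge0 _ _) (hA n).
  - by move=> b'; have [] := hC2 (F n) _ b' h1 (powR_ge0 _ _) (hA n).
have [cv cv0 hcv] := tcone_volume m0.
apply: (averages_vanish h_gt0 cv0 C10 beta_gt0 gamma_gt0 gb2 vanish) => lam eps n l0 lh eps0 hd hN' hz.
have [h1 _ _] := HF n.
apply: (average_bound oOm bOm Om_T vH.1.1 hcv cv0 C10 l0 lh _ _ eps0 _ _ (F0 n) hd hN' hz).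
- exact: powR_ge0.
- exact: powR_ge0.
- by move=> b; exact: (part_csmooth b h1 0%N).
- by move=> b; have [] := H1_error oOm bOm Om_T vH b h1 (powR_ge0 _ _) (hA n).
Qed.
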